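(* Let $E$ be an embedded Bryant surface end of finite total curvature which is not part of a horosphere. Assume that its Weierstrass data are given in $\Omega^*$ by $g(z)=z^\mu$, $\omega=z^\nu h(z)\,dz$, where $h$ is holomorphic near $0$ with $h(0)\neq0$ and $\mu>0$, $\nu\le -1$ are real numbers with $\mu+\nu=-1$. Then there exist a unique real $\chi$ and a unique couple of distinct points $(\mathcal A,\mathcal B)$ of $\overline{\mathbb C}$ such that $E$ is a catenoidal end of growth $\chi$, of asymptotic boundary $\mathcal B$ and of axis $(\mathcal A,\mathcal B)$. Moreover $\chi=1-\mu$ and, if the Bryant representation of $E$ is given by $$F(z)=\begin{pmatrix} z^{\lambda_1}a(z) & z^{r_1}b(z) \\ z^{\lambda_1}c(z) & z^{r_1}d(z) \end{pmatrix},\qquad \lambda_1=\frac{-1-\mu}2,\quad r_1=\frac{\mu-1}2,$$ with $a,b,c,d$ holomorphic near $0$, then $\mathcal A=c'(0)/a'(0)$ and $\mathcal B=c(0)/a(0)$ (quotients taken in $\overline{\mathbb C}$).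
   Context: Hyperbolic space is $\mathbb H^3=\{(\zeta,w)\in\mathbb C\times\mathbb R: w>0\}$ with metric $(|d\zeta|^2+dw^2)/w^2$; its asymptotic boundary is identified with $\overline{\mathbb C}=\mathbb C\cup\{\infty\}$, on which isometries act. The asymptotic boundary of a subset is its set of accumulation points in $\overline{\mathbb C}$. A Bryant surface is a surface of constant mean curvature $1$ (half the trace of the second fundamental form) in $\mathbb H^3$. $\Omega$ is a neighbourhood of $0$ in $\mathbb C$, $\Omega^*=\Omega\setminus\{0\}$. A Bryant surface end is given by a conformal immersion $X=(\zeta,w):\Omega^*\to\mathbb H^3$ of constant mean curvature $1$ (puncture $0$ corresponding to the end; $\Omega$ may be shrunk). A Bryant representation is a holomorphic map $F=\begin{pmatrix} A & B \\ C & D \end{pmatrix}$ from the universal cover of $\Omega^*$ to $\mathrm{SL}_2(\mathbb C)$ with $dA\,dD-dB\,dC=0$, $\zeta=\frac{\bar A C+\bar B D}{|A|^2+|B|^2}$, $w=\frac1{|A|^2+|B|^2}$. The Weierstrass data $(g,\omega)$ are defined by $F^{-1}dF=\begin{pmatrix} g & -g^2 \\ 1 & -g \end{pmatrix}\omega$ (so $\omega=A\,dC-C\,dA$, $g^2\omega=B\,dD-D\,dB$). Canonical catenoidal end: let $\mu\in(0,1)\cup(1,\infty)$, $\mathcal Z\in\mathbb C$. A canonical catenoidal end of growth $1-\mu$, asymptotic boundary $\infty$ and axis $(\mathcal Z,\infty)$ is an embedded Bryant surface end of finite total curvature with Weierstrass data $g=z^\mu$, $\omega=z^{-1-\mu}h(z)\,dz$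 ($h$ holomorphic near $0$, $h(0)\ne0$) and a Bryant representation $$F(z)=\begin{pmatrix} z^{\lambda_2}f_2(z) & \frac{\mu-1}{\mu+1}z^{r_2}g_2(z) \\ \frac{\mu^2-1}{4\mu}z^{\lambda_1}f_1(z) & \frac{(1+\mu)^2}{4\mu}z^{r_1}g_1(z) \end{pmatrix},$$ $\lambda_1=\frac{-1-\mu}2$, $\lambda_2=\frac{1-\mu}2$, $r_1=\frac{\mu-1}2$, $r_2=\frac{1+\mu}2$, with $f_1,f_2,g_1,g_2$ holomorphic near $0$, equal to $1$ at $0$, and $\mathcal Z=\frac{\mu^2-1}{4\mu}f_1'(0)$. Catenoidal end: let $\mathcal A\neq\mathcal B$ in $\overline{\mathbb C}$. An embedded Bryant surface end $E$ of finite total curvature, not part of a horosphere, is a catenoidal end of growth $1-\mu$, asymptotic boundary $\mathcal B$ and axis $(\mathcal A,\mathcal B)$ if there is an isometry of $\mathbb H^3$ (orientation-preserving or not) mapping $\mathcal A$ to $0$, $\mathcal B$ to $\infty$ and $E$ to a canonical catenoidal end of growth $1-\mu$, asymptotic boundary $\infty$ and axis $(0,\infty)$. *)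

(* Defs.v *)
(* Stdlib reals with Coquelicot *)
From Stdlib Require Import Reals.
From Coquelicot Require Import Coquelicot.
Open Scope R_scope.

(** * Hyperbolic space: the upper half-space of [C * R] *)

Definition E3 : NormedModule R_AbsRing :=
  prod_NormedModule R_AbsRing C_R_NormedModule R_NormedModule.

Definition pos1 (p : E3) : R := fst (fst p).
Definition pos2 (p : E3) : R := snd (fst p).
Definition zeta (p : E3) : C := fst p.
Definition height (p : E3) : R := snd p.

Definition H3 (p : E3) : Prop := 0 < height p.

Definition eucl (u v : E3) : R :=
  pos1 u * pos1 v + pos2 u * pos2 v + height u * height v.

(* The metric (|d zeta|^2 + dw^2) / w^2 at the point [p]. *)
Definition hyp (p u v : E3) : R := eucl u v / height p ^ 2.

(* The Levi-Civita derivative of [V] in the direction [U] at [p], where [DUV]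
   is the Euclidean directional derivative.  For the metric
   exp(2 phi) <.,.> with phi = - ln w it is
   D_U V + dphi(U) V + dphi(V) U - <U,V> grad phi. *)
Definition cov_deriv (p U V DUV : E3) : E3 :=
  let e_w : E3 := ((0, 0), 1) in
  minus DUV
    (scal (/ height p)
      (minus (plus (scal (height U) V) (scal (height V) U))
             (scal (eucl U V) e_w))).

Definition preserves_metric (Phi : E3 -> E3) : Prop :=
  forall p, H3 p ->
    H3 (Phi p) /\
    exists L : E3 -> E3, filterdiff Phi (locally p) L /\
      forall u v, hyp (Phi p) (L u) (L v) = hyp p u v.

(* Riemannian isometries (diffeomorphisms preserving the metric tensor),
   whether or not they preserve the orientation; only the values on [H3]
   matter.  Such a differentiable map preserves the Riemannian distance, so it
   is automatically smooth. *)
Definition isometry (Phi : E3 -> E3) : Prop :=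
  exists Psi : E3 -> E3,
    preserves_metric Phi /\ preserves_metric Psi /\
    (forall p, H3 p -> Psi (Phi p) = p) /\
    (forall p, H3 p -> Phi (Psi p) = p).

(* [None] is the point at infinity. *)
Definition Cbar : Type := option C.

(* [P] is the quotient [p / q] in [Cbar]; this excludes [0 / 0]. *)
Definition is_Cbar_quot (p q : C) (P : Cbar) : Prop :=
  match P with
  | Some x => q <> RtoC 0 /\ x = (p / q)%C
  | None => q = RtoC 0 /\ p <> RtoC 0
  end.

(* The traces on [H3] of the neighbourhoods of a boundary point, in the closed
   ball obtained by adding [Cbar] to [H3]. *)
Definition bdry_nbhd (P : Cbar) : (E3 -> Prop) -> Prop :=
  match P with
  | Some a => within H3 (locally ((a, 0) : E3))
  | None => fun S => exists M : R, forall p, H3 p -> M < eucl p p -> S p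
  end.

(* The extension of the isometry [Phi] to the asymptotic boundary maps
   [P] to [Q]. *)
Definition maps_bdry (Phi : E3 -> E3) (P Q : Cbar) : Prop :=
  filterlim Phi (bdry_nbhd P) (bdry_nbhd Q).

Definition horosphere (S : E3 -> Prop) : Prop :=
  (exists c : R, 0 < c /\ forall p, S p <-> height p = c) \/
  (exists (a : C) (r : R), 0 < r /\
     forall p, S p <->
       H3 p /\ Cmod (zeta p - a) ^ 2 + (height p - r) ^ 2 = r ^ 2).

(** * Surface ends *)

(* The end is at the puncture 0; since the domain of an end may be shrunk, it
   is taken to be a punctured disc.  Maps are total, and only their values on
   the punctured disc matter. *)
Definition pdisc (rho : R) (z : C) : Prop := 0 < Cmod z < rho.

Definition pdx (f : C -> R) (z : C) : R :=
  Derive (fun t => f (t, snd z)) (fst z).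
Definition pdy (f : C -> R) (z : C) : R :=
  Derive (fun t => f (fst z, t)) (snd z).

Fixpoint Ck (k : nat) (U : C -> Prop) (f : C -> R) : Prop :=
  match k with
  | O => forall z, U z -> continuous f z
  | S k' =>
      (forall z, U z ->
         ex_derive (fun t => f (t, snd z)) (fst z) /\
         ex_derive (fun t => f (fst z, t)) (snd z)) /\
      Ck k' U (pdx f) /\ Ck k' U (pdy f)
  end.

Definition smooth (U : C -> Prop) (X : C -> E3) : Prop :=
  forall k, Ck k U (fun z => pos1 (X z)) /\
            Ck k U (fun z => pos2 (X z)) /\
            Ck k U (fun z => height (X z)).

Definition vdx (X : C -> E3) (z : C) : E3 :=
  ((pdx (fun z => pos1 (X z)) z, pdx (fun z => pos2 (X z)) z),
   pdx (fun z => height (X z)) z).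
Definition vdy (X : C -> E3) (z : C) : E3 :=
  ((pdy (fun z => pos1 (X z)) z, pdy (fun z => pos2 (X z)) z),
   pdy (fun z => height (X z)) z).

(* First fundamental form of [X]. *)
Definition ff_xx (X : C -> E3) (z : C) : R := hyp (X z) (vdx X z) (vdx X z).
Definition ff_xy (X : C -> E3) (z : C) : R := hyp (X z) (vdx X z) (vdy X z).
Definition ff_yy (X : C -> E3) (z : C) : R := hyp (X z) (vdy X z) (vdy X z).

Definition conformal_immersion (rho : R) (X : C -> E3) : Prop :=
  forall z, pdisc rho z ->
    0 < ff_xx X z /\ ff_xx X z = ff_yy X z /\ ff_xy X z = 0.

Definition unit_normal (X : C -> E3) (z : C) (N : E3) : Prop :=
  hyp (X z) N N = 1 /\ hyp (X z) N (vdx X z) = 0 /\ hyp (X z) N (vdy X z) = 0.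

(* Second fundamental form of [X] with respect to the normal [N]. *)
Definition sff_xx (X : C -> E3) (z : C) (N : E3) : R :=
  hyp (X z) (cov_deriv (X z) (vdx X z) (vdx X z) (vdx (vdx X) z)) N.
Definition sff_xy (X : C -> E3) (z : C) (N : E3) : R :=
  hyp (X z) (cov_deriv (X z) (vdx X z) (vdy X z) (vdx (vdy X) z)) N.
Definition sff_yy (X : C -> E3) (z : C) (N : E3) : R :=
  hyp (X z) (cov_deriv (X z) (vdy X z) (vdy X z) (vdy (vdy X) z)) N.

Definition mean_curvature (X : C -> E3) (z : C) (N : E3) : R :=
  (ff_yy X z * sff_xx X z N - 2 * ff_xy X z * sff_xy X z N
     + ff_xx X z * sff_yy X z N)
  / (2 * (ff_xx X z * ff_yy X z - ff_xy X z ^ 2)).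

(* The normal field [N] is necessarily the mean curvature vector, hence
   continuous. *)
Definition bryant_end (rho : R) (X : C -> E3) : Prop :=
  0 < rho /\
  (forall z, pdisc rho z -> H3 (X z)) /\
  smooth (pdisc rho) X /\
  conformal_immersion rho X /\
  exists N : C -> E3, forall z, pdisc rho z ->
    unit_normal X z (N z) /\ mean_curvature X z (N z) = 1.

(* [X] is injective on the punctured disc, with continuous inverse. *)
Definition embedded (rho : R) (X : C -> E3) : Prop :=
  (forall z z', pdisc rho z -> pdisc rho z' -> X z = X z' -> z = z') /\
  (forall z, pdisc rho z -> forall eps : posreal,
     locally (X z)
       (fun p => forall z', pdisc rho z' -> X z' = p -> Cmod (z' - z) < eps)).

(* Gauss curvature of the conformal metric [ff_xx X * |dz|^2]. *)
Definition gauss_curvature (X : C -> E3) (z : C) : R :=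
  let log_factor := fun z => ln (ff_xx X z) / 2 in
  - (pdx (pdx log_factor) z + pdy (pdy log_factor) z) / ff_xx X z.

(* The integral of |K| with respect to the area element
   [ff_xx X] t dt dtheta (in polar coordinates) is bounded on the compact
   annuli eps <= |z| <= r that exhaust the punctured disc. *)
Definition finite_total_curvature (rho : R) (X : C -> E3) : Prop :=
  exists M : R, forall eps r : R, 0 < eps -> eps < r -> r < rho ->
    RInt (fun t =>
      RInt (fun theta =>
        let z : C := (t * cos theta, t * sin theta) in
        Rabs (gauss_curvature X z) * ff_xx X z * t) 0 (2 * PI)) eps r <= M.

Definition part_of_horosphere (rho : R) (X : C -> E3) : Prop :=
  exists S, horosphere S /\ forall z, pdisc rho z -> S (X z).

(* [X] and [Y] parametrize the same end: near the puncture they differ by a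
   bijective germ [phi] of punctured neighbourhoods of 0.  When [X] and [Y] are
   conformal embeddings [phi] is automatically a conformal or anticonformal
   diffeomorphism. *)
Definition same_end (X Y : C -> E3) : Prop :=
  let punctured : (C -> Prop) -> Prop := locally' (RtoC 0) in
  exists phi psi : C -> C,
    filterlim phi punctured punctured /\
    filterlim psi punctured punctured /\
    punctured (fun z => psi (phi z) = z) /\
    punctured (fun z => phi (psi z) = z) /\
    punctured (fun z => X z = Y (phi z)).

(** * Bryant representation and Weierstrass data *)

Definition Cexp (s : C) : C :=
  (exp (fst s) * cos (snd s), exp (fst s) * sin (snd s)).

(* This is the half-plane Re s < ln rho, on which [Cexp] is the universal
   covering of [pdisc rho].  Multivalued objects on the punctured disc are written as
   functions of s = log z, and holomorphic 1-forms as their coefficient with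
   respect to ds. *)
Definition cover (rho : R) (s : C) : Prop := pdisc rho (Cexp s).

(* The function z^alpha on the universal covering. *)
Definition zpow (alpha : R) (s : C) : C := Cexp (RtoC alpha * s)%C.

Record mat2 : Type :=
  Mat2 { mA : C; mB : C; mC : C; mD : C }.

Definition mat2_det (P : mat2) : C := (mA P * mD P - mB P * mC P)%C.

Definition mat2_mul (P Q : mat2) : mat2 :=
  Mat2 (mA P * mA Q + mB P * mC Q)%C (mA P * mB Q + mB P * mD Q)%C
       (mC P * mA Q + mD P * mC Q)%C (mC P * mB Q + mD P * mD Q)%C.

Definition mat2_scale (c : C) (P : mat2) : mat2 :=
  Mat2 (c * mA P)%C (c * mB P)%C (c * mC P)%C (c * mD P)%C.

Definition mat2_inv (P : mat2) : mat2 :=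
  mat2_scale (/ mat2_det P)%C (Mat2 (mD P) (- mB P)%C (- mC P)%C (mA P)).

Definition holomorphic_on (U : C -> Prop) (f : C -> C) : Prop :=
  forall s, U s -> @ex_derive C_AbsRing C_NormedModule f s.

Definition holomorphic_near_0 (f : C -> C) : Prop :=
  locally (RtoC 0) (fun z : C => @ex_derive C_AbsRing C_NormedModule f z).

Definition mat2_holomorphic (U : C -> Prop) (F : C -> mat2) : Prop :=
  holomorphic_on U (fun s => mA (F s)) /\
  holomorphic_on U (fun s => mB (F s)) /\
  holomorphic_on U (fun s => mC (F s)) /\
  holomorphic_on U (fun s => mD (F s)).

Definition mat2_derive (F : C -> mat2) (s : C) : mat2 :=
  Mat2 (C_derive (fun t => mA (F t)) s) (C_derive (fun t => mB (F t)) s)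
       (C_derive (fun t => mC (F t)) s) (C_derive (fun t => mD (F t)) s).

Definition bryant_representation (rho : R) (X : C -> E3) (F : C -> mat2)
  : Prop :=
  mat2_holomorphic (cover rho) F /\
  forall s, cover rho s ->
    mat2_det (F s) = RtoC 1 /\
    mat2_det (mat2_derive F s) = RtoC 0 /\
    zeta (X (Cexp s)) =
      ((Cconj (mA (F s)) * mC (F s) + Cconj (mB (F s)) * mD (F s))
       / RtoC (Cmod (mA (F s)) ^ 2 + Cmod (mB (F s)) ^ 2))%C /\
    height (X (Cexp s)) = / (Cmod (mA (F s)) ^ 2 + Cmod (mB (F s)) ^ 2).

(* [(g, omega)] are the Weierstrass data of [F]. *)
Definition weierstrass_data (rho : R) (F : C -> mat2) (g omega : C -> C)
  : Prop :=
  forall s, cover rho s ->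
    mat2_mul (mat2_inv (F s)) (mat2_derive F s) =
    mat2_scale (omega s) (Mat2 (g s) (- (g s * g s))%C (RtoC 1) (- g s)%C).

(* The 1-form z^nu h(z) dz in the coordinate s = log z, where dz = e^s ds. *)
Definition power_form (nu : R) (h : C -> C) (s : C) : C :=
  (zpow nu s * h (Cexp s) * Cexp s)%C.

(** * Catenoidal ends *)

(* [Y] is a canonical catenoidal end of growth [1 - mu], asymptotic boundary
   infinity and axis [(Z, infinity)]. *)
Definition canonical_catenoidal_end
    (rho : R) (Y : C -> E3) (mu : R) (Z : C) : Prop :=
  0 < mu /\ mu <> 1 /\
  bryant_end rho Y /\ embedded rho Y /\ finite_total_curvature rho Y /\
  let lambda1 := (-1 - mu) / 2 in
  let lambda2 := (1 - mu) / 2 in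
  let r1 := (mu - 1) / 2 in
  let r2 := (1 + mu) / 2 in
  exists (F : C -> mat2) (h f1 f2 g1 g2 : C -> C),
    bryant_representation rho Y F /\
    holomorphic_near_0 h /\ h (RtoC 0) <> RtoC 0 /\
    weierstrass_data rho F (zpow mu) (power_form (-1 - mu) h) /\
    holomorphic_near_0 f1 /\ f1 (RtoC 0) = RtoC 1 /\
    holomorphic_near_0 f2 /\ f2 (RtoC 0) = RtoC 1 /\
    holomorphic_near_0 g1 /\ g1 (RtoC 0) = RtoC 1 /\
    holomorphic_near_0 g2 /\ g2 (RtoC 0) = RtoC 1 /\
    (forall s, cover rho s ->
       F s =
       Mat2 (zpow lambda2 s * f2 (Cexp s))%C
            (RtoC ((mu - 1) / (mu + 1)) * zpow r2 s * g2 (Cexp s))%C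
            (RtoC ((mu ^ 2 - 1) / (4 * mu)) * zpow lambda1 s * f1 (Cexp s))%C
            (RtoC ((1 + mu) ^ 2 / (4 * mu)) * zpow r1 s * g1 (Cexp s))%C) /\
    Z = (RtoC ((mu ^ 2 - 1) / (4 * mu)) * C_derive f1 (RtoC 0))%C.

(* [X] is a catenoidal end of growth [chi], asymptotic boundary [B] and axis
   [(A, B)]. *)
Definition catenoidal_end
    (rho : R) (X : C -> E3) (chi : R) (A B : Cbar) : Prop :=
  A <> B /\
  bryant_end rho X /\ embedded rho X /\ finite_total_curvature rho X /\
  ~ part_of_horosphere rho X /\
  exists mu : R, chi = 1 - mu /\
  exists Phi : E3 -> E3,
    isometry Phi /\
    maps_bdry Phi A (Some (RtoC 0)) /\ maps_bdry Phi B None /\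
    exists (rho' : R) (Y : C -> E3),
      canonical_catenoidal_end rho' Y mu (RtoC 0) /\
      same_end (fun z => Phi (X z)) Y.

(* Main.v *)
Require Import Defs.
From Stdlib Require Import Reals Lra Lia ZArith Classical.
From Coquelicot Require Import Coquelicot.
Open Scope R_scope.

(** Multivalued objects on the punctured disc are functions of [s = log z] on a
    left half-plane, and [tau = 2 pi i] is the change of sheet.

    Local form.  The change of sheet multiplies the frame [F] on the right by a
    matrix that is unitary, because [F F^*] is determined by the immersion, and
    holomorphic, hence constant; since [g = z^mu] is multivalued this matrix is
    diagonal, and after twisting the rows of [F] by powers of [z] their
    monodromy is plus or minus 1 ([monodromy]).  The twisted rows solve a linear
    system whose coefficients are bounded at the puncture.  Gronwall's
    inequality confines solutions between powers of [|z|], so each of them is a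
    power of [z] times a holomorphic vector ([frobenius]); the exponents are
    [m / 2] and [- m / 2] for an integer [m >= 1], and a constant matrix on the
    left of [F] brings it to an explicit form ([normal_form]).

    Embeddedness.  In that form the horizontal coordinate is [z^(-m)] up to a
    factor tending to a constant.  If [m >= 2], the end meets itself: along a
    curve around the puncture on which the horizontal coordinate runs [m] times
    through a circle, the height must agree at two points with the same
    horizontal coordinate ([common_value], [winding_one]).  So [m = 1], and [F]
    has the form of a canonical end.

    Existence.  A constant matrix on the left of [F] moves the end by an isometry
    ([mob], [pt_mul]), which factors into similarities and an inversion; these
    preserve the metric, the mean curvature and the first fundamental form
    ([motion], [rigid_mob]).  Adding a multiple of the first row to the second
    one puts the axis of the canonical end at 0 ([canonical_form]), and the axis
    of the given end is the preimage of 0 and infinity ([axis_of]).  Comparing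
    Taylor coefficients of the first column expresses it by the entries of [F]
    ([row_jet]).

    Uniqueness.  Isometries preserve hyperbolic distances and therefore come from
    matrices, up to a reflection ([isometry_classification]).  Two canonical ends
    of the same surface are related by such an isometry; both go to infinity, so
    it is a similarity with factor [al] and translation [be].  A canonical end
    with axis at 0 is a surface of revolution up to an error small compared with
    [|z|] ([canonical_asymptotics]).  The leading terms give equal growths and
    [|al| = 1]; the heights then match the parameters of both ends up to a factor
    [1 + o(|z|)], so the distances to the axis differ by [o(1)], which excludes a
    translation ([comparison_axis]).  Thus both isometries pull 0 and infinity
    back to the same points of the boundary ([catenoidal_uniqueness]). *)

(** * Complex derivatives *)

Notation cder := (@is_derive C_AbsRing C_NormedModule).

Lemma locally_Cmod (z : C) (P : C -> Prop) :
  locally z P <-> exists d, 0 < d /\ forall w, Cmod (w - z) < d -> P w.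
Proof.
split.
- intros [e He]. exists e. split; [apply cond_pos|].
  intros w Hw. apply He. now apply C_NormedModule_mixin_compat1.
- intros (d & Hd & H).
  assert (Hs : 0 < sqrt 2) by (apply sqrt_lt_R0; lra).
  assert (He : 0 < d / sqrt 2) by now apply Rdiv_lt_0_compat.
  exists (mkposreal _ He). intros w Hw. apply H.
  generalize (C_NormedModule_mixin_compat2 z w _ Hw). simpl.
  replace (sqrt 2 * (d / sqrt 2)) with d by (field; lra). easy.
Qed.

(** The two uniform structures on [C], from the product and from the modulus,
    have the same neighbourhoods. *)
Lemma locally_Cmod_AbsRing (z : C) (P : C -> Prop) :
  @locally (AbsRing_UniformSpace C_AbsRing) z P <->
  exists d, 0 < d /\ forall w, Cmod (w - z) < d -> P w.
Proof.
split.
- intros [e He]. exists e. split; [apply cond_pos|].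
  intros w Hw. apply He. exact Hw.
- intros (d & Hd & H). exists (mkposreal _ Hd). intros w Hw. apply H. exact Hw.
Qed.

Lemma cder_eps (f : C -> C) (z l : C) :
  cder f z l <->
  forall eps, 0 < eps -> exists d, 0 < d /\ forall w, Cmod (w - z) < d ->
    Cmod (f w - f z - l * (w - z)) <= eps * Cmod (w - z).
Proof.
split.
- intros [_ H] eps Heps.
  specialize (H z (fun P HP => HP) (mkposreal _ Heps)).
  apply locally_Cmod_AbsRing in H. destruct H as (d & Hd & H).
  exists d. split; [easy|]. intros w Hw. specialize (H w Hw).
  simpl in H.
  replace (f w - f z - l * (w - z))%C
    with (@minus C_NormedModule (@minus C_NormedModule (f w) (f z))
      (@scal C_AbsRing C_NormedModule (@minus (AbsRing_NormedModule C_AbsRing) w z) l)).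
  + exact H.
  + unfold minus, plus, opp, scal; simpl; unfold mult; simpl. ring.
- intros H. split.
  + apply (@is_linear_scal_l C_AbsRing C_NormedModule).
  + intros x Hx.
    apply (@is_filter_lim_locally_unique C_AbsRing (AbsRing_NormedModule C_AbsRing)) in Hx.
    subst x. intros eps.
    destruct (H eps (cond_pos eps)) as (d & Hd & H1).
    apply locally_Cmod_AbsRing. exists d. split; [easy|].
    intros w Hw. specialize (H1 w Hw).
    replace (f w - f z - l * (w - z))%C
      with (@minus C_NormedModule (@minus C_NormedModule (f w) (f z))
      (@scal C_AbsRing C_NormedModule (@minus (AbsRing_NormedModule C_AbsRing) w z) l)) in H1.
    * exact H1.
    * unfold minus, plus, opp, scal; simpl; unfold mult; simpl. ring.
Qed.

Lemma continuous_C_eps (f : C -> C) (z : C) :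
  continuous f z <->
  forall eps, 0 < eps -> exists d, 0 < d /\ forall w, Cmod (w - z) < d ->
    Cmod (f w - f z) < eps.
Proof.
split.
- intros H eps Heps.
  apply (locally_Cmod z (fun w => Cmod (f w - f z) < eps)).
  apply (H (fun y => Cmod (y - f z) < eps)).
  apply locally_Cmod. exists eps. now split.
- intros H P HP. apply locally_Cmod in HP. destruct HP as (e & He & HP).
  apply locally_Cmod. destruct (H e He) as (d & Hd & H1).
  exists d. split; [easy|]. intros w Hw. apply HP. now apply H1.
Qed.

Lemma cder_continuous (f : C -> C) (z l : C) : cder f z l -> continuous f z.
Proof.
intros H. apply continuous_C_eps. intros eps Heps.
destruct (proj1 (cder_eps f z l) H 1 Rlt_0_1) as (d & Hd & H1).
assert (HM : 0 < 2 + Cmod l) by (generalize (Cmod_ge_0 l); lra).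
exists (Rmin d (eps / (2 + Cmod l))). split.
- apply Rmin_pos; [easy|]. now apply Rdiv_lt_0_compat.
- intros w Hw.
  assert (Hw1 : Cmod (w - z) < d) by (eapply Rlt_le_trans; [apply Hw|apply Rmin_l]).
  assert (Hw2 : Cmod (w - z) < eps / (2 + Cmod l))
    by (eapply Rlt_le_trans; [apply Hw|apply Rmin_r]).
  specialize (H1 w Hw1).
  replace (f w - f z)%C with ((f w - f z - l * (w - z)) + l * (w - z))%C by ring.
  eapply Rle_lt_trans; [apply Cmod_triangle|]. rewrite Cmod_mult.
  apply Rle_lt_trans with ((1 + Cmod l) * Cmod (w - z)); [lra|].
  apply Rle_lt_trans with ((2 + Cmod l) * Cmod (w - z)).
  + generalize (Cmod_ge_0 (w - z)). nra.
  + apply (Rmult_lt_compat_l _ _ _ HM) in Hw2.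
    replace ((2 + Cmod l) * (eps / (2 + Cmod l))) with eps in Hw2 by (field; lra).
    easy.
Qed.

Lemma cder_const (c z : C) : cder (fun _ => c) z (RtoC 0).
Proof.
apply cder_eps. intros eps Heps. exists 1. split; [lra|]. intros w _.
replace (c - c - RtoC 0 * (w - z))%C with (RtoC 0) by ring. rewrite Cmod_0.
apply Rmult_le_pos; [lra|apply Cmod_ge_0].
Qed.

Lemma cder_id (z : C) : cder (fun w => w) z (RtoC 1).
Proof.
apply cder_eps. intros eps Heps. exists 1. split; [lra|]. intros w _.
replace (w - z - RtoC 1 * (w - z))%C with (RtoC 0) by ring. rewrite Cmod_0.
apply Rmult_le_pos; [lra|apply Cmod_ge_0].
Qed.

Lemma cder_plus (f g : C -> C) (z l m : C) :
  cder f z l -> cder g z m -> cder (fun w => f w + g w)%C z (l + m)%C.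
Proof. exact (@is_derive_plus C_AbsRing C_NormedModule f g z l m). Qed.

Lemma cder_minus (f g : C -> C) (z l m : C) :
  cder f z l -> cder g z m -> cder (fun w => f w - g w)%C z (l - m)%C.
Proof. exact (@is_derive_minus C_AbsRing C_NormedModule f g z l m). Qed.

Lemma cder_opp (f : C -> C) (z l : C) : cder f z l -> cder (fun w => - f w)%C z (- l)%C.
Proof. exact (@is_derive_opp C_AbsRing C_NormedModule f z l). Qed.

Lemma cder_ext_loc (f g : C -> C) (z l : C) :
  locally z (fun w => f w = g w) -> cder f z l -> cder g z l.
Proof.
intros H. apply (@is_derive_ext_loc C_AbsRing C_NormedModule f g z l).
apply locally_Cmod_AbsRing. now apply locally_Cmod.
Qed.

Lemma cder_comp (f g : C -> C) (z l m : C) :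
  cder f (g z) l -> cder g z m -> cder (fun w => f (g w)) z (l * m)%C.
Proof.
intros Hf Hg. apply cder_eps. intros eps Heps.
pose (e1 := Rmin 1 (eps / (2 + Cmod l + Cmod m))).
assert (HK : 0 < 2 + Cmod l + Cmod m)
  by (generalize (Cmod_ge_0 l) (Cmod_ge_0 m); lra).
assert (He1 : 0 < e1)
  by (apply Rmin_pos; [lra|]; now apply Rdiv_lt_0_compat).
assert (He1' : e1 * (2 + Cmod l + Cmod m) <= eps).
{ assert (H : e1 <= eps / (2 + Cmod l + Cmod m)) by apply Rmin_r.
  apply (Rmult_le_compat_r _ _ _ (Rlt_le _ _ HK)) in H.
  replace (eps / (2 + Cmod l + Cmod m) * (2 + Cmod l + Cmod m)) with eps in H
    by (field; lra). easy. }
destruct (proj1 (cder_eps f _ l) Hf e1 He1) as (d1 & Hd1 & H1).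
destruct (proj1 (cder_eps g _ m) Hg e1 He1) as (d2 & Hd2 & H2).
destruct (proj1 (continuous_C_eps g z) (cder_continuous _ _ _ Hg) d1 Hd1)
  as (d3 & Hd3 & H3).
exists (Rmin d2 d3). split; [now apply Rmin_pos|]. intros w Hw.
assert (Hw2 : Cmod (w - z) < d2) by (eapply Rlt_le_trans; [apply Hw|apply Rmin_l]).
assert (Hw3 : Cmod (w - z) < d3) by (eapply Rlt_le_trans; [apply Hw|apply Rmin_r]).
specialize (H1 _ (H3 w Hw3)). specialize (H2 w Hw2).
set (t := Cmod (w - z)) in *.
assert (Ht : 0 <= t) by apply Cmod_ge_0.
assert (Hgw : Cmod (g w - g z) <= (1 + Cmod m) * t).
{ replace (g w - g z)%C with ((g w - g z - m * (w - z)) + m * (w - z))%C by ring.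
  eapply Rle_trans; [apply Cmod_triangle|]. rewrite Cmod_mult. fold t.
  assert (e1 <= 1) by apply Rmin_l. nra. }
replace (f (g w) - f (g z) - l * m * (w - z))%C
  with ((f (g w) - f (g z) - l * (g w - g z)) + l * (g w - g z - m * (w - z)))%C
  by ring.
eapply Rle_trans; [apply Cmod_triangle|]. rewrite Cmod_mult.
apply Rle_trans with (e1 * ((1 + Cmod m) * t) + Cmod l * (e1 * t)).
- apply Rplus_le_compat.
  + eapply Rle_trans; [apply H1|]. apply Rmult_le_compat_l; lra.
  + apply Rmult_le_compat_l; [apply Cmod_ge_0|easy].
- replace (e1 * ((1 + Cmod m) * t) + Cmod l * (e1 * t))
    with ((e1 * (1 + Cmod l + Cmod m)) * t) by ring.
  apply Rmult_le_compat_r; [easy|]. nra.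
Qed.

(** Products follow from squares by polarization. *)
Lemma cder_sqr (z : C) : cder (fun w => w * w)%C z (2 * z)%C.
Proof.
apply cder_eps. intros eps Heps. exists eps. split; [easy|]. intros w Hw.
replace (w * w - z * z - 2 * z * (w - z))%C with ((w - z) * (w - z))%C by ring.
rewrite Cmod_mult. apply Rmult_le_compat_r; [apply Cmod_ge_0|lra].
Qed.

Lemma cder_scal (c : C) (f : C -> C) (z l : C) : cder f z l -> cder (fun w => c * f w)%C z (c * l)%C.
Proof.
intros H. apply (cder_comp (fun w => c * w)%C f); [|easy].
apply cder_eps. intros eps Heps. exists 1. split; [lra|]. intros w _.
replace (c * w - c * f z - c * (w - f z))%C with (RtoC 0) by ring. rewrite Cmod_0.
apply Rmult_le_pos; [lra|apply Cmod_ge_0].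
Qed.

Lemma cder_mult (f g : C -> C) (z l m : C) :
  cder f z l -> cder g z m -> cder (fun w => f w * g w)%C z (l * g z + f z * m)%C.
Proof.
intros Hf Hg.
assert (H1 := cder_comp (fun w => w * w)%C (fun w => f w + g w)%C z _ _ (cder_sqr (f z + g z)%C) (cder_plus _ _ _ _ _ Hf Hg)).
assert (H2 := cder_comp (fun w => w * w)%C (fun w => f w - g w)%C z _ _ (cder_sqr (f z - g z)%C) (cder_minus _ _ _ _ _ Hf Hg)).
assert (H3 := cder_scal (/ 4)%C _ _ _ (cder_minus _ _ _ _ _ H1 H2)).
assert (H4 : RtoC 4 <> RtoC 0) by (intros E; apply RtoC_inj in E; lra).
replace (l * g z + f z * m)%C with
 (/ 4 * (2 * (f z + g z) * (l + m) - 2 * (f z - g z) * (l - m)))%C by (field; easy).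
eapply is_derive_ext; [|exact H3]. intros w. simpl. field.
Qed.

Lemma cder_inv0 (z : C) : z <> RtoC 0 -> cder (fun w => / w)%C z (- / (z * z))%C.
Proof.
intros Hz. assert (Hm : 0 < Cmod z) by now apply Cmod_gt_0.
apply cder_eps. intros eps Heps.
exists (Rmin (Cmod z / 2) (eps * Cmod z ^ 3 / 2)). split.
- apply Rmin_pos; [lra|]. assert (0 < Cmod z ^ 3) by now apply pow_lt. nra.
- intros w Hw.
  assert (Hw1 : Cmod (w - z) < Cmod z / 2) by (eapply Rlt_le_trans; [apply Hw|apply Rmin_l]).
  assert (Hw2 : Cmod (w - z) < eps * Cmod z ^ 3 / 2)
    by (eapply Rlt_le_trans; [apply Hw|apply Rmin_r]).
  assert (Hww : Cmod z / 2 <= Cmod w).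
  { assert (T := Cmod_triangle w (z - w)). replace (w + (z - w))%C with z in T by ring.
    replace (z - w)%C with (- (w - z))%C in T by ring. rewrite Cmod_opp in T. lra. }
  assert (Hw0 : w <> RtoC 0) by (apply Cmod_gt_0; lra).
  replace (/ w - / z - - / (z * z) * (w - z))%C
    with ((w - z) * (w - z) * / (w * (z * z)))%C by (field; easy).
  assert (Hn : (w * (z * z))%C <> RtoC 0) by (repeat apply Cmult_neq_0; easy).
  rewrite !Cmod_mult, Cmod_inv by easy. rewrite !Cmod_mult.
  set (t := Cmod (w - z)) in *. assert (0 <= t) by apply Cmod_ge_0.
  set (a := Cmod z) in *. set (b := Cmod w) in *.
  replace (t * t * / (b * (a * a))) with ((t / (b * (a * a))) * t) by (field; split; lra).
  apply Rmult_le_compat_r; [easy|].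
  apply Rmult_le_reg_r with (b * (a * a)).
  + apply Rmult_lt_0_compat; nra.
  + replace (t / (b * (a * a)) * (b * (a * a))) with t by (field; split; lra).
    simpl in Hw2. assert (0 < a * a) by nra.
    apply Rle_trans with (eps * (a / 2 * (a * a))); [nra|].
    apply Rmult_le_compat_l; [lra|]. apply Rmult_le_compat_r; lra.
Qed.

Lemma cder_inv (f : C -> C) (z l : C) : f z <> RtoC 0 ->
  cder f z l -> cder (fun w => / f w)%C z (- l / (f z * f z))%C.
Proof.
intros Hz H. replace (- l / (f z * f z))%C with (- / (f z * f z) * l)%C by (field; easy).
apply (cder_comp Cinv f); [now apply cder_inv0|easy].
Qed.

(** Along a real line a complex derivative gives a real one for each real
    linear functional [c |-> Re (e * c)]; this reduces mean value arguments
    to real functions of one real variable. *)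
Lemma cder_line (f : C -> C) (e z v : C) (t : R) (l : C) :
  cder f (z + RtoC t * v)%C l ->
  is_derive (fun u : R => Re (e * f (z + RtoC u * v))%C) t (Re (e * (l * v))%C).
Proof.
intros H. split; [apply is_linear_scal_l|].
intros x Hx. apply (@is_filter_lim_locally_unique R_AbsRing R_NormedModule) in Hx. subst x.
intros eps.
set (K := 1 + Cmod e * Cmod v).
assert (HK : 0 < K) by (unfold K; generalize (Cmod_ge_0 e) (Cmod_ge_0 v); nra).
destruct (proj1 (cder_eps f _ l) H (eps / K)) as (d & Hd & H1).
{ apply Rdiv_lt_0_compat; [apply cond_pos|easy]. }
assert (HV : 0 < 1 + Cmod v) by (generalize (Cmod_ge_0 v); lra).
assert (Hd' : 0 < d / (1 + Cmod v)) by now apply Rdiv_lt_0_compat.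
exists (mkposreal _ Hd'). intros u Hu.
change (Rabs (minus u t) < d / (1 + Cmod v)) in Hu.
unfold minus, plus, opp in Hu. simpl in Hu.
assert (Hu' : Cmod (z + RtoC u * v - (z + RtoC t * v)) = Rabs (u + - t) * Cmod v).
{ rewrite <- Cmod_R, <- Cmod_mult. f_equal. rewrite RtoC_plus, RtoC_opp. ring. }
specialize (H1 (z + RtoC u * v)%C). rewrite Hu' in H1.
assert (Hlt : Rabs (u + - t) * Cmod v < d).
{ apply Rmult_lt_compat_r with (r := 1 + Cmod v) in Hu; [|easy].
  replace (d / (1 + Cmod v) * (1 + Cmod v)) with d in Hu by (field; lra).
  generalize (Rabs_pos (u + - t)). nra. }
specialize (H1 Hlt).
change (Rabs (Re (e * f (z + RtoC u * v))%C - Re (e * f (z + RtoC t * v))%C -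
   (u + - t) * Re (e * (l * v))%C) <= eps * Rabs (u + - t)).
replace (Re (e * f (z + RtoC u * v))%C - Re (e * f (z + RtoC t * v))%C -
   (u + - t) * Re (e * (l * v))%C) with
  (Re (e * (f (z + RtoC u * v) - f (z + RtoC t * v)
     - l * (z + RtoC u * v - (z + RtoC t * v)))))%C by (simpl; ring).
eapply Rle_trans; [apply re_le_Cmod|]. rewrite Cmod_mult.
eapply Rle_trans; [apply Rmult_le_compat_l; [apply Cmod_ge_0|apply H1]|].
assert (Hr := Rabs_pos (u + - t)). set (r := Rabs (u + - t)) in *.
replace (Cmod e * (eps / K * (r * Cmod v))) with
  (eps * r * ((Cmod e * Cmod v) / K)) by (field; lra).
assert (He := cond_pos eps).
assert (Cmod e * Cmod v / K <= 1).
{ apply Rmult_le_reg_r with K; [easy|].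
  replace (Cmod e * Cmod v / K * K) with (Cmod e * Cmod v) by (field; lra).
  unfold K. lra. }
assert (0 <= eps * r) by (apply Rmult_le_pos; lra). nra.
Qed.

Lemma Re_1_mult (c : C) : Re (RtoC 1 * c)%C = Re c.
Proof. unfold Re; simpl. ring. Qed.
Lemma Re_mCi_mult (c : C) : Re (- Ci * c)%C = Im c.
Proof. unfold Ci, Re, Im, Cmult, Copp; simpl; ring. Qed.

Lemma C_unit_dir (c : C) : exists e, Cmod e <= 1 /\ Re (e * c)%C = Cmod c.
Proof.
destruct (Req_dec (Cmod c) 0) as [H|H].
- exists (RtoC 0). rewrite Cmod_0, H. split; [lra|]. simpl. ring.
- assert (Hn : RtoC (Cmod c) <> RtoC 0) by (intros E; apply RtoC_inj in E; easy).
  exists (Cconj c / RtoC (Cmod c))%C. split.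
  + rewrite Cmod_div, Cmod_conj, Cmod_R, Rabs_pos_eq; [|apply Cmod_ge_0|easy].
    right. now field.
  + replace (Cconj c / RtoC (Cmod c) * c)%C with (RtoC (Cmod c)); [easy|].
    replace (Cconj c / RtoC (Cmod c) * c)%C with ((c * Cconj c) / RtoC (Cmod c))%C
      by (field; easy).
    rewrite <- Cmod2_conj. rewrite RtoC_pow. field. easy.
Qed.

(** The real mean value theorem, applied to the component of [f] in the
    direction of [f w - f z]. *)
Lemma cder_mvt (f df : C -> C) (z w : C) (M : R) :
  (forall t, 0 <= t <= 1 -> cder f (z + RtoC t * (w - z))%C (df (z + RtoC t * (w - z))%C)) ->
  (forall t, 0 <= t <= 1 -> Cmod (df (z + RtoC t * (w - z))%C) <= M) ->
  Cmod (f w - f z) <= M * Cmod (w - z).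
Proof.
intros Hd HM.
destruct (C_unit_dir (f w - f z)) as (e & He & Hee).
destruct (MVT_gen (fun u : R => Re (e * f (z + RtoC u * (w - z)))%C) 0 1
  (fun t => Re (e * (df (z + RtoC t * (w - z))%C * (w - z)))%C)) as (c & Hc & Heq).
- intros x Hx. rewrite Rmin_left, Rmax_right in Hx by lra.
  apply cder_line. apply Hd. lra.
- intros x Hx. rewrite Rmin_left, Rmax_right in Hx by lra.
  apply continuity_pt_filterlim.
  apply (@ex_derive_continuous R_AbsRing R_NormedModule). eexists. apply cder_line, Hd. lra.
- rewrite Rmin_left, Rmax_right in Hc by lra.
  replace (z + RtoC 1 * (w - z))%C with w in Heq by ring.
  replace (z + RtoC 0 * (w - z))%C with z in Heq by ring.
  rewrite <- Hee.
  replace (Re (e * (f w - f z)))%C with (Re (e * f w)%C - Re (e * f z)%C) by (simpl; ring).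
  rewrite Heq, Rminus_0_r, Rmult_1_r.
  eapply Rle_trans; [apply Rle_abs|]. eapply Rle_trans; [apply re_le_Cmod|].
  rewrite !Cmod_mult. specialize (HM c Hc).
  assert (H1 := Cmod_ge_0 e). assert (H2 := Cmod_ge_0 (w - z)).
  assert (H3 := Cmod_ge_0 (df (z + RtoC c * (w - z))%C)).
  apply Rle_trans with (1 * (M * Cmod (w - z))); [|lra].
  apply Rmult_le_compat; try easy; [nra|]. now apply Rmult_le_compat_r.
Qed.

Lemma cder_eq (f : C -> C) (z l m : C) : cder f z l -> l = m -> cder f z m.
Proof. now intros H <-. Qed.

Lemma is_derive_eq (f : R -> R) (x l m : R) : is_derive f x l -> l = m -> is_derive f x m.
Proof. now intros H <-. Qed.

(** * Cauchy's formula on circles and division by the coordinate *)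

Lemma continuous_C_intro {U : UniformSpace} (f : U -> C) (x : U) :
  continuous (fun u => Re (f u)) x -> continuous (fun u => Im (f u)) x ->
  continuous f x.
Proof.
intros H1 H2. apply filterlim_locally. intros eps.
apply filterlim_locally with (eps := eps) in H1.
apply filterlim_locally with (eps := eps) in H2.
generalize (filter_and _ _ H1 H2). apply filter_imp.
intros u [Hu1 Hu2]. split; assumption.
Qed.

Lemma continuous_Re {U : UniformSpace} (f : U -> C) (x : U) :
  continuous f x -> continuous (fun u => Re (f u)) x.
Proof.
intros H. apply (continuous_comp f (fun c : C => Re c)); [easy|].
destruct (f x). apply continuous_fst.
Qed.

Lemma continuous_Im {U : UniformSpace} (f : U -> C) (x : U) :
  continuous f x -> continuous (fun u => Im (f u)) x.
Proof.
intros H. apply (continuous_comp f (fun c : C => Im c)); [easy|].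
destruct (f x). apply continuous_snd.
Qed.

Lemma continuous_Rmult {U : UniformSpace} (f g : U -> R) (x : U) :
  continuous f x -> continuous g x -> continuous (fun u => f u * g u) x.
Proof. exact (@continuous_mult U R_AbsRing f g x). Qed.

Lemma continuous_Rplus {U : UniformSpace} (f g : U -> R) (x : U) :
  continuous f x -> continuous g x -> continuous (fun u => f u + g u) x.
Proof. exact (@continuous_plus U R_AbsRing R_NormedModule f g x). Qed.

Lemma continuous_Rminus {U : UniformSpace} (f g : U -> R) (x : U) :
  continuous f x -> continuous g x -> continuous (fun u => f u - g u) x.
Proof. exact (@continuous_minus U R_AbsRing R_NormedModule f g x). Qed.

Lemma continuous_Ropp {U : UniformSpace} (f : U -> R) (x : U) :
  continuous f x -> continuous (fun u => - f u) x.
Proof. exact (@continuous_opp U R_AbsRing R_NormedModule f x). Qed.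

Lemma continuous_Cmod2 {U : UniformSpace} (f : U -> C) (x : U) :
  continuous f x -> continuous (fun u => Cmod (f u) ^ 2) x.
Proof.
intros H. apply (continuous_ext (fun u => Re (f u) * Re (f u) + Im (f u) * Im (f u))).
- intros u. rewrite Cmod2_alt. match goal with |- ?a = ?b => change (@eq R a b) end. ring.
- assert (H1 := continuous_Re f x H). assert (H2 := continuous_Im f x H).
  apply continuous_Rplus; now apply continuous_Rmult.
Qed.

Lemma continuous_Rinv_comp {U : UniformSpace} (f : U -> R) (x : U) :
  f x <> 0 -> continuous f x -> continuous (fun u => / f u) x.
Proof.
intros H0 H. apply (continuous_comp f Rinv); [easy|].
now apply continuous_Rinv.
Qed.

Lemma continuous_RtoC {U : UniformSpace} (f : U -> R) (x : U) :
  continuous f x -> continuous (fun u => RtoC (f u)) x.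
Proof.
intros H. apply continuous_C_intro; simpl; [exact H|apply continuous_const].
Qed.

Lemma continuous_Cplus {U : UniformSpace} (f g : U -> C) (x : U) :
  continuous f x -> continuous g x -> continuous (fun u => f u + g u)%C x.
Proof.
intros Hf Hg.
apply continuous_C_intro; simpl; apply continuous_Rplus;
  [now apply continuous_Re|now apply continuous_Re|now apply continuous_Im|now apply continuous_Im].
Qed.

Lemma continuous_Copp {U : UniformSpace} (f : U -> C) (x : U) :
  continuous f x -> continuous (fun u => - f u)%C x.
Proof.
intros Hf.
apply continuous_C_intro; simpl; apply continuous_Ropp; [now apply continuous_Re|now apply continuous_Im].
Qed.

Lemma continuous_Cminus {U : UniformSpace} (f g : U -> C) (x : U) :
  continuous f x -> continuous g x -> continuous (fun u => f u - g u)%C x.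
Proof. intros Hf Hg. apply continuous_Cplus; [easy|]. now apply continuous_Copp. Qed.

Lemma continuous_Cmult {U : UniformSpace} (f g : U -> C) (x : U) :
  continuous f x -> continuous g x -> continuous (fun u => f u * g u)%C x.
Proof.
intros Hf Hg.
assert (H1 := continuous_Re _ _ Hf). assert (H2 := continuous_Im _ _ Hf).
assert (H3 := continuous_Re _ _ Hg). assert (H4 := continuous_Im _ _ Hg).
apply continuous_C_intro; simpl.
- apply continuous_Rminus; now apply continuous_Rmult.
- apply continuous_Rplus; now apply continuous_Rmult.
Qed.

Lemma continuous_Cinv {U : UniformSpace} (f : U -> C) (x : U) :
  f x <> RtoC 0 -> continuous f x -> continuous (fun u => / f u)%C x.
Proof.
intros H0 H. apply (continuous_comp f Cinv); [easy|].
eapply cder_continuous. now apply cder_inv0.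
Qed.

Definition circ (t : R) : C := (cos t, sin t).

Lemma Cmod_circ t : Cmod (circ t) = 1.
Proof.
unfold Cmod, circ; simpl. rewrite !Rmult_1_r.
replace (cos t * cos t + sin t * sin t) with 1; [apply sqrt_1|].
generalize (sin2_cos2 t). unfold Rsqr. lra.
Qed.

Lemma continuous_circ {U : UniformSpace} (f : U -> R) (x : U) :
  continuous f x -> continuous (fun u => circ (f u)) x.
Proof.
intros H. apply continuous_C_intro; simpl.
- apply (continuous_comp f cos); [easy|apply continuous_cos].
- apply (continuous_comp f sin); [easy|apply continuous_sin].
Qed.

Lemma is_derive_eps (f : R -> R) (x l : R) : is_derive f x l ->
  forall eps, 0 < eps -> exists d, 0 < d /\ forall y, Rabs (y - x) < d ->
    Rabs (f y - f x - l * (y - x)) <= eps * Rabs (y - x).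
Proof.
intros [_ H] eps Heps.
specialize (H x (fun P HP => HP) (mkposreal _ Heps)).
destruct H as [d H]. exists d. split; [apply cond_pos|].
intros y Hy. specialize (H y Hy). simpl in H.
unfold norm, minus, plus, opp, scal in H; simpl in H; unfold abs, mult in H; simpl in H.
replace (f y - f x - l * (y - x)) with (f y + - f x + - ((y + - x) * l)) by ring.
exact H.
Qed.

Lemma Cmod_le_sum (c : C) : Cmod c <= Rabs (Re c) + Rabs (Im c).
Proof.
replace c with (RtoC (Re c) + Ci * RtoC (Im c))%C at 1.
- eapply Rle_trans; [apply Cmod_triangle|].
  rewrite Cmod_mult, Cmod_Ci, !Cmod_R. lra.
- destruct c as [x y]. unfold Ci, RtoC, Cplus, Cmult, Re, Im; simpl. f_equal; ring.
Qed.

Lemma im_le_Cmod (c : C) : Rabs (Im c) <= Cmod c.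
Proof. eapply Rle_trans; [apply Rmax_r|apply Rmax_Cmod]. Qed.

Lemma Cexp_plus (a b : C) : Cexp (a + b) = (Cexp a * Cexp b)%C.
Proof.
unfold Cexp, Cplus, Cmult; simpl. rewrite exp_plus, cos_plus, sin_plus.
f_equal; ring.
Qed.

Lemma Cexp_0 : Cexp (RtoC 0) = RtoC 1.
Proof. unfold Cexp; simpl. rewrite exp_0, cos_0, sin_0. unfold RtoC. f_equal; ring. Qed.

Lemma Cmod_Cexp (s : C) : Cmod (Cexp s) = exp (Re s).
Proof.
replace (Cexp s) with (RtoC (exp (Re s)) * circ (Im s))%C.
- rewrite Cmod_mult, Cmod_circ, Cmod_R, Rabs_pos_eq, Rmult_1_r; [easy|].
  left. apply exp_pos.
- unfold Cexp, circ, RtoC, Cmult, Re, Im; simpl. f_equal; ring.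
Qed.

Lemma Cexp_neq0 (s : C) : Cexp s <> RtoC 0.
Proof. apply Cmod_gt_0. rewrite Cmod_Cexp. apply exp_pos. Qed.

Lemma cder_Cexp (s : C) : cder Cexp s (Cexp s).
Proof.
apply cder_eps. intros eps Heps.
assert (HK : 0 < 6 * exp (Re s)) by (generalize (exp_pos (Re s)); lra).
pose (e := Rmin 1 (eps / (6 * exp (Re s)))).
assert (He : 0 < e) by (apply Rmin_pos; [lra|now apply Rdiv_lt_0_compat]).
assert (He1 : e <= 1) by apply Rmin_l.
assert (He2 : e * (6 * exp (Re s)) <= eps).
{ assert (H : e <= eps / (6 * exp (Re s))) by apply Rmin_r.
  apply (Rmult_le_compat_r _ _ _ (Rlt_le _ _ HK)) in H.
  replace (eps / (6 * exp (Re s)) * (6 * exp (Re s))) with eps in H by (field; lra).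
  easy. }
assert (E1 : is_derive exp 0 1) by (auto_derive; [easy|rewrite exp_0; ring]).
assert (E2 : is_derive cos 0 0) by (auto_derive; [easy|rewrite sin_0; ring]).
assert (E3 : is_derive sin 0 1) by (auto_derive; [easy|rewrite cos_0; ring]).
destruct (is_derive_eps _ _ _ E1 e He) as (d1 & Hd1 & H1).
destruct (is_derive_eps _ _ _ E2 e He) as (d2 & Hd2 & H2).
destruct (is_derive_eps _ _ _ E3 e He) as (d3 & Hd3 & H3).
exists (Rmin (Rmin d1 d2) (Rmin d3 (e / 2))). split.
{ repeat apply Rmin_pos; lra. }
intros w Hw.
assert (Hwd : Cmod (w - s) < d1 /\ Cmod (w - s) < d2 /\ Cmod (w - s) < d3 /\ Cmod (w - s) < e / 2).
{ revert Hw. unfold Rmin. repeat destruct Rle_dec; lra. }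
destruct Hwd as (Hw1 & Hw2 & Hw3 & Hw4).
set (h := (w - s)%C) in *.
replace (Cexp w) with (Cexp s * Cexp h)%C
  by (rewrite <- Cexp_plus; f_equal; unfold h; ring).
replace (Cexp s * Cexp h - Cexp s - Cexp s * h)%C with (Cexp s * (Cexp h - 1 - h))%C by ring.
rewrite Cmod_mult, Cmod_Cexp.
assert (Hx := re_le_Cmod h). assert (Hy := im_le_Cmod h).
set (t := Cmod h) in *.
specialize (H1 (Re h)). specialize (H2 (Im h)). specialize (H3 (Im h)).
rewrite Rminus_0_r in H1, H2, H3. rewrite exp_0 in H1. rewrite cos_0 in H2. rewrite sin_0 in H3.
specialize (H1 ltac:(lra)). specialize (H2 ltac:(lra)). specialize (H3 ltac:(lra)).
assert (Ht : 0 <= t) by apply Cmod_ge_0.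
assert (Hex : Cmod (Cexp h - 1 - h) <= 6 * e * t).
{ eapply Rle_trans; [apply Cmod_le_sum|].
  set (X := exp (Re h)) in *. set (c := cos (Im h)) in *. set (S := sin (Im h)) in *.
  replace (Re (Cexp h - 1 - h)) with ((X - 1 - 1 * Re h) + X * (c - 1 - 0 * Im h))
    by (unfold Cexp, X, c, Re, Im; simpl; ring).
  replace (Im (Cexp h - 1 - h)) with (X * (S - 0 - 1 * Im h) + Im h * (X - 1))
    by (unfold Cexp, X, S, Re, Im; simpl; ring).
  assert (HX0 : Rabs (X - 1) <= e).
  { replace (X - 1) with ((X - 1 - 1 * Re h) + Re h) by ring.
    eapply Rle_trans; [apply Rabs_triang|]. nra. }
  assert (HX : 0 < X <= 2).
  { split; [apply exp_pos|]. generalize (Rle_abs (X - 1)). lra. }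
  assert (T1 := Rabs_triang (X - 1 - 1 * Re h) (X * (c - 1 - 0 * Im h))).
  assert (T2 := Rabs_triang (X * (S - 0 - 1 * Im h)) (Im h * (X - 1))).
  rewrite Rabs_mult in T1. rewrite !Rabs_mult in T2. rewrite (Rabs_pos_eq X) in T1, T2 by lra.
  assert (P1 := Rabs_pos (Re h)). assert (P2 := Rabs_pos (Im h)).
  assert (P3 := Rabs_pos (c - 1 - 0 * Im h)). assert (P4 := Rabs_pos (S - 0 - 1 * Im h)).
  assert (P5 := Rabs_pos (X - 1)).
  assert (Q1 : e * Rabs (Re h) <= e * t) by (apply Rmult_le_compat_l; lra).
  assert (Q2 : e * Rabs (Im h) <= e * t) by (apply Rmult_le_compat_l; lra).
  assert (Q3 : X * Rabs (c - 1 - 0 * Im h) <= 2 * (e * t)) by (apply Rmult_le_compat; lra).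
  assert (Q4 : X * Rabs (S - 0 - 1 * Im h) <= 2 * (e * t)) by (apply Rmult_le_compat; lra).
  assert (Q5 : Rabs (Im h) * Rabs (X - 1) <= t * e) by (apply Rmult_le_compat; lra).
  lra. }
apply Rle_trans with (exp (Re s) * (6 * e * t)).
- apply Rmult_le_compat_l; [left; apply exp_pos|easy].
- replace (exp (Re s) * (6 * e * t)) with (e * (6 * exp (Re s)) * t) by ring.
  apply Rmult_le_compat_r; easy.
Qed.

Lemma Cexp_Ci (t : R) : Cexp (RtoC t * Ci) = circ t.
Proof.
unfold Cexp, circ, Cmult, Ci, RtoC; simpl.
replace (t * 0 - 0 * 1) with 0 by ring. replace (t * 1 + 0 * 0) with t by ring.
rewrite exp_0. f_equal; ring.
Qed.

(** The circle is the image of a vertical line under [Cexp], so the derivative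
    along it follows from [cder_line] by the chain rule. *)
Lemma cder_circ (f : C -> C) (e c a : C) (t : R) (l : C) :
  cder f (c + a * circ t)%C l ->
  is_derive (fun u : R => Re (e * f (c + a * circ u))%C) t
    (Re (e * (l * (a * (Ci * circ t))))%C).
Proof.
intros H.
assert (H1 := cder_line (fun s => f (c + a * Cexp s)%C) e (RtoC 0) Ci t
  (l * (RtoC 0 + a * Cexp (RtoC 0 + RtoC t * Ci)))%C).
replace (l * (a * (Ci * circ t)))%C
  with (l * (RtoC 0 + a * Cexp (RtoC 0 + RtoC t * Ci)) * Ci)%C
  by (rewrite !Cplus_0_l, Cexp_Ci; ring).
eapply is_derive_ext; [|apply H1].
- intros u. cbv beta. now rewrite Cplus_0_l, Cexp_Ci.
- apply (cder_comp f (fun s => c + a * Cexp s)%C).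
  + rewrite Cplus_0_l, Cexp_Ci. exact H.
  + apply cder_plus; [apply cder_const|]. apply cder_scal, cder_Cexp.
Qed.

Lemma ex_RInt_cont (f : R -> R) (a b : R) : (forall t, continuous f t) -> ex_RInt f a b.
Proof. intros H. apply (@ex_RInt_continuous R_CompleteNormedModule). intros; apply H. Qed.

(** The interval of parameters is larger than [[0, 1]] so that differentiation
    under the integral sign applies at its ends. *)
Lemma RInt_const_param (P dP : R -> R -> R) (a b : R) : a < 0 -> 1 < b ->
  (forall l t, a < l < b -> is_derive (fun u => P u t) l (dP l t)) ->
  (forall l t, a < l < b -> continuous (fun q : R * R => dP (fst q) (snd q)) (l, t)) ->
  (forall l t, a < l < b -> continuous (P l) t) ->
  (forall l, a < l < b -> RInt (dP l) 0 (2 * PI) = 0) ->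
  RInt (P 1) 0 (2 * PI) = RInt (P 0) 0 (2 * PI).
Proof.
intros Ha Hb HP HdP Hc H0.
assert (Hloc : forall l, a < l < b -> locally l (fun x => a < x < b)).
{ intros l Hl. apply (open_and (fun x => a < x) (fun x => x < b));
    [apply open_gt|apply open_lt|easy]. }
assert (HD : forall l, a < l < b ->
   is_derive (fun u => RInt (P u) 0 (2 * PI)) l 0).
{ intros l Hl.
  assert (E : RInt (fun t => Derive (fun u => P u t) l) 0 (2 * PI) = 0).
  { transitivity (RInt (dP l) 0 (2 * PI)); [|now apply H0]. apply RInt_ext. intros x _. now apply is_derive_unique, HP. }
  assert (HH : is_derive (fun u => RInt (P u) 0 (2 * PI)) l
    (RInt (fun t => Derive (fun u => P u t) l) 0 (2 * PI))); [|now rewrite E in HH].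
  apply is_derive_RInt_param.
  - generalize (Hloc l Hl). apply filter_imp. intros x Hx t _. eexists. now apply HP.
  - intros t _. apply continuity_2d_pt_filterlim.
    apply filterlim_ext_loc with (fun q : R * R => dP (fst q) (snd q)).
    + destruct (Hloc l Hl) as [d Hd]. exists d. intros [x y] [Hx _]. simpl.
      symmetry. apply is_derive_unique, HP. apply Hd. exact Hx.
    + replace (Derive (fun z : R => P z t) l) with (dP l t)
        by (symmetry; now apply is_derive_unique, HP).
      now apply HdP.
  - generalize (Hloc l Hl). apply filter_imp. intros x Hx.
    apply ex_RInt_cont. intros t. now apply Hc. }
destruct (MVT_gen (fun u => RInt (P u) 0 (2 * PI)) 0 1 (fun _ => 0)) as (c & _ & Hc').
- intros x Hx. rewrite Rmin_left, Rmax_right in Hx by lra. apply HD. lra.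
- intros x Hx. rewrite Rmin_left, Rmax_right in Hx by lra.
  apply continuity_pt_filterlim. apply (@ex_derive_continuous R_AbsRing R_NormedModule (fun u => RInt (P u) 0 (2 * PI))).
  exists 0. exact (HD x ltac:(lra)).
- simpl in Hc'. lra.
Qed.

(** Continuously complex differentiable on the disc of radius [r].  Requiring
    the derivative to be continuous makes Cauchy's formula a matter of
    differentiating under the integral sign. *)
Definition hol1 (r : R) (f df : C -> C) : Prop :=
  forall z, Cmod z < r -> cder f z (df z) /\ continuous df z.

Lemma Cmod_segment (r l : R) (z : C) (t : R) : Cmod z < r -> -1/2 < l < 3/2 ->
  Cmod (z + RtoC l * (RtoC r * circ t - z)) < 2 * r.
Proof.
intros Hz Hl. assert (0 <= Cmod z) by apply Cmod_ge_0.
replace (z + RtoC l * (RtoC r * circ t - z))%C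
  with (RtoC (1 - l) * z + RtoC (l * r) * circ t)%C
  by (rewrite RtoC_minus, RtoC_mult; ring).
eapply Rle_lt_trans; [apply Cmod_triangle|].
rewrite !Cmod_mult, !Cmod_R, Cmod_circ, Rabs_mult, (Rabs_pos_eq r) by lra.
unfold Rabs; repeat destruct Rcase_abs; nra.
Qed.

Lemma circ_period : circ (2 * PI) = circ 0.
Proof. unfold circ. now rewrite cos_2PI, sin_2PI, cos_0, sin_0. Qed.

(** The integrand is the derivative of a [2 pi]-periodic function of [t]. *)
Lemma RInt_circ_derive (f df : C -> C) (e c a : C) :
  (forall t, cder f (c + a * circ t)%C (df (c + a * circ t)%C)) ->
  (forall t, continuous df (c + a * circ t)%C) ->
  RInt (fun t => Re (e * (df (c + a * circ t)%C * (a * (Ci * circ t))))%C) 0 (2 * PI) = 0.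
Proof.
intros H Hc. apply is_RInt_unique.
replace 0 with (Re (e * f (c + a * circ (2 * PI)))%C - Re (e * f (c + a * circ 0))%C) at 2
  by (rewrite circ_period; ring).
apply (is_RInt_derive (fun u : R => Re (e * f (c + a * circ u))%C)).
- intros x _. apply cder_circ. apply H.
- intros x _. apply continuous_Re. apply continuous_Cmult; [apply continuous_const|].
  apply continuous_Cmult.
  + apply (continuous_comp (fun t => (c + a * circ t)%C) df); [|apply Hc].
    apply continuous_Cplus; [apply continuous_const|].
    apply continuous_Cmult; [apply continuous_const|].
    apply continuous_circ, continuous_id.
  + apply (continuous_Cmult (fun _ => a) (fun t => Ci * circ t)%C); [apply continuous_const|].
    apply (continuous_Cmult (fun _ => Ci)); [apply continuous_const|].
    apply continuous_circ, continuous_id.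
Qed.

Ltac cont :=
  repeat match goal with
  | |- continuous (fun _ => ?c) _ => apply continuous_const
  | |- continuous (fun x => x) _ => apply continuous_id
  | |- continuous (fun x => Cplus _ _) _ => apply continuous_Cplus
  | |- continuous (fun x => Cminus _ _) _ => apply continuous_Cminus
  | |- continuous (fun x => Copp _) _ => apply continuous_Copp
  | |- continuous (fun x => Cmult _ _) _ => apply continuous_Cmult
  | |- continuous (fun x => circ _) _ => apply continuous_circ
  | |- continuous circ _ => apply (continuous_circ (fun x => x))
  | |- continuous (fun x => RtoC _) _ => apply continuous_RtoC
  | |- continuous RtoC _ => apply (continuous_RtoC (fun x => x))
  end.

Lemma circ_sub_neq0 (r : R) (z : C) (t : R) : Cmod z < r -> (RtoC r * circ t - z)%C <> RtoC 0.
Proof.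
intros Hz E. assert (0 <= Cmod z) by apply Cmod_ge_0. assert (0 <= r) by lra.
assert (H1 : (RtoC r * circ t)%C = z).
{ replace (RtoC r * circ t)%C with ((RtoC r * circ t - z) + z)%C by ring. rewrite E. ring. }
rewrite <- H1, Cmod_mult, Cmod_circ, Cmod_R, Rabs_pos_eq in Hz; lra.
Qed.

Lemma continuous_fst' (p : R * R) : continuous (fun q : R * R => fst q) p.
Proof. destruct p. apply continuous_fst. Qed.
Lemma continuous_snd' (p : R * R) : continuous (fun q : R * R => snd q) p.
Proof. destruct p. apply continuous_snd. Qed.

(** Replacing [z] by [l * z] does not change the integral, since the
    derivative with respect to [l] is a derivative along the circle; at [l =
    0] the kernel is 1. *)
Lemma RInt_kernel (e : C) (r : R) (z : C) : Cmod z < r ->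
  RInt (fun t => Re (e * (RtoC r * circ t / (RtoC r * circ t - z)))%C) 0 (2 * PI) = 2 * PI * Re e.
Proof.
intros Hz. assert (Hz0 : 0 <= Cmod z) by apply Cmod_ge_0.
set (b := (r + Cmod z) / 2 / ((3 * Cmod z + r) / 4)).
assert (Hb0 : 0 < (3 * Cmod z + r) / 4) by lra.
assert (Hb : 1 < b).
{ unfold b. apply Rmult_lt_reg_r with (1 := Hb0).
  set (Y := (3 * Cmod z + r) / 4) in *.
  replace ((r + Cmod z) / 2 / Y * Y) with ((r + Cmod z) / 2) by (field; lra).
  unfold Y. lra. }
assert (Hlz : forall l, -b < l < b -> Cmod (RtoC l * z) < r).
{ intros l Hl. rewrite Cmod_mult, Cmod_R.
  assert (Rabs l < b) by (apply Rabs_def1; lra).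
  apply Rle_lt_trans with (b * Cmod z); [nra|].
  apply Rle_lt_trans with (b * ((3 * Cmod z + r) / 4)); [apply Rmult_le_compat_l; lra|].
  unfold b. set (Y := (3 * Cmod z + r) / 4) in *.
  replace ((r + Cmod z) / 2 / Y * Y) with ((r + Cmod z) / 2) by (field; lra). lra. }
pose (P := fun l t => Re (e * (RtoC r * circ t / (RtoC r * circ t - RtoC l * z)))%C).
pose (dP := fun l t => Re (e * (RtoC r * circ t * (z /
   ((RtoC r * circ t - RtoC l * z) * (RtoC r * circ t - RtoC l * z)))))%C).
assert (H : RInt (P 1) 0 (2 * PI) = RInt (P 0) 0 (2 * PI)).
{ apply (RInt_const_param P dP (-b) b); [lra|lra| | | |].
  - intros l t Hl. unfold P, dP.
    assert (Hn := circ_sub_neq0 _ _ t (Hlz l Hl)).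
    assert (H1 := cder_line (fun s => RtoC r * circ t * / (RtoC r * circ t - s * z))%C e (RtoC 0)
      (RtoC 1) l (RtoC r * circ t * (z /
   ((RtoC r * circ t - RtoC l * z) * (RtoC r * circ t - RtoC l * z))))%C).
    eapply is_derive_ext; [|eapply is_derive_eq; [apply H1|]].
    + intros u. cbv beta. now rewrite Cplus_0_l, Cmult_1_r.
    + rewrite Cplus_0_l, Cmult_1_r. apply cder_scal.
      eapply cder_eq.
      * apply (cder_inv (fun s => RtoC r * circ t - s * z)%C); [easy|].
        apply cder_minus; [apply cder_const|].
        apply cder_mult; [apply cder_id|apply cder_const].
      * cbv beta. field. easy.
    + now rewrite Cmult_1_r.
  - intros l t Hl. unfold dP.
    assert (Hn := circ_sub_neq0 _ _ t (Hlz l Hl)).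
    apply continuous_Re. unfold Cdiv. cont; try apply continuous_snd'.
    apply continuous_Cinv; [simpl; now apply Cmult_neq_0|].
    cont; try apply continuous_snd'; try apply continuous_fst'.
  - intros l t Hl. unfold P.
    assert (Hn := circ_sub_neq0 _ _ t (Hlz l Hl)).
    apply continuous_Re. unfold Cdiv. cont.
    apply continuous_Cinv; [easy|]. cont.
  - intros l Hl. unfold dP.
    assert (Hn := fun t => circ_sub_neq0 _ _ t (Hlz l Hl)).
    etransitivity; [|apply (RInt_circ_derive (fun s => Ci * z * / (s - RtoC l * z))%C
      (fun s => Ci * z * (- RtoC 1 / ((s - RtoC l * z) * (s - RtoC l * z))))%C e (RtoC 0) (RtoC r))].
    + apply RInt_ext. intros t _. f_equal. f_equal. cbv beta. rewrite !Cplus_0_l.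
      specialize (Hn t).
      replace (RtoC r * circ t * (z / ((RtoC r * circ t - RtoC l * z) * (RtoC r * circ t - RtoC l * z))))%C
        with ((- (Ci * Ci)) * (RtoC r * circ t * (z / ((RtoC r * circ t - RtoC l * z) * (RtoC r * circ t - RtoC l * z)))))%C.
      * cbv beta. field. easy.
      * replace (- (Ci * Ci))%C with (RtoC 1); [ring|].
        unfold Ci, Copp, Cmult, RtoC; simpl. f_equal; ring.
    + intros t. rewrite Cplus_0_l. specialize (Hn t). eapply cder_eq.
      * apply cder_scal.
        apply (cder_inv (fun s => s - RtoC l * z)%C); [easy|].
        apply cder_minus; [apply cder_id|apply cder_const].
      * cbv beta. field. easy.
    + intros t. rewrite Cplus_0_l. specialize (Hn t). unfold Cdiv. cont.
      apply continuous_Cinv; [now apply Cmult_neq_0|]. cont. }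
transitivity (RInt (P 1) 0 (2 * PI)).
{ apply RInt_ext. intros t _. unfold P. now rewrite Cmult_1_l. }
rewrite H. transitivity (RInt (fun _ => Re e) 0 (2 * PI)).
- apply RInt_ext. intros t _. unfold P.
  replace (RtoC r * circ t / (RtoC r * circ t - RtoC 0 * z))%C with (RtoC 1); [now rewrite Cmult_1_r|].
  assert (Hn : (RtoC r * circ t - RtoC 0)%C <> RtoC 0).
  { apply circ_sub_neq0. rewrite Cmod_0. lra. }
  assert (Hn' : (RtoC r * circ t)%C <> RtoC 0).
  { intros E. apply Hn. rewrite E. ring. }
  rewrite Cmult_0_l. unfold Cminus. rewrite Copp_0, Cplus_0_r. unfold Cdiv. now rewrite Cinv_r.
- rewrite RInt_const. unfold scal; simpl; unfold mult; simpl. ring.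
Qed.

(** The points [w l t] join the circle to [z]. The derivative of the integral
    with respect to [l] is an integral of a derivative along a circle, hence
    zero, and at [l = 0] the integral is that of the kernel. The factor [e]
    extracts real components, because only real functions are integrated. *)
Lemma cauchy_formula (e : C) (r : R) (z : C) (f df : C -> C) :
  hol1 (2 * r) f df -> Cmod z < r ->
  RInt (fun t => Re (e * (f (RtoC r * circ t) * (RtoC r * circ t / (RtoC r * circ t - z))))%C)
     0 (2 * PI) = 2 * PI * Re (e * f z)%C.
Proof.
intros Hf Hz. assert (Hz0 : 0 <= Cmod z) by apply Cmod_ge_0.
assert (Hn := fun t => circ_sub_neq0 r z t Hz).
set (w := fun l t => (z + RtoC l * (RtoC r * circ t - z))%C).
pose (P := fun l t => Re (e * (f (w l t) * (RtoC r * circ t / (RtoC r * circ t - z))))%C).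
pose (dP := fun l t => Re (e * (df (w l t) * (RtoC r * circ t)))%C).
assert (Hw := fun l t Hl => Hf (w l t) (Cmod_segment r l z t Hz Hl)).
assert (H : RInt (P 1) 0 (2 * PI) = RInt (P 0) 0 (2 * PI)).
{ apply (RInt_const_param P dP (-1/2) (3/2)); [lra|lra| | | |].
  - intros l t Hl. destruct (Hw l t Hl) as [H1 _]. unfold P, dP.
    assert (H2 := cder_line f (e * (RtoC r * circ t / (RtoC r * circ t - z)))%C _ _ _ _ H1).
    eapply is_derive_ext; [|eapply is_derive_eq; [apply H2|]].
    + intros u. cbv beta. f_equal. unfold w. ring.
    + f_equal. field. apply Hn.
  - intros l t Hl. destruct (Hw l t Hl) as [_ H1]. unfold dP.
    apply continuous_Re. cont; try apply continuous_snd'.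
    apply (continuous_comp (fun q : R * R => w (fst q) (snd q)) df); [|exact H1].
    unfold w. cont; try apply continuous_snd'; try apply continuous_fst'.
  - intros l t Hl. destruct (Hw l t Hl) as [H1 _]. unfold P.
    apply continuous_Re. unfold Cdiv. cont.
    + apply (continuous_comp (w l) f); [|eapply cder_continuous; exact H1].
      unfold w. cont.
    + apply continuous_Cinv; [apply Hn|]. cont.
  - intros l Hl. unfold dP.
    destruct (Req_dec l 0) as [->|Hl0].
    + (* at [l = 0] the integrand is a constant times [circ t] *)
      etransitivity; [|apply (RInt_circ_derive (fun s => - Ci * df z * s)%C (fun s => - Ci * df z * RtoC 1)%C e (RtoC 0) (RtoC r))].
      * apply RInt_ext. intros t _. f_equal. f_equal. unfold w.
        rewrite Cmult_0_l, Cplus_0_r.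
        replace (- Ci * df z * 1 * (RtoC r * (Ci * circ t)))%C with (-(Ci * Ci) * (df z * (RtoC r * circ t)))%C by ring.
        replace (- (Ci * Ci))%C with (RtoC 1); [ring|].
        unfold Ci, Copp, Cmult, RtoC; simpl. f_equal; ring.
      * intros t. apply cder_scal. apply cder_id.
      * intros t. cont.
    + assert (Hlc : RtoC l <> RtoC 0) by (intros E; now apply RtoC_inj in E).
      etransitivity; [|apply (RInt_circ_derive (fun s => - Ci * / RtoC l * f s)%C (fun s => - Ci * / RtoC l * df s)%C e
        ((RtoC 1 - RtoC l) * z)%C (RtoC l * RtoC r)%C)].
      * apply RInt_ext. intros t _. f_equal. f_equal.
        replace ((1 - l) * z + l * r * circ t)%C with (w l t) by (unfold w; ring).
        replace (- Ci * / l * df (w l t) * (l * r * (Ci * circ t)))%C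
          with (-(Ci * Ci) * (df (w l t) * (r * circ t)))%C by (field; easy).
        replace (- (Ci * Ci))%C with (RtoC 1); [ring|].
        unfold Ci, Copp, Cmult, RtoC; simpl. f_equal; ring.
      * intros t. apply cder_scal.
        replace ((1 - l) * z + l * r * circ t)%C with (w l t) by (unfold w; ring).
        apply Hw, Hl.
      * intros t.
        replace ((1 - l) * z + l * r * circ t)%C with (w l t) by (unfold w; ring).
        cont. apply Hw, Hl. }
transitivity (RInt (P 1) 0 (2 * PI)).
{ apply RInt_ext. intros t _. unfold P. do 4 f_equal. unfold w. ring. }
rewrite H.
rewrite <- (RInt_kernel (e * f z) r z Hz).
apply RInt_ext. intros t _. unfold P. f_equal.
replace (w 0 t) with z by (unfold w; ring). ring.
Qed.

Definition CInt (g : R -> C) : C :=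
  (RInt (fun t => Re (g t)) 0 (2 * PI), RInt (fun t => Im (g t)) 0 (2 * PI)).

Lemma CInt_Re (e : C) (g : R -> C) : (forall t, continuous g t) ->
  Re (e * CInt g)%C = RInt (fun t => Re (e * g t)%C) 0 (2 * PI).
Proof.
intros Hg. symmetry. apply is_RInt_unique.
assert (H1 : is_RInt (fun t => Re (g t)) 0 (2 * PI) (Re (CInt g))).
{ apply (@RInt_correct R_CompleteNormedModule).
  apply ex_RInt_cont. intros t. now apply continuous_Re. }
assert (H2 : is_RInt (fun t => Im (g t)) 0 (2 * PI) (Im (CInt g))).
{ apply (@RInt_correct R_CompleteNormedModule).
  apply ex_RInt_cont. intros t. now apply continuous_Im. }
exact (is_RInt_minus _ _ _ _ _ _ (is_RInt_scal _ _ _ (Re e) _ H1) (is_RInt_scal _ _ _ (Im e) _ H2)).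
Qed.

Lemma CInt_bound (g1 g0 g2 : R -> C) (c : C) (M : R) :
  (forall t, continuous g1 t) -> (forall t, continuous g0 t) ->
  (forall t, continuous g2 t) ->
  (forall t, Cmod (g1 t - g0 t - g2 t * c) <= M) ->
  Cmod (CInt g1 - CInt g0 - CInt g2 * c) <= 2 * PI * M.
Proof.
intros H1 H0 H2 HM.
destruct (C_unit_dir (CInt g1 - CInt g0 - CInt g2 * c)) as (e & He & <-).
replace (Re (e * (CInt g1 - CInt g0 - CInt g2 * c)))
  with (Re (e * CInt g1) - Re (e * CInt g0) - Re (e * c * CInt g2))
  by (unfold Re; simpl; ring).
rewrite !CInt_Re by easy.
assert (C1 : forall (e' : C) g, (forall t, continuous g t) ->
   ex_RInt (fun t => Re (e' * g t)%C) 0 (2 * PI)).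
{ intros e' g Hg. apply ex_RInt_cont. intros t. apply continuous_Re. cont. apply Hg. }
assert (HP := PI_RGT_0).
rewrite <- (@RInt_minus R_CompleteNormedModule (fun t => Re (e * g1 t)%C) (fun t => Re (e * g0 t)%C)) by auto.
rewrite <- (@RInt_minus R_CompleteNormedModule); auto.
2: { apply ex_RInt_minus; auto. }
replace (2 * PI * M) with (RInt (fun _ => M) 0 (2 * PI))
  by (rewrite RInt_const; unfold scal; simpl; unfold mult; simpl; ring).
apply RInt_le; [lra| | |].
- apply (@ex_RInt_minus R_NormedModule); auto. apply (@ex_RInt_minus R_NormedModule); auto.
- apply ex_RInt_const.
- intros t _.
  change (Re (e * g1 t) - Re (e * g0 t) - Re (e * c * g2 t) <= M).
  replace (Re (e * g1 t) - Re (e * g0 t) - Re (e * c * g2 t))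
    with (Re (e * (g1 t - g0 t - g2 t * c))) by (unfold Re; simpl; ring).
  eapply Rle_trans; [apply Rle_abs|]. eapply Rle_trans; [apply re_le_Cmod|].
  rewrite Cmod_mult. specialize (HM t).
  assert (T := Cmod_ge_0 (g1 t - g0 t - g2 t * c)). assert (T' := Cmod_ge_0 e). nra.
Qed.

Lemma Cmod_circ_sub_ge (r : R) (z : C) (t : R) : 0 <= r ->
  r - Cmod z <= Cmod (RtoC r * circ t - z).
Proof.
intros Hr. assert (T := Cmod_triangle (RtoC r * circ t - z) z).
replace (r * circ t - z + z)%C with (RtoC r * circ t)%C in T by ring.
rewrite Cmod_mult, Cmod_circ, Cmod_R, Rabs_pos_eq in T; lra.
Qed.

(** Differentiation under the integral sign, with explicit remainders: the
    distance from the circle to the points near [z] is at least [eta]. *)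
Lemma cauchy_kernel_derive (r : R) (g : R -> C) (z : C) (M : R) :
  Cmod z < r -> (forall t, continuous g t) -> (forall t, Cmod (g t) <= M) ->
  let K1 := fun z => CInt (fun t => g t / (RtoC r * circ t - z))%C in
  let K2 := fun z => CInt (fun t => g t / ((RtoC r * circ t - z) * (RtoC r * circ t - z)))%C in
  cder K1 z (K2 z) /\ continuous K2 z.
Proof.
intros Hz Hg HM K1 K2. assert (Hz0 : 0 <= Cmod z) by apply Cmod_ge_0.
set (eta := (r - Cmod z) / 2). assert (Heta : 0 < eta) by (unfold eta; lra).
assert (HM0 : 0 <= M) by (eapply Rle_trans; [apply Cmod_ge_0|apply (HM 0)]).
assert (Hfar : forall z', Cmod (z' - z) < eta -> Cmod z' < r /\
   forall t, eta <= Cmod (RtoC r * circ t - z')).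
{ intros z' Hz'.
  assert (T := Cmod_triangle (z' - z) z). replace (z' - z + z)%C with z' in T by ring.
  split; [unfold eta in *; lra|]. intros t.
  assert (T' := Cmod_circ_sub_ge r z' t). unfold eta in *; lra. }
assert (Hzz : Cmod (z - z) < eta) by (replace (z - z)%C with (RtoC 0) by ring; now rewrite Cmod_0).
destruct (Hfar z Hzz) as [_ Hz1].
assert (Hc1 : forall z', Cmod z' < r -> forall t, continuous (fun t => g t / (RtoC r * circ t - z'))%C t).
{ intros z' Hz' t. unfold Cdiv. cont; [apply Hg|].
  apply continuous_Cinv; [now apply circ_sub_neq0|]. cont. }
assert (Hc2 : forall z', Cmod z' < r -> forall t,
   continuous (fun t => g t / ((RtoC r * circ t - z') * (RtoC r * circ t - z')))%C t).
{ intros z' Hz' t. unfold Cdiv. cont; [apply Hg|].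
  apply continuous_Cinv; [apply Cmult_neq_0; now apply circ_sub_neq0|]. cont. }
assert (Hi : 0 < / eta) by now apply Rinv_0_lt_compat.
assert (Hinv : forall c : C, eta <= Cmod c -> Cmod (/ c) <= / eta).
{ intros c Hc. rewrite Cmod_inv; [apply Rinv_le_contravar; easy|].
  apply Cmod_gt_0. lra. }
assert (HPI := PI_RGT_0). split.
- apply cder_eps. intros eps Heps.
  set (A := 2 * PI * (M * (/ eta * (/ eta * / eta)))).
  assert (HA : 0 <= A).
  { unfold A. repeat (apply Rmult_le_pos; try lra). }
  assert (Hd : 0 < eps / (1 + A)) by (apply Rdiv_lt_0_compat; lra).
  exists (Rmin eta (eps / (1 + A))). split; [now apply Rmin_pos|].
  intros w Hw.
  assert (Hw1 : Cmod (w - z) < eta) by (eapply Rlt_le_trans; [apply Hw|apply Rmin_l]).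
  assert (Hw2 : Cmod (w - z) < eps / (1 + A)) by (eapply Rlt_le_trans; [apply Hw|apply Rmin_r]).
  destruct (Hfar w Hw1) as [Hwr Hwf].
  set (h := Cmod (w - z)) in *. assert (Hh : 0 <= h) by apply Cmod_ge_0.
  apply Rle_trans with (2 * PI * (M * (h * h * (/ eta * (/ eta * / eta))))).
  + apply CInt_bound; try now auto.
    intros t. assert (N1 := circ_sub_neq0 r z t Hz). assert (N2 := circ_sub_neq0 r w t Hwr).
    set (a := (r * circ t - z)%C) in *. set (b := (r * circ t - w)%C) in *.
    replace (g t / b - g t / a - g t / (a * a) * (w - z))%C
      with (g t * ((w - z) * (w - z) * (/ b * (/ a * / a))))%C.
    * rewrite !Cmod_mult. fold h.
      assert (B1 := Hinv _ (Hz1 t)). assert (B2 := Hinv _ (Hwf t)). fold a in B1. fold b in B2.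
      apply Rmult_le_compat; [apply Cmod_ge_0| |apply HM|].
      -- repeat apply Rmult_le_pos; try apply Cmod_ge_0; easy.
      -- apply Rmult_le_compat_l; [nra|].
         apply Rmult_le_compat; try apply Cmod_ge_0; [|easy|].
         ++ apply Rmult_le_pos; apply Cmod_ge_0.
         ++ apply Rmult_le_compat; try apply Cmod_ge_0; easy.
    * replace (w - z)%C with (a - b)%C by (unfold a, b; ring). field. easy.
  + replace (2 * PI * (M * (h * h * (/ eta * (/ eta * / eta))))) with (A * h * h)
      by (unfold A; ring).
    apply Rmult_le_compat_r; [easy|].
    apply Rle_trans with ((1 + A) * h); [nra|].
    apply (Rmult_lt_compat_l (1 + A)) in Hw2; [|lra].
    replace ((1 + A) * (eps / (1 + A))) with eps in Hw2 by (field; lra). lra.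
- apply continuous_C_eps. intros eps Heps.
  set (A := 2 * PI * (M * (2 * (/ eta * (/ eta * / eta))))).
  assert (HA : 0 <= A).
  { unfold A. repeat (apply Rmult_le_pos; try lra). }
  assert (Hd : 0 < eps / (1 + A)) by (apply Rdiv_lt_0_compat; lra).
  exists (Rmin eta (eps / (1 + A))). split; [now apply Rmin_pos|].
  intros w Hw.
  assert (Hw1 : Cmod (w - z) < eta) by (eapply Rlt_le_trans; [apply Hw|apply Rmin_l]).
  assert (Hw2 : Cmod (w - z) < eps / (1 + A)) by (eapply Rlt_le_trans; [apply Hw|apply Rmin_r]).
  destruct (Hfar w Hw1) as [Hwr Hwf].
  set (h := Cmod (w - z)) in *. assert (Hh : 0 <= h) by apply Cmod_ge_0.
  apply Rle_lt_trans with (2 * PI * (M * (h * (2 * (/ eta * (/ eta * / eta)))))).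
  + replace (K2 w - K2 z)%C with (K2 w - K2 z - CInt (fun _ => RtoC 0) * RtoC 0)%C by ring.
    apply CInt_bound; try now auto.
    { intros t. apply continuous_const. }
    intros t. assert (N1 := circ_sub_neq0 r z t Hz). assert (N2 := circ_sub_neq0 r w t Hwr).
    set (a := (r * circ t - z)%C) in *. set (b := (r * circ t - w)%C) in *.
    replace (g t / (b * b) - g t / (a * a) - 0 * 0)%C
      with (g t * ((w - z) * (/ b * (/ a * / a) + / b * (/ b * / a))))%C.
    * rewrite !Cmod_mult. fold h.
      assert (B1 := Hinv _ (Hz1 t)). assert (B2 := Hinv _ (Hwf t)). fold a in B1. fold b in B2.
      apply Rmult_le_compat; [apply Cmod_ge_0| |apply HM|].
      -- repeat apply Rmult_le_pos; try apply Cmod_ge_0; easy.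
      -- apply Rmult_le_compat_l; [easy|].
         eapply Rle_trans; [apply Cmod_triangle|]. rewrite !Cmod_mult.
         assert (P1 := Cmod_ge_0 (/ a)). assert (P2 := Cmod_ge_0 (/ b)).
         set (x := Cmod (/ a)) in *. set (y := Cmod (/ b)) in *. set (q := / eta) in *.
         assert (x * x <= q * q) by (apply Rmult_le_compat; lra).
         assert (y * x <= q * q) by (apply Rmult_le_compat; lra).
         assert (y * (x * x) <= q * (q * q)) by (apply Rmult_le_compat; nra).
         assert (y * (y * x) <= q * (q * q)) by (apply Rmult_le_compat; nra). lra.
    * replace (w - z)%C with (a - b)%C by (unfold a, b; ring). field. easy.
  + replace (2 * PI * (M * (h * (2 * (/ eta * (/ eta * / eta)))))) with (A * h)
      by (unfold A; ring).
    apply (Rmult_lt_compat_l (1 + A)) in Hw2; [|lra].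
    replace ((1 + A) * (eps / (1 + A))) with eps in Hw2 by (field; lra). nra.
Qed.

Lemma periodic_representative (T : Type) (f : R -> T) :
  (forall t, f (t + 2 * PI) = f t) ->
  (forall k t, f (t + 2 * PI * IZR k) = f t) /\
  (forall t, exists s, 0 <= s <= 2 * PI /\ f s = f t).
Proof.
intros Hf. assert (HPI := PI_RGT_0).
assert (Hn : forall n t, f (t + 2 * PI * INR n) = f t).
{ induction n as [|n IH]; intros t.
  - simpl. f_equal. ring.
  - rewrite S_INR. rewrite <- (Hf t), <- (IH (t + 2 * PI)). f_equal. ring. }
assert (Hk : forall k t, f (t + 2 * PI * IZR k) = f t).
{ intros k t. destruct (Z_le_gt_dec 0 k) as [Hk|Hk].
  - rewrite <- (Hn (Z.to_nat k) t), INR_IZR_INZ, Z2Nat.id by easy. reflexivity.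
  - rewrite <- (Hn (Z.to_nat (- k)) (t + 2 * PI * IZR k)), INR_IZR_INZ, Z2Nat.id by lia.
    f_equal. rewrite opp_IZR. ring. }
split; [exact Hk|]. intros t.
destruct (archimed (t / (2 * PI))) as [A1 A2].
set (k := (up (t / (2 * PI)) - 1)%Z).
assert (Ek : IZR k = IZR (up (t / (2 * PI))) - 1) by (unfold k; now rewrite minus_IZR).
exists (t + 2 * PI * IZR (- k)). split; [|apply Hk].
rewrite opp_IZR. assert (E : t = t / (2 * PI) * (2 * PI)) by (field; lra).
set (q := t / (2 * PI)) in *. split; rewrite E; nra.
Qed.

(** A zero at the origin can be divided out: by Cauchy's formula
    [f z = f 0 + z / (2 pi) * int f (r e^it) / (r e^it - z) dt]. *)
Lemma hol1_div (r : R) (f df : C -> C) : 0 < r -> hol1 (2 * r) f df -> f (RtoC 0) = RtoC 0 ->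
  exists q dq, hol1 r q dq /\ forall z, Cmod z < r -> f z = (z * q z)%C.
Proof.
intros Hr Hf Hf0. assert (HPI := PI_RGT_0).
set (g := fun t => f (RtoC r * circ t)%C).
assert (Hgc : forall t, continuous g t).
{ intros t. apply (continuous_comp (fun t => RtoC r * circ t)%C f); [cont|].
  eapply cder_continuous. apply Hf.
  rewrite Cmod_mult, Cmod_circ, Cmod_R, Rabs_pos_eq; lra. }
assert (HM : exists M, forall t, Cmod (g t) <= M).
{ destruct (continuity_ab_maj (fun t => Cmod (g t)) 0 (2 * PI)) as (m & Hm & _); [lra| |].
  - intros c _. apply continuity_pt_filterlim.
    apply (@continuous_comp R_UniformSpace C_UniformSpace R_UniformSpace g Cmod); [apply Hgc|].
    intros P HP. destruct HP as [eps HP].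
    apply (proj2 (locally_Cmod (g c) (fun w => P (Cmod w)))).
    exists eps. split; [apply cond_pos|]. intros w Hw.
    apply HP. change (Rabs (Cmod w - Cmod (g c)) < eps).
    assert (T1 := Cmod_triangle (w - g c) (g c)). replace (w - g c + g c)%C with w in T1 by ring.
    assert (T2 := Cmod_triangle (- (w - g c)) w). replace (- (w - g c) + w)%C with (g c) in T2 by ring.
    rewrite Cmod_opp in T2. apply Rabs_def1; lra.
  - exists (Cmod (g m)). intros t.
    (* the maximum over one period bounds all values *)
    assert (Hper : forall t, circ (t + 2 * PI) = circ t).
    { intros u. unfold circ. f_equal; [rewrite <- (cos_period u 1); f_equal; simpl; ring|rewrite <- (sin_period u 1); f_equal; simpl; ring]. }
    assert (Hex := proj2 (periodic_representative C circ Hper) t).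
    destruct Hex as (s & Hs & Es). unfold g at 1. rewrite <- Es. now apply Hm. }
destruct HM as [M HM].
set (K1 := fun z => CInt (fun t => g t / (RtoC r * circ t - z))%C).
set (K2 := fun z => CInt (fun t => g t / ((RtoC r * circ t - z) * (RtoC r * circ t - z)))%C).
exists (fun z => RtoC (/ (2 * PI)) * K1 z)%C, (fun z => RtoC (/ (2 * PI)) * K2 z)%C.
split.
- intros z Hz. destruct (cauchy_kernel_derive r g z M Hz Hgc HM) as [H1 H2]. split.
  + now apply cder_scal.
  + cont. exact H2.
- intros z Hz.
  assert (Hn := fun t => circ_sub_neq0 r z t Hz).
  assert (Hn0 : forall t, (RtoC r * circ t)%C <> RtoC 0).
  { intros t E. assert (T := circ_sub_neq0 r (RtoC 0) t). rewrite E in T.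
    apply T; [now rewrite Cmod_0|ring]. }
  assert (Hall : forall e : C, Re (e * f z) = Re (e * (z * (RtoC (/ (2 * PI)) * K1 z)))).
  { intros e.
    apply Rmult_eq_reg_l with (2 * PI); [|lra].
    rewrite <- (cauchy_formula e r z f df Hf Hz).
    assert (H0 := cauchy_formula e r (RtoC 0) f df Hf). rewrite Cmod_0, Hf0 in H0.
    specialize (H0 Hr). rewrite Cmult_0_r in H0. change (Re (RtoC 0)) with 0 in H0. rewrite Rmult_0_r in H0.
    transitivity (Re (e * z * K1 z)).
    2: { replace (Re (e * (z * (RtoC (/ (2 * PI)) * K1 z)))) with (/ (2 * PI) * Re (e * z * K1 z))
           by (unfold Re; simpl; ring).
         field. lra. }
    unfold K1. rewrite CInt_Re.
    2: { intros t. unfold Cdiv. cont; [apply Hgc|].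
         apply continuous_Cinv; [easy|]. cont. }
    match goal with |- ?I1 = ?I2 => match type of H0 with ?I0 = _ =>
      enough (E : I1 - I0 = I2) by (rewrite <- E, H0; symmetry; apply Rminus_0_r) end end.
    etransitivity; [symmetry; apply (@RInt_minus R_CompleteNormedModule)|].
    3: { apply RInt_ext. intros t _. fold (g t).
      assert (N := Hn t). assert (N0 := Hn0 t).
      change (Re (e * (g t * (r * circ t / (r * circ t - z)))) +
        - Re (e * (g t * (r * circ t / (r * circ t - 0)))) = Re (e * z * (g t / (r * circ t - z)))).
      replace (e * (g t * (r * circ t / (r * circ t - z))))%C
        with (e * z * (g t / (r * circ t - z)) + e * (g t * (r * circ t / (r * circ t - 0))))%C.
      + unfold Re; simpl; ring.
      + field. repeat split; [easy| |]; intros E; apply N0; rewrite E; ring. }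
    - apply ex_RInt_cont. intros t. apply continuous_Re. unfold Cdiv. cont; [apply Hgc|].
      apply continuous_Cinv; [easy|]. cont.
    - apply ex_RInt_cont. intros t. apply continuous_Re. unfold Cdiv. cont; [apply Hgc|].
      apply continuous_Cinv; [|cont]. intros E. apply (Hn0 t). rewrite <- E. ring. }
  assert (R1 := Hall (RtoC 1)). assert (R2 := Hall (- Ci)%C).
  rewrite !Re_1_mult in R1. rewrite !Re_mCi_mult in R2.
  apply injective_projections; [exact R1|exact R2].
Qed.

(** * The logarithm and functions on the universal covering *)

Definition carg (z : C) : R :=
  if Rle_dec 0 (Im z) then acos (Re z / Cmod z) else - acos (Re z / Cmod z).
Definition clog (z : C) : C := (ln (Cmod z), carg z).

Lemma Cexp_clog (z : C) : z <> RtoC 0 -> Cexp (clog z) = z.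
Proof.
intros Hz. assert (Hm : 0 < Cmod z) by now apply Cmod_gt_0.
assert (H2 : Cmod z ^ 2 = Re z ^ 2 + Im z ^ 2) by apply Cmod2_alt.
set (x := Re z / Cmod z). set (y := Im z / Cmod z).
assert (Hxy : x * x + y * y = 1).
{ unfold x, y. apply Rmult_eq_reg_r with (Cmod z ^ 2); [|apply pow_nonzero; lra].
  replace ((Re z / Cmod z * (Re z / Cmod z) + Im z / Cmod z * (Im z / Cmod z)) * Cmod z ^ 2)
    with (Re z ^ 2 + Im z ^ 2) by (field; lra). lra. }
assert (Hx : -1 <= x <= 1) by nra.
assert (Hs : sqrt (1 - x²) = Rabs y).
{ replace (1 - x²) with (y²) by (unfold Rsqr; lra). apply sqrt_Rsqr_abs. }
assert (Hc : cos (carg z) = x /\ sin (carg z) = y).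
{ unfold carg. fold x. destruct Rle_dec as [H|H].
  - rewrite cos_acos, sin_acos, Hs by easy. split; [easy|].
    apply Rabs_pos_eq. unfold y. apply Rmult_le_pos; [easy|].
    left. now apply Rinv_0_lt_compat.
  - rewrite cos_neg, sin_neg, cos_acos, sin_acos, Hs by easy. split; [easy|].
    rewrite Rabs_left; [ring|]. unfold y.
    apply Rmult_lt_reg_r with (Cmod z); [easy|].
    replace (Im z / Cmod z * Cmod z) with (Im z) by (field; lra). lra. }
destruct Hc as [Hc1 Hc2]. unfold Cexp, clog; simpl.
rewrite Hc1, Hc2, exp_ln by easy. unfold x, y.
apply injective_projections; simpl; unfold Re, Im; field; lra.
Qed.

Lemma Cexp_inj (s t : C) : Cexp s = Cexp t ->
  exists k, t = (s + RtoC (2 * PI * IZR k) * Ci)%C.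
Proof.
intros H. assert (HPI := PI_RGT_0).
assert (H1 : Re s = Re t).
{ apply exp_inv. rewrite <- !Cmod_Cexp. now rewrite H. }
unfold Cexp in H. change (fst s) with (Re s) in H. change (fst t) with (Re t) in H.
rewrite H1 in H. injection H as Hc Hs.
assert (He := exp_pos (Re t)).
apply Rmult_eq_reg_l in Hc; [|lra]. apply Rmult_eq_reg_l in Hs; [|lra].
set (a := snd s) in *. set (b := snd t) in *.
assert (Hd : cos (b - a) = 1).
{ rewrite cos_minus, Hc, Hs. generalize (sin2_cos2 b). unfold Rsqr. lra. }
assert (Hh : sin ((b - a) / 2) = 0).
{ assert (Q : cos (b - a) = 1 - 2 * sin ((b - a) / 2) * sin ((b - a) / 2)).
  { rewrite <- cos_2a_sin. f_equal. field. }
  rewrite Hd in Q. nra. }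
destruct (sin_eq_0_0 _ Hh) as [k Hk]. exists k.
apply injective_projections.
- change (Re t = Re (s + RtoC (2 * PI * IZR k) * Ci)). rewrite <- H1.
  unfold Re, Ci; simpl. ring.
- change (b = Im (s + RtoC (2 * PI * IZR k) * Ci)).
  unfold Im, Ci; simpl. fold a. replace (snd s) with a by easy. lra.
Qed.

(** The principal value, whose imaginary part is [atan (Im w / Re w)] near 1,
    is continuous there. *)
Lemma local_log (eps : R) : 0 < eps ->
  exists d, 0 < d /\ forall w, Cmod (w - 1) < d -> exists t, Cmod t < eps /\ Cexp t = w.
Proof.
intros Heps.
assert (C1 : continuous ln 1) by (apply continuous_ln; lra).
assert (C2 : continuous atan 0).
{ apply continuity_pt_filterlim, derivable_continuous_pt, derivable_pt_atan. }
destruct (proj1 (filterlim_locally (F := locally 1) ln (ln 1)) C1 (mkposreal (eps/2) ltac:(lra))) as [d1 H1].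
destruct (proj1 (filterlim_locally (F := locally 0) atan (atan 0)) C2 (mkposreal (eps/2) ltac:(lra))) as [d2 H2].
exists (Rmin (Rmin d1 (d2 / 2)) (1/2)). split.
{ repeat apply Rmin_pos; try lra; [apply cond_pos|]. generalize (cond_pos d2). lra. }
intros w Hw.
assert (Hd : Cmod (w - 1) < d1 /\ Cmod (w - 1) < d2 / 2 /\ Cmod (w - 1) < 1/2).
{ revert Hw. unfold Rmin. repeat destruct Rle_dec; lra. }
destruct Hd as (Hw1 & Hw2 & Hw3).
assert (Hre := re_le_Cmod (w - 1)). assert (Him := im_le_Cmod (w - 1)).
replace (Re (w - 1)) with (Re w - 1) in Hre by (unfold Re; simpl; ring).
replace (Im (w - 1)) with (Im w) in Him by (unfold Im; simpl; ring).
assert (Hr : 1/2 < Re w) by (apply Rabs_le_between in Hre; lra).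
assert (Hm : Rabs (Cmod w - 1) <= Cmod (w - 1)).
{ assert (T1 := Cmod_triangle (w - 1) 1). replace (w - 1 + 1)%C with w in T1 by ring.
  assert (T2 := Cmod_triangle (- (w - 1)) w). replace (- (w - 1) + w)%C with (RtoC 1) in T2 by ring.
  rewrite Cmod_opp in T2. rewrite Cmod_1 in *. apply Rabs_le; lra. }
assert (Hm0 : 0 < Cmod w) by (apply Rabs_le_between in Hm; lra).
set (q := Im w / Re w).
assert (Hq : Rabs q < d2).
{ unfold q, Rdiv. rewrite Rabs_mult, (Rabs_pos_eq (/ Re w)) by (left; apply Rinv_0_lt_compat; lra).
  apply Rmult_lt_reg_r with (Re w); [lra|]. rewrite Rmult_assoc, Rinv_l by lra.
  generalize (cond_pos d2). nra. }
exists (ln (Cmod w), atan q). split.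
- eapply Rle_lt_trans; [apply Cmod_le_sum|].
  specialize (H1 (Cmod w)). specialize (H2 q).
  change (Rabs (Cmod w - 1) < d1 -> Rabs (ln (Cmod w) - ln 1) < eps / 2) in H1.
  change (Rabs (q - 0) < d2 -> Rabs (atan q - atan 0) < eps / 2) in H2.
  rewrite ln_1, Rminus_0_r in H1. rewrite atan_0, !Rminus_0_r in H2.
  specialize (H1 ltac:(lra)). specialize (H2 Hq).
  change (Rabs (ln (Cmod w)) + Rabs (atan q) < eps). lra.
- unfold Cexp; simpl. rewrite exp_ln, cos_atan, sin_atan by easy.
  assert (Hs : sqrt (1 + q²) = Cmod w / Re w).
  { apply sqrt_lem_1.
    - unfold Rsqr; nra.
    - left. apply Rdiv_lt_0_compat; lra.
    - assert (E := Cmod2_alt w). unfold q, Rsqr. simpl in E. field_simplify; [|lra|lra].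
      f_equal. simpl. lra. }
  rewrite Hs. unfold q. apply injective_projections; simpl; unfold Re, Im in *; field; lra.
Qed.

(** Near [Cexp s] the function [g] is [G (s + log (w / Cexp s))] for a local
    logarithm, and the chain rule applies. *)
Lemma descend_cder (G g : C -> C) (L : R) (s l : C) :
  (forall t, Re t < L -> g (Cexp t) = G t) -> Re s < L -> cder G s l ->
  cder g (Cexp s) (l / Cexp s)%C.
Proof.
intros Hg Hs HG. assert (Hz0 := Cexp_neq0 s). set (z0 := Cexp s) in *.
assert (Hm : 0 < Cmod z0) by now apply Cmod_gt_0.
assert (Hz0' : 0 < Cmod z0) by easy.
apply cder_eps. intros eps Heps.
(* [e1] controls both the derivative of [G] and the second order part of [Cexp] *)
set (B := 2 * (1 + Cmod l) / Cmod z0).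
assert (HB : 0 < B).
{ unfold B. apply Rdiv_lt_0_compat; [|easy]. generalize (Cmod_ge_0 l). lra. }
set (e1 := Rmin (1/2) (eps / B)).
assert (He1 : 0 < e1) by (apply Rmin_pos; [lra|now apply Rdiv_lt_0_compat]).
assert (He1a : e1 <= 1/2) by apply Rmin_l.
assert (He1b : e1 * B <= eps).
{ assert (T : e1 <= eps / B) by apply Rmin_r. apply (Rmult_le_compat_r B) in T; [|lra].
  replace (eps / B * B) with eps in T by (field; lra). easy. }
destruct (proj1 (cder_eps _ _ _) HG e1 He1) as (d1 & Hd1 & H1).
destruct (proj1 (cder_eps _ _ _) (cder_Cexp (RtoC 0)) e1 He1) as (d2 & Hd2 & H2).
destruct (local_log (Rmin (Rmin d1 d2) (L - Re s))) as (d & Hd & Hlog).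
{ repeat apply Rmin_pos; lra. }
exists (d * Cmod z0). split; [now apply Rmult_lt_0_compat|]. intros w Hw.
destruct (Hlog (w / z0)%C) as (t & Ht & Et).
{ replace (w / z0 - 1)%C with ((w - z0) / z0)%C by (field; easy).
  rewrite Cmod_div by easy. apply Rmult_lt_reg_r with (Cmod z0); [easy|].
  replace (Cmod (w - z0) / Cmod z0 * Cmod z0) with (Cmod (w - z0)) by (field; lra). easy. }
assert (Ht3 : Cmod t < d1 /\ Cmod t < d2 /\ Cmod t < L - Re s).
{ revert Ht. unfold Rmin. repeat destruct Rle_dec; lra. }
destruct Ht3 as (Ht1 & Ht2 & Ht3).
assert (Ew : w = Cexp (s + t)).
{ rewrite Cexp_plus, Et. fold z0. field. easy. }
assert (Hst : Re (s + t) < L).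
{ assert (T := re_le_Cmod t). replace (Re (s + t)) with (Re s + Re t) by (unfold Re; easy).
  apply Rabs_le_between in T. lra. }
rewrite Ew at 1. rewrite Hg by easy. unfold z0 at 1. rewrite Hg by easy.
specialize (H1 (s + t)%C). replace (s + t - s)%C with t in H1 by ring. specialize (H1 Ht1).
specialize (H2 t). replace (t - 0)%C with t in H2 by ring. specialize (H2 Ht2).
rewrite Cexp_0, Cmult_1_l in H2.
assert (Ewz : (w - z0)%C = (z0 * (Cexp t - 1))%C) by (rewrite Ew, Cexp_plus; fold z0; ring).
assert (Htt : Cmod t <= 2 * (Cmod (w - z0) / Cmod z0)).
{ rewrite Ewz, Cmod_mult.
  replace (Cmod z0 * Cmod (Cexp t - 1) / Cmod z0) with (Cmod (Cexp t - 1)) by (field; lra).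
  assert (T := Cmod_triangle (Cexp t - 1) (- (Cexp t - 1 - t))).
  replace (Cexp t - 1 + - (Cexp t - 1 - t))%C with t in T by ring. rewrite Cmod_opp in T.
  generalize (Cmod_ge_0 t). nra. }
replace (G (s + t)%C - G s - l / z0 * (w - z0))%C
  with ((G (s + t)%C - G s - l * t) - l * (Cexp t - 1 - t))%C by (rewrite Ewz; field; easy).
eapply Rle_trans; [apply Cmod_triangle|]. rewrite Cmod_opp, Cmod_mult.
apply Rle_trans with (e1 * ((1 + Cmod l) * Cmod t)).
- assert (Hl := Cmod_ge_0 l). assert (Cmod l * Cmod (Cexp t - 1 - t) <= Cmod l * (e1 * Cmod t)).
  { now apply Rmult_le_compat_l. } lra.
- apply Rle_trans with (e1 * B * Cmod (w - z0)).
  + rewrite Rmult_assoc. apply Rmult_le_compat_l; [lra|]. unfold B.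
    replace (2 * (1 + Cmod l) / Cmod z0 * Cmod (w - z0))
      with ((1 + Cmod l) * (2 * (Cmod (w - z0) / Cmod z0))) by (field; lra).
    apply Rmult_le_compat_l; [generalize (Cmod_ge_0 l); lra|easy].
  + apply Rmult_le_compat_r; [apply Cmod_ge_0|easy].
Qed.

Definition tau : C := (RtoC (2 * PI) * Ci)%C.

Lemma Re_plus (a b : C) : Re (a + b) = Re a + Re b.
Proof. easy. Qed.

Lemma Re_tau : Re tau = 0.
Proof. unfold tau, Ci, Re; simpl. ring. Qed.

(** A function with period [2 pi i] in [s = log z] is a function of [z]. *)
Lemma descend (G : C -> C) (L : R) :
  (forall s, Re s < L -> G (s + tau)%C = G s) ->
  forall s, Re s < L -> G (clog (Cexp s)) = G s.
Proof.
intros HG s Hs.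
assert (E : Cexp (clog (Cexp s)) = Cexp s) by apply Cexp_clog, Cexp_neq0.
destruct (Cexp_inj _ _ (eq_sym E)) as [k Hk]. rewrite Hk.
pose (f := fun t => G (s + RtoC t * Ci)%C).
assert (Hf : forall t, f (t + 2 * PI) = f t).
{ intros t. unfold f. rewrite <- (HG (s + RtoC t * Ci)%C).
  - f_equal. unfold tau. rewrite RtoC_plus. ring.
  - rewrite Re_plus. replace (Re (t * Ci)) with 0 by (unfold Re, Ci; simpl; ring). lra. }
destruct (periodic_representative _ f Hf) as [Hp _].
generalize (Hp k 0). unfold f. rewrite Rplus_0_l. intros ->. f_equal. ring.
Qed.

(** * Frobenius theory of the Fuchsian system *)

(** The system satisfied by [y1 = z^(mu/2) P] and [y2 = z^(-mu/2) Q] when [(P,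
    Q)] is a row of the frame: the powers of [z] make the coefficients
    functions of [z] that are bounded at the puncture. *)
Definition solves (mu : R) (h : C -> C) (L : R) (y1 y2 : C -> C) : Prop :=
  forall s, Re s < L ->
    cder y1 s ((RtoC (mu / 2) + h (Cexp s)) * y1 s + h (Cexp s) * y2 s)%C /\
    cder y2 s (- h (Cexp s) * y1 s - (RtoC (mu / 2) + h (Cexp s)) * y2 s)%C.

Definition nrm2 (y1 y2 : C -> C) (s : C) : R := Cmod (y1 s) ^ 2 + Cmod (y2 s) ^ 2.

Arguments nrm2 y1 y2 s%_C_scope.

Lemma monotone_of_derive (f df : R -> R) (a b : R) : a <= b ->
  (forall x, a <= x <= b -> is_derive f x (df x)) ->
  (forall x, a <= x <= b -> 0 <= df x) -> f a <= f b.
Proof.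
intros Hab Hd Hp.
destruct (MVT_gen f a b df) as (c & Hc & E).
- intros x Hx. rewrite Rmin_left, Rmax_right in Hx by lra. apply Hd. lra.
- intros x Hx. rewrite Rmin_left, Rmax_right in Hx by lra.
  apply continuity_pt_filterlim.
  apply (@ex_derive_continuous R_AbsRing R_NormedModule f). exists (df x). now apply Hd.
- rewrite Rmin_left, Rmax_right in Hc by lra. specialize (Hp c Hc). nra.
Qed.

Lemma cder_hline (f : C -> C) (s l : C) (x : R) : cder f (s + RtoC x)%C l ->
  is_derive (fun u : R => Re (f (s + RtoC u)%C)) x (Re l) /\
  is_derive (fun u : R => Im (f (s + RtoC u)%C)) x (Im l).
Proof.
intros H. rewrite <- (Cmult_1_r (RtoC x)) in H.
assert (A1 := cder_line _ (RtoC 1) _ _ _ _ H). assert (A2 := cder_line _ (- Ci)%C _ _ _ _ H).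
rewrite Cmult_1_r, Re_1_mult in A1. rewrite Cmult_1_r, Re_mCi_mult in A2.
split; (eapply is_derive_ext; [|eassumption]); intros u; cbv beta.
- now rewrite Re_1_mult, Cmult_1_r.
- now rewrite Re_mCi_mult, Cmult_1_r.
Qed.

Lemma nrm2_derive (y1 y2 : C -> C) (s l1 l2 : C) (x : R) :
  cder y1 (s + RtoC x)%C l1 -> cder y2 (s + RtoC x)%C l2 ->
  is_derive (fun u => nrm2 y1 y2 (s + RtoC u)) x
    (2 * (Re (Cconj (y1 (s + RtoC x)%C) * l1) + Re (Cconj (y2 (s + RtoC x)%C) * l2))).
Proof.
intros H1 H2.
destruct (cder_hline _ _ _ _ H1) as [A1 A2]. destruct (cder_hline _ _ _ _ H2) as [A3 A4].
apply is_derive_ext with (fun u => (Re (y1 (s + RtoC u)%C) ^ 2 + Im (y1 (s + RtoC u)%C) ^ 2)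
  + (Re (y2 (s + RtoC u)%C) ^ 2 + Im (y2 (s + RtoC u)%C) ^ 2)).
{ intros u. unfold nrm2. now rewrite !Cmod2_alt. }
eapply is_derive_eq.
{ apply (@is_derive_plus R_AbsRing R_NormedModule).
  - apply (@is_derive_plus R_AbsRing R_NormedModule).
    + apply is_derive_pow, A1.
    + apply is_derive_pow, A2.
  - apply (@is_derive_plus R_AbsRing R_NormedModule).
    + apply is_derive_pow, A3.
    + apply is_derive_pow, A4. }
unfold plus; simpl. unfold Re, Im; simpl. ring.
Qed.

Lemma Re_le_Cmod' (c : C) : Re c <= Cmod c.
Proof. eapply Rle_trans; [apply Rle_abs|apply re_le_Cmod]. Qed.
Section Growth.
Variables (mu : R) (h : C -> C) (L Hb : R) (y1 y2 : C -> C).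
Hypothesis mu_gt0 : 0 < mu.
Hypothesis hb : forall s, Re s < L -> Cmod (h (Cexp s)) <= Hb.
Hypothesis sol : solves mu h L y1 y2.

(** A bound for the norm of the coefficient matrix, hence half of one for the
    logarithmic derivative of [nrm2]. *)
Definition grate : R := mu / 2 + 2 * Hb.

Lemma nrm2_log_derive (s : C) (x : R) : Re s + x < L ->
  exists l, is_derive (fun u => nrm2 y1 y2 (s + RtoC u)) x l /\
    Rabs l <= 2 * grate * nrm2 y1 y2 (s + RtoC x).
Proof.
intros Hs. assert (Hs' : Re (s + RtoC x) < L) by (rewrite Re_plus; simpl; easy).
destruct (sol _ Hs') as [S1 S2]. specialize (hb _ Hs').
eexists. split; [apply nrm2_derive; eassumption|].
set (a := y1 (s + x)%C) in *. set (b := y2 (s + x)%C) in *. set (k := h (Cexp (s + x))) in *.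
replace (Re (Cconj a * ((RtoC (mu / 2) + k) * a + k * b)) +
         Re (Cconj b * (- k * a - (RtoC (mu / 2) + k) * b)))
  with (Re (Cconj a * ((RtoC (mu / 2) + k) * a + k * b) +
         Cconj b * (- k * a - (RtoC (mu / 2) + k) * b))) by easy.
rewrite Rabs_mult, (Rabs_pos_eq 2), Rmult_assoc by lra.
apply Rmult_le_compat_l; [lra|].
eapply Rle_trans; [apply re_le_Cmod|].
unfold nrm2. fold a b. assert (Ha := Cmod_ge_0 a). assert (Hb' := Cmod_ge_0 b).
assert (Hk := Cmod_ge_0 k).
assert (Hmk : Cmod (RtoC (mu / 2) + k) <= mu / 2 + Hb).
{ eapply Rle_trans; [apply Cmod_triangle|]. rewrite Cmod_R, Rabs_pos_eq; lra. }
eapply Rle_trans; [apply Cmod_triangle|]. rewrite !Cmod_mult, !Cmod_conj.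
set (A := Cmod a) in *. set (B := Cmod b) in *.
assert (M1 := Rmult_le_compat_r A _ _ Ha hb). assert (M2 := Rmult_le_compat_r B _ _ Hb' hb).
assert (M3 := Rmult_le_compat_r A _ _ Ha Hmk). assert (M4 := Rmult_le_compat_r B _ _ Hb' Hmk).
assert (U1 : Cmod ((RtoC (mu / 2) + k) * a + k * b) <= (mu / 2 + Hb) * A + Hb * B).
{ eapply Rle_trans; [apply Cmod_triangle|]. rewrite !Cmod_mult. fold A B. lra. }
assert (U2 : Cmod (- k * a - (RtoC (mu / 2) + k) * b) <= Hb * A + (mu / 2 + Hb) * B).
{ eapply Rle_trans; [apply Cmod_triangle|]. rewrite Cmod_opp, !Cmod_mult, Cmod_opp. fold A B. lra. }
apply Rle_trans with (A * ((mu / 2 + Hb) * A + Hb * B) + B * (Hb * A + (mu / 2 + Hb) * B)).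
- apply Rplus_le_compat; now apply Rmult_le_compat_l.
- assert (HB0 : 0 <= Hb) by lra.
  assert (Hq := Rmult_le_pos _ _ HB0 (Rle_0_sqr (A - B))).
  unfold grate, Rsqr in *. lra.
Qed.

(** The logarithmic derivative of [nrm2] is bounded, so [nrm2 * exp (2 * grate
    * x)] and its counterpart with the opposite sign are monotone along a
    horizontal line. *)
Lemma gronwall (s : C) (x : R) : 0 <= x -> Re s < L ->
  nrm2 y1 y2 (s + RtoC (- x)) <= nrm2 y1 y2 s * exp (2 * grate * x) /\
  nrm2 y1 y2 s * exp (- (2 * grate * x)) <= nrm2 y1 y2 (s + RtoC (- x)).
Proof.
intros Hx Hs.
assert (HE : forall c u, is_derive (fun u => exp (c * u)) u (c * exp (c * u))).
{ intros c u. auto_derive; [easy|ring]. }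
assert (Hgen : forall sg, sg = 1 \/ sg = -1 ->
  sg * (nrm2 y1 y2 (s + RtoC (- x)) * exp (sg * (2 * grate) * (- x))) <= sg * (nrm2 y1 y2 s)).
{ intros sg Hsg.
  pose (df := fun u => sg * (Derive (fun u => nrm2 y1 y2 (s + RtoC u)) u * exp (sg * (2 * grate) * u)
      + nrm2 y1 y2 (s + RtoC u) * (sg * (2 * grate) * exp (sg * (2 * grate) * u)))).
  assert (M := monotone_of_derive
    (fun u => sg * (nrm2 y1 y2 (s + RtoC u) * exp (sg * (2 * grate) * u))) df (- x) 0).
  cbv beta in M. rewrite Rmult_0_r, exp_0, Rmult_1_r, Cplus_0_r in M. apply M; [lra| |].
  - intros u Hu. unfold df.
    destruct (nrm2_log_derive s u) as (l & Hl & _); [lra|].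
    assert (El : Derive (fun u => nrm2 y1 y2 (s + RtoC u)) u = l) by (now apply is_derive_unique).
    rewrite El.
    apply (is_derive_scal (fun u => nrm2 y1 y2 (s + RtoC u) * exp (sg * (2 * grate) * u))).
    apply (is_derive_mult (fun u => nrm2 y1 y2 (s + RtoC u)) (fun u => exp (sg * (2 * grate) * u)));
      [exact Hl|apply HE|intros; apply Rmult_comm].
  - intros u Hu. unfold df.
    destruct (nrm2_log_derive s u) as (l & Hl & Hb'); [lra|].
    assert (El : Derive (fun u => nrm2 y1 y2 (s + RtoC u)) u = l) by (now apply is_derive_unique).
    rewrite El. apply Rabs_le_between in Hb'.
    assert (P := exp_pos (sg * (2 * grate) * u)). set (E := exp (sg * (2 * grate) * u)) in *.
    set (N := nrm2 y1 y2 (s + RtoC u)) in *.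
    replace (sg * (l * E + N * (sg * (2 * grate) * E)))
      with ((sg * l + sg * sg * (2 * grate * N)) * E) by ring.
    apply Rmult_le_pos; [|lra]. destruct Hsg as [-> | ->]; lra. }
assert (E1 := exp_pos (2 * grate * x)). assert (E2 := exp_pos (- (2 * grate * x))).
assert (E3 : exp (2 * grate * x) * exp (- (2 * grate * x)) = 1).
{ rewrite <- exp_plus. replace (2 * grate * x + - (2 * grate * x)) with 0 by ring. apply exp_0. }
set (N := nrm2 y1 y2 (s + RtoC (- x))) in *. set (N0 := nrm2 y1 y2 s) in *.
split.
- assert (H := Hgen 1 (or_introl eq_refl)). rewrite !Rmult_1_l in H.
  replace (2 * grate * - x) with (- (2 * grate * x)) in H by ring.
  apply (Rmult_le_compat_r (exp (2 * grate * x))) in H; [|lra].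
  replace (N * exp (- (2 * grate * x)) * exp (2 * grate * x))
    with (N * (exp (2 * grate * x) * exp (- (2 * grate * x)))) in H by ring.
  rewrite E3 in H. lra.
- assert (H := Hgen (-1) (or_intror eq_refl)).
  replace (-1 * (2 * grate) * - x) with (2 * grate * x) in H by ring.
  assert (H' : N0 <= N * exp (2 * grate * x)) by lra.
  apply (Rmult_le_compat_r (exp (- (2 * grate * x)))) in H'; [|lra].
  replace (N * exp (2 * grate * x) * exp (- (2 * grate * x)))
    with (N * (exp (2 * grate * x) * exp (- (2 * grate * x)))) in H' by ring.
  rewrite E3 in H'. lra.
Qed.

Hypothesis mono : forall s, Re s < L ->
  nrm2 y1 y2 (s + tau) = nrm2 y1 y2 s.
Hypothesis nz : forall s, Re s < L -> 0 < nrm2 y1 y2 s.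

(** The norm has the period [tau], so it is bounded above and below by
    positive constants on a vertical line; Gronwall carries the bounds to the
    left. *)
Lemma growth (x0 : R) : x0 < L ->
  exists c C0, 0 < c /\ 0 < C0 /\ forall s, Re s <= x0 ->
    c * exp (2 * grate * (Re s - x0)) <= nrm2 y1 y2 s <= C0 * exp (2 * grate * (x0 - Re s)).
Proof.
intros Hx0. assert (HPI := PI_RGT_0).
pose (f := fun t => nrm2 y1 y2 (RtoC x0 + RtoC t * Ci)).
assert (HR : forall t, Re (RtoC x0 + RtoC t * Ci) = x0) by (intros t; unfold Re, Ci; simpl; ring).
assert (Hper : forall t, f (t + 2 * PI) = f t).
{ intros t. unfold f. rewrite <- (mono (RtoC x0 + RtoC t * Ci)) by now rewrite HR.
  f_equal. unfold tau. rewrite RtoC_plus. ring. }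
destruct (periodic_representative _ f Hper) as [_ Hrep].
assert (Hcont : forall t, continuity_pt f t).
{ intros t. apply continuity_pt_filterlim.
  destruct (sol (RtoC x0 + RtoC t * Ci)%C) as [S1 S2]; [now rewrite HR|].
  assert (K : forall y : C -> C, continuous y (RtoC x0 + RtoC t * Ci)%C ->
    continuous (fun u : R => Cmod (y (RtoC x0 + RtoC u * Ci)%C) ^ 2) t).
  { intros y Hy. apply (continuous_Cmod2 (fun u : R => y (RtoC x0 + RtoC u * Ci)%C)).
    apply (continuous_comp (fun u : R => (RtoC x0 + RtoC u * Ci)%C) y); [cont|exact Hy]. }
  apply continuous_Rplus; apply K; eapply cder_continuous; eassumption. }
destruct (continuity_ab_min f 0 (2 * PI)) as (m & Hm & _); [lra|easy|].
destruct (continuity_ab_maj f 0 (2 * PI)) as (M & HM & _); [lra|easy|].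
exists (f m), (f M). split; [unfold f; apply nz; now rewrite HR|]. split; [unfold f; apply nz; now rewrite HR|].
intros s Hs. split.
- assert (Es : s = (RtoC x0 + RtoC (Im s) * Ci + RtoC (- (x0 - Re s)))%C).
  { destruct s as [a b]. unfold Ci, RtoC, Cplus, Cmult, Re, Im; simpl. f_equal; ring. }
  destruct (gronwall (RtoC x0 + RtoC (Im s) * Ci) (x0 - Re s)) as [_ G2]; [lra|now rewrite HR|].
  rewrite <- Es in G2. fold (f (Im s)) in G2.
  destruct (Hrep (Im s)) as (t & Ht & Et).
  eapply Rle_trans; [|apply G2]. rewrite <- Et.
  replace (- (2 * grate * (x0 - Re s))) with (2 * grate * (Re s - x0)) by ring.
  apply Rmult_le_compat_r; [left; apply exp_pos|now apply Hm].
- assert (Es : s = (RtoC x0 + RtoC (Im s) * Ci + RtoC (- (x0 - Re s)))%C).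
  { destruct s as [a b]. unfold Ci, RtoC, Cplus, Cmult, Re, Im; simpl. f_equal; ring. }
  destruct (gronwall (RtoC x0 + RtoC (Im s) * Ci) (x0 - Re s)) as [G1 _]; [lra|now rewrite HR|].
  rewrite <- Es in G1. fold (f (Im s)) in G1.
  destruct (Hrep (Im s)) as (t & Ht & Et).
  eapply Rle_trans; [apply G1|]. rewrite <- Et.
  apply Rmult_le_compat_r; [left; apply exp_pos|now apply HM].
Qed.
End Growth.

Lemma hol1_le (r r' : R) (f df : C -> C) : r' <= r -> hol1 r f df -> hol1 r' f df.
Proof. intros Hr H z Hz. apply H. lra. Qed.

Lemma hol1_cont (r : R) (f df : C -> C) (z : C) : hol1 r f df -> Cmod z < r -> continuous f z.
Proof. intros H Hz. eapply cder_continuous. apply H, Hz. Qed.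

(** The lower bound by [|z|^n] limits how often [z] can be divided out of both
    functions. *)
Lemma hol1_divide_out (n : nat) : forall (r : R) (f1 df1 f2 df2 : C -> C) (c : R),
  0 < r -> 0 < c -> hol1 r f1 df1 -> hol1 r f2 df2 ->
  (forall z, 0 < Cmod z < r -> c * Cmod z ^ n <= Cmod (f1 z) + Cmod (f2 z)) ->
  exists (k : nat) (r' : R) (v1 dv1 v2 dv2 : C -> C),
    0 < r' /\ r' <= r /\ hol1 r' v1 dv1 /\ hol1 r' v2 dv2 /\
    (v1 (RtoC 0) <> RtoC 0 \/ v2 (RtoC 0) <> RtoC 0) /\
    (forall z, Cmod z < r' -> f1 z = (z ^ k * v1 z)%C /\ f2 z = (z ^ k * v2 z)%C).
Proof.
assert (Hdone : forall (r : R) (f1 df1 f2 df2 : C -> C), 0 < r -> hol1 r f1 df1 -> hol1 r f2 df2 ->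
  (f1 (RtoC 0) <> RtoC 0 \/ f2 (RtoC 0) <> RtoC 0) ->
  exists (k : nat) (r' : R) (v1 dv1 v2 dv2 : C -> C),
    0 < r' /\ r' <= r /\ hol1 r' v1 dv1 /\ hol1 r' v2 dv2 /\
    (v1 (RtoC 0) <> RtoC 0 \/ v2 (RtoC 0) <> RtoC 0) /\
    (forall z, Cmod z < r' -> f1 z = (z ^ k * v1 z)%C /\ f2 z = (z ^ k * v2 z)%C)).
{ intros r f1 df1 f2 df2 Hr H1 H2 Hnz. exists 0%nat, r, f1, df1, f2, df2.
  repeat (split; [assumption || lra|]). intros z _. simpl. split; ring. }
assert (Hdec : forall a b : C, (a <> RtoC 0 \/ b <> RtoC 0) \/ (a = RtoC 0 /\ b = RtoC 0)).
{ intros a b. destruct (Req_dec (Cmod a) 0) as [Ea|Ea].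
  - destruct (Req_dec (Cmod b) 0) as [Eb|Eb].
    + right. split; now apply Cmod_eq_0.
    + left. right. intros ->. now rewrite Cmod_0 in Eb.
  - left. left. intros ->. now rewrite Cmod_0 in Ea. }
induction n as [|n IH]; intros r f1 df1 f2 df2 c Hr Hc H1 H2 Hlow;
  (destruct (Hdec (f1 (RtoC 0)) (f2 (RtoC 0))) as [Hnz|[Z1 Z2]]; [now apply (Hdone r f1 df1 f2 df2)|]).
- exfalso.
  assert (H0r : Cmod (RtoC 0) < r) by (rewrite Cmod_0; lra).
  destruct (proj1 (continuous_C_eps _ _) (hol1_cont _ _ _ _ H1 H0r) (c / 2)) as (d1 & Hd1 & K1); [lra|].
  destruct (proj1 (continuous_C_eps _ _) (hol1_cont _ _ _ _ H2 H0r) (c / 2)) as (d2 & Hd2 & K2); [lra|].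
  set (x := Rmin r (Rmin d1 d2) / 2).
  assert (Hx : 0 < x < r /\ x < d1 /\ x < d2).
  { unfold x, Rmin. repeat destruct Rle_dec; lra. }
  specialize (Hlow (RtoC x)). specialize (K1 (RtoC x)). specialize (K2 (RtoC x)).
  replace (x - 0)%C with (RtoC x) in K1, K2 by ring.
  rewrite Z1 in K1. rewrite Z2 in K2.
  replace (f1 x - 0)%C with (f1 x) in K1 by ring. replace (f2 x - 0)%C with (f2 x) in K2 by ring.
  rewrite Cmod_R, Rabs_pos_eq in * by lra. simpl in Hlow.
  specialize (Hlow ltac:(lra)). specialize (K1 ltac:(lra)). specialize (K2 ltac:(lra)). lra.
- destruct (hol1_div (r / 2) f1 df1) as (q1 & dq1 & Q1 & E1); [lra| |easy|].
  { replace (2 * (r / 2)) with r by field. easy. }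
  destruct (hol1_div (r / 2) f2 df2) as (q2 & dq2 & Q2 & E2); [lra| |easy|].
  { replace (2 * (r / 2)) with r by field. easy. }
  destruct (IH (r / 2) q1 dq1 q2 dq2 c) as (k & r' & v1 & dv1 & v2 & dv2 & Hr' & Hle & V1 & V2 & Hnz & E); try easy; [lra| |].
  + intros z Hz. specialize (Hlow z ltac:(lra)).
    rewrite E1, E2 in Hlow by easy. rewrite !Cmod_mult in Hlow. simpl in Hlow.
    apply Rmult_le_reg_l with (Cmod z); [easy|]. lra.
  + exists (S k), r', v1, dv1, v2, dv2. repeat (split; [assumption || lra|]).
    intros z Hz. split.
    * rewrite E1 by lra. rewrite (proj1 (E z Hz)). simpl. ring.
    * rewrite E2 by lra. rewrite (proj2 (E z Hz)). simpl. ring.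
Qed.

Lemma zpow_plus (a b : R) (s : C) : zpow (a + b) s = (zpow a s * zpow b s)%C.
Proof. unfold zpow. rewrite <- Cexp_plus. f_equal. rewrite RtoC_plus. ring. Qed.

Lemma zpow_0 (s : C) : zpow 0 s = RtoC 1.
Proof. unfold zpow. rewrite Cmult_0_l. apply Cexp_0. Qed.

Lemma zpow_neq0 (a : R) (s : C) : zpow a s <> RtoC 0.
Proof. apply Cexp_neq0. Qed.

Lemma zpow_inv (a : R) (s : C) : (zpow (- a) s * zpow a s)%C = RtoC 1.
Proof. rewrite <- zpow_plus. replace (- a + a) with 0 by ring. apply zpow_0. Qed.

Lemma zpow_INR (n : nat) (s : C) : zpow (INR n) s = (Cexp s ^ n)%C.
Proof.
induction n as [|n IH].
- apply zpow_0.
- rewrite S_INR, zpow_plus, IH. simpl.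
  replace (zpow 1 s) with (Cexp s) by (unfold zpow; f_equal; ring). ring.
Qed.

Lemma Cmod_zpow (a : R) (s : C) : Cmod (zpow a s) = exp (a * Re s).
Proof. unfold zpow. rewrite Cmod_Cexp. f_equal. unfold Re; simpl. ring. Qed.

Lemma cder_zpow (a : R) (s : C) : cder (zpow a) s (RtoC a * zpow a s)%C.
Proof.
unfold zpow. eapply cder_eq.
- apply (cder_comp Cexp (fun s => RtoC a * s)%C); [apply cder_Cexp|].
  apply cder_scal, cder_id.
- ring.
Qed.

Lemma Cexp_Ztau (k : Z) : Cexp (RtoC (IZR k) * tau) = RtoC 1.
Proof.
replace (IZR k * tau)%C with (RtoC (2 * PI * IZR k) * Ci)%C
  by (unfold tau; rewrite RtoC_mult; ring).
rewrite Cexp_Ci.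
assert (Hp : forall t, circ (t + 2 * PI) = circ t).
{ intros t. unfold circ. now rewrite cos_plus, sin_plus, cos_2PI, sin_2PI, !Rmult_0_r, !Rmult_1_r,
    Rminus_0_r, Rplus_0_r. }
destruct (periodic_representative _ circ Hp) as [H _].
specialize (H k 0). rewrite Rplus_0_l in H. rewrite H.
unfold circ. now rewrite cos_0, sin_0.
Qed.

Lemma zpow_tau (a : R) (s : C) : zpow a (s + tau) = (zpow a s * Cexp (RtoC a * tau))%C.
Proof. unfold zpow. rewrite <- Cexp_plus. f_equal. ring. Qed.

Lemma exists_nat_ge (x : R) : exists n, x <= INR n.
Proof.
destruct (archimed (Rabs x)) as [A _]. exists (Z.to_nat (up (Rabs x))).
assert (B := Rle_abs x). assert (B' := Rabs_pos x).
assert (0 <= up (Rabs x))%Z by (apply le_IZR; lra).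
rewrite INR_IZR_INZ, Z2Nat.id by easy. lra.
Qed.

(** Every solution with scalar monodromy is a power of [z] times a
    holomorphic vector that does not vanish at the puncture: Gronwall bounds
    it above and below by powers of [|z|], so a high power of [z] makes it
    continuously differentiable at 0, and dividing by [z] must stop. *)
Lemma frobenius (mu : R) (h : C -> C) (L Hb : R) (y1 y2 : C -> C) (kap0 : R) :
  0 < mu ->
  (forall s, Re s < L -> Cmod (h (Cexp s)) <= Hb) ->
  (forall s, Re s < L -> continuous h (Cexp s)) ->
  solves mu h L y1 y2 ->
  (forall s, Re s < L -> y1 (s + tau)%C = (Cexp (RtoC kap0 * tau) * y1 s)%C) ->
  (forall s, Re s < L -> y2 (s + tau)%C = (Cexp (RtoC kap0 * tau) * y2 s)%C) ->
  (forall s, Re s < L -> 0 < nrm2 y1 y2 s) ->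
  exists (n : Z) (r : R) (v1 dv1 v2 dv2 : C -> C),
    0 < r /\ hol1 r v1 dv1 /\ hol1 r v2 dv2 /\
    (v1 (RtoC 0) <> RtoC 0 \/ v2 (RtoC 0) <> RtoC 0) /\
    forall s, Re s < L -> exp (Re s) < r ->
      y1 s = (zpow (kap0 + IZR n) s * v1 (Cexp s))%C /\
      y2 s = (zpow (kap0 + IZR n) s * v2 (Cexp s))%C.
Proof.
intros Hmu HHb Hhc Hsol Hm1 Hm2 Hnz.
assert (Hmon : forall s, Re s < L -> nrm2 y1 y2 (s + tau) = nrm2 y1 y2 s).
{ intros s Hs. unfold nrm2. rewrite Hm1, Hm2, !Cmod_mult by easy.
  replace (Cmod (Cexp (RtoC kap0 * tau))) with 1; [ring|].
  rewrite Cmod_Cexp. replace (Re (RtoC kap0 * tau)) with 0; [now rewrite exp_0|].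
  unfold tau, Re, Ci; simpl. ring. }
assert (Hb0 : 0 <= Hb).
{ eapply Rle_trans; [apply Cmod_ge_0|apply (HHb (RtoC (L - 1)))]. simpl. lra. }
set (x0 := Rmin L 0 - 1). assert (Hx0 : x0 < L /\ x0 <= -1).
{ unfold x0, Rmin. destruct Rle_dec; lra. }
destruct (growth mu h L Hb y1 y2 Hmu HHb Hsol Hmon Hnz x0 (proj1 Hx0)) as (c & C0 & Hc & HC0 & Hgr).
set (G := grate mu Hb) in *. assert (HG : 0 <= G) by (unfold G, grate; lra).
(* the factor [z^(N - kap0)] removes the monodromy and beats the growth rate
   by 2, so that the product is O(z^2) *)
destruct (exists_nat_ge (kap0 + G + 2)) as [N HN].
destruct (exists_nat_ge (INR N - kap0 + G)) as [n Hn].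
pose (kp := INR N - kap0).
pose (U1 := fun s => (zpow kp s * y1 s)%C). pose (U2 := fun s => (zpow kp s * y2 s)%C).
assert (Hper : forall y : C -> C,
  (forall s, Re s < L -> y (s + tau)%C = (Cexp (RtoC kap0 * tau) * y s)%C) ->
  forall s, Re s < L -> (zpow kp (s + tau) * y (s + tau))%C = (zpow kp s * y s)%C).
{ intros y Hy s Hs. rewrite Hy, zpow_tau by easy.
  replace (zpow kp s * Cexp (kp * tau) * (Cexp (kap0 * tau) * y s))%C
    with (Cexp (kp * tau) * Cexp (kap0 * tau) * (zpow kp s * y s))%C by ring.
  rewrite <- Cexp_plus. replace (kp * tau + kap0 * tau)%C with (RtoC (IZR (Z.of_nat N)) * tau)%C.
  - rewrite Cexp_Ztau. ring.
  - unfold kp. rewrite <- INR_IZR_INZ, RtoC_minus. ring. }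
assert (D1 := descend U1 L (Hper y1 Hm1)). assert (D2 := descend U2 L (Hper y2 Hm2)).
pose (ext := fun (u : C -> C) (z : C) => if Req_EM_T (Cmod z) 0 then RtoC 0 else u z).
assert (ext0 : forall u, ext u (RtoC 0) = RtoC 0).
{ intros u. unfold ext. destruct Req_EM_T as [_|H]; [easy|]. now rewrite Cmod_0 in H. }
assert (extn : forall u z, z <> RtoC 0 -> ext u z = u z).
{ intros u z Hz. unfold ext. destruct Req_EM_T as [H|_]; [|easy]. now apply Cmod_eq_0 in H. }
pose (f1 := ext (fun z => U1 (clog z))). pose (f2 := ext (fun z => U2 (clog z))).
assert (F1 : forall s, Re s < L -> f1 (Cexp s) = U1 s).
{ intros s Hs. unfold f1. rewrite extn by apply Cexp_neq0. now apply D1. }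
assert (F2 : forall s, Re s < L -> f2 (Cexp s) = U2 s).
{ intros s Hs. unfold f2. rewrite extn by apply Cexp_neq0. now apply D2. }
pose (df1 := ext (fun z => ((RtoC (mu / 2 + kp) + h z) * f1 z + h z * f2 z) / z)%C).
pose (df2 := ext (fun z => (- h z * f1 z - (RtoC (mu / 2 - kp) + h z) * f2 z) / z)%C).
set (r := exp x0). assert (Hr : 0 < r) by apply exp_pos.
(* every point of the punctured disc is [Cexp s] *)
assert (Hlog : forall z, z <> RtoC 0 -> Cmod z < r -> exists s, z = Cexp s /\ Re s < x0).
{ intros z Hz Hzr. exists (clog z). split; [symmetry; now apply Cexp_clog|].
  apply exp_lt_inv. change (exp (Re (clog z)) < r). rewrite <- Cmod_Cexp. now rewrite Cexp_clog. }
assert (Hnr : forall s, nrm2 U1 U2 s = exp (2 * kp * Re s) * nrm2 y1 y2 s).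
{ intros s. unfold nrm2, U1, U2. rewrite !Cmod_mult, Cmod_zpow.
  replace (exp (2 * kp * Re s)) with (exp (kp * Re s) * exp (kp * Re s))
    by (rewrite <- exp_plus; f_equal; ring). ring. }
set (B := Rmax 1 (C0 * exp (2 * G * x0))).
assert (HB : 1 <= B) by apply Rmax_l.
assert (Hup : forall z, z <> RtoC 0 -> Cmod z < r ->
   Cmod (f1 z) <= B * Cmod z ^ 2 /\ Cmod (f2 z) <= B * Cmod z ^ 2).
{ intros z Hz Hzr. destruct (Hlog z Hz Hzr) as (s & -> & Hs).
  rewrite F1, F2, Cmod_Cexp by lra.
  assert (HU : nrm2 U1 U2 s <= B * exp (4 * Re s)).
  { rewrite Hnr. apply Rle_trans with (exp (2 * kp * Re s) * (C0 * exp (2 * G * (x0 - Re s)))).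
    - apply Rmult_le_compat_l; [left; apply exp_pos|]. apply Hgr. lra.
    - replace (exp (2 * kp * Re s) * (C0 * exp (2 * G * (x0 - Re s))))
        with (C0 * exp (2 * G * x0) * exp ((2 * kp - 2 * G) * Re s)).
      + apply Rmult_le_compat; [|left; apply exp_pos|apply Rmax_r|].
        * apply Rmult_le_pos; [lra|left; apply exp_pos].
        * assert (Hle : (2 * kp - 2 * G) * Re s <= 4 * Re s) by (unfold kp; nra).
          destruct Hle as [Hlt| ->]; [left; now apply exp_increasing|lra].
      + replace (C0 * exp (2 * G * x0) * exp ((2 * kp - 2 * G) * Re s))
          with (C0 * (exp (2 * G * x0) * exp ((2 * kp - 2 * G) * Re s))) by ring.
        replace (exp (2 * kp * Re s) * (C0 * exp (2 * G * (x0 - Re s))))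
          with (C0 * (exp (2 * kp * Re s) * exp (2 * G * (x0 - Re s)))) by ring.
        rewrite <- !exp_plus. do 2 f_equal. ring. }
  assert (HBB : B * exp (4 * Re s) <= (B * exp (Re s) ^ 2) ^ 2).
  { replace (exp (4 * Re s)) with (exp (Re s) ^ 4).
    - assert (0 <= exp (Re s) ^ 4) by (apply pow_le; left; apply exp_pos). nra.
    - simpl. rewrite Rmult_1_r, <- !exp_plus. f_equal. ring. }
  assert (HP : 0 <= B * exp (Re s) ^ 2).
  { apply Rmult_le_pos; [lra|]. apply pow_le. left. apply exp_pos. }
  unfold nrm2 in HU. assert (T1 := Cmod_ge_0 (U1 s)). assert (T2 := Cmod_ge_0 (U2 s)).
  split; apply Rsqr_incr_0; try easy; unfold Rsqr; nra. }
assert (HcF : forall U f : C -> C, (forall s, Re s < L -> f (Cexp s) = U s) ->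
   forall s l, Re s < L -> cder U s (Cexp s * l)%C -> cder f (Cexp s) l).
{ intros U f Hf s l Hs Hd. eapply cder_eq; [apply (descend_cder U f L); eassumption|].
  field. apply Cexp_neq0. }
assert (Hd1 : forall z, z <> RtoC 0 -> Cmod z < r -> cder f1 z (df1 z)).
{ intros z Hz Hzr. unfold df1. rewrite extn by easy. destruct (Hlog z Hz Hzr) as (s & -> & Hs).
  apply (HcF U1); [easy|lra|]. rewrite F1, F2 by lra.
  destruct (Hsol s ltac:(lra)) as [S1 _]. eapply cder_eq.
  - apply cder_mult; [apply cder_zpow|exact S1].
  - unfold U1, U2. rewrite RtoC_plus. field. apply Cexp_neq0. }
assert (Hd2 : forall z, z <> RtoC 0 -> Cmod z < r -> cder f2 z (df2 z)).
{ intros z Hz Hzr. unfold df2. rewrite extn by easy. destruct (Hlog z Hz Hzr) as (s & -> & Hs).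
  apply (HcF U2); [easy|lra|]. rewrite F1, F2 by lra.
  destruct (Hsol s ltac:(lra)) as [_ S2]. eapply cder_eq.
  - apply cder_mult; [apply cder_zpow|exact S2].
  - unfold U1, U2. rewrite RtoC_minus. field. apply Cexp_neq0. }
assert (Hc1 : forall z, z <> RtoC 0 -> Cmod z < r -> continuous df1 z /\ continuous df2 z).
{ intros z Hz Hzr.
  assert (Hhz : continuous h z).
  { destruct (Hlog z Hz Hzr) as (s & -> & Hs). apply Hhc. lra. }
  assert (K1 := cder_continuous _ _ _ (Hd1 z Hz Hzr)).
  assert (K2 := cder_continuous _ _ _ (Hd2 z Hz Hzr)).
  assert (Hloc : forall u, continuous u z -> continuous (ext u) z).
  { intros u Hu. apply (@continuous_ext_loc _ _ (ext u) u); [|easy].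
    apply locally_Cmod. exists (Cmod z). split; [now apply Cmod_gt_0|].
    intros w Hw. symmetry. apply extn. intros ->.
    replace (0 - z)%C with (- z)%C in Hw by ring. rewrite Cmod_opp in Hw. lra. }
  split; apply Hloc; unfold Cdiv; cont; try easy; apply (continuous_Cinv (fun z => z));
    try easy; apply continuous_id. }
(* a bound by [|z|^2] for a function, and by [|z|] for its derivative, give
   continuous differentiability at 0 *)
assert (Hquad : forall f, f (RtoC 0) = RtoC 0 -> (forall z, z <> RtoC 0 -> Cmod z < r ->
   Cmod (f z) <= B * Cmod z ^ 2) -> cder f (RtoC 0) (RtoC 0)).
{ intros f Hf0 Hf. apply cder_eps. intros eps Heps.
  exists (Rmin r (eps / B)). split; [apply Rmin_pos; [easy|apply Rdiv_lt_0_compat; lra]|].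
  intros w Hw. replace (w - 0)%C with w in * by ring.
  assert (W1 : Cmod w < r) by (eapply Rlt_le_trans; [apply Hw|apply Rmin_l]).
  assert (W2 : Cmod w < eps / B) by (eapply Rlt_le_trans; [apply Hw|apply Rmin_r]).
  rewrite Hf0. replace (f w - 0 - 0 * w)%C with (f w) by ring.
  destruct (Req_dec (Cmod w) 0) as [E|E].
  - apply Cmod_eq_0 in E. subst w. rewrite Hf0, Cmod_0. lra.
  - eapply Rle_trans; [apply Hf; [|easy]|].
    + intros ->. now rewrite Cmod_0 in E.
    + simpl. rewrite Rmult_1_r, <- Rmult_assoc. apply Rmult_le_compat_r; [apply Cmod_ge_0|].
      apply (Rmult_lt_compat_l B) in W2; [|lra].
      replace (B * (eps / B)) with eps in W2 by (field; lra). lra. }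
assert (Hlin : forall df, df (RtoC 0) = RtoC 0 -> (exists M, 0 <= M /\ forall z, z <> RtoC 0 -> Cmod z < r ->
   Cmod (df z) <= M * Cmod z) -> continuous df (RtoC 0)).
{ intros df Hf0 (M & HM & Hf). apply continuous_C_eps. intros eps Heps.
  exists (Rmin r (eps / (1 + M))). split; [apply Rmin_pos; [easy|apply Rdiv_lt_0_compat; lra]|].
  intros w Hw. replace (w - 0)%C with w in * by ring.
  assert (W1 : Cmod w < r) by (eapply Rlt_le_trans; [apply Hw|apply Rmin_l]).
  assert (W2 : Cmod w < eps / (1 + M)) by (eapply Rlt_le_trans; [apply Hw|apply Rmin_r]).
  rewrite Hf0. replace (df w - 0)%C with (df w) by ring.
  destruct (Req_dec (Cmod w) 0) as [E|E].
  - apply Cmod_eq_0 in E. subst w. rewrite Hf0, Cmod_0. lra.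
  - eapply Rle_lt_trans; [apply Hf; [|easy]|].
    + intros ->. now rewrite Cmod_0 in E.
    + assert (W3 := Cmod_ge_0 w). apply (Rmult_lt_compat_l (1 + M)) in W2; [|lra].
      replace ((1 + M) * (eps / (1 + M))) with eps in W2 by (field; lra). nra. }
assert (Hhz : forall z, z <> RtoC 0 -> Cmod z < r -> Cmod (h z) <= Hb).
{ intros z Hz Hzr. destruct (Hlog z Hz Hzr) as (s & -> & Hs). apply HHb. lra. }
assert (Hbd : forall (a b : C) (M z : _), z <> RtoC 0 -> Cmod z < r -> Cmod a <= M -> Cmod b <= M ->
   Cmod ((a * f1 z + b * f2 z) / z) <= 2 * M * B * Cmod z).
{ intros a b M z Hz Hzr Ha Hb'. destruct (Hup z Hz Hzr) as [B1 B2].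
  assert (Hzp : 0 < Cmod z) by now apply Cmod_gt_0.
  rewrite Cmod_div by easy. apply Rmult_le_reg_r with (Cmod z); [easy|].
  replace (Cmod (a * f1 z + b * f2 z) / Cmod z * Cmod z) with (Cmod (a * f1 z + b * f2 z)) by (field; lra).
  eapply Rle_trans; [apply Cmod_triangle|]. rewrite !Cmod_mult.
  assert (U : Cmod a * Cmod (f1 z) <= M * (B * Cmod z ^ 2)) by (apply Rmult_le_compat; try easy; apply Cmod_ge_0).
  assert (V : Cmod b * Cmod (f2 z) <= M * (B * Cmod z ^ 2)) by (apply Rmult_le_compat; try easy; apply Cmod_ge_0).
  simpl in *. lra. }
pose (M := Rabs (mu / 2 + kp) + Rabs (mu / 2 - kp) + Hb).
assert (HM0 : 0 <= M) by (unfold M; generalize (Rabs_pos (mu / 2 + kp)) (Rabs_pos (mu / 2 - kp)); lra).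
assert (Hol1 : hol1 r f1 df1).
{ intros z Hzr. destruct (Req_dec (Cmod z) 0) as [E|E].
  - apply Cmod_eq_0 in E. subst z. split.
    + unfold df1. rewrite ext0. apply Hquad; [apply ext0|]. intros; now apply Hup.
    + apply Hlin; [apply ext0|]. exists (2 * M * B). split; [nra|].
      intros z Hz Hzr'. unfold df1. rewrite extn by easy. apply Hbd; try easy.
      * eapply Rle_trans; [apply Cmod_triangle|]. rewrite Cmod_R. specialize (Hhz z Hz Hzr').
        unfold M. generalize (Rabs_pos (mu / 2 - kp)). lra.
      * specialize (Hhz z Hz Hzr').
        unfold M. generalize (Rabs_pos (mu / 2 + kp)) (Rabs_pos (mu / 2 - kp)). lra.
  - assert (Hz : z <> RtoC 0) by (intros ->; now rewrite Cmod_0 in E).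
    split; [now apply Hd1|]. exact (proj1 (Hc1 z Hz Hzr)). }
assert (Hol2 : hol1 r f2 df2).
{ intros z Hzr. destruct (Req_dec (Cmod z) 0) as [E|E].
  - apply Cmod_eq_0 in E. subst z. split.
    + unfold df2. rewrite ext0. apply Hquad; [apply ext0|]. intros; now apply Hup.
    + apply Hlin; [apply ext0|]. exists (2 * M * B). split; [nra|].
      intros z Hz Hzr'. unfold df2. rewrite extn by easy.
      replace (- h z * f1 z - (RtoC (mu / 2 - kp) + h z) * f2 z)%C
        with (- h z * f1 z + - (RtoC (mu / 2 - kp) + h z) * f2 z)%C by ring.
      specialize (Hhz z Hz Hzr'). apply Hbd; try easy; rewrite Cmod_opp.
      * unfold M. generalize (Rabs_pos (mu / 2 + kp)) (Rabs_pos (mu / 2 - kp)). lra.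
      * eapply Rle_trans; [apply Cmod_triangle|]. rewrite Cmod_R.
        unfold M. generalize (Rabs_pos (mu / 2 + kp)). lra.
  - assert (Hz : z <> RtoC 0) by (intros ->; now rewrite Cmod_0 in E).
    split; [now apply Hd2|]. exact (proj2 (Hc1 z Hz Hzr)). }
(* the lower bound from [growth] bounds the order of vanishing *)
set (cl := c * exp (- (2 * G * x0))).
assert (Hcl : 0 < cl) by (apply Rmult_lt_0_compat; [easy|apply exp_pos]).
destruct (hol1_divide_out n r f1 df1 f2 df2 (sqrt cl)) as
  (k & r' & v1 & dv1 & v2 & dv2 & Hr' & Hle & V1 & V2 & Hv0 & E); try easy.
{ now apply sqrt_lt_R0. }
{ intros z [Hz0 Hzr]. assert (Hz : z <> RtoC 0) by now apply Cmod_gt_0.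
  destruct (Hlog z Hz Hzr) as (s & -> & Hs). rewrite F1, F2 by lra.
  assert (HU : cl * (exp (Re s) ^ n) ^ 2 <= nrm2 U1 U2 s).
  { rewrite Hnr. apply Rle_trans with (exp (2 * kp * Re s) * (c * exp (2 * G * (Re s - x0)))).
    - replace (exp (2 * kp * Re s) * (c * exp (2 * G * (Re s - x0))))
        with (cl * exp ((2 * kp + 2 * G) * Re s)).
      + apply Rmult_le_compat_l; [lra|].
        replace ((exp (Re s) ^ n) ^ 2) with (exp (2 * INR n * Re s)).
        * assert (Hle : 2 * INR n * Re s <= (2 * kp + 2 * G) * Re s) by (unfold kp; nra).
          destruct Hle as [Hlt| ->]; [left; now apply exp_increasing|lra].
        * rewrite <- (exp_ln (exp (Re s) ^ n)) by (apply pow_lt, exp_pos).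
          rewrite ln_pow by apply exp_pos. rewrite ln_exp. simpl. rewrite Rmult_1_r, <- exp_plus.
          f_equal. ring.
      + unfold cl.
        replace (c * exp (- (2 * G * x0)) * exp ((2 * kp + 2 * G) * Re s))
          with (c * (exp (- (2 * G * x0)) * exp ((2 * kp + 2 * G) * Re s))) by ring.
        replace (exp (2 * kp * Re s) * (c * exp (2 * G * (Re s - x0))))
          with (c * (exp (2 * kp * Re s) * exp (2 * G * (Re s - x0)))) by ring.
        rewrite <- !exp_plus. do 2 f_equal. ring.
    - apply Rmult_le_compat_l; [left; apply exp_pos|]. apply Hgr. lra. }
  rewrite Cmod_Cexp. assert (T1 := Cmod_ge_0 (U1 s)). assert (T2 := Cmod_ge_0 (U2 s)).
  apply Rsqr_incr_0; [|apply Rmult_le_pos; [apply sqrt_pos|apply pow_le; left; apply exp_pos]|lra].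
  unfold Rsqr. replace (sqrt cl * exp (Re s) ^ n * (sqrt cl * exp (Re s) ^ n))
    with ((sqrt cl * sqrt cl) * (exp (Re s) ^ n) ^ 2) by ring.
  rewrite sqrt_sqrt by lra. unfold nrm2 in HU. nra. }
exists (Z.of_nat k - Z.of_nat N)%Z, r', v1, dv1, v2, dv2.
split; [easy|]. split; [easy|]. split; [easy|]. split; [easy|].
intros s Hs Hsr. destruct (E (Cexp s)) as [E1 E2]; [now rewrite Cmod_Cexp|].
rewrite F1, <- zpow_INR in E1 by easy. rewrite F2, <- zpow_INR in E2 by easy.
assert (Hz : zpow (kap0 + IZR (Z.of_nat k - Z.of_nat N)) s = (zpow (- kp) s * zpow (INR k) s)%C).
{ rewrite <- zpow_plus. f_equal. unfold kp. rewrite minus_IZR, <- !INR_IZR_INZ. ring. }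
rewrite Hz. split.
- rewrite <- Cmult_assoc, <- E1. unfold U1. rewrite Cmult_assoc, zpow_inv. ring.
- rewrite <- Cmult_assoc, <- E2. unfold U2. rewrite Cmult_assoc, zpow_inv. ring.
Qed.

(** * The frame of a Bryant end with [mu + nu = -1] *)

Lemma cover_iff (rho : R) (s : C) : 0 < rho -> (cover rho s <-> Re s < ln rho).
Proof.
intros Hr. unfold cover, pdisc. rewrite Cmod_Cexp. split.
- intros [_ H]. apply exp_lt_inv. now rewrite exp_ln.
- intros H. split; [apply exp_pos|]. rewrite <- (exp_ln rho) by easy. now apply exp_increasing.
Qed.

Lemma cder_C_derive (f : C -> C) (s : C) :
  @ex_derive C_AbsRing C_NormedModule f s -> cder f s (C_derive f s).
Proof. intros H. now apply C_derive_correct. Qed.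

(** The rows of the equation [F' = F (F^-1 F')] for the data [g = z^mu],
    [omega = z^(-1-mu) h dz], in the coordinate [s]. *)
Definition row_ode (mu : R) (h : C -> C) (P Q : C -> C) (s : C) : Prop :=
  cder P s (h (Cexp s) * (P s + zpow (- mu) s * Q s))%C /\
  cder Q s (- (h (Cexp s) * (zpow mu s * P s + Q s)))%C.

Lemma power_form_zpow (mu : R) (h : C -> C) (s : C) :
  power_form (-1 - mu) h s = (zpow (- mu) s * h (Cexp s))%C.
Proof.
unfold power_form. replace (- mu) with ((-1 - mu) + 1) by ring. rewrite zpow_plus.
replace (zpow 1 s) with (Cexp s) by (unfold zpow; f_equal; ring). ring.
Qed.

Lemma bryant_ode (rho mu : R) (X : C -> E3) (F : C -> mat2) (h : C -> C) :
  0 < rho -> bryant_representation rho X F ->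
  weierstrass_data rho F (zpow mu) (power_form (-1 - mu) h) ->
  forall s, Re s < ln rho ->
    mat2_det (F s) = RtoC 1 /\
    row_ode mu h (fun s => mA (F s)) (fun s => mB (F s)) s /\
    row_ode mu h (fun s => mC (F s)) (fun s => mD (F s)) s.
Proof.
intros Hrho [[HA [HB [HC HD]]] HF] HW s Hs.
apply cover_iff in Hs; [|easy].
destruct (HF s Hs) as [Hdet _]. split; [easy|].
specialize (HW s Hs). unfold mat2_inv in HW. rewrite Hdet in HW.
assert (A' := cder_C_derive _ _ (HA s Hs)). assert (B' := cder_C_derive _ _ (HB s Hs)).
assert (C' := cder_C_derive _ _ (HC s Hs)). assert (D' := cder_C_derive _ _ (HD s Hs)).
unfold mat2_derive, mat2_mul, mat2_scale, mat2_det in *. cbn [mA mB mC mD] in HW, Hdet.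
rewrite power_form_zpow in HW.
set (a := mA (F s)) in *. set (b := mB (F s)) in *. set (c := mC (F s)) in *. set (d := mD (F s)) in *.
set (a' := C_derive (fun t => mA (F t)) s) in *. set (b' := C_derive (fun t => mB (F t)) s) in *.
set (c' := C_derive (fun t => mC (F t)) s) in *. set (d' := C_derive (fun t => mD (F t)) s) in *.
assert (Hi : (/ 1)%C = RtoC 1) by (field; apply C1_nz). rewrite Hi in HW.
assert (Hz := zpow_inv mu s). set (g := zpow mu s) in *. set (gi := zpow (- mu) s) in *.
set (k := h (Cexp s)) in *.
assert (W1 := f_equal mA HW). assert (W2 := f_equal mB HW).
assert (W3 := f_equal mC HW). assert (W4 := f_equal mD HW).
cbn [mA mB mC mD] in W1, W2, W3, W4.
assert (E1 : a' = (k * (a + gi * b))%C).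
{ replace a' with ((a * d - b * c) * a')%C by (rewrite Hdet; ring).
  replace ((a * d - b * c) * a')%C with
    (a * (1 * d * a' + 1 * - b * c') + b * (1 * - c * a' + 1 * a * c'))%C by ring.
  rewrite W1, W3. transitivity (k * (gi * g * a + gi * b))%C; [ring|]. rewrite Hz. ring. }
assert (E3 : c' = (k * (c + gi * d))%C).
{ replace c' with ((a * d - b * c) * c')%C by (rewrite Hdet; ring).
  replace ((a * d - b * c) * c')%C with
    (c * (1 * d * a' + 1 * - b * c') + d * (1 * - c * a' + 1 * a * c'))%C by ring.
  rewrite W1, W3. transitivity (k * (gi * g * c + gi * d))%C; [ring|]. rewrite Hz. ring. }
assert (E2 : b' = (- (k * (g * a + b)))%C).
{ replace b' with ((a * d - b * c) * b')%C by (rewrite Hdet; ring).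
  replace ((a * d - b * c) * b')%C with
    (a * (1 * d * b' + 1 * - b * d') + b * (1 * - c * b' + 1 * a * d'))%C by ring.
  rewrite W2, W4. transitivity (- (k * ((gi * g) * g * a + gi * g * b)))%C; [ring|]. rewrite Hz. ring. }
assert (E4 : d' = (- (k * (g * c + d)))%C).
{ replace d' with ((a * d - b * c) * d')%C by (rewrite Hdet; ring).
  replace ((a * d - b * c) * d')%C with
    (c * (1 * d * b' + 1 * - b * d') + d * (1 * - c * b' + 1 * a * d'))%C by ring.
  rewrite W2, W4. transitivity (- (k * ((gi * g) * g * c + gi * g * d)))%C; [ring|]. rewrite Hz. ring. }
unfold row_ode. split; split; (eapply cder_eq; [eassumption|]).
- exact E1.
- exact E2.
- exact E3.
- exact E4.
Qed.

(** If [F F^*] takes the same value at two matrices of determinant 1 then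
    they differ by a matrix of [SU(2)] on the right. *)
Lemma gram_unitary (A B C0 D A' B' C' D' : C) :
  (A * D - B * C0 = 1)%C -> (A' * D' - B' * C' = 1)%C ->
  (A * Cconj A + B * Cconj B = A' * Cconj A' + B' * Cconj B')%C ->
  (Cconj A * C0 + Cconj B * D = Cconj A' * C' + Cconj B' * D')%C ->
  (A * D' - C0 * B')%C = Cconj (D * A' - B * C') /\
  (D * B' - B * D')%C = Cconj (C0 * A' - A * C').
Proof.
intros H1 H2 Hn Hm.
assert (H1c : (Cconj A * Cconj D - Cconj B * Cconj C0 = 1)%C).
{ rewrite <- !Cmult_conj, <- Cminus_conj, H1. unfold Cconj, RtoC; simpl. f_equal. ring. }
assert (H2c : (Cconj A' * Cconj D' - Cconj B' * Cconj C' = 1)%C).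
{ rewrite <- !Cmult_conj, <- Cminus_conj, H2. unfold Cconj, RtoC; simpl. f_equal. ring. }
assert (Hmc : (A * Cconj C0 + B * Cconj D = A' * Cconj C' + B' * Cconj D')%C).
{ apply (f_equal Cconj) in Hm. rewrite !Cplus_conj, !Cmult_conj, !Cconj_conj in Hm. exact Hm. }
rewrite !Cminus_conj, !Cmult_conj.
set (a := Cconj A) in *. set (b := Cconj B) in *. set (c := Cconj C0) in *. set (d := Cconj D) in *.
set (a' := Cconj A') in *. set (b' := Cconj B') in *. set (c' := Cconj C') in *. set (d' := Cconj D') in *.
(* Lagrange's identity gives the equality of the last entries of [F F^*] *)
assert (Hk : ((A * a + B * b) * (C0 * c + D * d - (C' * c' + D' * d')) = 0)%C).
{ transitivity ((A * c + B * d) * (a * C0 + b * D) + (A * D - B * C0) * (a * d - b * c)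
    - (A * a + B * b) * (C' * c' + D' * d'))%C; [ring|].
  rewrite H1, H1c, Hn, Hm, Hmc.
  transitivity (1 - (A' * D' - B' * C') * (a' * d' - b' * c'))%C; [ring|].
  rewrite H2, H2c. ring. }
assert (Hnz : (A * a + B * b)%C <> RtoC 0).
{ intros E. unfold a, b in E. rewrite <- !Cmod2_conj, <- RtoC_plus in E. apply RtoC_inj in E.
  assert (P1 := Cmod_ge_0 A). assert (P2 := Cmod_ge_0 B).
  assert (Z1 : Cmod A = 0) by nra. assert (Z2 : Cmod B = 0) by nra.
  apply Cmod_eq_0 in Z1. apply Cmod_eq_0 in Z2. rewrite Z1, Z2 in H1.
  replace (0 * D - 0 * C0)%C with (RtoC 0) in H1 by ring. now apply C1_nz. }
assert (Hk' : (C0 * c + D * d = C' * c' + D' * d')%C).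
{ apply Ceq_minus. destruct (Ceq_dec (C0 * c + D * d - (C' * c' + D' * d')) 0) as [E|E]; [easy|].
  exfalso. now apply (Cmult_neq_0 _ _ Hnz E). }
(* [F' = F V] with [V = F^* (F'^-1)^*] *)
assert (R1 : (A * (a * d' - c * b') + B * (b * d' - d * b') = A')%C).
{ transitivity ((A * a + B * b) * d' - (A * c + B * d) * b')%C; [ring|].
  rewrite Hn, Hmc. transitivity (A' * (a' * d' - b' * c'))%C; [ring|]. rewrite H2c. ring. }
assert (R2 : (C0 * (a * d' - c * b') + D * (b * d' - d * b') = C')%C).
{ transitivity ((a * C0 + b * D) * d' - (C0 * c + D * d) * b')%C; [ring|].
  rewrite Hm, Hk'. transitivity (C' * (a' * d' - b' * c'))%C; [ring|]. rewrite H2c. ring. }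
assert (V1 : (D * A' - B * C' = a * d' - c * b')%C).
{ rewrite <- R1, <- R2. transitivity ((A * D - B * C0) * (a * d' - c * b'))%C; [ring|].
  rewrite H1. ring. }
assert (V2 : (A * C' - C0 * A' = b * d' - d * b')%C).
{ rewrite <- R1, <- R2. transitivity ((A * D - B * C0) * (b * d' - d * b'))%C; [ring|].
  rewrite H1. ring. }
apply (f_equal Cconj) in V1, V2. rewrite !Cminus_conj, !Cmult_conj in V1, V2.
unfold a, b, c, d, a', b', c', d' in *. rewrite !Cconj_conj in V1, V2. split.
- rewrite V1. ring.
- replace (D * B' - B * D')%C with (- (B * D' - D * B'))%C by ring. rewrite <- V2. ring.
Qed.

(** The derivatives satisfy [m * v = Cconj (l * v)] for all [v]; the left-hand side
    is complex linear in [v] and the right-hand side antilinear. *)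
Lemma cder_conj_zero (f g : C -> C) (s l m : C) (d : R) : 0 < d ->
  (forall w, Cmod (w - s) < d -> g w = Cconj (f w)) ->
  cder f s l -> cder g s m -> l = RtoC 0 /\ m = RtoC 0.
Proof.
intros Hd Hfg Hf Hg.
assert (Hlin : forall v : C, (m * v)%C = Cconj (l * v)%C).
{ intros v. apply Ceq_minus. apply Cmod_eq_0.
  apply Rle_antisym; [|apply Cmod_ge_0]. apply le_epsilon. intros eps Heps.
  rewrite Rplus_0_l.
  assert (HK : 0 < 2 * (1 + Cmod v)) by (generalize (Cmod_ge_0 v); lra).
  assert (He : 0 < eps / (2 * (1 + Cmod v))) by now apply Rdiv_lt_0_compat.
  destruct (proj1 (cder_eps _ _ _) Hf _ He) as (d1 & Hd1 & H1).
  destruct (proj1 (cder_eps _ _ _) Hg _ He) as (d2 & Hd2 & H2).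
  set (q := Rmin d (Rmin d1 d2)). assert (Hq : 0 < q) by (repeat apply Rmin_pos; easy).
  set (t := q / (2 * (1 + Cmod v))).
  assert (Ht : 0 < t) by now apply Rdiv_lt_0_compat.
  assert (Hw : Cmod (s + t * v - s)%C = t * Cmod v).
  { replace (s + t * v - s)%C with (t * v)%C by ring. rewrite Cmod_mult, Cmod_R, Rabs_pos_eq; lra. }
  assert (Htv : t * Cmod v < q).
  { apply Rlt_le_trans with (t * (2 * (1 + Cmod v))).
    - apply Rmult_lt_compat_l; [easy|]. generalize (Cmod_ge_0 v); lra.
    - unfold t. right. field. lra. }
  assert (Hqs : q <= d /\ q <= d1 /\ q <= d2) by (unfold q, Rmin; repeat destruct Rle_dec; lra).
  specialize (H1 (s + t * v)%C). specialize (H2 (s + t * v)%C). rewrite Hw in H1, H2.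
  specialize (H1 ltac:(lra)). specialize (H2 ltac:(lra)).
  rewrite !Hfg in H2; [| replace (s - s)%C with (RtoC 0) by ring; now rewrite Cmod_0 | rewrite Hw; lra].
  replace (s + t * v - s)%C with (t * v)%C in H1, H2 by ring.
  rewrite <- Cmod_conj in H1.
  apply Rmult_le_reg_l with t; [easy|].
  rewrite <- (Rabs_pos_eq t) at 1 by lra. rewrite <- Cmod_R, <- Cmod_mult.
  set (fa := f (s + t * v)%C) in *. set (fb := f s) in *.
  replace (t * (m * v - Cconj (l * v)))%C with
    (Cconj (fa - fb - l * (t * v)) + - (Cconj fa - Cconj fb - m * (t * v)))%C.
  - eapply Rle_trans; [apply Cmod_triangle|]. rewrite Cmod_opp.
    apply Rle_trans with (2 * (eps / (2 * (1 + Cmod v)) * (t * Cmod v))); [lra|].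
    replace (2 * (eps / (2 * (1 + Cmod v)) * (t * Cmod v)))
      with (t * (eps * (Cmod v / (1 + Cmod v)))) by (field; lra).
    apply Rmult_le_compat_l; [lra|]. rewrite <- (Rmult_1_r eps) at 2.
    apply Rmult_le_compat_l; [lra|]. apply Rmult_le_reg_r with (1 + Cmod v); [lra|].
    replace (Cmod v / (1 + Cmod v) * (1 + Cmod v)) with (Cmod v) by (field; lra). lra.
  - rewrite !Cminus_conj, !Cmult_conj.
    replace (Cconj (RtoC t)) with (RtoC t) by (unfold Cconj, RtoC; simpl; f_equal; ring). ring. }
assert (E1 := Hlin (RtoC 1)). assert (E2 := Hlin Ci). rewrite !Cmult_1_r in E1.
rewrite Cmult_conj, <- E1 in E2.
replace (Cconj Ci) with (- Ci)%C in E2 by (unfold Cconj, Ci, Copp; simpl; f_equal; ring).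
assert (E3 : m = RtoC 0).
{ destruct m as [x y]. unfold Cmult, Copp, Ci, RtoC in *. simpl in E2. injection E2 as X1 X2.
  f_equal; lra. }
split; [|easy]. rewrite E3 in E1. rewrite <- (Cconj_conj l), <- E1.
unfold Cconj, RtoC; simpl. f_equal. ring.
Qed.

Lemma cder_shift (f : C -> C) (s t l : C) :
  cder f (s + t)%C l -> cder (fun w => f (w + t)%C) s l.
Proof.
intros H. eapply cder_eq.
- apply (cder_comp f (fun w => w + t)%C); [exact H|].
  apply cder_plus; [apply cder_id|apply cder_const].
- ring.
Qed.

Lemma Cexp_tau : Cexp tau = RtoC 1.
Proof. rewrite <- (Cexp_Ztau 1). f_equal. ring. Qed.

Lemma Re_add_tau (s : C) : Re (s + tau) = Re s.
Proof. rewrite Re_plus, Re_tau. ring. Qed.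

Lemma locally_half_plane (L : R) (s : C) : Re s < L ->
  forall w, Cmod (w - s) < L - Re s -> Re w < L.
Proof.
intros Hs w Hw. assert (T := re_le_Cmod (w - s)).
replace (Re (w - s)) with (Re w - Re s) in T by (unfold Re; simpl; ring).
apply Rabs_le_between in T. lra.
Qed.

Lemma const_of_cder_zero (f : C -> C) (L : R) :
  (forall s, Re s < L -> cder f s (RtoC 0)) ->
  forall s t, Re s < L -> Re t < L -> f s = f t.
Proof.
intros H s t Hs Ht. apply Ceq_minus, Cmod_eq_0. apply Rle_antisym; [|apply Cmod_ge_0].
replace 0 with (0 * Cmod (s - t)) by ring.
apply (cder_mvt f (fun _ => RtoC 0)).
- intros u Hu. apply H. replace (Re (t + u * (s - t))) with ((1 - u) * Re t + u * Re s)
    by (unfold Re; simpl; ring).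
  assert (M := Rmax_l (Re t) (Re s)). assert (M' := Rmax_r (Re t) (Re s)).
  assert (M2 : Rmax (Re t) (Re s) < L) by now apply Rmax_lub_lt. nra.
- intros u _. rewrite Cmod_0. lra.
Qed.

(** The change of sheet [s -> s + 2 pi i] multiplies the frame [F] on the right
    by a matrix [V] that is unitary, because [F F^*] only depends on the
    immersion, and holomorphic, hence constant; the multivaluedness of the
    Weierstrass data then forces [V] to be diagonal, and equal to plus or minus
    the monodromy of [(z^(-mu/2), z^(mu/2))]. *)
Lemma monodromy (rho mu L : R) (X : C -> E3) (F : C -> mat2) (h : C -> C) :
  0 < rho -> 0 < mu -> bryant_representation rho X F ->
  weierstrass_data rho F (zpow mu) (power_form (-1 - mu) h) ->
  L <= ln rho -> L <= 0 -> (forall s, Re s < L -> h (Cexp s) <> RtoC 0) ->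
  exists sg : C, (sg = RtoC 1 \/ sg = (- RtoC 1)%C) /\
  forall s, Re s < L ->
    (zpow (mu / 2) (s + tau) * mA (F (s + tau)%C))%C = (sg * (zpow (mu / 2) s * mA (F s)))%C /\
    (zpow (- (mu / 2)) (s + tau) * mB (F (s + tau)%C))%C = (sg * (zpow (- (mu / 2)) s * mB (F s)))%C /\
    (zpow (mu / 2) (s + tau) * mC (F (s + tau)%C))%C = (sg * (zpow (mu / 2) s * mC (F s)))%C /\
    (zpow (- (mu / 2)) (s + tau) * mD (F (s + tau)%C))%C = (sg * (zpow (- (mu / 2)) s * mD (F s)))%C.
Proof.
intros Hrho Hmu HF HW HL HL0 Hh.
assert (ODE := bryant_ode rho mu X F h Hrho HF HW).
set (A := fun s => mA (F s)) in *. set (B := fun s => mB (F s)) in *.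
set (C0 := fun s => mC (F s)) in *. set (D := fun s => mD (F s)) in *.
pose (At := fun s => A (s + tau)%C). pose (Bt := fun s => B (s + tau)%C).
pose (Ct := fun s => C0 (s + tau)%C). pose (Dt := fun s => D (s + tau)%C).
(* [V = F(s)^-1 F(s + tau)] has the rows [(p, q)] and [(- q', p')] *)
pose (p := fun s => (D s * At s - B s * Ct s)%C). pose (p' := fun s => (A s * Dt s - C0 s * Bt s)%C).
pose (q := fun s => (D s * Bt s - B s * Dt s)%C). pose (q' := fun s => (C0 s * At s - A s * Ct s)%C).
set (e := Cexp (RtoC mu * tau)). set (ei := Cexp (RtoC (- mu) * tau)).
set (e2 := Cexp (RtoC (mu / 2) * tau)). set (e2i := Cexp (RtoC (- (mu / 2)) * tau)).
assert (Hee : (e * ei)%C = RtoC 1).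
{ unfold e, ei. rewrite <- Cexp_plus, RtoC_opp.
  replace (mu * tau + - mu * tau)%C with (RtoC 0) by ring. apply Cexp_0. }
assert (Hee2 : (e2 * e2)%C = e).
{ unfold e, e2. rewrite <- Cexp_plus. f_equal.
  replace mu with (mu / 2 + mu / 2) at 3 by field. rewrite RtoC_plus. ring. }
assert (Hei2 : (e2i * e)%C = e2).
{ unfold e, e2, e2i. rewrite <- Cexp_plus. f_equal.
  replace mu with (mu / 2 + mu / 2) at 2 by field. rewrite RtoC_plus, RtoC_opp. ring. }
assert (He2m : Cmod e2 = 1).
{ unfold e2. rewrite Cmod_Cexp. replace (Re (RtoC (mu / 2) * tau)) with 0; [apply exp_0|].
  unfold tau, Re, Ci; simpl. ring. }
assert (Heim : Cmod ei = 1).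
{ unfold ei. rewrite Cmod_Cexp. replace (Re (RtoC (- mu) * tau)) with 0; [apply exp_0|].
  unfold tau, Re, Ci; simpl. ring. }
assert (Hun : forall s, Re s < L -> p' s = Cconj (p s) /\ q s = Cconj (q' s)).
{ intros s Hs. assert (Hst : Re (s + tau) < L) by now rewrite Re_add_tau.
  destruct (ODE s ltac:(lra)) as [D1 _]. destruct (ODE (s + tau)%C ltac:(lra)) as [D2 _].
  destruct HF as [_ HF].
  destruct (HF s (proj2 (cover_iff rho s Hrho) ltac:(lra))) as (_ & _ & Z1 & H1).
  destruct (HF (s + tau)%C (proj2 (cover_iff rho (s + tau)%C Hrho) ltac:(lra))) as (_ & _ & Z2 & H2).
  rewrite Cexp_plus, Cexp_tau, Cmult_1_r in Z2, H2.
  fold (A s) (B s) (C0 s) (D s) in Z1, H1.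
  fold (A (s + tau)%C) (B (s + tau)%C) (C0 (s + tau)%C) (D (s + tau)%C) in Z2, H2.
  fold (At s) (Bt s) (Ct s) (Dt s) in Z2, H2.
  assert (Hpos : forall a b c d : C, (a * d - b * c)%C = RtoC 1 -> Cmod a ^ 2 + Cmod b ^ 2 <> 0).
  { intros a b c d Hd E. assert (P1 := Cmod_ge_0 a). assert (P2 := Cmod_ge_0 b).
    assert (Ea : Cmod a = 0) by nra. assert (Eb : Cmod b = 0) by nra.
    apply Cmod_eq_0 in Ea. apply Cmod_eq_0 in Eb. rewrite Ea, Eb in Hd.
    replace (0 * d - 0 * c)%C with (RtoC 0) in Hd by ring. now apply C1_nz. }
  assert (N1 := Hpos _ _ _ _ D1). assert (N2 := Hpos _ _ _ _ D2).
  fold (A s) (B s) in N1. fold (A (s + tau)%C) (B (s + tau)%C) in N2. fold (At s) (Bt s) in N2.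
  assert (N : Cmod (A s) ^ 2 + Cmod (B s) ^ 2 = Cmod (At s) ^ 2 + Cmod (Bt s) ^ 2).
  { rewrite <- (Rinv_inv (Cmod (A s) ^ 2 + _)), <- H1, H2, Rinv_inv. reflexivity. }
  apply gram_unitary; [exact D1|exact D2| |].
  - rewrite <- !Cmod2_conj, <- !RtoC_plus. now rewrite N.
  - rewrite Z1, N in Z2.
    assert (Nc : RtoC (Cmod (At s) ^ 2 + Cmod (Bt s) ^ 2) <> RtoC 0).
    { intros E. apply RtoC_inj in E. easy. }
    set (n := RtoC (Cmod (At s) ^ 2 + Cmod (Bt s) ^ 2)) in *.
    set (m1 := (Cconj (A s) * C0 s + Cconj (B s) * D s)%C) in *.
    set (m2 := (Cconj (At s) * Ct s + Cconj (Bt s) * Dt s)%C) in *.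
    replace m1 with (m1 / n * n)%C by (field; easy). rewrite Z2. field. easy. }
assert (Hder : forall s, Re s < L ->
  let k := h (Cexp s) in let g := zpow mu s in let gi := zpow (- mu) s in
  cder p s (k * (gi * ei * q s - g * q' s))%C /\
  cder q' s (k * (2 * q' s + gi * p s - gi * ei * p' s))%C /\
  (exists l, cder p' s l) /\ (exists l, cder q s l)).
{ intros s Hs k g gi. assert (Hst : Re (s + tau) < L) by now rewrite Re_add_tau.
  destruct (ODE s ltac:(lra)) as (_ & [A1 B1] & [C1 D1]).
  destruct (ODE (s + tau)%C ltac:(lra)) as (_ & [A2 B2] & [C2 D2]).
  rewrite !zpow_tau, Cexp_plus, Cexp_tau, Cmult_1_r in A2, B2, C2, D2.
  apply cder_shift in A2, B2, C2, D2. fold (At s) (Bt s) in A2, B2. fold (Ct s) (Dt s) in C2, D2.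
  fold k g gi e ei in A1, B1, C1, D1, A2, B2, C2, D2.
  assert (Hm : forall f1 f2 f3 f4 l1 l2 l3 l4, cder f1 s l1 -> cder f2 s l2 -> cder f3 s l3 ->
    cder f4 s l4 -> cder (fun w => f1 w * f2 w - f3 w * f4 w)%C s
      (l1 * f2 s + f1 s * l2 - (l3 * f4 s + f3 s * l4))%C).
  { intros f1 f2 f3 f4 l1 l2 l3 l4 G1 G2 G3 G4.
    exact (cder_minus _ _ _ _ _ (cder_mult _ _ _ _ _ G1 G2) (cder_mult _ _ _ _ _ G3 G4)). }
  split; [|split; [|split]].
  - eapply cder_eq; [exact (Hm D At B Ct _ _ _ _ D1 A2 B1 C2)|].
    unfold q, q'. ring.
  - eapply cder_eq; [exact (Hm C0 At A Ct _ _ _ _ C1 A2 A1 C2)|].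
    unfold p, p', q'. ring.
  - eexists. exact (Hm A Dt C0 Bt _ _ _ _ A1 D2 C1 B2).
  - eexists. exact (Hm D Bt B Dt _ _ _ _ D1 B2 B1 D2). }
assert (Hkey : forall s, Re s < L -> q' s = RtoC 0 /\ q s = RtoC 0 /\ p s = (ei * p' s)%C /\
   cder p s (RtoC 0)).
{ intros s Hs. destruct (Hder s Hs) as (P1 & Q1 & [l P2] & [m Q2]).
  assert (Hk := Hh s Hs).
  assert (HLs : 0 < L - Re s) by lra.
  assert (Hloc := locally_half_plane L s Hs).
  destruct (cder_conj_zero p p' s _ _ _ HLs (fun w Hw => proj1 (Hun w (Hloc w Hw))) P1 P2) as [Z1 _].
  destruct (cder_conj_zero q' q s _ _ _ HLs (fun w Hw => proj2 (Hun w (Hloc w Hw))) Q1 Q2) as [Z2 _].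
  rewrite Z1 in P1.
  assert (Hcanc : forall x : C, (h (Cexp s) * x)%C = RtoC 0 -> x = RtoC 0).
  { intros x Hx. destruct (Ceq_dec x 0) as [E|E]; [easy|]. exfalso. now apply (Cmult_neq_0 _ _ Hk E). }
  apply Hcanc in Z1. apply Hcanc in Z2.
  assert (Hq : Cmod (q s) = Cmod (q' s)).
  { rewrite (proj2 (Hun s Hs)). apply Cmod_conj. }
  assert (E : Cmod (zpow (- mu) s * ei * q s) = Cmod (zpow mu s * q' s)).
  { f_equal. apply Ceq_minus. exact Z1. }
  rewrite !Cmod_mult, Heim, Hq, !Cmod_zpow, Rmult_1_r in E.
  (* in [E] the equal moduli of [q] and [q'] carry different factors *)
  assert (G1 : exp (mu * Re s) < exp (- mu * Re s)) by (apply exp_increasing; nra).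
  assert (Q0 : q' s = RtoC 0) by (apply Cmod_eq_0; nra).
  rewrite Q0 in Hq, Z2. rewrite Cmod_0 in Hq. apply Cmod_eq_0 in Hq.
  split; [assumption|]. split; [assumption|]. split; [|assumption].
  apply Ceq_minus.
  destruct (Ceq_dec (p s - ei * p' s) 0) as [E'|E']; [easy|]. exfalso.
  apply (Cmult_neq_0 _ _ (zpow_neq0 (- mu) s) E'). rewrite <- Z2. ring. }
assert (Hfac : forall s, Re s < L -> At s = (p s * A s)%C /\ Bt s = (p' s * B s)%C /\
   Ct s = (p s * C0 s)%C /\ Dt s = (p' s * D s)%C /\ (p s * p' s)%C = RtoC 1).
{ intros s Hs. destruct (ODE s ltac:(lra)) as [D1 _]. unfold mat2_det in D1.
  change (A s * D s - B s * C0 s = 1)%C in D1.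
  assert (Hst : Re (s + tau) < L) by now rewrite Re_add_tau.
  destruct (ODE (s + tau)%C ltac:(lra)) as [D2 _]. unfold mat2_det in D2.
  change (At s * Dt s - Bt s * Ct s = 1)%C in D2.
  destruct (Hkey s Hs) as (Q1 & Q2 & _).
  repeat split.
  - transitivity ((A s * D s - B s * C0 s) * At s)%C; [rewrite D1; ring|].
    transitivity (p s * A s - B s * q' s)%C; [unfold p, q'; ring|]. rewrite Q1. ring.
  - transitivity ((A s * D s - B s * C0 s) * Bt s)%C; [rewrite D1; ring|].
    transitivity (A s * q s + p' s * B s)%C; [unfold p', q; ring|]. rewrite Q2. ring.
  - transitivity ((A s * D s - B s * C0 s) * Ct s)%C; [rewrite D1; ring|].
    transitivity (p s * C0 s - D s * q' s)%C; [unfold p, q'; ring|]. rewrite Q1. ring.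
  - transitivity ((A s * D s - B s * C0 s) * Dt s)%C; [rewrite D1; ring|].
    transitivity (C0 s * q s + p' s * D s)%C; [unfold p', q; ring|]. rewrite Q2. ring.
  - transitivity ((A s * D s - B s * C0 s) * (At s * Dt s - Bt s * Ct s) - q s * q' s)%C.
    + unfold p, p', q, q'. ring.
    + rewrite D1, D2, Q1. ring. }
set (s0 := RtoC (L - 1)). assert (Hs0 : Re s0 < L) by (simpl; lra).
exists (e2 * p s0)%C. split.
- destruct (Hkey s0 Hs0) as (_ & _ & E & _). destruct (Hfac s0 Hs0) as (_ & _ & _ & _ & N).
  assert (S1 : ((e2 * p s0 - 1) * (e2 * p s0 + 1))%C = RtoC 0).
  { transitivity ((e2 * e2) * p s0 * p s0 - 1)%C; [ring|]. rewrite Hee2, E at 1.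
    transitivity ((e * ei) * (p s0 * p' s0) - 1)%C; [ring|]. rewrite Hee, N. ring. }
  destruct (Ceq_dec (e2 * p s0 - 1) 0) as [E1|E1].
  + left. apply Ceq_minus. exact E1.
  + right. destruct (Ceq_dec (e2 * p s0 + 1) 0) as [E2|E2].
    * transitivity (e2 * p s0 + 1 - 1)%C; [ring|]. rewrite E2. ring.
    * exfalso. now apply (Cmult_neq_0 _ _ E1 E2).
- intros s Hs.
  assert (Ep : p s0 = p s).
  { apply (const_of_cder_zero p L); try easy. intros t Ht. now apply Hkey. }
  rewrite Ep. destruct (Hkey s Hs) as (_ & _ & E & _).
  destruct (Hfac s Hs) as (F1 & F2 & F3 & F4 & _).
  assert (E' : (e2i * p' s)%C = (e2 * p s)%C).
  { rewrite E. transitivity (e2i * (e * ei) * p' s)%C; [rewrite Hee; ring|].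
    transitivity ((e2i * e) * ei * p' s)%C; [ring|]. rewrite Hei2. ring. }
  rewrite !zpow_tau. fold e2 e2i. fold (A (s + tau)%C) (B (s + tau)%C) (C0 (s + tau)%C) (D (s + tau)%C).
  fold (At s) (Bt s) (Ct s) (Dt s). rewrite F1, F2, F3, F4. fold (A s) (B s) (C0 s) (D s).
  repeat split.
  + ring.
  + rewrite <- E'. ring.
  + ring.
  + rewrite <- E'. ring.
Qed.

Lemma cder_unique (f : C -> C) (z l m : C) : cder f z l -> cder f z m -> l = m.
Proof.
intros H1 H2. rewrite <- (is_C_derive_unique _ _ _ H1). now apply is_C_derive_unique.
Qed.

Lemma eq_at_puncture (f g : C -> C) (r : R) : 0 < r ->
  continuous f (RtoC 0) -> continuous g (RtoC 0) ->
  (forall z, z <> RtoC 0 -> Cmod z < r -> f z = g z) -> f (RtoC 0) = g (RtoC 0).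
Proof.
intros Hr Hf Hg H. apply Ceq_minus, Cmod_eq_0. apply Rle_antisym; [|apply Cmod_ge_0].
apply le_epsilon. intros eps Heps. rewrite Rplus_0_l.
destruct (proj1 (continuous_C_eps _ _) Hf (eps / 2)) as (d1 & Hd1 & H1); [lra|].
destruct (proj1 (continuous_C_eps _ _) Hg (eps / 2)) as (d2 & Hd2 & H2); [lra|].
set (x := Rmin r (Rmin d1 d2) / 2).
assert (Hx : 0 < x < r /\ x < d1 /\ x < d2) by (unfold x, Rmin; repeat destruct Rle_dec; lra).
assert (Ex : Cmod (RtoC x) = x) by (rewrite Cmod_R, Rabs_pos_eq; lra).
assert (Ex0 : Cmod (RtoC x - 0) = x) by (replace (x - 0)%C with (RtoC x) by ring; easy).
specialize (H1 (RtoC x)). specialize (H2 (RtoC x)). rewrite Ex0 in H1, H2.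
rewrite <- H in H2; [|intros E; apply RtoC_inj in E; lra|rewrite Ex; lra].
replace (f 0 - g 0)%C with (- (f (RtoC x) - f 0) + (f (RtoC x) - g 0))%C by ring.
eapply Rle_trans; [apply Cmod_triangle|]. rewrite Cmod_opp.
specialize (H1 ltac:(lra)). specialize (H2 ltac:(lra)). lra.
Qed.

Lemma log_small (L r : R) (z : C) : z <> RtoC 0 -> Cmod z < Rmin (exp L) r ->
  exists s, z = Cexp s /\ Re s < L /\ exp (Re s) < r.
Proof.
intros Hz Hzr. exists (clog z). rewrite <- Cmod_Cexp, Cexp_clog by easy.
repeat split.
- apply exp_lt_inv. rewrite <- Cmod_Cexp, Cexp_clog by easy.
  eapply Rlt_le_trans; [apply Hzr|apply Rmin_l].
- eapply Rlt_le_trans; [apply Hzr|apply Rmin_r].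
Qed.

(** Substituting [y = z^kap v] into the system, where [d/ds = z d/dz]. *)
Lemma factor_ode (mu : R) (h : C -> C) (L kap r : R) (y1 y2 v1 v2 : C -> C) (l1 l2 s : C) :
  solves mu h L y1 y2 ->
  (forall s, Re s < L -> exp (Re s) < r ->
     y1 s = (zpow kap s * v1 (Cexp s))%C /\ y2 s = (zpow kap s * v2 (Cexp s))%C) ->
  Re s < L -> exp (Re s) < r -> cder v1 (Cexp s) l1 -> cder v2 (Cexp s) l2 ->
  (Cexp s * l1 = (RtoC (mu / 2 - kap) + h (Cexp s)) * v1 (Cexp s) + h (Cexp s) * v2 (Cexp s))%C /\
  (Cexp s * l2 = - h (Cexp s) * v1 (Cexp s) - (RtoC (mu / 2 + kap) + h (Cexp s)) * v2 (Cexp s))%C.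
Proof.
intros Hsol Hv Hs Hsr H1 H2.
destruct (Hsol s Hs) as [S1 S2]. destruct (Hv s Hs Hsr) as [E1 E2].
assert (Hloc : locally s (fun w => Re w < L /\ exp (Re w) < r)).
{ assert (Hr : 0 < r) by (eapply Rlt_trans; [apply exp_pos|exact Hsr]).
  assert (Hl : Re s < ln r) by (apply exp_lt_inv; now rewrite exp_ln).
  apply locally_Cmod. exists (Rmin (L - Re s) (ln r - Re s)). split; [apply Rmin_pos; lra|].
  intros w Hw. split.
  - apply (locally_half_plane L s); [easy|]. eapply Rlt_le_trans; [apply Hw|apply Rmin_l].
  - rewrite <- (exp_ln r) by easy. apply exp_increasing.
    apply (locally_half_plane (ln r) s); [easy|]. eapply Rlt_le_trans; [apply Hw|apply Rmin_r]. }
assert (Hz := zpow_inv kap).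
assert (T : forall (y v : C -> C) (l d : C), locally s (fun w => y w = (zpow kap w * v (Cexp w))%C) ->
   cder v (Cexp s) l -> cder y s d -> (Cexp s * l = - RtoC kap * v (Cexp s) + zpow (- kap) s * d)%C).
{ intros y v l d Hy Hvd Hyd.
  transitivity (l * Cexp s)%C; [ring|].
  apply (cder_unique (fun w => v (Cexp w)) s).
  - apply (cder_comp v Cexp); [easy|apply cder_Cexp].
  - eapply cder_eq.
    + apply (cder_ext_loc (fun w => zpow (- kap) w * y w)%C).
      * revert Hy. apply filter_imp. intros w ->. rewrite Cmult_assoc, Hz. ring.
      * apply cder_mult; [apply cder_zpow|exact Hyd].
    + apply locally_singleton in Hy. cbv beta. rewrite Hy.
      transitivity (- RtoC kap * (zpow (- kap) s * zpow kap s) * v (Cexp s) + zpow (- kap) s * d)%C.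
      * rewrite RtoC_opp. ring.
      * rewrite Hz. ring. }
split.
- rewrite (T y1 v1 l1 _ (filter_imp _ _ (fun w Hw => proj1 (Hv w (proj1 Hw) (proj2 Hw))) Hloc) H1 S1).
  rewrite E1, E2.
  transitivity (- RtoC kap * v1 (Cexp s) + (zpow (- kap) s * zpow kap s) *
    ((RtoC (mu / 2) + h (Cexp s)) * v1 (Cexp s) + h (Cexp s) * v2 (Cexp s)))%C; [ring|].
  rewrite Hz, RtoC_minus. ring.
- rewrite (T y2 v2 l2 _ (filter_imp _ _ (fun w Hw => proj2 (Hv w (proj1 Hw) (proj2 Hw))) Hloc) H2 S2).
  rewrite E1, E2.
  transitivity (- RtoC kap * v2 (Cexp s) + (zpow (- kap) s * zpow kap s) *
    (- h (Cexp s) * v1 (Cexp s) - (RtoC (mu / 2) + h (Cexp s)) * v2 (Cexp s)))%C; [ring|].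
  rewrite Hz, RtoC_plus. ring.
Qed.

(** The limit of [factor_ode] at the puncture, where [z v'] tends to 0. *)
Lemma leading_eigenvector (mu : R) (h : C -> C) (L kap r : R) (y1 y2 v1 dv1 v2 dv2 : C -> C) :
  solves mu h L y1 y2 -> 0 < r -> hol1 r v1 dv1 -> hol1 r v2 dv2 -> continuous h (RtoC 0) ->
  (forall s, Re s < L -> exp (Re s) < r ->
     y1 s = (zpow kap s * v1 (Cexp s))%C /\ y2 s = (zpow kap s * v2 (Cexp s))%C) ->
  ((RtoC (mu / 2 - kap) + h (RtoC 0)) * v1 (RtoC 0) + h (RtoC 0) * v2 (RtoC 0) = 0)%C /\
  (h (RtoC 0) * v1 (RtoC 0) + (RtoC (mu / 2 + kap) + h (RtoC 0)) * v2 (RtoC 0) = 0)%C.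
Proof.
intros Hsol Hr V1 V2 Hh Hv.
assert (H0 : Cmod (RtoC 0) < r) by now rewrite Cmod_0.
assert (Hr' : 0 < Rmin (exp L) r) by (apply Rmin_pos; [apply exp_pos|easy]).
destruct (V1 _ H0) as [D1 C1]. destruct (V2 _ H0) as [D2 C2].
apply cder_continuous in D1. apply cder_continuous in D2.
assert (Hall : forall z, z <> RtoC 0 -> Cmod z < Rmin (exp L) r ->
  (z * dv1 z = (RtoC (mu / 2 - kap) + h z) * v1 z + h z * v2 z)%C /\
  (z * dv2 z = - h z * v1 z - (RtoC (mu / 2 + kap) + h z) * v2 z)%C).
{ intros z Hz Hzr. destruct (log_small L r z Hz Hzr) as (s & -> & Hs & Hsr).
  assert (Hsr' : Cmod (Cexp s) < r) by now rewrite Cmod_Cexp.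
  apply (factor_ode mu h L kap r y1 y2); try easy; [apply V1|apply V2]; easy. }
split.
- rewrite <- (eq_at_puncture (fun z => z * dv1 z)%C
   (fun z => (RtoC (mu / 2 - kap) + h z) * v1 z + h z * v2 z)%C _ Hr').
  + ring.
  + cont. easy.
  + cont; easy.
  + intros z Hz Hzr. now apply Hall.
- assert (E := eq_at_puncture (fun z => z * dv2 z)%C
   (fun z => - h z * v1 z - (RtoC (mu / 2 + kap) + h z) * v2 z)%C _ Hr').
  cbv beta in E.
  transitivity (- (- h (RtoC 0) * v1 (RtoC 0) - (RtoC (mu / 2 + kap) + h (RtoC 0)) * v2 (RtoC 0)))%C; [ring|].
  rewrite <- E.
  + ring.
  + cont. easy.
  + cont; easy.
  + intros z Hz Hzr. now apply Hall.
Qed.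

Lemma solves_of_row_ode (mu L : R) (h P Q : C -> C) :
  (forall s, Re s < L -> row_ode mu h P Q s) ->
  solves mu h L (fun s => zpow (mu / 2) s * P s)%C (fun s => zpow (- (mu / 2)) s * Q s)%C.
Proof.
intros H s Hs. destruct (H s Hs) as [H1 H2].
assert (Z1 : zpow (- mu) s = (zpow (- (mu / 2)) s * zpow (- (mu / 2)) s)%C)
  by (rewrite <- zpow_plus; f_equal; field).
assert (Z2 : zpow mu s = (zpow (mu / 2) s * zpow (mu / 2) s)%C)
  by (rewrite <- zpow_plus; f_equal; field).
assert (Z3 := zpow_inv (mu / 2) s).
set (a := zpow (mu / 2) s) in *. set (b := zpow (- (mu / 2)) s) in *.
split.
- eapply cder_eq; [apply cder_mult; [apply cder_zpow|exact H1]|]. fold a. cbv beta.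
  rewrite Z1. transitivity ((RtoC (mu / 2) + h (Cexp s)) * (a * P s) + h (Cexp s) * ((b * a) * (b * Q s)))%C; [ring|].
  rewrite Z3. ring.
- eapply cder_eq; [apply cder_mult; [apply cder_zpow|exact H2]|]. fold b. cbv beta.
  rewrite Z2, RtoC_opp. transitivity (- h (Cexp s) * ((b * a) * (a * P s)) - (RtoC (mu / 2) + h (Cexp s)) * (b * Q s))%C; [ring|].
  rewrite Z3. ring.
Qed.

Lemma row_ode_comb (mu : R) (h P Q P' Q' : C -> C) (c1 c2 s : C) :
  row_ode mu h P Q s -> row_ode mu h P' Q' s ->
  row_ode mu h (fun s => c1 * P s + c2 * P' s)%C (fun s => c1 * Q s + c2 * Q' s)%C s.
Proof.
intros [H1 H2] [H3 H4]. split.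
- eapply cder_eq; [apply cder_plus; apply cder_scal; eassumption|]. ring.
- eapply cder_eq; [apply cder_plus; apply cder_scal; eassumption|]. ring.
Qed.

Lemma good_half_plane (rho : R) (h : C -> C) : 0 < rho ->
  holomorphic_near_0 h -> h (RtoC 0) <> RtoC 0 ->
  continuous h (RtoC 0) /\ exists L Hb, L <= ln rho /\ L <= 0 /\
   forall s, Re s < L -> h (Cexp s) <> RtoC 0 /\ Cmod (h (Cexp s)) <= Hb /\ continuous h (Cexp s).
Proof.
intros Hrho Hh H0. apply locally_Cmod in Hh. destruct Hh as (d & Hd & Hh).
assert (Hc : forall z, Cmod z < d -> continuous h z).
{ intros z Hz. eapply cder_continuous. apply cder_C_derive, Hh.
  replace (z - 0)%C with z by ring. easy. }
assert (Hc0 : continuous h (RtoC 0)) by (apply Hc; rewrite Cmod_0; lra).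
split; [easy|].
assert (Hm : 0 < Cmod (h (RtoC 0))) by now apply Cmod_gt_0.
destruct (proj1 (continuous_C_eps _ _) Hc0 _ Hm) as (d' & Hd' & Hn).
exists (Rmin (Rmin (ln rho) 0) (Rmin (ln d) (ln d'))), (2 * Cmod (h (RtoC 0))).
split; [eapply Rle_trans; [apply Rmin_l|apply Rmin_l]|].
split; [eapply Rle_trans; [apply Rmin_l|apply Rmin_r]|].
intros s Hs.
assert (Hs2 : Re s < ln d /\ Re s < ln d') by (revert Hs; unfold Rmin; repeat destruct Rle_dec; lra).
assert (E1 : Cmod (Cexp s) < d) by (rewrite Cmod_Cexp, <- (exp_ln d) by easy; now apply exp_increasing).
assert (E2 : Cmod (Cexp s) < d') by (rewrite Cmod_Cexp, <- (exp_ln d') by easy; now apply exp_increasing).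
specialize (Hn (Cexp s)). replace (Cexp s - 0)%C with (Cexp s) in Hn by ring. specialize (Hn E2).
split; [|split].
- intros E. rewrite E in Hn. replace (0 - h 0)%C with (- h 0)%C in Hn by ring. rewrite Cmod_opp in Hn. lra.
- replace (h (Cexp s)) with ((h (Cexp s) - h 0) + h 0)%C by ring.
  eapply Rle_trans; [apply Cmod_triangle|]. lra.
- now apply Hc.
Qed.

Lemma RtoC_neq0 (x : R) : x <> 0 -> RtoC x <> RtoC 0.
Proof. intros H E. now apply RtoC_inj in E. Qed.

Lemma Cmult_eq0 (a b : C) : (a * b)%C = RtoC 0 -> a = RtoC 0 \/ b = RtoC 0.
Proof.
intros H. destruct (Ceq_dec a 0) as [E|E]; [now left|]. right.
destruct (Ceq_dec b 0) as [E'|E']; [easy|]. exfalso. now apply (Cmult_neq_0 _ _ E E').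
Qed.

Lemma hol1_scal (r : R) (c : C) (f df : C -> C) :
  hol1 r f df -> hol1 r (fun z => c * f z)%C (fun z => c * df z)%C.
Proof.
intros H z Hz. destruct (H z Hz) as [H1 H2]. split; [now apply cder_scal|]. cont. easy.
Qed.

(** A continuous function with a factor [z^d], [d > 0], is small at the
    puncture. *)
Lemma zpow_vanish (d r L : R) (f : C -> C) (l : C) : 0 < r -> 0 < d -> continuous f (RtoC 0) ->
  (forall s, Re s < L -> exp (Re s) < r -> (zpow d s * f (Cexp s))%C = l) -> l = RtoC 0.
Proof.
intros Hr Hd Hf H. apply Cmod_eq_0. apply Rle_antisym; [|apply Cmod_ge_0].
apply le_epsilon. intros eps Heps. rewrite Rplus_0_l.
destruct (proj1 (continuous_C_eps _ _) Hf 1 Rlt_0_1) as (d1 & Hd1 & H1).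
set (K := 1 + Cmod (f (RtoC 0))). assert (HK : 0 < K) by (unfold K; generalize (Cmod_ge_0 (f 0)); lra).
set (x := Rmin (Rmin L (ln r)) (Rmin (ln d1) (ln (eps / K) / d)) - 1).
assert (Hx : x < L /\ x < ln r /\ x < ln d1 /\ x < ln (eps / K) / d).
{ unfold x, Rmin. repeat destruct Rle_dec; lra. }
destruct Hx as (X1 & X2 & X3 & X4).
assert (Hek : 0 < eps / K) by now apply Rdiv_lt_0_compat.
rewrite <- (H (RtoC x)).
- rewrite Cmod_mult, Cmod_zpow. change (Re (RtoC x)) with x.
  assert (E1 : Cmod (Cexp (RtoC x)) < d1).
  { rewrite Cmod_Cexp. change (Re (RtoC x)) with x. rewrite <- (exp_ln d1) by easy. now apply exp_increasing. }
  specialize (H1 (Cexp (RtoC x))).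
  replace (Cexp (RtoC x) - 0)%C with (Cexp (RtoC x)) in H1 by ring. specialize (H1 E1).
  assert (E2 : Cmod (f (Cexp (RtoC x))) <= K).
  { replace (f (Cexp (RtoC x))) with ((f (Cexp (RtoC x)) - f 0) + f 0)%C by ring.
    eapply Rle_trans; [apply Cmod_triangle|]. unfold K. lra. }
  assert (E3 : exp (d * x) < eps / K).
  { rewrite <- (exp_ln (eps / K)) by easy. apply exp_increasing.
    apply (Rmult_lt_compat_l d) in X4; [|easy].
    replace (d * (ln (eps / K) / d)) with (ln (eps / K)) in X4 by (field; lra). easy. }
  apply Rle_trans with (eps / K * K); [|right; field; lra].
  apply Rmult_le_compat; [left; apply exp_pos|apply Cmod_ge_0|lra|easy].
- easy.
- change (Re (RtoC x)) with x. rewrite <- (exp_ln r) by easy. now apply exp_increasing.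
Qed.

Section Rows.

Variables (mu L Hb kap0 : R) (h : C -> C) (F : C -> mat2).
Hypothesis Hmu : 0 < mu.
Hypothesis HL0 : L <= 0.
Hypothesis Hh0 : h (RtoC 0) <> RtoC 0.
Hypothesis Hch : continuous h (RtoC 0).
Hypothesis Hbound : forall s, Re s < L -> Cmod (h (Cexp s)) <= Hb.
Hypothesis Hcont : forall s, Re s < L -> continuous h (Cexp s).
Hypothesis ODE : forall s, Re s < L ->
  mat2_det (F s) = RtoC 1 /\
  row_ode mu h (fun s => mA (F s)) (fun s => mB (F s)) s /\
  row_ode mu h (fun s => mC (F s)) (fun s => mD (F s)) s.
Hypothesis Hmono : forall s, Re s < L ->
  (zpow (mu / 2) (s + tau) * mA (F (s + tau)%C))%C = (Cexp (RtoC kap0 * tau) * (zpow (mu / 2) s * mA (F s)))%C /\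
  (zpow (- (mu / 2)) (s + tau) * mB (F (s + tau)%C))%C = (Cexp (RtoC kap0 * tau) * (zpow (- (mu / 2)) s * mB (F s)))%C /\
  (zpow (mu / 2) (s + tau) * mC (F (s + tau)%C))%C = (Cexp (RtoC kap0 * tau) * (zpow (mu / 2) s * mC (F s)))%C /\
  (zpow (- (mu / 2)) (s + tau) * mD (F (s + tau)%C))%C = (Cexp (RtoC kap0 * tau) * (zpow (- (mu / 2)) s * mD (F s)))%C.

Definition row1 (c1 c2 s : C) : C := (zpow (mu / 2) s * (c1 * mA (F s) + c2 * mC (F s)))%C.
Definition row2 (c1 c2 s : C) : C := (zpow (- (mu / 2)) s * (c1 * mB (F s) + c2 * mD (F s)))%C.
Let h0 : C := h (RtoC 0).

Lemma row_solves (c1 c2 : C) : solves mu h L (row1 c1 c2) (row2 c1 c2).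
Proof.
apply solves_of_row_ode. intros s Hs. destruct (ODE s Hs) as (_ & R1 & R2). now apply row_ode_comb.
Qed.

(** The combination [(c1, c2)] of the rows behaves like [z^kap] at the
    puncture; the last two clauses say that the leading coefficient is an
    eigenvector of the residue matrix for the eigenvalue [kap]. *)
Definition row_expansion (c1 c2 : C) (kap r : R) (v1 dv1 v2 dv2 : C -> C) : Prop :=
  0 < r /\ hol1 r v1 dv1 /\ hol1 r v2 dv2 /\ v1 (RtoC 0) <> RtoC 0 /\
  (forall s, Re s < L -> exp (Re s) < r ->
    row1 c1 c2 s = (zpow kap s * v1 (Cexp s))%C /\ row2 c1 c2 s = (zpow kap s * v2 (Cexp s))%C) /\
  ((RtoC (mu / 2 - kap) + h0) * v1 (RtoC 0) + h0 * v2 (RtoC 0) = 0)%C /\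
  (RtoC (kap ^ 2) = RtoC (mu ^ 2 / 4) + RtoC mu * h0)%C.

(** The residue matrix is trace free and its square is [mu^2/4 + mu h(0)]
    times the identity, which determines [kap^2]. *)
Lemma row_exponent (c1 c2 : C) : (c1 <> RtoC 0 \/ c2 <> RtoC 0) ->
  exists (n : Z) (r : R) (v1 dv1 v2 dv2 : C -> C), row_expansion c1 c2 (kap0 + IZR n) r v1 dv1 v2 dv2.
Proof.
intros Hc. assert (Hh0n : h0 <> RtoC 0) by exact Hh0.
destruct (frobenius mu h L Hb (row1 c1 c2) (row2 c1 c2) kap0) as
  (n & r & v1 & dv1 & v2 & dv2 & Hr & V1 & V2 & Hnz & E); try easy; try apply row_solves.
- intros s Hs. destruct (Hmono s Hs) as (M1 & M2 & M3 & M4). unfold row1.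
  rewrite !Cmult_plus_distr_l.
  transitivity (c1 * (zpow (mu / 2) (s + tau) * mA (F (s + tau)%C)) +
    c2 * (zpow (mu / 2) (s + tau) * mC (F (s + tau)%C)))%C; [ring|]. rewrite M1, M3. ring.
- intros s Hs. destruct (Hmono s Hs) as (M1 & M2 & M3 & M4). unfold row2.
  rewrite !Cmult_plus_distr_l.
  transitivity (c1 * (zpow (- (mu / 2)) (s + tau) * mB (F (s + tau)%C)) +
    c2 * (zpow (- (mu / 2)) (s + tau) * mD (F (s + tau)%C)))%C; [ring|]. rewrite M2, M4. ring.
- intros s Hs. unfold nrm2.
  destruct (Req_dec (Cmod (row1 c1 c2 s)) 0) as [N1|N1].
  + destruct (Req_dec (Cmod (row2 c1 c2 s)) 0) as [N2|N2].
    * exfalso. apply Cmod_eq_0 in N1. apply Cmod_eq_0 in N2.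
      apply Cmult_eq0 in N1. apply Cmult_eq0 in N2.
      destruct N1 as [N1|N1]; [now apply zpow_neq0 in N1|].
      destruct N2 as [N2|N2]; [now apply zpow_neq0 in N2|].
      destruct (ODE s Hs) as (Hdet & _). unfold mat2_det in Hdet.
      assert (Z1 : c1 = RtoC 0).
      { transitivity (c1 * (mA (F s) * mD (F s) - mB (F s) * mC (F s)))%C; [rewrite Hdet; ring|].
        transitivity ((c1 * mA (F s) + c2 * mC (F s)) * mD (F s) -
          (c1 * mB (F s) + c2 * mD (F s)) * mC (F s))%C; [ring|]. rewrite N1, N2. ring. }
      assert (Z2 : c2 = RtoC 0).
      { transitivity (c2 * (mA (F s) * mD (F s) - mB (F s) * mC (F s)))%C; [rewrite Hdet; ring|].
        transitivity ((c1 * mB (F s) + c2 * mD (F s)) * mA (F s) -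
          (c1 * mA (F s) + c2 * mC (F s)) * mB (F s))%C; [ring|]. rewrite N1, N2. ring. }
      destruct Hc as [Hc|Hc]; now apply Hc.
    * assert (P1 := Cmod_ge_0 (row1 c1 c2 s)). assert (P2 := Cmod_ge_0 (row2 c1 c2 s)). nra.
  + assert (P1 := Cmod_ge_0 (row1 c1 c2 s)). assert (P2 := Cmod_ge_0 (row2 c1 c2 s)). nra.
- set (kap := kap0 + IZR n) in *.
  destruct (leading_eigenvector mu h L kap r _ _ v1 dv1 v2 dv2 (row_solves c1 c2) Hr V1 V2 Hch E) as [E1 E2].
  fold h0 in E1, E2.
  assert (Hv1 : v1 (RtoC 0) <> RtoC 0).
  { intros Z. rewrite Z in E1. destruct Hnz as [Hnz|Hnz]; [easy|].
    apply (Cmult_neq_0 _ _ Hh0n Hnz). transitivity ((RtoC (mu / 2 - kap) + h0) * 0 + h0 * v2 (RtoC 0))%C; [ring|exact E1]. }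
  exists n, r, v1, dv1, v2, dv2. unfold row_expansion. repeat (split; [assumption|]). fold kap.
  apply Ceq_minus.
  assert (Q : (v1 (RtoC 0) * (RtoC (mu ^ 2 / 4) + RtoC mu * h0 - RtoC (kap ^ 2)))%C = RtoC 0).
  { transitivity ((RtoC (mu / 2 + kap) + h0) * ((RtoC (mu / 2 - kap) + h0) * v1 0 + h0 * v2 0)
      - h0 * (h0 * v1 0 + (RtoC (mu / 2 + kap) + h0) * v2 0))%C.
    - replace (mu ^ 2 / 4) with (mu / 2 * (mu / 2)) by field. replace (kap ^ 2) with (kap * kap) by ring.
      replace (RtoC mu) with (RtoC (mu / 2) + RtoC (mu / 2))%C
        by (rewrite <- RtoC_plus; f_equal; field).
      rewrite RtoC_plus, RtoC_minus, !RtoC_mult. ring.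
    - rewrite E1, E2. ring. }
  apply Cmult_eq0 in Q. destruct Q as [Q|Q]; [easy|].
  transitivity (- (RtoC (mu ^ 2 / 4) + RtoC mu * h0 - RtoC (kap ^ 2)))%C; [ring|]. rewrite Q. ring.
Qed.

Lemma exponent_opposite (n n' : Z) :
  (RtoC ((kap0 + IZR n) ^ 2) = RtoC (mu ^ 2 / 4) + RtoC mu * h0)%C ->
  (RtoC ((kap0 + IZR n') ^ 2) = RtoC (mu ^ 2 / 4) + RtoC mu * h0)%C ->
  kap0 + IZR n = kap0 + IZR n' \/ kap0 + IZR n = - (kap0 + IZR n').
Proof.
intros E E'. rewrite <- E' in E. apply RtoC_inj in E.
set (a := kap0 + IZR n) in *. set (b := kap0 + IZR n') in *.
assert (Q : (a - b) * (a + b) = 0) by (simpl in E; lra).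
apply Rmult_integral in Q. destruct Q; [left|right]; lra.
Qed.

(** If both rows have the same nonpositive exponent, the combination that
    cancels their leading coefficients has a larger one. *)
Lemma positive_exponent : exists (c1 c2 : C) (n : Z) (r : R) (v1 dv1 v2 dv2 : C -> C),
  (c1 <> RtoC 0 \/ c2 <> RtoC 0) /\ 0 < kap0 + IZR n /\
  row_expansion c1 c2 (kap0 + IZR n) r v1 dv1 v2 dv2.
Proof.
assert (N10 : RtoC 1 <> RtoC 0) by apply C1_nz.
destruct (row_exponent (RtoC 1) (RtoC 0)) as (n & r & v1 & dv1 & v2 & dv2 & Hr & V1 & V2 & Hv & E & E1 & E2); [now left|].
destruct (Rlt_dec 0 (kap0 + IZR n)) as [P|P].
{ exists (RtoC 1), (RtoC 0), n, r, v1, dv1, v2, dv2. split; [now left|]. split; [exact P|]. unfold row_expansion. repeat (split; [assumption|]). assumption. }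
destruct (row_exponent (RtoC 0) (RtoC 1)) as (n' & r' & v1' & dv1' & v2' & dv2' & Hr' & V1' & V2' & Hv' & E' & E1' & E2'); [now right|].
destruct (Rlt_dec 0 (kap0 + IZR n')) as [P'|P'].
{ exists (RtoC 0), (RtoC 1), n', r', v1', dv1', v2', dv2'. split; [now right|]. split; [exact P'|]. unfold row_expansion. repeat (split; [assumption|]). assumption. }
assert (Enn : kap0 + IZR n' = kap0 + IZR n) by (destruct (exponent_opposite n n' E2 E2'); lra).
destruct (row_exponent (v1' (RtoC 0)) (- v1 (RtoC 0))%C) as (n2 & r2 & w1 & dw1 & w2 & dw2 & Hr2 & W1 & W2 & Hw & E'' & E1'' & E2''); [now left|].
exists (v1' (RtoC 0)), (- v1 (RtoC 0))%C, n2, r2, w1, dw1, w2, dw2.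
assert (Hlt : ~ (kap0 + IZR n2 <= kap0 + IZR n)).
{ intros Hle. apply Hw.
  set (rr := Rmin r2 (Rmin r r')). assert (Hrr : 0 < rr) by (repeat apply Rmin_pos; easy).
  assert (Hrr3 : rr <= r2 /\ rr <= r /\ rr <= r') by (unfold rr, Rmin; repeat destruct Rle_dec; lra).
  set (gam := kap0 + IZR n - (kap0 + IZR n2)).
  assert (Hfun : forall s, Re s < L -> exp (Re s) < rr ->
     w1 (Cexp s) = (zpow gam s * (v1' 0 * v1 (Cexp s) - v1 0 * v1' (Cexp s)))%C).
  { intros s Hs Hsr. destruct (E'' s Hs ltac:(lra)) as [X1 _].
    destruct (E s Hs ltac:(lra)) as [X2 _]. destruct (E' s Hs ltac:(lra)) as [X3 _].
    rewrite Enn in X3.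
    transitivity (zpow (- (kap0 + IZR n2)) s * row1 (v1' 0) (- v1 0)%C s)%C.
    - rewrite X1, Cmult_assoc, zpow_inv. ring.
    - replace (row1 (v1' 0) (- v1 0)%C s) with (v1' 0 * row1 1 0 s - v1 0 * row1 0 1 s)%C
        by (unfold row1; ring).
      rewrite X2, X3.
      replace (zpow gam s) with (zpow (- (kap0 + IZR n2)) s * zpow (kap0 + IZR n) s)%C
        by (rewrite <- zpow_plus; f_equal; unfold gam; ring). ring. }
  assert (H0r : Cmod (RtoC 0) < r) by (rewrite Cmod_0; lra).
  assert (H0r' : Cmod (RtoC 0) < r') by (rewrite Cmod_0; lra).
  assert (H0r2 : Cmod (RtoC 0) < r2) by (rewrite Cmod_0; lra).
  assert (K1 := hol1_cont _ _ _ _ V1 H0r). assert (K2 := hol1_cont _ _ _ _ V1' H0r').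
  assert (K3 := hol1_cont _ _ _ _ W1 H0r2).
  (* the right-hand factor vanishes at 0, and z^gam is bounded there *)
  pose (u := fun z => (v1' 0 * v1 z - v1 0 * v1' z)%C).
  assert (Ku : continuous u (RtoC 0)) by (unfold u; cont; easy).
  assert (Ku0 : u (RtoC 0) = RtoC 0) by (unfold u; ring).
  apply Cmod_eq_0. apply Rle_antisym; [|apply Cmod_ge_0].
  apply le_epsilon. intros eps Heps. rewrite Rplus_0_l.
  destruct (proj1 (continuous_C_eps _ _) Ku (eps / 2)) as (d1 & Hd1 & J1); [lra|].
  destruct (proj1 (continuous_C_eps _ _) K3 (eps / 2)) as (d2 & Hd2 & J2); [lra|].
  set (x := Rmin L (Rmin (ln rr) (Rmin (ln d1) (ln d2))) - 1).
  assert (Hx : x < L /\ x < ln rr /\ x < ln d1 /\ x < ln d2).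
  { unfold x, Rmin. repeat destruct Rle_dec; lra. }
  destruct Hx as (X1 & X2 & X3 & X4).
  assert (Hex : forall d, 0 < d -> x < ln d -> exp x < d).
  { intros d Hd Hxd. rewrite <- (exp_ln d) by easy. now apply exp_increasing. }
  specialize (J1 (Cexp x)). specialize (J2 (Cexp x)).
  replace (Cexp x - 0)%C with (Cexp x) in J1, J2 by ring.
  rewrite Cmod_Cexp in J1, J2. change (Re (RtoC x)) with x in J1, J2.
  specialize (J1 (Hex d1 Hd1 X3)). specialize (J2 (Hex d2 Hd2 X4)).
  rewrite Ku0 in J1. replace (u (Cexp x) - 0)%C with (u (Cexp x)) in J1 by ring.
  assert (Ew := Hfun (RtoC x) X1 (Hex rr Hrr X2)). fold (u (Cexp x)) in Ew.
  replace (w1 0) with (- (w1 (Cexp x) - w1 0) + w1 (Cexp x))%C by ring.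
  eapply Rle_trans; [apply Cmod_triangle|]. rewrite Cmod_opp.
  assert (Hwx : Cmod (w1 (Cexp x)) <= Cmod (u (Cexp x))).
  { rewrite Ew, Cmod_mult, Cmod_zpow. change (Re (RtoC x)) with x.
    assert (exp (gam * x) <= 1).
    { rewrite <- exp_0. assert (Hgx : gam * x <= 0) by (unfold gam; nra).
      destruct (Rle_lt_or_eq_dec _ _ Hgx) as [Hlt|Heq]; [left; now apply exp_increasing|rewrite Heq; apply Rle_refl]. }
    assert (0 <= Cmod (u (Cexp x))) by apply Cmod_ge_0. nra. }
  lra. }
split; [now left|]. split; [destruct (exponent_opposite n n2 E2 E2''); lra|]. unfold row_expansion. repeat (split; [assumption|]). assumption.
Qed.

End Rows.

(** A row with positive exponent exists, and its exponent is some [m / 2]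
    because the monodromy is plus or minus 1. The determinant of the frame is
    1 and behaves like the power of [z] whose exponent is the sum of those of
    the rows, so any complementary row has the opposite exponent. The
    eigenvector equations and the value of the determinant at the puncture
    then give all constants. *)
Lemma normal_form (rho mu : R) (X : C -> E3) (F : C -> mat2) (h : C -> C) :
  0 < rho -> 0 < mu -> bryant_representation rho X F ->
  weierstrass_data rho F (zpow mu) (power_form (-1 - mu) h) ->
  holomorphic_near_0 h -> h (RtoC 0) <> RtoC 0 ->
  exists (m : nat) (l11 l12 l21 l22 : C) (r : R) (f1 df1 f2 df2 g1 dg1 g2 dg2 : C -> C),
    (1 <= m)%nat /\ INR m <> mu /\ (l11 * l22 - l12 * l21 = 1)%C /\ 0 < r <= rho /\
    hol1 r f1 df1 /\ hol1 r f2 df2 /\ hol1 r g1 dg1 /\ hol1 r g2 dg2 /\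
    f1 (RtoC 0) = RtoC 1 /\ f2 (RtoC 0) = RtoC 1 /\ g1 (RtoC 0) = RtoC 1 /\ g2 (RtoC 0) = RtoC 1 /\
    forall s, Re s < ln r ->
      (l11 * mA (F s) + l12 * mC (F s) = zpow ((INR m - mu) / 2) s * f2 (Cexp s))%C /\
      (l11 * mB (F s) + l12 * mD (F s) =
         RtoC ((mu - INR m) / (mu + INR m)) * zpow ((mu + INR m) / 2) s * g2 (Cexp s))%C /\
      (l21 * mA (F s) + l22 * mC (F s) =
         RtoC ((mu ^ 2 - INR m ^ 2) / (4 * INR m * mu)) * zpow ((- INR m - mu) / 2) s * f1 (Cexp s))%C /\
      (l21 * mB (F s) + l22 * mD (F s) =
         RtoC ((mu + INR m) ^ 2 / (4 * INR m * mu)) * zpow ((mu - INR m) / 2) s * g1 (Cexp s))%C.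
Proof.
intros Hrho Hmu HF HW Hh Hh0.
destruct (good_half_plane rho h Hrho Hh Hh0) as (Hch & L & Hb & HL & HL0 & HLs).
destruct (monodromy rho mu L X F h Hrho Hmu HF HW HL HL0 (fun s Hs => proj1 (HLs s Hs)))
  as (sg & Hsg & Hmono).
(* a sign is the monodromy of [z^kap0] with [kap0] half an integer *)
assert (Hkap0 : exists e : nat, sg = Cexp (RtoC (INR e / 2) * tau)).
{ destruct Hsg as [-> | ->].
  - exists 0%nat. simpl. replace (0 / 2) with 0 by field. rewrite Cmult_0_l. symmetry. apply Cexp_0.
  - exists 1%nat. simpl. replace (RtoC (1 / 2) * tau)%C with (RtoC PI * Ci)%C.
    + rewrite Cexp_Ci. unfold circ. rewrite cos_PI, sin_PI. unfold RtoC, Copp; simpl. f_equal. ring.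
    + unfold tau. rewrite Cmult_assoc, <- RtoC_mult. do 2 f_equal. field. }
destruct Hkap0 as [e0 ->]. set (kap0 := INR e0 / 2) in *.
assert (ODE : forall s, Re s < L -> mat2_det (F s) = RtoC 1 /\
  row_ode mu h (fun s => mA (F s)) (fun s => mB (F s)) s /\
  row_ode mu h (fun s => mC (F s)) (fun s => mD (F s)) s).
{ intros s Hs. apply (bryant_ode rho mu X F h Hrho HF HW). lra. }
assert (Hfrob := row_exponent mu L Hb kap0 h F Hmu Hh0 Hch (fun s Hs => proj1 (proj2 (HLs s Hs)))
  (fun s Hs => proj2 (proj2 (HLs s Hs))) ODE Hmono).
assert (Hpos := positive_exponent mu L Hb kap0 h F Hmu HL0 Hh0 Hch (fun s Hs => proj1 (proj2 (HLs s Hs)))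
  (fun s Hs => proj2 (proj2 (HLs s Hs))) ODE Hmono).
assert (Hsq := exponent_opposite mu kap0 h).
set (R1 := row1 mu F). set (R2 := row2 mu F). unfold row_expansion in Hfrob, Hpos.
fold R1 R2 in Hfrob, Hpos. set (h0 := h (RtoC 0)) in *.
destruct Hpos as (c1 & c2 & n & r & v1 & dv1 & v2 & dv2 & Hc & Hkp & Hr & V1 & V2 & Hv & E & E1 & E2).
assert (Hm : exists m : nat, (1 <= m)%nat /\ kap0 + IZR n = INR m / 2).
{ assert (Ek : kap0 + IZR n = IZR (Z.of_nat e0 + 2 * n) / 2).
  { unfold kap0. rewrite plus_IZR, mult_IZR, <- INR_IZR_INZ. field. }
  assert (P : (0 < Z.of_nat e0 + 2 * n)%Z) by (apply lt_IZR; lra).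
  exists (Z.to_nat (Z.of_nat e0 + 2 * n)). split; [lia|].
  rewrite Ek, INR_IZR_INZ, Z2Nat.id by lia. reflexivity. }
destruct Hm as (m & Hm1 & Hkap). rewrite Hkap in E, E1, E2, Hkp.
assert (HmR : 1 <= INR m) by (change 1 with (INR 1); now apply le_INR).
assert (Hmuc : RtoC mu <> RtoC 0) by (apply RtoC_neq0; lra).
assert (Eh0 : h0 = RtoC ((INR m ^ 2 - mu ^ 2) / (4 * mu))).
{ transitivity ((RtoC mu * h0) / RtoC mu)%C; [field; easy|].
  replace (RtoC mu * h0)%C with (RtoC ((INR m / 2) ^ 2) - RtoC (mu ^ 2 / 4))%C by (rewrite E2; ring).
  rewrite <- RtoC_minus, <- RtoC_div by lra. f_equal. field. lra. }
assert (Hmmu : INR m <> mu).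
{ intros Em. apply Hh0. fold h0. rewrite Eh0, Em. f_equal. field. lra. }
assert (Hmp : mu + INR m <> 0) by lra.
set (L11 := (c1 / v1 (RtoC 0))%C). set (L12 := (c2 / v1 (RtoC 0))%C).
assert (Hcompl : exists l21 l22, (L11 * l22 - L12 * l21 = 1)%C).
{ destruct (Ceq_dec c1 0) as [Z|Z].
  - destruct Hc as [Hc|Hc]; [easy|]. exists (- (v1 (RtoC 0) / c2))%C, (RtoC 0).
    unfold L11, L12. field. split; assumption.
  - exists (RtoC 0), (v1 (RtoC 0) / c1)%C. unfold L11, L12. field. split; assumption. }
destruct Hcompl as (l21 & l22 & Hdet).
assert (Hnz2 : l21 <> RtoC 0 \/ l22 <> RtoC 0).
{ destruct (Ceq_dec l21 0) as [Z|Z]; [|now left]. right. intros Z'. rewrite Z, Z' in Hdet.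
  apply C1_nz. rewrite <- Hdet. ring. }
destruct (Hfrob l21 l22 Hnz2) as (n2 & r2 & w1 & dw1 & w2 & dw2 & Hr2 & W1 & W2 & Hw & E' & E1' & E2').
assert (Hzmu : forall s, (zpow (- (mu / 2)) s * zpow (mu / 2) s)%C = RtoC 1) by (intros; apply zpow_inv).
assert (HF1 : forall s, R1 L11 L12 s = (R1 c1 c2 s / v1 (RtoC 0))%C).
{ intros s. unfold R1, row1, L11, L12. field. easy. }
assert (HF2 : forall s, R2 L11 L12 s = (R2 c1 c2 s / v1 (RtoC 0))%C).
{ intros s. unfold R2, row2, L11, L12. field. easy. }
assert (Hwr : forall s, Re s < L ->
  (R1 L11 L12 s * R2 l21 l22 s - R2 L11 L12 s * R1 l21 l22 s = 1)%C).
{ intros s Hs. destruct (ODE s Hs) as (D & _). unfold mat2_det in D.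
  transitivity ((zpow (- (mu / 2)) s * zpow (mu / 2) s) * (L11 * l22 - L12 * l21) *
    (mA (F s) * mD (F s) - mB (F s) * mC (F s)))%C; [unfold R1, R2, row1, row2; ring|].
  rewrite Hzmu, Hdet, D. ring. }
set (rr := Rmin r r2). assert (Hrr : 0 < rr) by now apply Rmin_pos.
assert (Hrr2 : rr <= r /\ rr <= r2) by (split; [apply Rmin_l|apply Rmin_r]).
pose (wr := fun z => (/ v1 (RtoC 0) * (v1 z * w2 z - v2 z * w1 z))%C).
assert (Hwr2 : forall s, Re s < L -> exp (Re s) < rr ->
  (zpow (INR m / 2 + (kap0 + IZR n2)) s * wr (Cexp s))%C = RtoC 1).
{ intros s Hs Hsr. rewrite <- (Hwr s Hs), HF1, HF2.
  destruct (E s Hs ltac:(lra)) as [-> ->]. destruct (E' s Hs ltac:(lra)) as [-> ->].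
  rewrite zpow_plus. unfold wr. field. easy. }
assert (H0r : Cmod (RtoC 0) < r) by (rewrite Cmod_0; lra).
assert (H0r2 : Cmod (RtoC 0) < r2) by (rewrite Cmod_0; lra).
assert (K1 := hol1_cont _ _ _ _ V1 H0r). assert (K2 := hol1_cont _ _ _ _ V2 H0r).
assert (K3 := hol1_cont _ _ _ _ W1 H0r2). assert (K4 := hol1_cont _ _ _ _ W2 H0r2).
assert (Kwr : continuous wr (RtoC 0)) by (unfold wr; cont; easy).
(* a second row with exponent [m / 2] would make the determinant tend to 0 *)
assert (Ek2 : kap0 + IZR n2 = - (INR m / 2)).
{ rewrite <- Hkap. rewrite <- Hkap in E2. destruct (Hsq n2 n E2' E2) as [Eq|Eq]; [|easy].
  exfalso. apply C1_nz.
  apply (zpow_vanish (INR m / 2 + (kap0 + IZR n2)) rr L wr); try easy. rewrite Eq, Hkap. lra. }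
rewrite Ek2 in E', E1', Hwr2.
assert (Hwr0 : wr (RtoC 0) = RtoC 1).
{ apply (eq_at_puncture wr (fun _ => RtoC 1) (Rmin (exp L) rr)).
  - apply Rmin_pos; [apply exp_pos|easy].
  - easy.
  - apply continuous_const.
  - intros z Hz Hzr. destruct (log_small L rr z Hz Hzr) as (s & -> & Hs & Hsr).
    rewrite <- (Hwr2 s Hs Hsr). replace (INR m / 2 + - (INR m / 2)) with 0 by ring.
    rewrite zpow_0. ring. }
set (a := INR m) in *.
assert (Hd1 : a - mu <> 0) by lra. assert (Hd2 : mu - a <> 0) by lra.
assert (Hm4 : 4 * a * mu <> 0) by (apply Rgt_not_eq; apply Rmult_lt_0_compat; lra).
assert (Ev2 : v2 (RtoC 0) = (RtoC ((mu - a) / (mu + a)) * v1 (RtoC 0))%C).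
{ transitivity ((h0 * v2 (RtoC 0)) / h0)%C; [field; easy|].
  replace (h0 * v2 (RtoC 0))%C with (- ((RtoC (mu / 2 - a / 2) + h0) * v1 (RtoC 0)))%C.
  2: { apply Ceq_minus. transitivity (- ((RtoC (mu / 2 - a / 2) + h0) * v1 0 + h0 * v2 0))%C; [ring|].
       rewrite E1. ring. }
  replace ((mu - a) / (mu + a)) with (- (mu / 2 - a / 2 + (a ^ 2 - mu ^ 2) / (4 * mu)) / ((a ^ 2 - mu ^ 2) / (4 * mu))).
  2: { field. repeat split; try lra.
       replace (a ^ 2 - mu ^ 2) with ((a - mu) * (mu + a)) by ring. now apply Rmult_integral_contrapositive. }
  rewrite RtoC_div, RtoC_opp, RtoC_plus, <- Eh0.
  - field. easy.
  - intros Z. apply Hh0. fold h0. rewrite Eh0. now f_equal. }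
assert (Ew2 : w2 (RtoC 0) = (RtoC ((mu + a) / (mu - a)) * w1 (RtoC 0))%C).
{ transitivity ((h0 * w2 (RtoC 0)) / h0)%C; [field; easy|].
  replace (h0 * w2 (RtoC 0))%C with (- ((RtoC (mu / 2 - - (a / 2)) + h0) * w1 (RtoC 0)))%C.
  2: { apply Ceq_minus. transitivity (- ((RtoC (mu / 2 - - (a / 2)) + h0) * w1 0 + h0 * w2 0))%C; [ring|].
       rewrite E1'. ring. }
  replace ((mu + a) / (mu - a)) with (- (mu / 2 - - (a / 2) + (a ^ 2 - mu ^ 2) / (4 * mu)) / ((a ^ 2 - mu ^ 2) / (4 * mu))).
  2: { field. repeat split; try lra.
       replace (a ^ 2 - mu ^ 2) with ((a - mu) * (mu + a)) by ring. now apply Rmult_integral_contrapositive. }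
  rewrite RtoC_div, RtoC_opp, RtoC_plus, <- Eh0.
  - field. easy.
  - intros Z. apply Hh0. fold h0. rewrite Eh0. now f_equal. }
set (k1 := (mu ^ 2 - a ^ 2) / (4 * a * mu)). set (k2 := (mu + a) ^ 2 / (4 * a * mu)).
set (k3 := (mu - a) / (mu + a)) in *.
assert (Hk1 : k1 <> 0).
{ unfold k1. replace (mu ^ 2 - a ^ 2) with ((mu - a) * (mu + a)) by ring.
  apply Rmult_integral_contrapositive. split; [now apply Rmult_integral_contrapositive|now apply Rinv_neq_0_compat]. }
assert (Hk2 : k2 <> 0).
{ unfold k2. apply Rmult_integral_contrapositive. split; [now apply pow_nonzero|now apply Rinv_neq_0_compat]. }
assert (Hk3 : k3 <> 0).
{ unfold k3. apply Rmult_integral_contrapositive. split; [easy|now apply Rinv_neq_0_compat]. }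
assert (Ew1 : w1 (RtoC 0) = RtoC k1).
{ unfold wr in Hwr0. rewrite Ev2, Ew2 in Hwr0.
  assert (Q : (w1 (RtoC 0) * RtoC ((mu + a) / (mu - a) - k3))%C = RtoC 1).
  { rewrite <- Hwr0, RtoC_minus. field. easy. }
  replace ((mu + a) / (mu - a) - k3) with (/ k1) in Q.
  2: { unfold k1, k3. field. repeat split; try lra.
       replace (mu ^ 2 - a ^ 2) with ((mu - a) * (mu + a)) by ring. now apply Rmult_integral_contrapositive. }
  rewrite RtoC_inv in Q by easy.
  transitivity (w1 (RtoC 0) * / RtoC k1 * RtoC k1)%C; [field; now apply RtoC_neq0|]. rewrite Q. ring. }
assert (Ew2' : w2 (RtoC 0) = RtoC k2).
{ rewrite Ew2, Ew1, <- RtoC_mult. f_equal. unfold k1, k2. field. lra. }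
assert (Nk1 := RtoC_neq0 _ Hk1). assert (Nk2 := RtoC_neq0 _ Hk2). assert (Nk3 := RtoC_neq0 _ Hk3).
set (R0 := Rmin rr (Rmin (exp L) rho)).
assert (HR0 : 0 < R0) by (repeat apply Rmin_pos; try easy; apply exp_pos).
assert (HR3 : R0 <= rr /\ R0 <= exp L /\ R0 <= rho).
{ unfold R0, Rmin; repeat destruct Rle_dec; lra. }
exists m, L11, L12, l21, l22, R0,
  (fun z => / RtoC k1 * w1 z)%C, (fun z => / RtoC k1 * dw1 z)%C,
  (fun z => / v1 (RtoC 0) * v1 z)%C, (fun z => / v1 (RtoC 0) * dv1 z)%C,
  (fun z => / RtoC k2 * w2 z)%C, (fun z => / RtoC k2 * dw2 z)%C,
  (fun z => / (RtoC k3 * v1 (RtoC 0)) * v2 z)%C, (fun z => / (RtoC k3 * v1 (RtoC 0)) * dv2 z)%C.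
fold a. fold k1 k2 k3.
split; [easy|]. split; [easy|]. split; [easy|]. split; [lra|].
split; [apply hol1_scal, (hol1_le r2); [lra|easy]|].
split; [apply hol1_scal, (hol1_le r); [lra|easy]|].
split; [apply hol1_scal, (hol1_le r2); [lra|easy]|].
split; [apply hol1_scal, (hol1_le r); [lra|easy]|].
split; [rewrite Ew1; field; easy|]. split; [field; easy|].
split; [rewrite Ew2'; field; easy|]. split; [rewrite Ev2; field; split; assumption|].
intros s Hs.
assert (Hse : exp (Re s) < R0) by (rewrite <- (exp_ln R0) by easy; now apply exp_increasing).
assert (HsL : Re s < L) by (apply exp_lt_inv; lra).
assert (Hrow1 : forall c1 c2, (c1 * mA (F s) + c2 * mC (F s))%C = (zpow (- (mu / 2)) s * R1 c1 c2 s)%C).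
{ intros d1 d2. unfold R1, row1. rewrite Cmult_assoc, Hzmu. ring. }
assert (Hrow2 : forall c1 c2, (c1 * mB (F s) + c2 * mD (F s))%C = (zpow (mu / 2) s * R2 c1 c2 s)%C).
{ intros d1 d2. unfold R2, row2. rewrite Cmult_assoc, (Cmult_comm (zpow (mu / 2) s)), Hzmu. ring. }
rewrite !Hrow1, !Hrow2, HF1, HF2.
destruct (E s HsL ltac:(lra)) as [-> ->]. destruct (E' s HsL ltac:(lra)) as [-> ->].
replace ((a - mu) / 2) with (- (mu / 2) + a / 2) by field.
replace ((mu + a) / 2) with (mu / 2 + a / 2) by field.
replace ((- a - mu) / 2) with (- (mu / 2) + - (a / 2)) by field.
replace ((mu - a) / 2) with (mu / 2 + - (a / 2)) by field.
rewrite !zpow_plus.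
split; [field; easy|]. split; [field; split; assumption|]. split; field; easy.
Qed.

(** * Embeddedness forces the winding number to be one *)

(** The limit of the iterates of [T], written with the total limit operator so
    that it can be used as a function of parameters of [T]. *)
Definition Cfix (T : C -> C) : C :=
  let u := fun n => Nat.iter n T (RtoC 0) in
  (real (Lim_seq (fun n => Re (u n))), real (Lim_seq (fun n => Im (u n)))).

Lemma Rabs_cauchy_lim (x : nat -> R) (K : R) :
  (forall n k, Rabs (x (n + k)%nat - x n) <= K * (1 / 2) ^ n) ->
  forall n, Rabs (real (Lim_seq x) - x n) <= K * (1 / 2) ^ n.
Proof.
intros H.
assert (HK : 0 <= K).
{ specialize (H 0%nat 0%nat). simpl in H. generalize (Rabs_pos (x 0%nat - x 0%nat)). lra. }
assert (Hex : ex_finite_lim_seq x).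
{ apply ex_lim_seq_cauchy_corr. intros eps.
  assert (Hlim : is_lim_seq (fun n => K * (1 / 2) ^ n) 0).
  { replace (Finite 0) with (Rbar_mult K 0) by (simpl; f_equal; ring).
    apply is_lim_seq_scal_l. apply is_lim_seq_geom. rewrite Rabs_pos_eq; lra. }
  apply is_lim_seq_spec in Hlim. destruct (Hlim (mkposreal (eps / 2) (is_pos_div_2 eps))) as [N HN].
  simpl in HN. exists N. intros n p Hn Hp.
  assert (A : forall q, (N <= q)%nat -> Rabs (x q - x N) < eps / 2).
  { intros q Hq. replace q with (N + (q - N))%nat by lia.
    eapply Rle_lt_trans; [apply H|]. specialize (HN N (Nat.le_refl N)).
    rewrite Rminus_0_r in HN. eapply Rle_lt_trans; [apply Rle_abs|exact HN]. }
  replace (x n - x p) with ((x n - x N) - (x p - x N)) by ring.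
  eapply Rle_lt_trans; [apply Rabs_triang|]. rewrite Rabs_Ropp.
  generalize (A n Hn) (A p Hp). lra. }
intros n. apply Lim_seq_correct' in Hex.
assert (L1 : is_lim_seq (fun k => x (n + k)%nat - x n) (real (Lim_seq x) - x n)).
{ apply is_lim_seq_minus'; [|apply is_lim_seq_const].
  apply is_lim_seq_ext with (fun k => x (k + n)%nat); [intros k; f_equal; lia|].
  now apply is_lim_seq_incr_n. }
apply is_lim_seq_abs in L1.
assert (L2 := is_lim_seq_le _ _ _ _ (H n) L1 (is_lim_seq_const (K * (1 / 2) ^ n))).
exact L2.
Qed.

Lemma Cfix_correct (T : C -> C) (d : R) : 0 < d ->
  (forall u, Cmod u <= d -> Cmod (T u) <= d) ->
  (forall u v, Cmod u <= d -> Cmod v <= d -> Cmod (T u - T v) <= 1 / 2 * Cmod (u - v)) ->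
  Cmod (Cfix T) <= d /\ T (Cfix T) = Cfix T.
Proof.
intros Hd Hin Hc. set (u := fun n => Nat.iter n T (RtoC 0)).
assert (Hu : forall n, Cmod (u n) <= d).
{ induction n; simpl; [rewrite Cmod_0; lra|]. now apply Hin. }
assert (H1 : forall n, Cmod (u (S n) - u n) <= d * (1 / 2) ^ n).
{ induction n.
  - simpl. replace (T 0 - 0)%C with (T 0) by ring. rewrite Rmult_1_r. apply Hin. rewrite Cmod_0. lra.
  - change (u (S (S n)) - u (S n))%C with (T (u (S n)) - T (u n))%C.
    eapply Rle_trans; [apply Hc; apply Hu|].
    replace (d * (1 / 2) ^ S n) with (1 / 2 * (d * (1 / 2) ^ n)) by (simpl; field). lra. }
assert (H2 : forall n k, Cmod (u (n + k)%nat - u n) <= 2 * d * (1 / 2) ^ n).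
{ assert (A : forall k n, Cmod (u (n + k)%nat - u n) <= 2 * d * ((1 / 2) ^ n - (1 / 2) ^ (n + k))).
  { induction k; intros n.
    - rewrite Nat.add_0_r. replace (u n - u n)%C with (RtoC 0) by ring. rewrite Cmod_0. lra.
    - replace (n + S k)%nat with (S n + k)%nat by lia.
      replace (u (S n + k)%nat - u n)%C with ((u (S n + k)%nat - u (S n)) + (u (S n) - u n))%C by ring.
      eapply Rle_trans; [apply Cmod_triangle|]. generalize (IHk (S n)) (H1 n).
      replace ((1 / 2) ^ S n) with (1 / 2 * (1 / 2) ^ n) by easy. lra. }
  intros n k. eapply Rle_trans; [apply A|].
  assert (0 < (1 / 2) ^ (n + k)) by (apply pow_lt; lra). nra. }
assert (R1 := Rabs_cauchy_lim (fun n => Re (u n)) (2 * d)).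
assert (R2 := Rabs_cauchy_lim (fun n => Im (u n)) (2 * d)).
assert (HR : forall n, Rabs (Re (Cfix T) - Re (u n)) <= 2 * d * (1 / 2) ^ n).
{ apply R1. intros n k. eapply Rle_trans; [|apply (H2 n k)].
  replace (Re (u (n + k)%nat) - Re (u n)) with (Re (u (n + k)%nat - u n)) by (unfold Re; simpl; ring).
  apply re_le_Cmod. }
assert (HI : forall n, Rabs (Im (Cfix T) - Im (u n)) <= 2 * d * (1 / 2) ^ n).
{ apply R2. intros n k. eapply Rle_trans; [|apply (H2 n k)].
  replace (Im (u (n + k)%nat) - Im (u n)) with (Im (u (n + k)%nat - u n)) by (unfold Im; simpl; ring).
  apply im_le_Cmod. }
assert (HC : forall n, Cmod (Cfix T - u n) <= 4 * d * (1 / 2) ^ n).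
{ intros n. eapply Rle_trans; [apply Cmod_le_sum|]. generalize (HR n) (HI n).
  replace (Re (Cfix T - u n)) with (Re (Cfix T) - Re (u n)) by (unfold Re; simpl; ring).
  replace (Im (Cfix T - u n)) with (Im (Cfix T) - Im (u n)) by (unfold Im; simpl; ring). lra. }
assert (Hlim : forall K, is_lim_seq (fun n => K * (1 / 2) ^ n) 0).
{ intros K. replace (Finite 0) with (Rbar_mult K 0) by (simpl; f_equal; ring).
  apply is_lim_seq_scal_l. apply is_lim_seq_geom. rewrite Rabs_pos_eq; lra. }
assert (Hlt : forall x K, (forall n, x <= K * (1 / 2) ^ n) -> x <= 0).
{ intros x K H. exact (is_lim_seq_le _ _ _ _ H (is_lim_seq_const x) (Hlim K)). }
assert (Hd' : Cmod (Cfix T) <= d).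
{ apply Rminus_le. apply (Hlt _ (4 * d)). intros n.
  replace (Cfix T) with ((Cfix T - u n) + u n)%C by ring.
  generalize (Cmod_triangle (Cfix T - u n) (u n)) (HC n) (Hu n). lra. }
split; [easy|].
apply Ceq_minus, Cmod_eq_0. apply Rle_antisym; [|apply Cmod_ge_0].
apply (Hlt _ (6 * d)). intros n.
replace (T (Cfix T) - Cfix T)%C with ((T (Cfix T) - T (u n)) + - (Cfix T - u (S n)))%C
  by (change (u (S n)) with (T (u n)); ring).
eapply Rle_trans; [apply Cmod_triangle|]. rewrite Cmod_opp.
generalize (Hc _ _ Hd' (Hu n)) (HC n) (HC (S n)).
replace ((1 / 2) ^ S n) with (1 / 2 * (1 / 2) ^ n) by easy.
assert (He : 0 < (1 / 2) ^ n) by (apply pow_lt; lra). assert (0 < d * (1 / 2) ^ n) by nra. lra.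
Qed.

(** Functions on left half-planes that tend to [l] with Lipschitz constants
    tending to 0: a substitute for convergence in the [C^1] sense that is
    stable under the non-holomorphic operations at hand. *)
Definition smallLip (G : C -> C) (l : C) : Prop :=
  forall eps, 0 < eps -> exists K, forall s t, Re s < K -> Re t < K ->
    Cmod (G s - l) <= eps /\ Cmod (G s - G t) <= eps * Cmod (s - t).

(** On the vertical line [Re t = x0] the equation [exp (m u) = 1 + E (t + u)]
    has a small solution [u = U t], by a contraction. Along the closed curve
    [t + U t] the given function is [z^(-m)] at [t], so it takes the same
    value at the [m] points that differ by multiples of [tau / m]. The
    differences of [W] between neighbouring ones of these points add up to 0,
    so [W] takes the same value at some pair of neighbours. *)
Lemma common_value (m : nat) (E : C -> C) (W : C -> R) (L : R) :
  (2 <= m)%nat -> smallLip E (RtoC 0) ->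
  (forall s, Re s < L -> E (s + tau)%C = E s) ->
  (forall s, Re s < L -> W (s + tau)%C = W s) ->
  (forall s, Re s < L -> continuous W s) ->
  exists s1 s2, Re s1 < L /\ Re s2 < L /\ Cexp s1 <> Cexp s2 /\ W s1 = W s2 /\
    (zpow (- INR m) s1 * (1 + E s1))%C = (zpow (- INR m) s2 * (1 + E s2))%C.
Proof.
intros Hm HE HEper HWper HWc. assert (HPI := PI_RGT_0). assert (HPI3 := PI2_1).
assert (HmR : 2 <= INR m) by (change 2 with (INR 2); now apply le_INR).
set (a := INR m) in *. assert (Ha0 : RtoC a <> RtoC 0) by (apply RtoC_neq0; lra).
destruct (proj1 (continuous_C_eps _ _) (cder_continuous _ _ _ (cder_Cexp (RtoC 0))) (1/4)) as (eta & Heta & Hexp); [lra|].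
rewrite Cexp_0 in Hexp.
set (d := Rmin (eta / 2) 1 / a).
assert (Hda : a * d = Rmin (eta / 2) 1) by (unfold d; field; lra).
assert (Hd0 : 0 < Rmin (eta / 2) 1) by (apply Rmin_pos; lra).
assert (Hd : 0 < d) by (apply Rdiv_lt_0_compat; lra).
assert (Hd1 : a * d < eta) by (rewrite Hda; eapply Rle_lt_trans; [apply Rmin_l|lra]).
assert (Hd2 : a * d <= 1) by (rewrite Hda; apply Rmin_r).
set (eps := Rmin (1/4) (d / 2)). assert (Heps : 0 < eps) by (apply Rmin_pos; lra).
assert (He1 : eps <= 1/4) by apply Rmin_l. assert (He2 : eps <= d / 2) by apply Rmin_r.
destruct (HE eps Heps) as [K HK].
set (x0 := Rmin K L - d - 1).
assert (Hx0 : forall t u, Re t = x0 -> Cmod u <= d -> Re (t + u) < K /\ Re (t + u) < L).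
{ intros t u Ht Hu. rewrite Re_plus, Ht. assert (R := Re_le_Cmod' u).
  unfold x0, Rmin. destruct Rle_dec; lra. }
(* Newton's method for [exp (a u) - 1 = E (t + u)] at [u = 0] *)
pose (T := fun t u => (u - (Cexp (RtoC a * u) - 1) / RtoC a + E (t + u) / RtoC a)%C).
assert (Hnewton : forall u v, Cmod u <= d -> Cmod v <= d ->
   Cmod (u - (Cexp (RtoC a * u) - 1) / RtoC a - (v - (Cexp (RtoC a * v) - 1) / RtoC a)) <= 1/4 * Cmod (u - v)).
{ intros u v Hu Hv.
  apply (cder_mvt (fun u => u - (Cexp (RtoC a * u) - 1) / RtoC a)%C (fun u => 1 - Cexp (RtoC a * u))%C).
  - intros r _. eapply cder_eq.
    + apply cder_minus; [apply cder_id|]. unfold Cdiv. apply cder_mult; [|apply cder_const].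
      apply cder_minus; [|apply cder_const].
      apply (cder_comp Cexp (fun u => RtoC a * u)%C); [apply cder_Cexp|]. apply cder_scal, cder_id.
    + cbv beta. field. easy.
  - intros r Hr. replace (1 - Cexp (a * (v + r * (u - v))))%C with (- (Cexp (a * (v + r * (u - v))) - 1))%C by ring.
    rewrite Cmod_opp. left. apply Hexp.
    replace (a * (v + r * (u - v)) - 0)%C with (RtoC a * (RtoC (1 - r) * v + RtoC r * u))%C
      by (rewrite RtoC_minus; ring).
    rewrite Cmod_mult, Cmod_R, Rabs_pos_eq by lra.
    apply Rle_lt_trans with (a * d); [|easy]. apply Rmult_le_compat_l; [lra|].
    eapply Rle_trans; [apply Cmod_triangle|]. rewrite !Cmod_mult, !Cmod_R, !Rabs_pos_eq by lra. nra. }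
assert (HT0 : forall t u v, Re t = x0 -> Cmod u <= d -> Cmod v <= d -> Cmod (T t u - T t v) <= 1 / 2 * Cmod (u - v)).
{ intros t u v Ht Hu Hv. unfold T.
  replace (u - (Cexp (a * u) - 1) / a + E (t + u)%C / a - (v - (Cexp (a * v) - 1) / a + E (t + v)%C / a))%C
    with ((u - (Cexp (a * u) - 1) / a - (v - (Cexp (a * v) - 1) / a)) + (E (t + u)%C - E (t + v)%C) / a)%C
    by (field; easy).
  eapply Rle_trans; [apply Cmod_triangle|].
  rewrite Cmod_div, Cmod_R, Rabs_pos_eq by (easy || lra).
  destruct (HK (t + u)%C (t + v)%C) as [_ H]; [now apply Hx0|now apply Hx0|].
  replace (t + u - (t + v))%C with (u - v)%C in H by ring.
  assert (H' : Cmod (E (t + u)%C - E (t + v)%C) / a <= 1/4 * Cmod (u - v)).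
  { assert (P := Cmod_ge_0 (u - v)). assert (P' := Cmod_ge_0 (E (t + u)%C - E (t + v)%C)).
    apply Rmult_le_reg_r with a; [lra|].
    replace (Cmod (E (t + u)%C - E (t + v)%C) / a * a) with (Cmod (E (t + u)%C - E (t + v)%C)) by (field; lra).
    nra. }
  generalize (Hnewton u v Hu Hv). lra. }
assert (HT1 : forall t u, Re t = x0 -> Cmod u <= d -> Cmod (T t u) <= d).
{ intros t u Ht Hu.
  assert (H0 : Cmod (RtoC 0) <= d) by (rewrite Cmod_0; lra).
  assert (HT00 : Cmod (T t 0) <= d / 2).
  { unfold T. replace (0 - (Cexp (a * 0) - 1) / a + E (t + 0)%C / a)%C with (E (t + 0)%C / a)%C.
    - rewrite Cmod_div, Cmod_R, Rabs_pos_eq by (easy || lra).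
      destruct (HK (t + 0)%C (t + 0)%C) as [H _]; [now apply Hx0|now apply Hx0|].
      replace (E (t + 0)%C - 0)%C with (E (t + 0)%C) in H by ring.
      assert (P := Cmod_ge_0 (E (t + 0)%C)). apply Rmult_le_reg_r with a; [lra|].
      replace (Cmod (E (t + 0)%C) / a * a) with (Cmod (E (t + 0)%C)) by (field; lra). nra.
    - rewrite Cmult_0_r, Cexp_0. field. easy. }
  replace (T t u) with ((T t u - T t 0) + T t 0)%C by ring.
  eapply Rle_trans; [apply Cmod_triangle|]. generalize (HT0 t u (RtoC 0) Ht Hu H0).
  replace (u - 0)%C with u by ring. lra. }
pose (U := fun t => Cfix (T t)).
assert (HU : forall t, Re t = x0 -> Cmod (U t) <= d /\ T t (U t) = U t).
{ intros t Ht. apply Cfix_correct; [easy| |].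
  - intros; now apply HT1.
  - intros; now apply HT0. }
assert (Heq : forall t, Re t = x0 -> Cexp (RtoC a * U t) = (1 + E (t + U t))%C).
{ intros t Ht. destruct (HU t Ht) as [_ H]. unfold T in H.
  assert (Q : (E (t + U t) - (Cexp (RtoC a * U t) - 1))%C = RtoC 0).
  { transitivity (RtoC a * ((U t - (Cexp (a * U t) - 1) / a + E (t + U t)%C / a) - U t))%C.
    - field. easy.
    - rewrite H. ring. }
  transitivity (1 + E (t + U t) - (E (t + U t) - (Cexp (RtoC a * U t) - 1)))%C; [ring|]. rewrite Q. ring. }
assert (HUc : forall t t', Re t = x0 -> Re t' = x0 -> Cmod (U t - U t') <= Cmod (t - t')).
{ intros t t' Ht Ht'. destruct (HU t Ht) as [B1 F1]. destruct (HU t' Ht') as [B2 F2].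
  assert (H1 := HT0 t (U t) (U t') Ht B1 B2). rewrite F1 in H1.
  assert (H2 : Cmod (T t (U t') - U t') <= 1/2 * Cmod (t - t')).
  { rewrite <- F2 at 2. unfold T.
    replace (U t' - (Cexp (a * U t') - 1) / a + E (t + U t')%C / a - (U t' - (Cexp (a * U t') - 1) / a + E (t' + U t')%C / a))%C
     with ((E (t + U t') - E (t' + U t')) / a)%C by (field; easy).
    rewrite Cmod_div, Cmod_R, Rabs_pos_eq by (easy || lra).
    destruct (HK (t + U t')%C (t' + U t')%C) as [_ H]; [now apply Hx0|now apply Hx0|].
    replace (t + U t' - (t' + U t'))%C with (t - t')%C in H by ring.
    assert (P := Cmod_ge_0 (t - t')). assert (P' := Cmod_ge_0 (E (t + U t')%C - E (t' + U t')%C)).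
    apply Rmult_le_reg_r with a; [lra|].
    replace (Cmod (E (t + U t')%C - E (t' + U t')%C) / a * a) with (Cmod (E (t + U t')%C - E (t' + U t')%C)) by (field; lra).
    nra. }
  assert (H3 : Cmod (U t - U t') <= Cmod (U t - T t (U t')) + Cmod (T t (U t') - U t')).
  { replace (U t - U t')%C with ((U t - T t (U t')) + (T t (U t') - U t'))%C by ring. apply Cmod_triangle. }
  lra. }
assert (HUper : forall t, Re t = x0 -> U (t + tau)%C = U t).
{ intros t Ht. assert (Ht' : Re (t + tau) = x0) by now rewrite Re_add_tau.
  destruct (HU t Ht) as [B1 F1]. destruct (HU _ Ht') as [B2 F2].
  assert (F3 : T t (U (t + tau)%C) = U (t + tau)%C).
  { rewrite <- F2 at 2. unfold T.
    replace (t + tau + U (t + tau)%C)%C with ((t + U (t + tau)%C) + tau)%C by ring.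
    rewrite HEper by now apply Hx0. reflexivity. }
  assert (H1 := HT0 t _ _ Ht B2 B1). rewrite F1, F3 in H1.
  apply Ceq_minus, Cmod_eq_0. generalize (Cmod_ge_0 (U (t + tau)%C - U t)). lra. }
pose (pt := fun th : R => (RtoC x0 + RtoC th * Ci)%C).
assert (Hpt : forall th, Re (pt th) = x0) by (intros th; unfold pt, Re, Ci; simpl; ring).
pose (V := fun th => W (pt th + U (pt th))%C).
assert (HVper : forall th, V (th + 2 * PI) = V th).
{ intros th. unfold V.
  replace (pt (th + 2 * PI)) with (pt th + tau)%C by (unfold pt, tau; rewrite RtoC_plus; ring).
  rewrite HUper by apply Hpt.
  replace (pt th + tau + U (pt th))%C with ((pt th + U (pt th)) + tau)%C by ring.
  apply HWper. apply Hx0; [apply Hpt|]. now apply HU. }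
assert (HVc : forall th, continuous V th).
{ intros th. unfold V. apply (continuous_comp (fun th => (pt th + U (pt th))%C) W).
  2: { apply HWc. apply Hx0; [apply Hpt|]. now apply HU. }
  apply continuous_Cplus; [unfold pt; cont|].
  intros P HP. apply locally_Cmod in HP. destruct HP as (r & Hr & HP).
  exists (mkposreal r Hr). intros th' Hth. apply HP.
  eapply Rle_lt_trans; [apply HUc; apply Hpt|].
  replace (pt th' - pt th)%C with (RtoC (th' - th) * Ci)%C by (unfold pt; rewrite RtoC_minus; ring).
  rewrite Cmod_mult, Cmod_R, Cmod_Ci, Rmult_1_r. exact Hth. }
pose (dV := fun th => V (th + 2 * PI / a) - V th).
assert (HdVc : continuity dV).
{ intros th. apply continuity_pt_filterlim. apply (continuous_Rminus (fun th => V (th + 2 * PI / a)) V); [|apply HVc].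
  apply (continuous_comp (fun th => th + 2 * PI / a) V); [|apply HVc].
  apply continuous_Rplus; [apply continuous_id|apply continuous_const]. }
assert (Hroot : exists th, dV th = 0).
{ destruct (Classical_Prop.classic (exists th, dV th = 0)) as [Hz|Hz]; [easy|].
  exfalso.
  assert (Hsgn : (forall th, 0 < dV th) \/ (forall th, dV th < 0)).
  { destruct (Rlt_dec 0 (dV 0)) as [P|P].
    - left. intros th. destruct (Rlt_dec 0 (dV th)) as [P'|P']; [easy|]. exfalso.
      destruct (IVT_gen dV 0 th 0 HdVc) as (x & _ & Hx).
      { split; [eapply Rle_trans; [apply Rmin_r|lra]|eapply Rle_trans; [|apply Rmax_l]; lra]. }
      apply Hz. now exists x.
    - right. intros th. destruct (Rlt_dec (dV th) 0) as [P'|P']; [easy|]. exfalso.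
      destruct (IVT_gen dV 0 th 0 HdVc) as (x & _ & Hx).
      { split; [eapply Rle_trans; [apply Rmin_l|lra]|eapply Rle_trans; [|apply Rmax_r]; lra]. }
      apply Hz. now exists x. }
  assert (Hstep : forall j, V (2 * PI / a * INR (S j)) = V (2 * PI / a * INR j) + dV (2 * PI / a * INR j)).
  { intros j. unfold dV. rewrite S_INR. replace (2 * PI / a * (INR j + 1)) with (2 * PI / a * INR j + 2 * PI / a) by ring. ring. }
  assert (Hend : V (2 * PI / a * INR m) = V (2 * PI / a * INR 0)).
  { fold a. simpl. rewrite <- (HVper (2 * PI / a * 0)). f_equal. field. lra. }
  destruct Hsgn as [Hs|Hs].
  - assert (A : forall j, (1 <= j)%nat -> V (2 * PI / a * INR 0) < V (2 * PI / a * INR j)).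
    { induction 1; rewrite Hstep; [|]; generalize (Hs (2 * PI / a * INR 0)); try generalize (Hs (2 * PI / a * INR m0)); lra. }
    specialize (A m ltac:(lia)). lra.
  - assert (A : forall j, (1 <= j)%nat -> V (2 * PI / a * INR j) < V (2 * PI / a * INR 0)).
    { induction 1; rewrite Hstep; [|]; generalize (Hs (2 * PI / a * INR 0)); try generalize (Hs (2 * PI / a * INR m0)); lra. }
    specialize (A m ltac:(lia)). lra. }
destruct Hroot as [th Hth]. unfold dV in Hth.
set (t1 := pt th). set (t2 := pt (th + 2 * PI / a)).
assert (Ht1 : Re t1 = x0) by apply Hpt. assert (Ht2 : Re t2 = x0) by apply Hpt.
destruct (HU t1 Ht1) as [B1 _]. destruct (HU t2 Ht2) as [B2 _].
assert (Hval : forall t, Re t = x0 -> (zpow (- a) (t + U t) * (1 + E (t + U t)))%C = zpow (- a) t).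
{ intros t Ht. rewrite <- (Heq t Ht). unfold zpow. rewrite <- Cexp_plus. f_equal. rewrite RtoC_opp. ring. }
exists (t1 + U t1)%C, (t2 + U t2)%C.
split; [now apply Hx0|]. split; [now apply Hx0|]. split; [|split].
- intros E0. apply Cexp_inj in E0. destruct E0 as [k Hk].
  assert (Hdiff : (U t2 - U t1)%C = (RtoC (2 * PI * (IZR k - 1 / a)) * Ci)%C).
  { transitivity ((t2 + U t2) - (t1 + U t1) - (t2 - t1))%C; [ring|]. rewrite Hk.
    unfold t1, t2, pt. rewrite RtoC_plus.
    replace (2 * PI * (IZR k - 1 / a)) with (2 * PI * IZR k - 2 * PI / a) by (field; lra).
    rewrite RtoC_minus. ring. }
  assert (Hn : Cmod (U t2 - U t1) <= 2 * d).
  { eapply Rle_trans; [apply Cmod_triangle|]. rewrite Cmod_opp. lra. }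
  rewrite Hdiff, Cmod_mult, Cmod_R, Cmod_Ci, Rmult_1_r in Hn.
  rewrite Rabs_mult, (Rabs_pos_eq (2 * PI)) in Hn by lra.
  assert (Hka : 1 / a <= Rabs (IZR k - 1 / a)).
  { assert (Hia : 0 < 1 / a <= 1 / 2).
    { split; [apply Rdiv_lt_0_compat; lra|]. apply Rmult_le_reg_r with a; [lra|].
      replace (1 / a * a) with 1 by (field; lra). lra. }
    destruct (Z_le_gt_dec 1 k) as [G|G].
    - apply IZR_le in G. rewrite Rabs_pos_eq; lra.
    - assert (G' : (k <= 0)%Z) by lia. apply IZR_le in G'. rewrite Rabs_left; lra. }
  assert (Hd3 : d <= 1 / a).
  { apply Rmult_le_reg_l with a; [lra|]. replace (a * (1 / a)) with 1 by (field; lra). lra. }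
  assert (Hia : 0 < 1 / a) by (apply Rdiv_lt_0_compat; lra). nra.
- unfold V in Hth. fold t1 t2 in Hth. lra.
- rewrite !Hval by easy. unfold t2, t1, pt, zpow.
  transitivity (Cexp (RtoC (- a) * (RtoC x0 + RtoC th * Ci)) * 1)%C; [ring|].
  rewrite <- (Cexp_Ztau (-1)), <- Cexp_plus. f_equal.
  rewrite RtoC_plus. unfold tau.
  replace (RtoC (2 * PI / a)) with (RtoC (2 * PI) / RtoC a)%C by (rewrite <- RtoC_div; [easy|lra]).
  rewrite !RtoC_opp. field. easy.
Qed.

Lemma smallLip_const (c : C) : smallLip (fun _ => c) c.
Proof.
intros eps Heps. exists 0. intros s t _ _.
replace (c - c)%C with (RtoC 0) by ring. rewrite Cmod_0. split; [lra|].
apply Rmult_le_pos; [lra|apply Cmod_ge_0].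
Qed.

Lemma smallLip_plus (F G : C -> C) (l m : C) : smallLip F l -> smallLip G m ->
  smallLip (fun s => F s + G s)%C (l + m)%C.
Proof.
intros HF HG eps Heps.
destruct (HF (eps / 2)) as [K1 H1]; [lra|]. destruct (HG (eps / 2)) as [K2 H2]; [lra|].
exists (Rmin K1 K2). intros s t Hs Ht.
assert (A : Re s < K1 /\ Re s < K2 /\ Re t < K1 /\ Re t < K2).
{ revert Hs Ht. unfold Rmin. destruct Rle_dec; lra. }
destruct (H1 s t) as [A1 A2]; [easy|easy|]. destruct (H2 s t) as [B1 B2]; [easy|easy|].
split.
- replace (F s + G s - (l + m))%C with ((F s - l) + (G s - m))%C by ring.
  eapply Rle_trans; [apply Cmod_triangle|]. lra.
- replace (F s + G s - (F t + G t))%C with ((F s - F t) + (G s - G t))%C by ring.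
  eapply Rle_trans; [apply Cmod_triangle|]. lra.
Qed.

Lemma smallLip_mult (F G : C -> C) (l m : C) : smallLip F l -> smallLip G m ->
  smallLip (fun s => F s * G s)%C (l * m)%C.
Proof.
intros HF HG eps Heps.
set (M := 2 + Cmod l + Cmod m).
assert (HM : 0 < M /\ 1 + Cmod l <= M /\ 1 + Cmod m <= M).
{ unfold M. generalize (Cmod_ge_0 l) (Cmod_ge_0 m). lra. }
set (e := Rmin 1 (eps / (2 * M))).
assert (He : 0 < e) by (apply Rmin_pos; [lra|apply Rdiv_lt_0_compat; lra]).
assert (He1 : e <= 1) by apply Rmin_l.
assert (He2 : 2 * M * e <= eps).
{ assert (T : e <= eps / (2 * M)) by apply Rmin_r.
  apply (Rmult_le_compat_l (2 * M)) in T; [|lra].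
  replace (2 * M * (eps / (2 * M))) with eps in T by (field; lra). easy. }
destruct (HF e He) as [K1 H1]. destruct (HG e He) as [K2 H2].
exists (Rmin K1 K2). intros s t Hs Ht.
assert (A : Re s < K1 /\ Re s < K2 /\ Re t < K1 /\ Re t < K2).
{ revert Hs Ht. unfold Rmin. destruct Rle_dec; lra. }
destruct (H1 s t) as [A1 A2]; [easy|easy|]. destruct (H2 s t) as [B1 B2]; [easy|easy|].
destruct (H1 t t) as [A3 _]; [easy|easy|].
assert (BG : Cmod (G s) <= M).
{ replace (G s) with ((G s - m) + m)%C by ring.
  eapply Rle_trans; [apply Cmod_triangle|]. lra. }
assert (BF : Cmod (F t) <= M).
{ replace (F t) with ((F t - l) + l)%C by ring.
  eapply Rle_trans; [apply Cmod_triangle|]. lra. }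
assert (P := Cmod_ge_0 (s - t)). split.
- replace (F s * G s - l * m)%C with ((F s - l) * G s + l * (G s - m))%C by ring.
  eapply Rle_trans; [apply Cmod_triangle|]. rewrite !Cmod_mult.
  assert (Cmod (F s - l) * Cmod (G s) <= e * M) by (apply Rmult_le_compat; try apply Cmod_ge_0; lra).
  assert (Cmod l * Cmod (G s - m) <= M * e) by (apply Rmult_le_compat; try apply Cmod_ge_0; lra).
  lra.
- replace (F s * G s - F t * G t)%C with ((F s - F t) * G s + F t * (G s - G t))%C by ring.
  eapply Rle_trans; [apply Cmod_triangle|]. rewrite !Cmod_mult.
  assert (Cmod (F s - F t) * Cmod (G s) <= (e * Cmod (s - t)) * M) by (apply Rmult_le_compat; try apply Cmod_ge_0; lra).
  assert (Cmod (F t) * Cmod (G s - G t) <= M * (e * Cmod (s - t))) by (apply Rmult_le_compat; try apply Cmod_ge_0; lra).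
  apply Rle_trans with (2 * M * e * Cmod (s - t)); [lra|]. now apply Rmult_le_compat_r.
Qed.

Lemma smallLip_conj (F : C -> C) (l : C) : smallLip F l ->
  smallLip (fun s => Cconj (F s)) (Cconj l).
Proof.
intros HF eps Heps. destruct (HF eps Heps) as [K H]. exists K. intros s t Hs Ht.
rewrite <- !Cminus_conj, !Cmod_conj. now apply H.
Qed.

Lemma smallLip_inv (F : C -> C) (l : C) : l <> RtoC 0 -> smallLip F l ->
  smallLip (fun s => / F s)%C (/ l)%C.
Proof.
intros Hl HF eps Heps.
assert (Hm : 0 < Cmod l) by now apply Cmod_gt_0. set (M := Cmod l) in *.
set (e := Rmin (M / 2) (eps * (M * M) / 4)).
assert (HMM : 0 < M * M) by nra.
assert (He : 0 < e) by (apply Rmin_pos; [lra|]; nra).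
assert (He1 : e <= M / 2) by apply Rmin_l. assert (He2 : e <= eps * (M * M) / 4) by apply Rmin_r.
destruct (HF e He) as [K H]. exists K. intros s t Hs Ht.
destruct (H s t Hs Ht) as [A1 A2]. destruct (H t t Ht Ht) as [A3 _].
assert (Hlow : forall c, Cmod (c - l) <= e -> M / 2 <= Cmod c).
{ intros c Hc. assert (T := Cmod_triangle c (- (c - l))).
  replace (c + - (c - l))%C with l in T by ring. rewrite Cmod_opp in T. fold M in T. lra. }
assert (L1 := Hlow _ A1). assert (L2 := Hlow _ A3).
assert (N1 : F s <> RtoC 0) by (apply Cmod_gt_0; lra).
assert (N2 : F t <> RtoC 0) by (apply Cmod_gt_0; lra).
split.
- replace (/ F s - / l)%C with (- (F s - l) / (F s * l))%C by (field; easy).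
  rewrite Cmod_div, Cmod_opp, Cmod_mult by now apply Cmult_neq_0. fold M.
  assert (P : 0 < Cmod (F s) * M) by nra.
  apply Rmult_le_reg_r with (Cmod (F s) * M); [easy|].
  replace (Cmod (F s - l) / (Cmod (F s) * M) * (Cmod (F s) * M)) with (Cmod (F s - l)) by (field; lra).
  assert (M * M / 2 <= Cmod (F s) * M) by nra. nra.
- replace (/ F s - / F t)%C with (- (F s - F t) / (F s * F t))%C by (field; easy).
  rewrite Cmod_div, Cmod_opp, Cmod_mult by now apply Cmult_neq_0.
  assert (P' : M * M / 4 <= Cmod (F s) * Cmod (F t)) by nra.
  assert (P : 0 < Cmod (F s) * Cmod (F t)) by nra.
  apply Rmult_le_reg_r with (Cmod (F s) * Cmod (F t)); [easy|].
  replace (Cmod (F s - F t) / (Cmod (F s) * Cmod (F t)) * (Cmod (F s) * Cmod (F t))) with (Cmod (F s - F t)) by (field; lra).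
  assert (Q := Cmod_ge_0 (s - t)).
  apply Rle_trans with (eps * (M * M) / 4 * Cmod (s - t)).
  + eapply Rle_trans; [apply A2|]. now apply Rmult_le_compat_r.
  + replace (eps * (M * M) / 4 * Cmod (s - t)) with (eps * Cmod (s - t) * (M * M / 4)) by field.
    apply Rmult_le_compat_l; [nra|easy].
Qed.

Lemma zpow_Lip (a K : R) (s t : C) : 0 <= a -> Re s < K -> Re t < K ->
  Cmod (zpow a s - zpow a t) <= a * exp (a * K) * Cmod (s - t).
Proof.
intros Ha Hs Ht.
apply (cder_mvt (zpow a) (fun w => RtoC a * zpow a w)%C).
- intros u _. apply cder_zpow.
- intros u Hu. rewrite Cmod_mult, Cmod_R, Cmod_zpow, Rabs_pos_eq by easy.
  apply Rmult_le_compat_l; [easy|].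
  replace (Re (t + u * (s - t))) with ((1 - u) * Re t + u * Re s) by (unfold Re; simpl; ring).
  assert (Hle : a * ((1 - u) * Re t + u * Re s) <= a * K) by (apply Rmult_le_compat_l; nra).
  destruct Hle as [Hlt| ->]; [left; now apply exp_increasing|lra].
Qed.

Lemma exp_small (a eps : R) : 0 < a -> 0 < eps -> exists K, exp (a * K) <= eps.
Proof.
intros Ha He. exists (ln eps / a).
replace (a * (ln eps / a)) with (ln eps) by (field; lra). rewrite exp_ln; lra.
Qed.

Lemma smallLip_abspow (a : R) : 0 < a -> smallLip (fun s => RtoC (exp (a * Re s))) (RtoC 0).
Proof.
intros Ha eps Heps.
destruct (exp_small a (eps / (1 + a))) as [K HK]; [easy|apply Rdiv_lt_0_compat; lra|].
assert (HK' : (1 + a) * exp (a * K) <= eps).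
{ apply (Rmult_le_compat_l (1 + a)) in HK; [|lra].
  replace ((1 + a) * (eps / (1 + a))) with eps in HK by (field; lra). easy. }
assert (HE := exp_pos (a * K)).
exists K. intros s t Hs Ht. split.
- replace (exp (a * Re s) - 0)%C with (RtoC (exp (a * Re s))) by ring.
  rewrite Cmod_R, Rabs_pos_eq by (left; apply exp_pos).
  assert (exp (a * Re s) < exp (a * K)) by (apply exp_increasing; nra). nra.
- assert (E : forall s, RtoC (exp (a * Re s)) = zpow a (RtoC (Re s))).
  { intros w. unfold zpow. rewrite <- RtoC_mult. unfold Cexp, RtoC; simpl. rewrite cos_0, sin_0.
    f_equal; ring. }
  rewrite !E. eapply Rle_trans; [apply (zpow_Lip a K); simpl; lra|].
  rewrite <- RtoC_minus, Cmod_R.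
  assert (H := re_le_Cmod (s - t)). replace (Re (s - t)) with (Re s - Re t) in H by (unfold Re; simpl; ring).
  apply Rmult_le_compat; [nra|apply Rabs_pos|nra|easy].
Qed.

Lemma smallLip_hol1 (r : R) (f df : C -> C) : 0 < r -> hol1 r f df ->
  smallLip (fun s => f (Cexp s)) (f (RtoC 0)).
Proof.
intros Hr Hf eps Heps.
assert (H0 : Cmod (RtoC 0) < r) by now rewrite Cmod_0.
destruct (Hf _ H0) as [_ Hc].
destruct (proj1 (continuous_C_eps _ _) Hc 1 Rlt_0_1) as (d & Hd & H1).
set (M := 1 + Cmod (df (RtoC 0))). assert (HM : 1 <= M) by (unfold M; generalize (Cmod_ge_0 (df 0)); lra).
set (q := Rmin r (Rmin d (eps / M))).
assert (Hem : 0 < eps / M) by (apply Rdiv_lt_0_compat; lra).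
assert (Hq : 0 < q) by (repeat apply Rmin_pos; easy).
assert (Hq3 : q <= r /\ q <= d /\ q <= eps / M) by (unfold q, Rmin; repeat destruct Rle_dec; lra).
assert (HqM : M * q <= eps).
{ destruct Hq3 as (_ & _ & T). apply (Rmult_le_compat_l M) in T; [|lra].
  replace (M * (eps / M)) with eps in T by (field; lra). easy. }
assert (HL : forall z w, Cmod z < q -> Cmod w < q -> Cmod (f z - f w) <= M * Cmod (z - w)).
{ intros z w Hz Hw.
  assert (Hseg : forall t, 0 <= t <= 1 -> Cmod (w + t * (z - w)) < q).
  { intros t Ht. replace (w + t * (z - w))%C with (RtoC (1 - t) * w + RtoC t * z)%C by (rewrite RtoC_minus; ring).
    eapply Rle_lt_trans; [apply Cmod_triangle|]. rewrite !Cmod_mult, !Cmod_R, !Rabs_pos_eq by lra.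
    assert (A := Cmod_ge_0 z). assert (B := Cmod_ge_0 w).
    assert (C1 := Rmax_l (Cmod z) (Cmod w)). assert (C2 := Rmax_r (Cmod z) (Cmod w)).
    assert (C3 : Rmax (Cmod z) (Cmod w) < q) by now apply Rmax_lub_lt. nra. }
  apply (cder_mvt f df).
  - intros t Ht. apply Hf. eapply Rlt_le_trans; [now apply Hseg|lra].
  - intros t Ht. specialize (H1 (w + t * (z - w))%C).
    set (p := (w + t * (z - w))%C) in *.
    replace (df p) with ((df p - df 0) + df 0)%C by ring.
    eapply Rle_trans; [apply Cmod_triangle|]. unfold M. apply Rplus_le_compat_r. left. apply H1.
    replace (p - 0)%C with p by ring. eapply Rlt_le_trans; [now apply Hseg|lra]. }
assert (Hexp : forall s, Re s < ln q -> Cmod (Cexp s) < q).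
{ intros s Hs. rewrite Cmod_Cexp, <- (exp_ln q) by easy. now apply exp_increasing. }
exists (ln q). intros s t Hs Ht. split.
- eapply Rle_trans; [apply HL; [now apply Hexp|now rewrite Cmod_0]|].
  replace (Cexp s - 0)%C with (Cexp s) by ring. specialize (Hexp s Hs). nra.
- eapply Rle_trans; [apply HL; now apply Hexp|].
  assert (E : forall s, Cexp s = zpow 1 s) by (intros w; unfold zpow; f_equal; ring).
  assert (Z := zpow_Lip 1 (ln q) s t Rle_0_1 Hs Ht). rewrite <- !E, !Rmult_1_l, exp_ln in Z by easy.
  assert (P := Cmod_ge_0 (s - t)). apply Rle_trans with (M * (q * Cmod (s - t))); [apply Rmult_le_compat_l; lra|].
  nra.
Qed.

(** * The shape of the end in normal form *)

(** Up to the factors [z^(-m)] and [|z|^(mu-m)], the immersion in normal form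
    is a function with a limit at the puncture; in particular its horizontal
    coordinate winds [m] times around infinity. *)
Definition end_num (mu : R) (f1 f2 g1 g2 : C -> C) (s : C) : C :=
  (Cconj (f2 (Cexp s)) * f1 (Cexp s) +
   RtoC (exp (2 * mu * Re s)) * (Cconj (g2 (Cexp s)) * g1 (Cexp s)))%C.
Definition end_den (mu k : R) (f2 g2 : C -> C) (s : C) : R :=
  Cmod (f2 (Cexp s)) ^ 2 + k ^ 2 * exp (2 * mu * Re s) * Cmod (g2 (Cexp s)) ^ 2.

Lemma zpow_conj_mult (a : R) (s : C) : (Cconj (zpow a s) * zpow a s)%C = RtoC (exp (2 * a * Re s)).
Proof.
rewrite Cmult_comm, <- Cmod2_conj, Cmod_zpow. f_equal. simpl. rewrite Rmult_1_r, <- exp_plus.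
f_equal. ring.
Qed.

(** In the entries of the second row the exponents differ from those of the
    first by [m], and the products of the constants in both columns agree. *)
Lemma end_formula (m mu : R) (f1 f2 g1 g2 : C -> C) (s a b c d : C) :
  0 < m -> 0 < mu ->
  a = (zpow ((m - mu) / 2) s * f2 (Cexp s))%C ->
  b = (RtoC ((mu - m) / (mu + m)) * zpow ((mu + m) / 2) s * g2 (Cexp s))%C ->
  c = (RtoC ((mu ^ 2 - m ^ 2) / (4 * m * mu)) * zpow ((- m - mu) / 2) s * f1 (Cexp s))%C ->
  d = (RtoC ((mu + m) ^ 2 / (4 * m * mu)) * zpow ((mu - m) / 2) s * g1 (Cexp s))%C ->
  Cmod a ^ 2 + Cmod b ^ 2 <> 0 ->
  end_den mu ((mu - m) / (mu + m)) f2 g2 s <> 0 /\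
  ((Cconj a * c + Cconj b * d) / RtoC (Cmod a ^ 2 + Cmod b ^ 2) =
   RtoC ((mu ^ 2 - m ^ 2) / (4 * m * mu)) * zpow (- m) s *
    (end_num mu f1 f2 g1 g2 s / RtoC (end_den mu ((mu - m) / (mu + m)) f2 g2 s)))%C /\
  / (Cmod a ^ 2 + Cmod b ^ 2) = exp ((mu - m) * Re s) / end_den mu ((mu - m) / (mu + m)) f2 g2 s.
Proof.
intros Hm Hmu Ha Hb Hc Hd Hn.
set (k1 := (mu ^ 2 - m ^ 2) / (4 * m * mu)) in *. set (k2 := (mu + m) ^ 2 / (4 * m * mu)) in *.
set (k3 := (mu - m) / (mu + m)) in *.
set (D := end_den mu k3 f2 g2 s). set (x := Re s).
assert (Hden : Cmod a ^ 2 + Cmod b ^ 2 = exp ((m - mu) * x) * D).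
{ rewrite Ha, Hb. rewrite !Cmod_mult, !Cmod_zpow, Cmod_R. unfold D, end_den. fold x.
  rewrite !Rpow_mult_distr, pow2_abs.
  replace (exp ((m - mu) / 2 * x) ^ 2) with (exp ((m - mu) * x))
    by (simpl; rewrite Rmult_1_r, <- exp_plus; f_equal; field).
  replace (exp ((mu + m) / 2 * x) ^ 2) with (exp ((m - mu) * x) * exp (2 * mu * x))
    by (simpl; rewrite Rmult_1_r, <- !exp_plus; f_equal; field).
  ring. }
assert (HE := exp_pos ((m - mu) * x)).
assert (HD : D <> 0) by (intros E; apply Hn; rewrite Hden, E; ring).
split; [easy|]. split.
- rewrite Hden.
  assert (HEc : RtoC (exp ((m - mu) * x)) <> RtoC 0) by (apply RtoC_neq0; lra).
  assert (HDc := RtoC_neq0 _ HD).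
  assert (Hnum : (Cconj a * c + Cconj b * d)%C =
    (RtoC (exp ((m - mu) * x)) * (RtoC k1 * zpow (- m) s * end_num mu f1 f2 g1 g2 s))%C).
  { rewrite Ha, Hb, Hc, Hd. unfold end_num. fold x.
    replace ((- m - mu) / 2) with ((m - mu) / 2 + - m) by field.
    replace ((mu - m) / 2) with ((mu + m) / 2 + - m) by field.
    rewrite !zpow_plus, !Cmult_conj.
    replace (Cconj (RtoC k3)) with (RtoC k3) by (unfold Cconj, RtoC; simpl; f_equal; ring).
    transitivity ((Cconj (zpow ((m - mu) / 2) s) * zpow ((m - mu) / 2) s) * RtoC k1 * zpow (- m) s *
        (Cconj (f2 (Cexp s)) * f1 (Cexp s)) +
      (Cconj (zpow ((mu + m) / 2) s) * zpow ((mu + m) / 2) s) * (RtoC k3 * RtoC k2) * zpow (- m) s *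
        (Cconj (g2 (Cexp s)) * g1 (Cexp s)))%C; [ring|].
    rewrite !zpow_conj_mult. fold x.
    replace (exp (2 * ((m - mu) / 2) * x)) with (exp ((m - mu) * x)) by (f_equal; field).
    replace (exp (2 * ((mu + m) / 2) * x)) with (exp ((m - mu) * x) * exp (2 * mu * x))
      by (rewrite <- exp_plus; f_equal; field).
    rewrite <- (RtoC_mult k3 k2).
    replace (k3 * k2) with k1 by (unfold k1, k2, k3; field; lra).
    rewrite RtoC_mult. ring. }
  rewrite Hnum, RtoC_mult. field. split; assumption.
- rewrite Hden. replace ((mu - m) * x) with (- ((m - mu) * x)) by ring.
  rewrite exp_Ropp. field. split; lra.
Qed.

Lemma end_factor_smallLip (r mu k : R) (f1 df1 f2 df2 g1 dg1 g2 dg2 : C -> C) :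
  0 < r -> 0 < mu -> hol1 r f1 df1 -> hol1 r f2 df2 -> hol1 r g1 dg1 -> hol1 r g2 dg2 ->
  f1 (RtoC 0) = RtoC 1 -> f2 (RtoC 0) = RtoC 1 ->
  smallLip (fun s => end_num mu f1 f2 g1 g2 s / RtoC (end_den mu k f2 g2 s) - 1)%C (RtoC 0).
Proof.
intros Hr Hmu H1 H2 H3 H4 E1 E2.
apply (smallLip_hol1 r) in H1, H2, H3, H4; try easy.
assert (HP : smallLip (fun s => RtoC (exp (2 * mu * Re s))) (RtoC 0)) by (apply smallLip_abspow; lra).
assert (HN : smallLip (end_num mu f1 f2 g1 g2) (RtoC 1)).
{ replace (RtoC 1) with (Cconj (f2 (RtoC 0)) * f1 (RtoC 0) + RtoC 0 * (Cconj (g2 (RtoC 0)) * g1 (RtoC 0)))%C.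
  - apply smallLip_plus; [apply smallLip_mult; [now apply smallLip_conj|easy]|].
    apply smallLip_mult; [easy|]. apply smallLip_mult; [now apply smallLip_conj|easy].
  - rewrite E1, E2. replace (Cconj (RtoC 1)) with (RtoC 1) by (unfold Cconj, RtoC; simpl; f_equal; ring). ring. }
assert (HD : smallLip (fun s => RtoC (end_den mu k f2 g2 s)) (RtoC 1)).
{ assert (T : smallLip (fun s => f2 (Cexp s) * Cconj (f2 (Cexp s)) +
     RtoC (k ^ 2) * RtoC (exp (2 * mu * Re s)) * (g2 (Cexp s) * Cconj (g2 (Cexp s))))%C
     (f2 (RtoC 0) * Cconj (f2 (RtoC 0)) + RtoC (k ^ 2) * RtoC 0 * (g2 (RtoC 0) * Cconj (g2 (RtoC 0))))%C).
  { apply smallLip_plus; [apply smallLip_mult; [easy|now apply smallLip_conj]|].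
    apply smallLip_mult; [apply smallLip_mult; [apply smallLip_const|easy]|].
    apply smallLip_mult; [easy|now apply smallLip_conj]. }
  replace (f2 (RtoC 0) * Cconj (f2 (RtoC 0)) + RtoC (k ^ 2) * RtoC 0 * (g2 (RtoC 0) * Cconj (g2 (RtoC 0))))%C
    with (RtoC 1) in T.
  - intros eps Heps. destruct (T eps Heps) as [K HK]. exists K. intros s t Hs Ht.
    specialize (HK s t Hs Ht). cbv beta in HK. rewrite <- !Cmod2_conj, <- !RtoC_mult, <- !RtoC_plus in HK. exact HK.
  - rewrite E2. replace (Cconj (RtoC 1)) with (RtoC 1) by (unfold Cconj, RtoC; simpl; f_equal; ring). ring. }
replace (RtoC 0) with (RtoC 1 * / RtoC 1 + - RtoC 1)%C by (field; apply C1_nz).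
unfold Cdiv, Cminus. apply smallLip_plus; [|apply smallLip_const].
apply smallLip_mult; [easy|]. apply smallLip_inv; [apply C1_nz|easy].
Qed.

(** * Smooth functions on an open set *)

(** The partial derivatives only see a neighbourhood in the two coordinate
    directions, continuity a full one. *)
Definition open_lines (U : C -> Prop) : Prop := forall z : C, U z ->
  locally (fst z) (fun t => U (t, snd z)) /\ locally (snd z) (fun t => U (fst z, t)) /\ locally z U.

Lemma pdisc_open (rho : R) : open_lines (pdisc rho).
Proof.
intros z [H1 H2].
set (d := Rmin (Cmod z) (rho - Cmod z)). assert (Hd : 0 < d) by (apply Rmin_pos; lra).
assert (HU : forall w, Cmod (w - z) < d -> pdisc rho w).
{ intros w Hw. assert (D1 : d <= Cmod z) by apply Rmin_l. assert (D2 : d <= rho - Cmod z) by apply Rmin_r.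
  assert (T1 := Cmod_triangle (w - z) z). replace (w - z + z)%C with w in T1 by ring.
  assert (T2 := Cmod_triangle (- (w - z)) w). replace (- (w - z) + w)%C with z in T2 by ring.
  rewrite Cmod_opp in T2. split; lra. }
split; [|split].
- exists (mkposreal d Hd). intros t Ht. apply HU.
  replace ((t, snd z) - z)%C with (RtoC (t - fst z)).
  + rewrite Cmod_R. exact Ht.
  + destruct z. unfold RtoC, Cminus, Cplus, Copp; simpl. f_equal; ring.
- exists (mkposreal d Hd). intros t Ht. apply HU.
  replace ((fst z, t) - z)%C with (RtoC (t - snd z) * Ci)%C.
  + rewrite Cmod_mult, Cmod_R, Cmod_Ci, Rmult_1_r. exact Ht.
  + destruct z. unfold RtoC, Cminus, Cplus, Copp, Cmult, Ci; simpl. f_equal; ring.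
- apply locally_Cmod. exists d. now split.
Qed.

Section Smooth.
Variable U : C -> Prop.
Hypothesis HU : open_lines U.

Lemma pdx_ext (f g : C -> R) : (forall z, U z -> f z = g z) -> forall z, U z -> pdx f z = pdx g z.
Proof.
intros H z Hz. unfold pdx. apply Derive_ext_loc.
generalize (proj1 (HU z Hz)). apply filter_imp. intros t Ht. now apply H.
Qed.

Lemma pdy_ext (f g : C -> R) : (forall z, U z -> f z = g z) -> forall z, U z -> pdy f z = pdy g z.
Proof.
intros H z Hz. unfold pdy. apply Derive_ext_loc.
generalize (proj1 (proj2 (HU z Hz))). apply filter_imp. intros t Ht. now apply H.
Qed.

Lemma Ck_ext (k : nat) : forall f g : C -> R,
  (forall z, U z -> f z = g z) -> Ck k U f -> Ck k U g.
Proof.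
induction k as [|k IH]; intros f g H.
- intros Hf z Hz. apply (@continuous_ext_loc _ _ g f).
  + generalize (proj2 (proj2 (HU z Hz))). apply filter_imp. exact H.
  + now apply Hf.
- intros (H1 & H2 & H3). split; [|split].
  + intros z Hz. destruct (H1 z Hz) as [D1 D2]. split.
    * apply (ex_derive_ext_loc (fun t => f (t, snd z))); [|easy].
      generalize (proj1 (HU z Hz)). apply filter_imp. intros t Ht. now apply H.
    * apply (ex_derive_ext_loc (fun t => f (fst z, t))); [|easy].
      generalize (proj1 (proj2 (HU z Hz))). apply filter_imp. intros t Ht. now apply H.
  + apply (IH (pdx f)); [|easy]. now apply pdx_ext.
  + apply (IH (pdy f)); [|easy]. now apply pdy_ext.
Qed.

(** Including the lower orders makes products and quotients go through by
    induction on [k]. *)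
Definition Ckle (k : nat) (f : C -> R) : Prop := forall j, (j <= k)%nat -> Ck j U f.

Lemma Ckle_S (k : nat) (f : C -> R) : Ckle (S k) f <->
  (forall z, U z -> continuous f z) /\
  (forall z, U z -> ex_derive (fun t => f (t, snd z)) (fst z) /\ ex_derive (fun t => f (fst z, t)) (snd z)) /\
  Ckle k (pdx f) /\ Ckle k (pdy f).
Proof.
split.
- intros H. split; [apply (H 0%nat); lia|]. split; [apply (H 1%nat); lia|].
  split; intros j Hj; apply (H (S j)); lia.
- intros (H1 & H2 & H3 & H4) [|j] Hj; [exact H1|].
  split; [exact H2|]. split; [apply H3; lia|apply H4; lia].
Qed.

Lemma Ckle_0 (f : C -> R) : Ckle 0 f <-> forall z, U z -> continuous f z.
Proof.
split; [intros H; apply (H 0%nat); lia|]. intros H j Hj. now replace j with 0%nat by lia.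
Qed.

Lemma Ckle_ext (k : nat) (f g : C -> R) : (forall z, U z -> f z = g z) -> Ckle k f -> Ckle k g.
Proof. intros H Hf j Hj. apply (Ck_ext j f); [easy|now apply Hf]. Qed.

Lemma Ckle_const (k : nat) : forall c : R, Ckle k (fun _ => c).
Proof.
induction k as [|k IH]; intros c.
- apply Ckle_0. intros. apply continuous_const.
- apply Ckle_S. split; [intros; apply continuous_const|].
  split; [intros; split; apply ex_derive_const|].
  split; apply (Ckle_ext _ (fun _ => 0)); try apply IH; intros z _; symmetry; unfold pdx, pdy; apply Derive_const.
Qed.

Lemma Ckle_plus (k : nat) : forall f g, Ckle k f -> Ckle k g -> Ckle k (fun z => f z + g z).
Proof.
induction k as [|k IH]; intros f g.
- rewrite !Ckle_0. intros Hf Hg z Hz. apply continuous_Rplus; auto.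
- rewrite !Ckle_S. intros (F1 & F2 & F3 & F4) (G1 & G2 & G3 & G4).
  split; [intros z Hz; apply continuous_Rplus; auto|].
  split; [intros z Hz; destruct (F2 z Hz); destruct (G2 z Hz); split;
    now apply (@ex_derive_plus R_AbsRing R_NormedModule)|].
  split.
  + apply (Ckle_ext _ (fun z => pdx f z + pdx g z)); [|now apply IH].
    intros z Hz. destruct (F2 z Hz). destruct (G2 z Hz). symmetry. unfold pdx. now apply Derive_plus.
  + apply (Ckle_ext _ (fun z => pdy f z + pdy g z)); [|now apply IH].
    intros z Hz. destruct (F2 z Hz). destruct (G2 z Hz). symmetry. unfold pdy. now apply Derive_plus.
Qed.

Lemma Ckle_pred (k : nat) (f : C -> R) : Ckle (S k) f -> Ckle k f.
Proof. intros H j Hj. apply H. lia. Qed.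

Lemma Ckle_mult (k : nat) : forall f g, Ckle k f -> Ckle k g -> Ckle k (fun z => f z * g z).
Proof.
induction k as [|k IH]; intros f g.
- rewrite !Ckle_0. intros Hf Hg z Hz. apply continuous_Rmult; auto.
- intros Hf Hg. assert (Hf' := Ckle_pred _ _ Hf). assert (Hg' := Ckle_pred _ _ Hg).
  revert Hf Hg. rewrite !Ckle_S. intros (F1 & F2 & F3 & F4) (G1 & G2 & G3 & G4).
  split; [intros z Hz; apply continuous_Rmult; auto|].
  split; [intros z Hz; destruct (F2 z Hz); destruct (G2 z Hz); split; now apply ex_derive_mult|].
  split.
  + apply (Ckle_ext _ (fun z => pdx f z * g z + f z * pdx g z)).
    * intros z Hz. destruct (F2 z Hz). destruct (G2 z Hz). symmetry. destruct z as [x y].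
      unfold pdx. simpl in *. now apply (Derive_mult (fun t => f (t, y)) (fun t => g (t, y))).
    * apply Ckle_plus; now apply IH.
  + apply (Ckle_ext _ (fun z => pdy f z * g z + f z * pdy g z)).
    * intros z Hz. destruct (F2 z Hz). destruct (G2 z Hz). symmetry. destruct z as [x y].
      unfold pdy. simpl in *. now apply (Derive_mult (fun t => f (x, t)) (fun t => g (x, t))).
    * apply Ckle_plus; now apply IH.
Qed.

Lemma Ckle_inv (k : nat) : forall f, (forall z, U z -> f z <> 0) -> Ckle k f -> Ckle k (fun z => / f z).
Proof.
induction k as [|k IH]; intros f Hn.
- rewrite !Ckle_0. intros Hf z Hz. apply continuous_Rinv_comp; auto.
- intros Hf. assert (Hf' := Ckle_pred _ _ Hf).
  revert Hf. rewrite !Ckle_S. intros (F1 & F2 & F3 & F4).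
  split; [intros z Hz; apply continuous_Rinv_comp; auto|].
  split.
  { intros z Hz; destruct (F2 z Hz). destruct z as [x y]. specialize (Hn _ Hz). simpl in *.
    split; apply ex_derive_inv; easy. }
  split.
  + apply (Ckle_ext _ (fun z => (-1) * (pdx f z * (/ f z * / f z)))).
    * intros z Hz. destruct (F2 z Hz). specialize (Hn _ Hz). destruct z as [x y]. simpl in *. symmetry.
      unfold pdx at 1. simpl. rewrite (Derive_inv (fun t => f (t, y))) by easy.
      unfold pdx. simpl. field. easy.
    * apply Ckle_mult; [apply Ckle_const|]. apply Ckle_mult; [easy|].
      apply Ckle_mult; now apply IH.
  + apply (Ckle_ext _ (fun z => (-1) * (pdy f z * (/ f z * / f z)))).
    * intros z Hz. destruct (F2 z Hz). specialize (Hn _ Hz). destruct z as [x y]. simpl in *. symmetry.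
      unfold pdy at 1. simpl. rewrite (Derive_inv (fun t => f (x, t))) by easy.
      unfold pdy. simpl. field. easy.
    * apply Ckle_mult; [apply Ckle_const|]. apply Ckle_mult; [easy|].
      apply Ckle_mult; now apply IH.
Qed.

Definition sm (f : C -> R) : Prop := forall k, Ck k U f.

Lemma sm_iff (f : C -> R) : sm f <-> forall k, Ckle k f.
Proof. split; [intros H k j _; apply H|]. intros H k. now apply (H k). Qed.

Lemma sm_const (c : R) : sm (fun _ => c).
Proof. apply sm_iff. intros k. apply Ckle_const. Qed.
Lemma sm_plus (f g : C -> R) : sm f -> sm g -> sm (fun z => f z + g z).
Proof. rewrite !sm_iff. intros F G k. now apply Ckle_plus. Qed.
Lemma sm_mult (f g : C -> R) : sm f -> sm g -> sm (fun z => f z * g z).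
Proof. rewrite !sm_iff. intros F G k. now apply Ckle_mult. Qed.
Lemma sm_inv (f : C -> R) : (forall z, U z -> f z <> 0) -> sm f -> sm (fun z => / f z).
Proof. rewrite !sm_iff. intros H F k. now apply Ckle_inv. Qed.
Lemma sm_ext (f g : C -> R) : (forall z, U z -> f z = g z) -> sm f -> sm g.
Proof. intros H F k. now apply (Ck_ext k f). Qed.
Lemma sm_pdx (f : C -> R) : sm f -> sm (pdx f).
Proof. intros F k. apply (F (S k)). Qed.
Lemma sm_pdy (f : C -> R) : sm f -> sm (pdy f).
Proof. intros F k. apply (F (S k)). Qed.
Lemma sm_ex (f : C -> R) (z : C) : sm f -> U z ->
  is_derive (fun t => f (t, snd z)) (fst z) (pdx f z) /\
  is_derive (fun t => f (fst z, t)) (snd z) (pdy f z).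
Proof.
intros F Hz. destruct (proj1 (F 1%nat) z Hz). split; now apply Derive_correct.
Qed.
End Smooth.

(** * Transformations that preserve Bryant surfaces *)

Definition dcurve (c : R -> E3) (t : R) (v : E3) : Prop :=
  is_derive (fun u => pos1 (c u)) t (pos1 v) /\
  is_derive (fun u => pos2 (c u)) t (pos2 v) /\
  is_derive (fun u => height (c u)) t (height v).

(** A transformation with its first derivative and the second derivative of
    its composition with a curve. *)
Record motion (Phi : E3 -> E3) (dPhi : E3 -> E3 -> E3) (d2Phi : E3 -> E3 -> E3 -> E3) : Prop := {
  motion_H3 : forall p, H3 p -> H3 (Phi p);
  motion_smooth : forall (U : C -> Prop) (X : C -> E3), open_lines U -> (forall z, U z -> H3 (X z)) ->
    smooth U X -> smooth U (fun z => Phi (X z));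
  motion_d : forall c t v, H3 (c t) -> dcurve c t v ->
    dcurve (fun u => Phi (c u)) t (dPhi (c t) v);
  motion_d2 : forall c c1 t a, H3 (c t) -> dcurve c t (c1 t) -> dcurve c1 t a ->
    dcurve (fun u => dPhi (c u) (c1 u)) t (d2Phi (c t) (c1 t) a);
  motion_hyp : forall p u v, H3 p -> hyp (Phi p) (dPhi p u) (dPhi p v) = hyp p u v;
  motion_cov : forall p v a n, H3 p ->
    hyp (Phi p) (cov_deriv (Phi p) (dPhi p v) (dPhi p v) (d2Phi p v a)) (dPhi p n) =
    hyp p (cov_deriv p v v a) n
}.

Lemma E3_ext (p q : E3) : pos1 p = pos1 q -> pos2 p = pos2 q -> height p = height q -> p = q.
Proof. destruct p as [[a b] c], q as [[a' b'] c']. unfold pos1, pos2, height; simpl. now intros -> -> ->. Qed.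

Lemma dcurve_ext_loc (c c' : R -> E3) (t : R) (v : E3) :
  locally t (fun u => c u = c' u) -> dcurve c t v -> dcurve c' t v.
Proof.
intros H (H1 & H2 & H3).
assert (K : forall f : E3 -> R, locally t (fun u => f (c u) = f (c' u))).
{ intros f. revert H. apply filter_imp. now intros u ->. }
split; [|split].
- exact (is_derive_ext_loc _ _ _ _ (K pos1) H1).
- exact (is_derive_ext_loc _ _ _ _ (K pos2) H2).
- exact (is_derive_ext_loc _ _ _ _ (K height) H3).
Qed.

Lemma dcurve_unique (c : R -> E3) (t : R) (v : E3) : dcurve c t v ->
  v = ((Derive (fun u => pos1 (c u)) t, Derive (fun u => pos2 (c u)) t), Derive (fun u => height (c u)) t).
Proof.
intros (H1 & H2 & H3). apply E3_ext; symmetry; now apply is_derive_unique.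
Qed.

Lemma smooth_sm (U : C -> Prop) (X : C -> E3) : smooth U X <->
  sm U (fun z => pos1 (X z)) /\ sm U (fun z => pos2 (X z)) /\ sm U (fun z => height (X z)).
Proof.
split.
- intros H. repeat split; intros k; apply H.
- intros (H1 & H2 & H3) k. repeat split; [apply H1|apply H2|apply H3].
Qed.

Section Motion.
Variables (U : C -> Prop) (X : C -> E3).
Hypothesis HU : open_lines U.
Hypothesis HX : smooth U X.

Lemma dcurve_vdx (z : C) : U z -> dcurve (fun t => X (t, snd z)) (fst z) (vdx X z) /\
  dcurve (fun t => X (fst z, t)) (snd z) (vdy X z).
Proof.
intros Hz. apply smooth_sm in HX. destruct HX as (H1 & H2 & H3).
destruct (sm_ex U _ z H1 Hz). destruct (sm_ex U _ z H2 Hz). destruct (sm_ex U _ z H3 Hz).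
split; (split; [assumption|split; assumption]).
Qed.

Lemma smooth_vdx : smooth U (vdx X) /\ smooth U (vdy X).
Proof.
apply smooth_sm in HX. destruct HX as (H1 & H2 & H3).
split; apply smooth_sm; repeat split; try (now apply sm_pdx); now apply sm_pdy.
Qed.
End Motion.

Lemma dcurve_line_eq (z : C) : (fst z, snd z) = z.
Proof. now destruct z. Qed.

Section Invariance.
Variables (Phi : E3 -> E3) (dPhi : E3 -> E3 -> E3) (d2Phi : E3 -> E3 -> E3 -> E3).
Hypothesis HM : motion Phi dPhi d2Phi.
Variables (U : C -> Prop) (X : C -> E3).
Hypothesis HU : open_lines U.
Hypothesis HX : smooth U X.
Hypothesis HH : forall z, U z -> H3 (X z).

Lemma vdx_motion (z : C) : U z ->
  vdx (fun z => Phi (X z)) z = dPhi (X z) (vdx X z) /\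
  vdy (fun z => Phi (X z)) z = dPhi (X z) (vdy X z).
Proof.
intros Hz. destruct (dcurve_vdx U X HX z Hz) as [D1 D2].
apply (motion_d _ _ _ HM) in D1; [|rewrite dcurve_line_eq; now apply HH].
apply (motion_d _ _ _ HM) in D2; [|rewrite dcurve_line_eq; now apply HH].
rewrite dcurve_line_eq in D1, D2. apply dcurve_unique in D1. apply dcurve_unique in D2.
rewrite D1, D2. split; reflexivity.
Qed.

Lemma vdxx_motion (z : C) : U z ->
  vdx (vdx (fun z => Phi (X z))) z = d2Phi (X z) (vdx X z) (vdx (vdx X) z) /\
  vdy (vdy (fun z => Phi (X z))) z = d2Phi (X z) (vdy X z) (vdy (vdy X) z).
Proof.
intros Hz. destruct (dcurve_vdx U X HX z Hz) as [D1 D2].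
destruct (smooth_vdx U X HX) as [S1 S2].
destruct (dcurve_vdx U _ S1 z Hz) as [D3 _]. destruct (dcurve_vdx U _ S2 z Hz) as [_ D4].
split.
- assert (E := motion_d2 _ _ _ HM (fun t => X (t, snd z)) (fun t => vdx X (t, snd z)) (fst z) (vdx (vdx X) z)).
  cbv beta in E. rewrite dcurve_line_eq in E. specialize (E (HH z Hz) D1 D3).
  apply (dcurve_ext_loc _ (fun t => vdx (fun z => Phi (X z)) (t, snd z))) in E.
  + apply dcurve_unique in E. rewrite E. reflexivity.
  + generalize (proj1 (HU z Hz)). apply filter_imp. intros t Ht. symmetry. now apply vdx_motion.
- assert (E := motion_d2 _ _ _ HM (fun t => X (fst z, t)) (fun t => vdy X (fst z, t)) (snd z) (vdy (vdy X) z)).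
  cbv beta in E. rewrite dcurve_line_eq in E. specialize (E (HH z Hz) D2 D4).
  apply (dcurve_ext_loc _ (fun t => vdy (fun z => Phi (X z)) (fst z, t))) in E.
  + apply dcurve_unique in E. rewrite E. reflexivity.
  + generalize (proj1 (proj2 (HU z Hz))). apply filter_imp. intros t Ht. symmetry. now apply vdx_motion.
Qed.

Lemma ff_motion (z : C) : U z ->
  ff_xx (fun z => Phi (X z)) z = ff_xx X z /\ ff_yy (fun z => Phi (X z)) z = ff_yy X z /\
  ff_xy (fun z => Phi (X z)) z = ff_xy X z.
Proof.
intros Hz. destruct (vdx_motion z Hz) as [E1 E2]. unfold ff_xx, ff_yy, ff_xy. rewrite E1, E2.
repeat split; now apply (motion_hyp _ _ _ HM), HH.
Qed.

Lemma sff_motion (z : C) (N : E3) : U z ->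
  sff_xx (fun z => Phi (X z)) z (dPhi (X z) N) = sff_xx X z N /\
  sff_yy (fun z => Phi (X z)) z (dPhi (X z) N) = sff_yy X z N.
Proof.
intros Hz. destruct (vdx_motion z Hz) as [E1 E2]. destruct (vdxx_motion z Hz) as [E3 E4].
unfold sff_xx, sff_yy. rewrite E1, E2, E3, E4.
split; now apply (motion_cov _ _ _ HM), HH.
Qed.
End Invariance.

Lemma bryant_end_motion (Phi : E3 -> E3) (dPhi : E3 -> E3 -> E3) (d2Phi : E3 -> E3 -> E3 -> E3)
  (rho : R) (X : C -> E3) : motion Phi dPhi d2Phi -> bryant_end rho X ->
  bryant_end rho (fun z => Phi (X z)) /\
  forall z, pdisc rho z -> ff_xx (fun z => Phi (X z)) z = ff_xx X z.
Proof.
intros HM (Hr & HH & HS & HC & N & HN).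
assert (HU := pdisc_open rho).
assert (FF := ff_motion Phi dPhi d2Phi HM (pdisc rho) X HS HH).
split; [|intros z Hz; now apply FF].
split; [easy|]. split; [intros z Hz; now apply (motion_H3 _ _ _ HM), HH|].
split; [now apply (motion_smooth _ _ _ HM)|].
split.
- intros z Hz. destruct (FF z Hz) as (-> & -> & ->). now apply HC.
- exists (fun z => dPhi (X z) (N z)). intros z Hz.
  destruct (HN z Hz) as [(N1 & N2 & N3) N4]. split.
  + destruct (vdx_motion Phi dPhi d2Phi HM (pdisc rho) X HS HH z Hz) as [E1 E2].
    unfold unit_normal. rewrite E1, E2. repeat split; rewrite (motion_hyp _ _ _ HM); auto.
  + rewrite <- N4. unfold mean_curvature.
    destruct (FF z Hz) as (-> & -> & ->).
    destruct (sff_motion Phi dPhi d2Phi HM (pdisc rho) X HU HS HH z (N z) Hz) as [-> ->].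
    destruct (HC z Hz) as (_ & _ & ->). f_equal. ring.
Qed.

Lemma bryant_end_ext (rho : R) (X Y : C -> E3) : (forall z, pdisc rho z -> X z = Y z) ->
  bryant_end rho X -> bryant_end rho Y /\ forall z, pdisc rho z -> ff_xx Y z = ff_xx X z.
Proof.
intros H (Hr & HH & HS & HC & N & HN).
assert (HU := pdisc_open rho).
assert (V : forall X Y : C -> E3, (forall z, pdisc rho z -> X z = Y z) ->
   forall z, pdisc rho z -> vdx Y z = vdx X z /\ vdy Y z = vdy X z).
{ clear -HU. intros X Y H z Hz. 
  assert (K : forall f : E3 -> R, forall w, pdisc rho w -> f (Y w) = f (X w)).
  { intros f w Hw. now rewrite (H w Hw). }
  assert (Kx : forall f : E3 -> R, pdx (fun w => f (Y w)) z = pdx (fun w => f (X w)) z).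
  { intros f. exact (pdx_ext _ HU _ _ (K f) z Hz). }
  assert (Ky : forall f : E3 -> R, pdy (fun w => f (Y w)) z = pdy (fun w => f (X w)) z).
  { intros f. exact (pdy_ext _ HU _ _ (K f) z Hz). }
  unfold vdx, vdy. split; [now rewrite !Kx|now rewrite !Ky]. }
assert (V1 := V X Y H).
assert (V2 := V (vdx X) (vdx Y) (fun z Hz => eq_sym (proj1 (V1 z Hz)))).
assert (V3 := V (vdy X) (vdy Y) (fun z Hz => eq_sym (proj2 (V1 z Hz)))).
assert (FF : forall z, pdisc rho z -> ff_xx Y z = ff_xx X z /\ ff_yy Y z = ff_yy X z /\ ff_xy Y z = ff_xy X z).
{ intros z Hz. unfold ff_xx, ff_yy, ff_xy. destruct (V1 z Hz) as [-> ->]. now rewrite <- (H z Hz). }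
split; [|intros z Hz; now apply FF].
split; [easy|]. split; [intros z Hz; rewrite <- H by easy; now apply HH|].
split.
{ apply smooth_sm in HS. destruct HS as (S1 & S2 & S3). apply smooth_sm.
  split; [|split]; [refine (sm_ext _ HU _ _ _ S1)|refine (sm_ext _ HU _ _ _ S2)|refine (sm_ext _ HU _ _ _ S3)];
    intros z Hz; cbv beta; now rewrite H. }
split.
- intros z Hz. destruct (FF z Hz) as (-> & -> & ->). now apply HC.
- exists N. intros z Hz. destruct (HN z Hz) as [N1 N2]. split.
  + unfold unit_normal in *. destruct (V1 z Hz) as [-> ->]. now rewrite <- H.
  + rewrite <- N2. unfold mean_curvature, sff_xx, sff_xy, sff_yy.
    destruct (FF z Hz) as (-> & -> & ->). destruct (V2 z Hz) as [-> _]. destruct (V3 z Hz) as [-> ->].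
    destruct (V1 z Hz) as [-> ->]. now rewrite <- H.
Qed.

(** * Similarities and the inversion *)

Definition lin (a b c d m : R) (v : E3) : E3 :=
  ((a * pos1 v + b * pos2 v, c * pos1 v + d * pos2 v), m * height v).

Definition simil (a b c d m e f : R) (p : E3) : E3 :=
  ((a * pos1 p + b * pos2 p + e, c * pos1 p + d * pos2 p + f), m * height p).

Lemma is_derive_comb (f g : R -> R) (t l k a b e : R) : is_derive f t l -> is_derive g t k ->
  is_derive (fun u => a * f u + b * g u + e) t (a * l + b * k).
Proof.
intros Hf Hg. eapply is_derive_eq.
- apply (@is_derive_plus R_AbsRing R_NormedModule (fun u => a * f u + b * g u) (fun _ => e));
    [|apply is_derive_const].
  apply (@is_derive_plus R_AbsRing R_NormedModule (fun u => a * f u) (fun u => b * g u));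
    apply is_derive_scal; eassumption.
- unfold plus, zero; simpl. ring.
Qed.

Lemma dcurve_lin (c0 : R -> E3) (t : R) (v : E3) (a b c d m e f : R) : dcurve c0 t v ->
  dcurve (fun u => simil a b c d m e f (c0 u)) t (lin a b c d m v).
Proof.
intros (H1 & H2 & H3). unfold dcurve, simil, lin, pos1 at 1 3, pos2 at 1 3, height at 1 2. cbn [fst snd].
split; [|split].
- now apply (is_derive_comb (fun u => pos1 (c0 u)) (fun u => pos2 (c0 u))).
- now apply (is_derive_comb (fun u => pos1 (c0 u)) (fun u => pos2 (c0 u))).
- now apply (is_derive_scal (fun u => height (c0 u))).
Qed.

Ltac unfold_E3 :=
  unfold hyp, cov_deriv, eucl, lin, simil, pos1, pos2, height,
    minus, plus, opp, scal in *; simpl in *;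
  unfold mult in *; simpl in *; unfold prod_plus, prod_opp, prod_scal in *; simpl in *;
  unfold plus, opp, scal in *; simpl in *; unfold prod_plus, prod_opp, prod_scal in *; simpl in *;
  unfold plus, opp, scal, mult in *; simpl in *; unfold mult in *; simpl in *.

Lemma motion_simil (a b c d m e f : R) : 0 < m ->
  a * a + c * c = m * m -> b * b + d * d = m * m -> a * b + c * d = 0 ->
  motion (simil a b c d m e f) (fun _ => lin a b c d m) (fun _ _ => lin a b c d m).
Proof.
intros Hm Q1 Q2 Q3.
assert (HE : forall u v, eucl (lin a b c d m u) (lin a b c d m v) = m * m * eucl u v).
{ intros [[u1 u2] u3] [[v1 v2] v3]. unfold eucl, lin, pos1, pos2, height; simpl.
  transitivity ((a * a + c * c) * (u1 * v1) + (b * b + d * d) * (u2 * v2) +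
    (a * b + c * d) * (u1 * v2 + u2 * v1) + m * m * (u3 * v3)); [ring|].
  rewrite Q1, Q2, Q3. ring. }
constructor.
- intros p Hp. unfold H3, simil, height in *. simpl. now apply Rmult_lt_0_compat.
- intros U X HU HH HX. apply smooth_sm in HX. destruct HX as (S1 & S2 & S3).
  assert (K : forall a b e, sm U (fun z => a * pos1 (X z) + b * pos2 (X z) + e)).
  { intros. apply sm_plus; [easy| |apply sm_const; easy].
    apply sm_plus; [easy| |]; apply sm_mult; try easy; apply sm_const; easy. }
  apply smooth_sm. split; [|split].
  + exact (K a b e).
  + exact (K c d f).
  + apply (sm_mult U HU (fun _ => m)); [apply sm_const; easy|easy].
- intros c0 t v _ Hd. now apply dcurve_lin.
- intros c0 c1 t a0 _ _ Hd. generalize (dcurve_lin c1 t a0 a b c d m 0 0 Hd).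
  apply dcurve_ext_loc. apply filter_forall. intros u. apply E3_ext; unfold simil, lin, pos1, pos2, height; simpl; ring.
- intros p u v Hp. unfold hyp. rewrite HE. unfold H3, simil, height in *. simpl. field.
  split; apply Rgt_not_eq; [exact Hp|exact Hm].
- intros p v a0 n Hp.
  assert (E : cov_deriv (simil a b c d m e f p) (lin a b c d m v) (lin a b c d m v) (lin a b c d m a0)
    = lin a b c d m (cov_deriv p v v a0)).
  { unfold cov_deriv. rewrite HE. destruct p as [[p1 p2] p3], v as [[v1 v2] v3], a0 as [[a1 a2] a3].
    unfold H3, height in Hp. simpl in Hp.
    apply E3_ext; unfold_E3; field; lra. }
  rewrite E. unfold hyp. rewrite HE. unfold H3, simil, height in *. simpl. field.
  split; apply Rgt_not_eq; [exact Hp|exact Hm].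
Qed.

Definition aff (al be : C) (p : E3) : E3 := ((al * zeta p + be)%C, Cmod al * height p).
Definition affc (al be : C) (p : E3) : E3 := ((al * Cconj (zeta p) + be)%C, Cmod al * height p).

Lemma aff_simil (al be : C) (p : E3) :
  aff al be p = simil (Re al) (- Im al) (Im al) (Re al) (Cmod al) (Re be) (Im be) p.
Proof. apply E3_ext; unfold aff, simil, zeta, pos1, pos2, height, Re, Im; simpl; ring. Qed.

Lemma affc_simil (al be : C) (p : E3) :
  affc al be p = simil (Re al) (Im al) (Im al) (- Re al) (Cmod al) (Re be) (Im be) p.
Proof. apply E3_ext; unfold affc, simil, zeta, pos1, pos2, height, Re, Im; simpl; ring. Qed.

Definition inversion (p : E3) : E3 := scal (/ eucl p p) p.
(** The derivative of the inversion at [p] in the direction [v]. *)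
Definition dinv (p v : E3) : E3 :=
  minus (scal (/ eucl p p) v) (scal (2 * eucl p v / eucl p p ^ 2) p).
(** The second derivative of the inversion of a curve at [p] with velocity [v]
    and acceleration [a]. *)
Definition d2inv (p v a : E3) : E3 :=
  minus (plus (scal (/ eucl p p) a) (scal (8 * eucl p v ^ 2 / eucl p p ^ 3) p))
    (plus (scal (4 * eucl p v / eucl p p ^ 2) v)
       (scal (2 * (eucl v v + eucl p a) / eucl p p ^ 2) p)).

Lemma eucl_pos (p : E3) : H3 p -> 0 < eucl p p.
Proof.
unfold H3, eucl. intros H. assert (0 < height p * height p) by nra.
assert (0 <= pos1 p * pos1 p) by apply Rle_0_sqr. assert (0 <= pos2 p * pos2 p) by apply Rle_0_sqr. lra.
Qed.

Lemma motion_inversion : motion inversion dinv d2inv.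
Proof.
constructor.
- intros p Hp. assert (HN := eucl_pos p Hp). unfold H3, inversion in *.
  change (0 < / eucl p p * height p). apply Rmult_lt_0_compat; [now apply Rinv_0_lt_compat|easy].
- intros U X HU HH HX. apply smooth_sm in HX. destruct HX as (S1 & S2 & S3).
  assert (SN : sm U (fun z => / eucl (X z) (X z))).
  { apply sm_inv; [easy| |].
    - intros z Hz. generalize (eucl_pos _ (HH z Hz)). lra.
    - unfold eucl. apply sm_plus; [easy| |now apply sm_mult].
      apply sm_plus; [easy| |]; now apply sm_mult. }
  apply smooth_sm. split; [|split].
  + exact (sm_mult U HU _ _ SN S1).
  + exact (sm_mult U HU _ _ SN S2).
  + exact (sm_mult U HU _ _ SN S3).
- intros c t v Hp (D1 & D2 & D3). assert (HN := eucl_pos _ Hp).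
  set (x := fun u => pos1 (c u)) in *. set (y := fun u => pos2 (c u)) in *. set (w := fun u => height (c u)) in *.
  assert (HN' : x t * x t + y t * y t + w t * w t <> 0) by (unfold x, y, w; unfold eucl in HN; lra).
  assert (X1 : ex_derive x t) by (eexists; exact D1). assert (X2 : ex_derive y t) by (eexists; exact D2).
  assert (X3 : ex_derive w t) by (eexists; exact D3).
  apply is_derive_unique in D1, D2, D3.
  change (Derive x t = pos1 v) in D1. change (Derive y t = pos2 v) in D2. change (Derive w t = height v) in D3.
  assert (K : forall f : R -> R, ex_derive f t ->
    is_derive (fun u => / (x u * x u + y u * y u + w u * w u) * f u) t
     (/ (x t * x t + y t * y t + w t * w t) * Derive f t -
      2 * (x t * Derive x t + y t * Derive y t + w t * Derive w t) / (x t * x t + y t * y t + w t * w t) ^ 2 * f t)).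
  { intros f Hf. auto_derive; [tauto|].
    change (Derive (fun x0 : R => x x0) t) with (Derive x t). change (Derive (fun x0 : R => y x0) t) with (Derive y t).
    change (Derive (fun x0 : R => w x0) t) with (Derive w t). change (Derive (fun x0 : R => f x0) t) with (Derive f t).
    field. easy. }
  split; [|split].
  + eapply is_derive_eq; [exact (K x X1)|]. rewrite D1, D2, D3. reflexivity.
  + eapply is_derive_eq; [exact (K y X2)|]. rewrite D1, D2, D3. reflexivity.
  + eapply is_derive_eq; [exact (K w X3)|]. rewrite D1, D2, D3. reflexivity.
- intros c c1 t a Hp (D1 & D2 & D3) (E1 & E2 & E3). assert (HN := eucl_pos _ Hp).
  set (x := fun u => pos1 (c u)) in *. set (y := fun u => pos2 (c u)) in *. set (w := fun u => height (c u)) in *.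
  set (x1 := fun u => pos1 (c1 u)) in *. set (y1 := fun u => pos2 (c1 u)) in *. set (w1 := fun u => height (c1 u)) in *.
  assert (HN' : x t * x t + y t * y t + w t * w t <> 0) by (unfold x, y, w; unfold eucl in HN; lra).
  assert (X1 : ex_derive x t) by (eexists; exact D1). assert (X2 : ex_derive y t) by (eexists; exact D2).
  assert (X3 : ex_derive w t) by (eexists; exact D3).
  assert (Y1 : ex_derive x1 t) by (eexists; exact E1). assert (Y2 : ex_derive y1 t) by (eexists; exact E2).
  assert (Y3 : ex_derive w1 t) by (eexists; exact E3).
  apply is_derive_unique in D1, D2, D3, E1, E2, E3.
  change (Derive x t = x1 t) in D1. change (Derive y t = y1 t) in D2. change (Derive w t = w1 t) in D3.
  change (Derive x1 t = pos1 a) in E1. change (Derive y1 t = pos2 a) in E2. change (Derive w1 t = height a) in E3.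
  pose (N := x t * x t + y t * y t + w t * w t).
  pose (S := x t * x1 t + y t * y1 t + w t * w1 t).
  pose (S' := x1 t * x1 t + y1 t * y1 t + w1 t * w1 t + (x t * pos1 a + y t * pos2 a + w t * height a)).
  assert (K : forall f f1 : R -> R, ex_derive f t -> ex_derive f1 t -> Derive f t = f1 t ->
    is_derive (fun u => / (x u * x u + y u * y u + w u * w u) * f1 u -
       2 * (x u * x1 u + y u * y1 u + w u * w1 u) / (x u * x u + y u * y u + w u * w u) ^ 2 * f u) t
     (/ N * Derive f1 t + 8 * S ^ 2 / N ^ 3 * f t - (4 * S / N ^ 2 * f1 t + 2 * S' / N ^ 2 * f t))).
  { intros f f1 Hf Hf1 Hff. auto_derive.
    - repeat (split; [easy|]). split; [|easy].
      rewrite Rmult_1_r. now apply Rmult_integral_contrapositive.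
    - change (Derive (fun x0 : R => x x0) t) with (Derive x t). change (Derive (fun x0 : R => y x0) t) with (Derive y t).
      change (Derive (fun x0 : R => w x0) t) with (Derive w t). change (Derive (fun x0 : R => f x0) t) with (Derive f t).
      change (Derive (fun x0 : R => x1 x0) t) with (Derive x1 t). change (Derive (fun x0 : R => y1 x0) t) with (Derive y1 t).
      change (Derive (fun x0 : R => w1 x0) t) with (Derive w1 t). change (Derive (fun x0 : R => f1 x0) t) with (Derive f1 t).
      rewrite Hff, D1, D2, D3, E1, E2, E3. unfold N, S, S'. field. easy. }
  split; [|split].
  + eapply is_derive_eq; [exact (K x x1 X1 Y1 D1)|]. rewrite E1. reflexivity.
  + eapply is_derive_eq; [exact (K y y1 X2 Y2 D2)|]. rewrite E2. reflexivity.
  + eapply is_derive_eq; [exact (K w w1 X3 Y3 D3)|]. rewrite E3. reflexivity.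
- intros p u v Hp. assert (HN := eucl_pos p Hp).
  destruct p as [[x y] w], u as [[u1 u2] u3], v as [[v1 v2] v3].
  unfold H3 in Hp. unfold inversion, dinv. unfold_E3. field. lra.
- intros p v a n Hp. assert (HN := eucl_pos p Hp).
  destruct p as [[x y] w], v as [[v1 v2] v3], a as [[a1 a2] a3], n as [[n1 n2] n3].
  unfold H3 in Hp. unfold inversion, dinv, d2inv. unfold_E3. field. lra.
Qed.

Lemma is_linear_form (a b c : R) :
  @is_linear R_AbsRing E3 R_NormedModule (fun v => a * pos1 v + b * pos2 v + c * height v).
Proof.
assert (L1 : @is_linear R_AbsRing E3 R_NormedModule (fun v => pos1 v)).
{ apply (is_linear_comp (fun v : E3 => fst v) (fun z : C => fst z)); apply is_linear_fst. }
assert (L2 : @is_linear R_AbsRing E3 R_NormedModule (fun v => pos2 v)).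
{ apply (is_linear_comp (fun v : E3 => fst v) (fun z : C => snd z)); [apply is_linear_fst|apply is_linear_snd]. }
assert (L3 : @is_linear R_AbsRing E3 R_NormedModule (fun v => height v)) by apply is_linear_snd.
assert (K : forall (k : R) l, @is_linear R_AbsRing E3 R_NormedModule l ->
  @is_linear R_AbsRing E3 R_NormedModule (fun v => k * l v)).
{ intros k l Hl. apply (is_linear_comp l (fun x : R => k * x)); [easy|].
  apply (@is_linear_scal_r R_AbsRing R_NormedModule k). intros; apply Rmult_comm. }
assert (S : forall l m, @is_linear R_AbsRing E3 R_NormedModule l -> @is_linear R_AbsRing E3 R_NormedModule m ->
  @is_linear R_AbsRing E3 R_NormedModule (fun v => l v + m v)).
{ intros l m Hl Hm. apply (is_linear_comp (fun v => (l v, m v)) (fun x : R * R => fst x + snd x)).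
  - now apply is_linear_prod.
  - apply (@is_linear_plus R_AbsRing R_NormedModule). }
apply (S (fun v => a * pos1 v + b * pos2 v)); [apply S|]; now apply K.
Qed.

Lemma is_linear_lin (a b c d m : R) : @is_linear R_AbsRing E3 E3 (lin a b c d m).
Proof.
apply (is_linear_ext (fun v : E3 => ((a * pos1 v + b * pos2 v + 0 * height v, c * pos1 v + d * pos2 v + 0 * height v),
   0 * pos1 v + 0 * pos2 v + m * height v) : E3)).
- intros v. unfold lin. apply E3_ext; unfold pos1, pos2, height; simpl; ring.
- apply (is_linear_prod (fun v : E3 => (a * pos1 v + b * pos2 v + 0 * height v, c * pos1 v + d * pos2 v + 0 * height v))
    (fun v : E3 => 0 * pos1 v + 0 * pos2 v + m * height v)); [|apply is_linear_form].
  apply (is_linear_prod (fun v : E3 => a * pos1 v + b * pos2 v + 0 * height v)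
    (fun v : E3 => c * pos1 v + d * pos2 v + 0 * height v)); apply is_linear_form.
Qed.

Lemma filterdiff_simil (a b c d m e f : R) (p : E3) :
  filterdiff (simil a b c d m e f) (locally p) (lin a b c d m).
Proof.
apply (filterdiff_ext_lin _ (fun v => plus (lin a b c d m v) zero)).
2: { intros v. apply plus_zero_r. }
apply (filterdiff_ext (fun v => plus (lin a b c d m v) (((e, f), 0) : E3))).
{ intros v. apply E3_ext; unfold lin, simil, pos1, pos2, height; simpl; unfold plus; simpl; ring. }
apply filterdiff_plus_fct; [apply filterdiff_linear, is_linear_lin|].
apply filterdiff_const.
Qed.

Lemma filterdiff_inversion (p : E3) : eucl p p <> 0 ->
  filterdiff inversion (locally p) (dinv p).
Proof.
intros Hp. assert (FF : Filter (locally p)) by apply filter_filter.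
assert (P : forall l : E3 -> R, @is_linear R_AbsRing E3 R_NormedModule l ->
   filterdiff (fun q => l q * l q) (locally p) (fun v => l v * l p + l p * l v)).
{ intros l Hl. apply (@filterdiff_mult_fct R_AbsRing E3 l l p l l); [intros; apply Rmult_comm| |];
  now apply filterdiff_linear. }
assert (L1 := is_linear_form 1 0 0). assert (L2 := is_linear_form 0 1 0). assert (L3 := is_linear_form 0 0 1).
assert (HE : filterdiff (fun q : E3 => eucl q q) (locally p) (fun v => 2 * eucl p v)).
{ assert (HE0 := @filterdiff_plus_fct R_AbsRing E3 R_NormedModule _ FF _ _ _ _
    (@filterdiff_plus_fct R_AbsRing E3 R_NormedModule _ FF _ _ _ _ (P _ L1) (P _ L2)) (P _ L3)).
  refine (@filterdiff_ext_lin R_AbsRing E3 R_NormedModule _ FF _ _ _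
    (@filterdiff_ext R_AbsRing E3 R_NormedModule _ FF _ _ _ _ HE0) _).
  - intros q. unfold plus, eucl; simpl. ring.
  - intros v. unfold plus, eucl; simpl. ring. }
assert (HI : filterdiff (fun q : E3 => / eucl q q) (locally p) (fun v => scal (2 * eucl p v) (- / eucl p p ^ 2))).
{ apply (filterdiff_comp' (fun q : E3 => eucl q q) Rinv p (fun v => 2 * eucl p v)
    (fun y => scal y (- / eucl p p ^ 2))); [easy|].
  assert (D : is_derive Rinv (eucl p p) (- / eucl p p ^ 2)).
  { eapply is_derive_eq; [apply (is_derive_inv (fun x => x)); [apply is_derive_id|easy]|]. unfold one; simpl. field. easy. }
  exact D. }
refine (@filterdiff_ext_lin R_AbsRing E3 E3 _ FF _ _ _
  (@filterdiff_scal_fct R_AbsRing E3 E3 p (fun q => / eucl q q) (fun q => q) _ _ Rmult_comm HI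
    (filterdiff_id _)) _).
intros v. unfold dinv. destruct p as [[x y] w], v as [[v1 v2] v3].
  apply E3_ext; unfold_E3; field; exact Hp.
Qed.

Lemma locally_H3 (p : E3) : H3 p -> locally p H3.
Proof.
intros Hp. destruct p as [z w]. exists (mkposreal w Hp). intros [z' w'] [_ Hw].
unfold H3, height in *. simpl in *. change (Rabs (w' - w) < w) in Hw. apply Rabs_def2 in Hw. lra.
Qed.

Lemma preserves_metric_comp (Phi Psi : E3 -> E3) :
  preserves_metric Phi -> preserves_metric Psi -> preserves_metric (fun p => Phi (Psi p)).
Proof.
intros H1 H2 p Hp. destruct (H2 p Hp) as (K1 & L & D & I). destruct (H1 _ K1) as (K1' & L' & D' & I').
split; [easy|]. exists (fun v => L' (L v)). split.
- now apply (filterdiff_comp' Psi Phi).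
- intros u v. now rewrite I', I.
Qed.

Lemma preserves_metric_ext (Phi Psi : E3 -> E3) : (forall p, H3 p -> Phi p = Psi p) ->
  preserves_metric Phi -> preserves_metric Psi.
Proof.
intros H H1 p Hp. destruct (H1 p Hp) as (K1 & L & D & I). rewrite <- H by easy.
split; [easy|]. exists L. split; [|easy].
apply (filterdiff_ext_locally Phi); [|easy].
generalize (locally_H3 p Hp). apply filter_imp. exact H.
Qed.

Lemma preserves_metric_simil (a b c d m e f : R) : 0 < m ->
  a * a + c * c = m * m -> b * b + d * d = m * m -> a * b + c * d = 0 ->
  preserves_metric (simil a b c d m e f).
Proof.
intros Hm Q1 Q2 Q3 p Hp. assert (M := motion_simil a b c d m e f Hm Q1 Q2 Q3).
split; [now apply (motion_H3 _ _ _ M)|]. exists (lin a b c d m). split; [apply filterdiff_simil|].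
intros u v. now apply (motion_hyp _ _ _ M).
Qed.

Lemma preserves_metric_inversion : preserves_metric inversion.
Proof.
intros p Hp. split; [now apply (motion_H3 _ _ _ motion_inversion)|]. exists (dinv p). split.
- apply filterdiff_inversion. generalize (eucl_pos p Hp). lra.
- intros u v. now apply (motion_hyp _ _ _ motion_inversion).
Qed.

(** [cosh d - 1] for the hyperbolic distance [d]. *)
Definition delta (p q : E3) : R :=
  ((pos1 p - pos1 q) ^ 2 + (pos2 p - pos2 q) ^ 2 + (height p - height q) ^ 2) / (2 * height p * height q).

Definition keeps_delta (Phi : E3 -> E3) : Prop :=
  forall p q, H3 p -> H3 q -> delta (Phi p) (Phi q) = delta p q.

Lemma keeps_delta_simil (a b c d m e f : R) : 0 < m ->
  a * a + c * c = m * m -> b * b + d * d = m * m -> a * b + c * d = 0 ->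
  keeps_delta (simil a b c d m e f).
Proof.
intros Hm Q1 Q2 Q3 [[x y] w] [[x' y'] w'] Hp Hq. unfold H3, delta, simil, pos1, pos2, height in *. simpl in *.
transitivity (((a * a + c * c) * (x - x') ^ 2 + (b * b + d * d) * (y - y') ^ 2 +
  2 * (a * b + c * d) * ((x - x') * (y - y')) + m * m * (w - w') ^ 2) / (2 * (m * w) * (m * w'))).
- f_equal. ring.
- rewrite Q1, Q2, Q3. field. lra.
Qed.

Lemma keeps_delta_inversion : keeps_delta inversion.
Proof.
intros p q Hp Hq. assert (P := eucl_pos p Hp). assert (Q := eucl_pos q Hq).
destruct p as [[x y] w], q as [[x' y'] w'].
unfold delta, inversion, H3 in *. unfold_E3. field. lra.
Qed.

(** Everything that is needed of a Moebius transformation except its action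
    on the boundary. *)
Definition rigid (Phi : E3 -> E3) : Prop :=
  preserves_metric Phi /\ keeps_delta Phi /\
  (forall p, H3 p -> H3 (Phi p)) /\
  (forall rho X, bryant_end rho X -> bryant_end rho (fun z => Phi (X z)) /\
     forall z, pdisc rho z -> ff_xx (fun z => Phi (X z)) z = ff_xx X z).

Lemma rigid_comp (Phi Psi : E3 -> E3) : rigid Phi -> rigid Psi -> rigid (fun p => Phi (Psi p)).
Proof.
intros (A1 & A2 & A3 & A4) (B1 & B2 & B3 & B4). split; [now apply preserves_metric_comp|].
split; [intros p q Hp Hq; rewrite A2 by auto; now apply B2|].
split; [auto|]. intros rho X HX.
destruct (B4 rho X HX) as [HX1 F1]. destruct (A4 rho _ HX1) as [HX2 F2]. split; [exact HX2|].
intros z Hz. rewrite <- F1 by easy. now apply F2.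
Qed.

Lemma rigid_ext (Phi Psi : E3 -> E3) : (forall p, H3 p -> Phi p = Psi p) -> rigid Phi -> rigid Psi.
Proof.
intros H (A1 & A2 & A3 & A4). split; [now apply (preserves_metric_ext Phi)|].
split; [intros p q Hp Hq; rewrite <- !H by easy; now apply A2|].
split; [intros p Hp; rewrite <- H by easy; auto|]. intros rho X HX.
destruct (A4 rho X HX) as [HX1 F1].
destruct (bryant_end_ext rho _ (fun z => Psi (X z)) (fun z Hz => H _ (proj1 (proj2 HX) z Hz)) HX1) as [HX2 F2].
split; [easy|]. intros z Hz. rewrite <- F1 by easy. now apply F2.
Qed.

Lemma rigid_simil (a b c d m e f : R) : 0 < m ->
  a * a + c * c = m * m -> b * b + d * d = m * m -> a * b + c * d = 0 ->
  rigid (simil a b c d m e f).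
Proof.
intros Hm Q1 Q2 Q3. assert (M := motion_simil a b c d m e f Hm Q1 Q2 Q3).
split; [now apply preserves_metric_simil|]. split; [now apply keeps_delta_simil|].
split; [apply (motion_H3 _ _ _ M)|]. intros rho X HX. now apply (bryant_end_motion _ _ _ rho X M).
Qed.

Lemma rigid_inversion : rigid inversion.
Proof.
split; [apply preserves_metric_inversion|]. split; [apply keeps_delta_inversion|].
split; [apply (motion_H3 _ _ _ motion_inversion)|]. intros rho X HX.
now apply (bryant_end_motion _ _ _ rho X motion_inversion).
Qed.

Lemma Cmod_sqr_Re_Im (al : C) : Re al * Re al + Im al * Im al = Cmod al * Cmod al.
Proof. assert (H := Cmod2_alt al). simpl in H. lra. Qed.

Lemma rigid_aff (al be : C) : al <> RtoC 0 -> rigid (aff al be).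
Proof.
intros Ha. apply Cmod_gt_0 in Ha. assert (H := Cmod_sqr_Re_Im al).
apply (rigid_ext (simil (Re al) (- Im al) (Im al) (Re al) (Cmod al) (Re be) (Im be))).
- intros p _. symmetry. apply aff_simil.
- apply rigid_simil; [easy| | |]; lra.
Qed.

Lemma rigid_affc (al be : C) : al <> RtoC 0 -> rigid (affc al be).
Proof.
intros Ha. apply Cmod_gt_0 in Ha. assert (H := Cmod_sqr_Re_Im al).
apply (rigid_ext (simil (Re al) (Im al) (Im al) (- Re al) (Cmod al) (Re be) (Im be))).
- intros p _. symmetry. apply affc_simil.
- apply rigid_simil; [easy| | |]; lra.
Qed.

(** * The action of [GL(2)] on hyperbolic space *)

(** The point represented by [M], as for Bryant representations but for any
    nonzero determinant. *)
Definition pt (M : mat2) : E3 :=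
  (((Cconj (mA M) * mC M + Cconj (mB M) * mD M) / RtoC (Cmod (mA M) ^ 2 + Cmod (mB M) ^ 2))%C,
   Cmod (mat2_det M) / (Cmod (mA M) ^ 2 + Cmod (mB M) ^ 2)).

Definition frame (p : E3) : mat2 := Mat2 (RtoC 1) (RtoC 0) (zeta p) (RtoC (height p)).

(** The action of [L] on points that multiplies representations by [L] on the
    left. *)
Definition mob (L : mat2) (p : E3) : E3 := pt (mat2_mul L (frame p)).

Lemma det_mul (L M : mat2) : mat2_det (mat2_mul L M) = (mat2_det L * mat2_det M)%C.
Proof. destruct L, M. unfold mat2_det, mat2_mul; simpl. ring. Qed.

Lemma mat2_mul_assoc (L M N : mat2) : mat2_mul L (mat2_mul M N) = mat2_mul (mat2_mul L M) N.
Proof. destruct L, M, N. unfold mat2_mul; simpl. f_equal; ring. Qed.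

Lemma gram_pos (M : mat2) : mat2_det M <> RtoC 0 -> 0 < Cmod (mA M) ^ 2 + Cmod (mB M) ^ 2.
Proof.
intros H. assert (P1 := Cmod_ge_0 (mA M)). assert (P2 := Cmod_ge_0 (mB M)).
destruct (Req_dec (Cmod (mA M)) 0) as [E1|E1]; [|nra].
destruct (Req_dec (Cmod (mB M)) 0) as [E2|E2]; [|nra].
exfalso. apply H. apply Cmod_eq_0 in E1. apply Cmod_eq_0 in E2. unfold mat2_det. rewrite E1, E2. ring.
Qed.

Lemma Cconj_RtoC (x : R) : Cconj (RtoC x) = RtoC x.
Proof. unfold Cconj, RtoC; simpl. f_equal. ring. Qed.

Lemma height_det (p : E3) : H3 p -> mat2_det (frame p) = RtoC (height p).
Proof. intros _. unfold mat2_det, frame; simpl. ring. Qed.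

Lemma pt_frame (p : E3) : H3 p -> pt (frame p) = p.
Proof.
intros Hp. unfold pt. rewrite height_det by easy. unfold frame. cbn [mA mB mC mD].
rewrite Cmod_1, Cmod_0, Cmod_R, Rabs_pos_eq by (unfold H3 in Hp; lra).
replace (1 ^ 2 + 0 ^ 2) with 1 by ring. rewrite !Cconj_RtoC.
replace ((1 * zeta p + 0 * height p) / 1)%C with (zeta p) by (field; apply C1_nz).
destruct p as [z w]. unfold zeta, height; simpl. f_equal. field.
Qed.

Lemma pt_H3 (M : mat2) : mat2_det M <> RtoC 0 -> H3 (pt M).
Proof.
intros H. unfold H3, pt, height. simpl snd. apply Rdiv_lt_0_compat; [now apply Cmod_gt_0|now apply gram_pos].
Qed.

(** The coordinates of [pt M] determine [M M^*] up to a positive factor, and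
    the Gram matrix of [L M] is a function of that of [M]. *)
Lemma pt_mul (L M : mat2) : mat2_det L <> RtoC 0 -> mat2_det M <> RtoC 0 ->
  pt (mat2_mul L M) = mob L (pt M).
Proof.
intros HL HM. assert (Hp := pt_H3 M HM). assert (Hn := gram_pos M HM).
assert (HLF : mat2_det (mat2_mul L (frame (pt M))) <> RtoC 0).
{ rewrite det_mul. apply Cmult_neq_0; [easy|]. rewrite height_det by easy.
  apply RtoC_neq0. unfold H3 in Hp. lra. }
assert (HLM : mat2_det (mat2_mul L M) <> RtoC 0) by (rewrite det_mul; now apply Cmult_neq_0).
assert (N1 := gram_pos _ HLF). assert (N2 := gram_pos _ HLM).
set (n := Cmod (mA M) ^ 2 + Cmod (mB M) ^ 2) in *.
assert (Hnc : RtoC n <> RtoC 0) by (apply RtoC_neq0; lra).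
(* Gram matrices of [M] and of the frame of [pt M] are proportional *)
set (z := zeta (pt M)). set (w := height (pt M)).
assert (Z : (Cconj (mA M) * mC M + Cconj (mB M) * mD M = RtoC n * z)%C).
{ assert (Ez : z = ((Cconj (mA M) * mC M + Cconj (mB M) * mD M) / RtoC n)%C) by reflexivity.
  rewrite Ez. field. easy. }
assert (Zc : (mA M * Cconj (mC M) + mB M * Cconj (mD M) = RtoC n * Cconj z)%C).
{ apply (f_equal Cconj) in Z. rewrite Cplus_conj, !Cmult_conj, !Cconj_conj, Cconj_RtoC in Z. exact Z. }
assert (A0 : (mA M * Cconj (mA M) + mB M * Cconj (mB M) = RtoC n)%C).
{ rewrite <- !Cmod2_conj, <- RtoC_plus. reflexivity. }
assert (W : RtoC w = (RtoC (Cmod (mat2_det M)) / RtoC n)%C).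
{ rewrite <- RtoC_div by lra. reflexivity. }
assert (B0 : (mC M * Cconj (mC M) + mD M * Cconj (mD M) = RtoC n * (z * Cconj z + RtoC w * RtoC w))%C).
{ assert (Lag : ((mA M * Cconj (mA M) + mB M * Cconj (mB M)) * (mC M * Cconj (mC M) + mD M * Cconj (mD M)) =
    (mA M * Cconj (mC M) + mB M * Cconj (mD M)) * (Cconj (mA M) * mC M + Cconj (mB M) * mD M) +
    mat2_det M * Cconj (mat2_det M))%C).
  { unfold mat2_det. rewrite Cminus_conj, !Cmult_conj. ring. }
  rewrite A0, Z, Zc, <- (Cmod2_conj (mat2_det M)) in Lag.
  transitivity ((RtoC n * (mC M * Cconj (mC M) + mD M * Cconj (mD M))) / RtoC n)%C; [field; easy|].
  rewrite Lag, W. replace (Cmod (mat2_det M) ^ 2) with (Cmod (mat2_det M) * Cmod (mat2_det M)) by ring.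
  rewrite RtoC_mult. field. easy. }
destruct L as [a b c d].
assert (G1 : Cmod (mA (mat2_mul (Mat2 a b c d) M)) ^ 2 + Cmod (mB (mat2_mul (Mat2 a b c d) M)) ^ 2 =
   n * (Cmod (mA (mat2_mul (Mat2 a b c d) (frame (pt M)))) ^ 2 + Cmod (mB (mat2_mul (Mat2 a b c d) (frame (pt M)))) ^ 2)).
{ apply RtoC_inj. rewrite RtoC_mult, !RtoC_plus, !Cmod2_conj. unfold mat2_mul, frame. cbn [mA mB mC mD].
  fold z w. rewrite !Cplus_conj, !Cmult_conj, !Cconj_RtoC.
  transitivity (a * Cconj a * (mA M * Cconj (mA M) + mB M * Cconj (mB M)) +
    a * Cconj b * (mA M * Cconj (mC M) + mB M * Cconj (mD M)) +
    b * Cconj a * (Cconj (mA M) * mC M + Cconj (mB M) * mD M) +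
    b * Cconj b * (mC M * Cconj (mC M) + mD M * Cconj (mD M)))%C; [ring|].
  rewrite A0, Z, Zc, B0. ring. }
assert (G2 : (Cconj (mA (mat2_mul (Mat2 a b c d) M)) * mC (mat2_mul (Mat2 a b c d) M) +
     Cconj (mB (mat2_mul (Mat2 a b c d) M)) * mD (mat2_mul (Mat2 a b c d) M) =
   RtoC n * (Cconj (mA (mat2_mul (Mat2 a b c d) (frame (pt M)))) * mC (mat2_mul (Mat2 a b c d) (frame (pt M))) +
     Cconj (mB (mat2_mul (Mat2 a b c d) (frame (pt M)))) * mD (mat2_mul (Mat2 a b c d) (frame (pt M)))))%C).
{ unfold mat2_mul, frame. cbn [mA mB mC mD].
  fold z w. rewrite !Cplus_conj, !Cmult_conj, !Cconj_RtoC.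
  transitivity (Cconj a * c * (mA M * Cconj (mA M) + mB M * Cconj (mB M)) +
    Cconj b * c * (mA M * Cconj (mC M) + mB M * Cconj (mD M)) +
    d * Cconj a * (Cconj (mA M) * mC M + Cconj (mB M) * mD M) +
    d * Cconj b * (mC M * Cconj (mC M) + mD M * Cconj (mD M)))%C; [ring|].
  rewrite A0, Z, Zc, B0. ring. }
assert (G3 : Cmod (mat2_det (mat2_mul (Mat2 a b c d) M)) = n * Cmod (mat2_det (mat2_mul (Mat2 a b c d) (frame (pt M))))).
{ rewrite !det_mul, !Cmod_mult, height_det by easy. fold w.
  rewrite Cmod_R, Rabs_pos_eq by (unfold w; unfold H3 in Hp; lra).
  assert (Ew : w = Cmod (mat2_det M) / n) by reflexivity. rewrite Ew. field. lra. }
unfold mob. unfold pt at 1. unfold pt at 1.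
set (N' := Cmod (mA (mat2_mul (Mat2 a b c d) (frame (pt M)))) ^ 2 + Cmod (mB (mat2_mul (Mat2 a b c d) (frame (pt M)))) ^ 2) in *.
rewrite G1, G2, G3.
assert (N1c : RtoC N' <> RtoC 0) by (apply RtoC_neq0; lra).
f_equal.
- rewrite RtoC_mult. field. split; assumption.
- field. split; lra.
Qed.

Lemma mob_H3 (L : mat2) (p : E3) : mat2_det L <> RtoC 0 -> H3 p -> H3 (mob L p).
Proof.
intros HL Hp. apply pt_H3. rewrite det_mul, height_det by easy. apply Cmult_neq_0; [easy|].
apply RtoC_neq0. unfold H3 in Hp. lra.
Qed.

Lemma mob_mul (L M : mat2) (p : E3) : mat2_det L <> RtoC 0 -> mat2_det M <> RtoC 0 -> H3 p ->
  mob L (mob M p) = mob (mat2_mul L M) p.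
Proof.
intros HL HM Hp. unfold mob at 2 3. rewrite <- mat2_mul_assoc, <- pt_mul; [easy|easy|].
rewrite det_mul, height_det by easy. apply Cmult_neq_0; [easy|].
apply RtoC_neq0. unfold H3 in Hp. lra.
Qed.

Definition I2 : mat2 := Mat2 (RtoC 1) (RtoC 0) (RtoC 0) (RtoC 1).

Lemma mul_I2 (M : mat2) : mat2_mul I2 M = M.
Proof. destruct M. unfold mat2_mul, I2; simpl. f_equal; ring. Qed.

Lemma mob_I2 (p : E3) : H3 p -> mob I2 p = p.
Proof. intros Hp. unfold mob. rewrite mul_I2. now apply pt_frame. Qed.

Lemma mat2_inv_l (L : mat2) : mat2_det L <> RtoC 0 -> mat2_mul (mat2_inv L) L = I2.
Proof.
destruct L as [a b c d]. unfold mat2_det, mat2_inv, mat2_mul, mat2_scale, I2, mat2_det; simpl. intros H. f_equal; field; easy.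
Qed.

Lemma mat2_inv_r (L : mat2) : mat2_det L <> RtoC 0 -> mat2_mul L (mat2_inv L) = I2.
Proof.
destruct L as [a b c d]. unfold mat2_det, mat2_inv, mat2_mul, mat2_scale, I2, mat2_det; simpl. intros H. f_equal; field; easy.
Qed.

Lemma det_I2 : mat2_det I2 = RtoC 1.
Proof. unfold mat2_det, I2; simpl. ring. Qed.

Lemma det_inv_neq0 (L : mat2) : mat2_det L <> RtoC 0 -> mat2_det (mat2_inv L) <> RtoC 0.
Proof.
intros H E. assert (T := det_mul L (mat2_inv L)). rewrite mat2_inv_r, det_I2, E in T by easy.
apply C1_nz. rewrite T. ring.
Qed.

Lemma mob_inv_l (L : mat2) (p : E3) : mat2_det L <> RtoC 0 -> H3 p -> mob (mat2_inv L) (mob L p) = p.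
Proof.
intros HL Hp. rewrite mob_mul by (easy || now apply det_inv_neq0). rewrite mat2_inv_l by easy. now apply mob_I2.
Qed.

Lemma mob_inv_r (L : mat2) (p : E3) : mat2_det L <> RtoC 0 -> H3 p -> mob L (mob (mat2_inv L) p) = p.
Proof.
intros HL Hp. rewrite mob_mul by (easy || now apply det_inv_neq0). rewrite mat2_inv_r by easy. now apply mob_I2.
Qed.

Lemma Cconj_neq0 (c : C) : c <> RtoC 0 -> Cconj c <> RtoC 0.
Proof. intros Hc. apply Cmod_gt_0. rewrite Cmod_conj. now apply Cmod_gt_0. Qed.

(** A matrix with vanishing upper right entry acts by a similarity; every
    other one is a product of similarities, a reflection and one inversion. *)
Lemma mob_lower (L : mat2) (p : E3) : mat2_det L <> RtoC 0 -> mB L = RtoC 0 -> H3 p ->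
  mob L p = aff (mD L / mA L) (mC L / mA L) p.
Proof.
destruct L as [a b c d]. cbn [mA mB mC mD]. intros HL -> Hp. unfold mat2_det in HL. cbn [mA mB mC mD] in HL.
assert (Ha : a <> RtoC 0) by (intros ->; apply HL; ring).
assert (Hm : 0 < Cmod a) by now apply Cmod_gt_0.
assert (Hac := Cconj_neq0 a Ha).
unfold mob, pt, aff, frame. rewrite det_mul. unfold mat2_mul, mat2_det; cbn [mA mB mC mD].
unfold H3 in Hp. set (z := zeta p). set (w := height p) in *.
replace (a * 1 + 0 * z)%C with a by ring. replace (a * 0 + 0 * w)%C with (RtoC 0) by ring.
rewrite Cmod_0, Cconj_RtoC. replace (Cmod a ^ 2 + 0 ^ 2) with (Cmod a ^ 2) by ring.
f_equal.
- rewrite Cmod2_conj. field. split; assumption.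
- replace ((a * d - 0 * c) * (1 * w - 0 * z))%C with (a * d * RtoC w)%C by ring.
  rewrite !Cmod_mult, Cmod_R, Cmod_div, Rabs_pos_eq by (easy || lra). field. lra.
Qed.

Lemma mob_upper (L : mat2) (p : E3) : mat2_det L <> RtoC 0 -> mB L <> RtoC 0 -> H3 p ->
  mob L p = affc (- mat2_det L / (mB L * mB L)) (mD L / mB L) (inversion (aff (RtoC 1) (mA L / mB L) p)).
Proof.
destruct L as [a b c d]. cbn [mA mB mC mD]. intros HL Hb Hp.
set (q := aff (RtoC 1) (a / b) p).
assert (Hq : H3 q).
{ unfold q, aff, H3, height. cbn [snd]. rewrite Cmod_1. unfold H3, height in Hp. lra. }
assert (HN := eucl_pos q Hq).
set (zq := (zeta p + a / b)%C). set (w := height p) in *.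
assert (Hw : 0 < w) by exact Hp.
assert (Eq1 : q = ((zq, w) : E3)).
{ unfold q, aff. fold w. rewrite Cmod_1, Rmult_1_l, Cmult_1_l. reflexivity. }
assert (EN : eucl q q = Cmod zq ^ 2 + w ^ 2).
{ rewrite Eq1, Cmod2_alt. unfold eucl, pos1, pos2, height, Re, Im. cbn [fst snd]. ring. }
set (N := eucl q q) in *.
assert (Einv : inversion q = (((zq / RtoC N)%C, w / N) : E3)).
{ unfold inversion. fold N. rewrite Eq1. apply E3_ext.
  - unfold pos1. change (/ N * fst zq = Re (zq / RtoC N)%C). unfold Cdiv. rewrite <- RtoC_inv by lra. unfold Re. simpl. ring.
  - unfold pos2. change (/ N * snd zq = Im (zq / RtoC N)%C). unfold Cdiv. rewrite <- RtoC_inv by lra. unfold Im. simpl. ring.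
  - change (/ N * w = w / N). unfold Rdiv. ring. }
rewrite Einv. unfold affc, mob, pt, frame. rewrite det_mul.
change (zeta (((zq / RtoC N)%C, w / N) : E3)) with (zq / RtoC N)%C.
change (height (((zq / RtoC N)%C, w / N) : E3)) with (w / N).
set (D := mat2_det (Mat2 a b c d)) in *.
assert (ED : D = (a * d - b * c)%C) by reflexivity.
unfold mat2_mul, mat2_det. cbn [mA mB mC mD]. fold w.
assert (HNc : RtoC N <> RtoC 0) by (apply RtoC_neq0; lra).
assert (Hbc := Cconj_neq0 b Hb).
assert (Hm : 0 < Cmod b) by now apply Cmod_gt_0.
replace (a * 1 + b * zeta p)%C with (b * zq)%C by (unfold zq; field; easy).
replace (a * 0 + b * w)%C with (b * w)%C by ring.
replace (c * 1 + d * zeta p)%C with (d * zq - D / b)%C by (rewrite ED; unfold zq; field; easy).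
replace (c * 0 + d * w)%C with (d * w)%C by ring.
replace (Cmod (b * zq) ^ 2 + Cmod (b * w) ^ 2) with (Cmod b ^ 2 * N).
2: { rewrite EN, !Cmod_mult, Cmod_R, !Rpow_mult_distr, pow2_abs. ring. }
f_equal.
- rewrite !Cmult_conj, Cconj_RtoC, RtoC_mult, Cmod2_conj, Cdiv_conj, Cconj_RtoC by easy.
  transitivity ((d * (zq * Cconj zq + w * w) - D / b * Cconj zq) / (b * N))%C.
  { field. repeat split; assumption. }
  replace (zq * Cconj zq + w * w)%C with (RtoC N).
  2: { rewrite EN, RtoC_plus, Cmod2_conj. replace (w ^ 2) with (w * w) by ring. now rewrite RtoC_mult. }
  field. split; assumption.
- replace (1 * w - 0 * zeta p)%C with (RtoC w) by ring.
  rewrite Cmod_mult, Cmod_R, Cmod_div, Cmod_opp, Cmod_mult, Rabs_pos_eq by (try apply Cmult_neq_0; easy || lra).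
  field. split; lra.
Qed.

Lemma rigid_mob (L : mat2) : mat2_det L <> RtoC 0 -> rigid (mob L).
Proof.
intros HL. destruct (Ceq_dec (mB L) 0) as [E|E].
- apply (rigid_ext (aff (mD L / mA L) (mC L / mA L))).
  + intros p Hp. symmetry. now apply mob_lower.
  + apply rigid_aff. intros Z. apply HL. unfold mat2_det. rewrite E.
    assert (HA : mA L <> RtoC 0).
    { intros Z'. apply HL. unfold mat2_det. rewrite E, Z'. ring. }
    replace (mD L) with (mD L / mA L * mA L)%C by (field; easy). rewrite Z. ring.
- apply (rigid_ext (fun p => affc (- mat2_det L / (mB L * mB L)) (mD L / mB L)
    (inversion (aff (RtoC 1) (mA L / mB L) p)))).
  + intros p Hp. symmetry. now apply mob_upper.
  + apply (rigid_comp _ (fun p => inversion (aff (RtoC 1) (mA L / mB L) p))).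
    * apply rigid_affc. intros Z. apply HL.
      replace (mat2_det L) with (- (- mat2_det L / (mB L * mB L)) * (mB L * mB L))%C by (field; easy).
      rewrite Z. ring.
    * apply (rigid_comp inversion); [apply rigid_inversion|]. apply rigid_aff, C1_nz.
Qed.

(** * Action on the boundary *)

Lemma bdry_nbhd_filter (P : Cbar) : ProperFilter (bdry_nbhd P).
Proof.
destruct P as [a|].
- constructor.
  + intros S [e He]. exists ((a, e / 2) : E3). 
    assert (Hp := cond_pos e). apply He.
    * split; [apply ball_center|]. change (Rabs (e / 2 - 0) < e). rewrite Rminus_0_r, Rabs_pos_eq; lra.
    * unfold H3, height. simpl. lra.
  + apply within_filter, locally_filter.
- constructor.
  + intros S [M HM]. set (x := Rabs M + 1). assert (Hx := Rabs_pos M). assert (Hx' := Rle_abs M).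
    exists ((((0, 0) : C), x) : E3). apply HM.
    * unfold H3, height, x. simpl. lra.
    * unfold eucl, pos1, pos2, height, x. simpl. nra.
  + constructor.
    * exists 0. easy.
    * intros S T [M1 H1] [M2 H2]. exists (Rmax M1 M2). intros p Hp HM. split.
      -- apply H1; [easy|]. eapply Rle_lt_trans; [apply Rmax_l|exact HM].
      -- apply H2; [easy|]. eapply Rle_lt_trans; [apply Rmax_r|exact HM].
    * intros S T HST [M HM]. exists M. intros p Hp H. apply HST. now apply HM.
Qed.

Lemma bdry_nbhd_H3 (P : Cbar) : bdry_nbhd P H3.
Proof.
destruct P as [a|].
- exists (mkposreal 1 Rlt_0_1). intros y _ Hy. exact Hy.
- exists 0. easy.
Qed.

Lemma bdry_nbhd_some (a : C) (S : E3 -> Prop) : bdry_nbhd (Some a) S <->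
  exists d, 0 < d /\ forall p, H3 p -> Cmod (zeta p - a) < d -> height p < d -> S p.
Proof.
split.
- intros [e He]. exists e. split; [apply cond_pos|]. intros p Hp H1 H2. apply He; [|easy].
  split.
  + now apply C_NormedModule_mixin_compat1.
  + change (Rabs (height p - 0) < e). rewrite Rminus_0_r, Rabs_pos_eq; [easy|]. unfold H3 in Hp. lra.
- intros (d & Hd & H).
  assert (Hs : 1 <= sqrt 2) by (rewrite <- sqrt_1; apply sqrt_le_1_alt; lra).
  assert (He : 0 < d / sqrt 2) by (apply Rdiv_lt_0_compat; lra).
  exists (mkposreal _ He). intros p [B1 B2] Hp. apply H; [easy| |].
  + generalize (C_NormedModule_mixin_compat2 _ _ _ B1). simpl.
    replace (sqrt 2 * (d / sqrt 2)) with d by (field; lra). easy.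
  + change (Rabs (height p - 0) < d / sqrt 2) in B2. rewrite Rminus_0_r in B2.
    assert (T := Rle_abs (height p)).
    assert (d / sqrt 2 <= d). { apply Rmult_le_reg_r with (sqrt 2); [lra|].
      replace (d / sqrt 2 * sqrt 2) with d by (field; lra). nra. } lra.
Qed.

Lemma eucl_Cmod (p : E3) : eucl p p = Cmod (zeta p) ^ 2 + height p ^ 2.
Proof. rewrite Cmod2_alt. unfold eucl, pos1, pos2, height, zeta, Re, Im. ring. Qed.

Lemma bdry_nbhd_none (S : E3 -> Prop) : bdry_nbhd None S <->
  exists M, forall p, H3 p -> M < Cmod (zeta p) ^ 2 + height p ^ 2 -> S p.
Proof.
split; intros [M HM]; exists M; intros p Hp H; apply HM; try easy; now rewrite eucl_Cmod in *.
Qed.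

Lemma bdry_separated (P Q : Cbar) : P <> Q -> exists S T, bdry_nbhd P S /\ bdry_nbhd Q T /\
  forall p, H3 p -> S p -> T p -> False.
Proof.
assert (Hfin : forall (a : C), exists S T, bdry_nbhd (Some a) S /\ bdry_nbhd None T /\
  forall p, H3 p -> S p -> T p -> False).
{ intros a. exists (fun p => Cmod (zeta p - a) < 1 /\ height p < 1), (fun p => (1 + Cmod a) ^ 2 + 1 < Cmod (zeta p) ^ 2 + height p ^ 2).
  split; [apply bdry_nbhd_some; exists 1; split; [lra|easy]|].
  split; [apply bdry_nbhd_none; now exists ((1 + Cmod a) ^ 2 + 1)|].
  intros p Hp [H1 H2] H. unfold H3 in Hp.
  assert (T := Cmod_triangle (zeta p - a) a). replace (zeta p - a + a)%C with (zeta p) in T by ring.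
  assert (0 <= Cmod (zeta p)) by apply Cmod_ge_0.
  assert (Cmod (zeta p) ^ 2 <= (1 + Cmod a) ^ 2) by (apply pow_incr; lra).
  assert (height p ^ 2 <= 1 ^ 2) by (apply pow_incr; lra). lra. }
destruct P as [a|], Q as [b|]; intros H.
- assert (Hd : 0 < Cmod (a - b)).
  { apply Cmod_gt_0. intros E. apply H. f_equal. apply Ceq_minus. exact E. }
  exists (fun p => Cmod (zeta p - a) < Cmod (a - b) / 2), (fun p => Cmod (zeta p - b) < Cmod (a - b) / 2).
  split; [apply bdry_nbhd_some; exists (Cmod (a - b) / 2); split; [lra|easy]|].
  split; [apply bdry_nbhd_some; exists (Cmod (a - b) / 2); split; [lra|easy]|].
  intros p Hp H1 H2.
  assert (T := Cmod_triangle (- (zeta p - a)) (zeta p - b)). rewrite Cmod_opp in T.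
  replace (- (zeta p - a) + (zeta p - b))%C with (a - b)%C in T by ring. lra.
- apply Hfin.
- destruct (Hfin b) as (S & T & H1 & H2 & H3'). exists T, S. repeat (split; [easy|]). intros p Hp A B. now apply (H3' p).
- easy.
Qed.

Lemma limit_bdry_unique {X : Type} (F : (X -> Prop) -> Prop) {FF : ProperFilter F} (f : X -> E3) (P Q : Cbar) :
  F (fun x => H3 (f x)) -> filterlim f F (bdry_nbhd P) -> filterlim f F (bdry_nbhd Q) -> P = Q.
Proof.
intros H0 H1 H2.
destruct (Classical_Prop.classic (P = Q)) as [E|E]; [easy|]. exfalso.
destruct (bdry_separated P Q E) as (S & T & HS & HT & Hd).
specialize (H1 S HS). specialize (H2 T HT). unfold filtermap in *.
apply (filter_not_empty (F := F)).
generalize (filter_and _ _ H0 (filter_and _ _ H1 H2)). apply filter_imp.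
intros x (A & B & D). now apply (Hd (f x)).
Qed.

Lemma maps_bdry_comp (Phi Psi : E3 -> E3) (P Q R : Cbar) :
  maps_bdry Psi P Q -> maps_bdry Phi Q R -> maps_bdry (fun p => Phi (Psi p)) P R.
Proof. intros H1 H2. exact (filterlim_comp _ _ _ Psi Phi _ _ _ H1 H2). Qed.

Lemma maps_bdry_ext (Phi Psi : E3 -> E3) (P Q : Cbar) : (forall p, H3 p -> Phi p = Psi p) ->
  maps_bdry Phi P Q -> maps_bdry Psi P Q.
Proof.
intros H H1. assert (FF := bdry_nbhd_filter P). apply (filterlim_ext_loc Phi); [|exact H1].
generalize (bdry_nbhd_H3 P). apply filter_imp. exact H.
Qed.

Lemma is_Cbar_quot_ex (p q : C) : (q <> RtoC 0 \/ p <> RtoC 0) -> exists P, is_Cbar_quot p q P.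
Proof.
intros H. destruct (Ceq_dec q 0) as [E|E].
- exists None. split; [easy|]. destruct H; easy.
- exists (Some (p / q)%C). now split.
Qed.

Lemma is_Cbar_quot_nz (p q : C) (P : Cbar) : is_Cbar_quot p q P -> q <> RtoC 0 \/ p <> RtoC 0.
Proof. destruct P; simpl; intros [H1 H2]; [now left|now right]. Qed.

(** The map [cj] is the identity or the conjugation, which treats both
    orientations at once. *)
Lemma maps_bdry_simil_like (al be : C) (cj : C -> C) : al <> RtoC 0 ->
  (forall z w, cj (z - w)%C = (cj z - cj w)%C) -> (forall z, Cmod (cj z) = Cmod z) ->
  let Phi := fun p : E3 => (((al * cj (zeta p) + be)%C, Cmod al * height p) : E3) in
  (forall a, maps_bdry Phi (Some a) (Some (al * cj a + be)%C)) /\ maps_bdry Phi None None.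
Proof.
intros Hal Hcj Hmod Phi. assert (Hm : 0 < Cmod al) by now apply Cmod_gt_0. split.
- intros a S HS. apply bdry_nbhd_some in HS. destruct HS as (d & Hd & HS).
  apply bdry_nbhd_some. exists (d / Cmod al). split; [now apply Rdiv_lt_0_compat|].
  intros p Hp H1 H2. apply HS.
  + unfold Phi, H3, height. cbn [snd]. apply Rmult_lt_0_compat; [easy|exact Hp].
  + change (zeta (Phi p)) with (al * cj (zeta p) + be)%C.
    replace (al * cj (zeta p) + be - (al * cj a + be))%C with (al * cj (zeta p - a))%C by (rewrite Hcj; ring).
    rewrite Cmod_mult, Hmod. apply (Rmult_lt_compat_l _ _ _ Hm) in H1.
    replace (Cmod al * (d / Cmod al)) with d in H1 by (field; lra). easy.
  + change (height (Phi p)) with (Cmod al * height p). apply (Rmult_lt_compat_l _ _ _ Hm) in H2.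
    replace (Cmod al * (d / Cmod al)) with d in H2 by (field; lra). easy.
- intros S HS. apply bdry_nbhd_none in HS. destruct HS as [M HS].
  apply bdry_nbhd_none. exists ((2 * M + 2 * Cmod be ^ 2) / Cmod al ^ 2).
  intros p Hp H. apply HS.
  + unfold Phi, H3, height. cbn [snd]. apply Rmult_lt_0_compat; [easy|exact Hp].
  + change (zeta (Phi p)) with (al * cj (zeta p) + be)%C.
    change (height (Phi p)) with (Cmod al * height p).
    assert (Hm2 : 0 < Cmod al ^ 2) by now apply pow_lt.
    apply (Rmult_lt_compat_l _ _ _ Hm2) in H.
    replace (Cmod al ^ 2 * ((2 * M + 2 * Cmod be ^ 2) / Cmod al ^ 2)) with (2 * M + 2 * Cmod be ^ 2) in H by (field; lra).
    assert (T := Cmod_triangle (al * cj (zeta p) + be) (- be)).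
    replace (al * cj (zeta p) + be + - be)%C with (al * cj (zeta p))%C in T by ring.
    rewrite Cmod_opp, Cmod_mult, Hmod in T.
    assert (P1 := Cmod_ge_0 (al * cj (zeta p) + be)). assert (P2 := Cmod_ge_0 be). assert (P3 := Cmod_ge_0 (zeta p)).
    set (A := Cmod (al * cj (zeta p) + be)) in *. set (B := Cmod be) in *. set (Z := Cmod (zeta p)) in *.
    set (a := Cmod al) in *.
    assert (Q : (a * Z) ^ 2 <= 2 * A ^ 2 + 2 * B ^ 2).
    { assert (Q1 : (a * Z) ^ 2 <= (A + B) ^ 2) by (apply pow_incr; nra).
      assert (Q2 := Rle_0_sqr (A - B)). unfold Rsqr in Q2. nra. }
    assert (Q3 := Rle_0_sqr (a * height p)). unfold Rsqr in Q3. nra.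
Qed.

Lemma maps_bdry_aff (al be u v : C) (P Q : Cbar) : al <> RtoC 0 ->
  is_Cbar_quot v u P -> is_Cbar_quot (al * v + be * u) u Q -> maps_bdry (aff al be) P Q.
Proof.
intros Hal HP HQ.
destruct (maps_bdry_simil_like al be (fun z => z) Hal) as [H1 H2]; [easy|easy|].
destruct P as [a|], Q as [b|]; simpl in HP, HQ.
- destruct HP as [Hu ->], HQ as [_ ->].
  replace ((al * v + be * u) / u)%C with (al * (v / u) + be)%C by (field; easy). apply H1.
- destruct HP as [Hu _], HQ as [Hu' _]. easy.
- destruct HP as [Hu _], HQ as [Hu' _]. easy.
- exact H2.
Qed.

Lemma maps_bdry_affc (al be u v : C) (P Q : Cbar) : al <> RtoC 0 ->
  is_Cbar_quot v u P -> is_Cbar_quot (al * Cconj v + be * Cconj u) (Cconj u) Q -> maps_bdry (affc al be) P Q.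
Proof.
intros Hal HP HQ.
destruct (maps_bdry_simil_like al be Cconj Hal Cminus_conj Cmod_conj) as [H1 H2].
assert (Hc := Cconj_neq0).
destruct P as [a|], Q as [b|]; simpl in HP, HQ.
- destruct HP as [Hu ->], HQ as [Hu' ->].
  replace ((al * Cconj v + be * Cconj u) / Cconj u)%C with (al * Cconj (v / u) + be)%C
    by (rewrite Cdiv_conj by easy; field; easy). apply H1.
- destruct HP as [Hu _], HQ as [Hu' _]. now apply Hc in Hu.
- destruct HP as [-> _], HQ as [Hu' _]. exfalso. apply Hu'. apply Cconj_RtoC.
- exact H2.
Qed.

Lemma inversion_coords (p : E3) : H3 p ->
  let N := Cmod (zeta p) ^ 2 + height p ^ 2 in
  0 < N /\ zeta (inversion p) = (zeta p / RtoC N)%C /\ height (inversion p) = height p / N.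
Proof.
intros Hp N.
assert (E : eucl p p = N) by apply eucl_Cmod.
assert (HN := eucl_pos p Hp). rewrite E in HN. split; [easy|]. unfold inversion. rewrite E. split.
- unfold Cdiv. rewrite <- RtoC_inv by lra. destruct p as [[x y] w].
  apply injective_projections; unfold zeta; simpl; unfold scal; simpl; unfold mult; simpl; ring.
- destruct p as [[x y] w]. unfold height; simpl. unfold scal; simpl. unfold mult; simpl. field. lra.
Qed.

Lemma maps_bdry_inversion (u v : C) (P Q : Cbar) :
  is_Cbar_quot v u P -> is_Cbar_quot (Cconj u) (Cconj v) Q -> maps_bdry inversion P Q.
Proof.
assert (Hc := Cconj_neq0).
assert (Hc0 : forall c : C, Cconj c = RtoC 0 -> c = RtoC 0).
{ intros c E. rewrite <- (Cconj_conj c), E. apply Cconj_RtoC. }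
assert (HI : forall p, H3 p -> H3 (inversion p)) by apply (motion_H3 _ _ _ motion_inversion).
intros HP HQ. destruct P as [a|], Q as [b|]; simpl in HP, HQ.
- (* a finite nonzero point: the inversion is continuous there *)
  destruct HP as [Hu Ha], HQ as [Hv Hb].
  assert (Hv' : v <> RtoC 0) by (intros ->; apply Hv, Cconj_RtoC).
  assert (Ha0 : a <> RtoC 0).
  { rewrite Ha. intros E. apply Hv'. replace v with (v / u * u)%C by (field; easy). rewrite E. ring. }
  assert (Eb : b = (a / RtoC (Cmod a ^ 2))%C).
  { assert (Hac := Hc a Ha0). rewrite Cmod2_conj, Hb. transitivity (/ Cconj a)%C; [|field; split; easy].
    assert (Huc := Hc u Hu). rewrite Ha, Cdiv_conj by exact Hu. field. split; assumption. }
  assert (Hm : 0 < Cmod a) by now apply Cmod_gt_0.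
  intros S HS. apply bdry_nbhd_some in HS. destruct HS as (d & Hd & HS).
  assert (C1 : continuous (fun p : E3 => zeta p) ((a, 0) : E3)) by apply continuous_fst.
  assert (C2 : continuous (fun p : E3 => height p) ((a, 0) : E3)) by apply continuous_snd.
  assert (C3 : continuous (fun p : E3 => Cmod (zeta p) ^ 2 + height p ^ 2) ((a, 0) : E3)).
  { apply continuous_Rplus; [now apply continuous_Cmod2|].
    apply (continuous_ext (fun p : E3 => height p * height p)); [|now apply continuous_Rmult].
    intros p. match goal with |- ?x = ?y => change (@eq R x y) end. ring. }
  assert (Ha2 : Cmod (zeta ((a, 0) : E3)) ^ 2 + height ((a, 0) : E3) ^ 2 <> 0).
  { unfold zeta, height. cbn [fst snd]. assert (0 < Cmod a ^ 2) by now apply pow_lt. lra. }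
  assert (Kz : continuous (fun p : E3 => (zeta p / RtoC (Cmod (zeta p) ^ 2 + height p ^ 2))%C) ((a, 0) : E3)).
  { unfold Cdiv. apply continuous_Cmult; [exact C1|].
    apply continuous_Cinv; [now apply RtoC_neq0|now apply continuous_RtoC]. }
  assert (Kw : continuous (fun p : E3 => height p / (Cmod (zeta p) ^ 2 + height p ^ 2)) ((a, 0) : E3)).
  { unfold Rdiv. apply continuous_Rmult; [exact C2|]. now apply continuous_Rinv_comp. }
  assert (Nz : locally ((a, 0) : E3) (fun p => Cmod ((zeta p / RtoC (Cmod (zeta p) ^ 2 + height p ^ 2))%C - b) < d)).
  { apply (Kz (fun w : C => Cmod (w - b)%C < d)). apply locally_Cmod. exists d. split; [easy|]. intros w Hw.
    unfold zeta, height in Hw. cbn [fst snd] in Hw. rewrite Eb. replace (Cmod a ^ 2 + 0 ^ 2) with (Cmod a ^ 2) in Hw by ring. exact Hw. }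
  assert (Nw : locally ((a, 0) : E3) (fun p => Rabs (height p / (Cmod (zeta p) ^ 2 + height p ^ 2)) < d)).
  { apply (Kw (fun x => Rabs x < d)). exists (mkposreal d Hd). intros x Hx.
    change (Rabs (x - height ((a, 0) : E3) / (Cmod (zeta ((a, 0) : E3)) ^ 2 + height ((a, 0) : E3) ^ 2)) < d) in Hx.
    unfold zeta, height in Hx. cbn [fst snd] in Hx.
    unfold Rdiv in Hx. rewrite Rmult_0_l, Rminus_0_r in Hx. exact Hx. }
  change (locally ((a, 0) : E3) (fun p => H3 p -> S (inversion p))).
  refine (filter_imp _ _ _ (filter_and _ _ Nz Nw)). intros p [H1 H2] Hp.
  destruct (inversion_coords p Hp) as (_ & E1 & E2). apply HS; [now apply HI| |].
  + now rewrite E1.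
  + rewrite E2. eapply Rle_lt_trans; [apply Rle_abs|exact H2].
- (* the origin goes to infinity *)
  destruct HP as [Hu Ha], HQ as [Hv _].
  assert (Ha0 : a = RtoC 0). { rewrite Ha, (Hc0 v Hv). field. easy. }
  subst a. rewrite Ha0. intros S HS. apply bdry_nbhd_none in HS. destruct HS as [M HS].
  set (K := Rabs M + 1). assert (HK : 0 < K) by (unfold K; generalize (Rabs_pos M); lra).
  assert (HKM : M < K) by (unfold K; generalize (Rle_abs M); lra).
  set (d := Rmin 1 (/ (2 * K))).
  assert (Hd : 0 < d) by (apply Rmin_pos; [lra|apply Rinv_0_lt_compat; lra]).
  assert (Hd1 : d <= 1) by apply Rmin_l. assert (Hd2 : d <= / (2 * K)) by apply Rmin_r.
  apply bdry_nbhd_some. exists d. split; [easy|]. intros p Hp H1 H2.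
  replace (zeta p - 0)%C with (zeta p) in H1 by ring.
  destruct (inversion_coords p Hp) as (HN & E1 & E2). apply HS; [now apply HI|].
  set (N := Cmod (zeta p) ^ 2 + height p ^ 2) in *. unfold H3 in Hp.
  rewrite E1, E2, Cmod_div, Cmod_R, Rabs_pos_eq by (try apply RtoC_neq0; lra).
  replace ((Cmod (zeta p) / N) ^ 2 + (height p / N) ^ 2) with (/ N).
  2: { transitivity ((Cmod (zeta p) ^ 2 + height p ^ 2) / (N * N)); [fold N|]; field; lra. }
  apply Rlt_trans with K; [easy|]. rewrite <- (Rinv_inv K). apply Rinv_lt_contravar.
  + apply Rmult_lt_0_compat; [easy|now apply Rinv_0_lt_compat].
  + assert (P := Cmod_ge_0 (zeta p)).
    assert (N < 2 * d).
    { assert (Cmod (zeta p) ^ 2 < d) by (simpl; nra). assert (height p ^ 2 < d) by (simpl; nra). unfold N. lra. }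
    replace (/ K) with (2 * / (2 * K)) by (field; lra). lra.
- (* infinity goes to the origin *)
  destruct HP as [Hu Ha], HQ as [Hv Hb].
  assert (Eb : b = RtoC 0). { rewrite Hb, Hu, Cconj_RtoC. field. easy. }
  rewrite Eb. intros S HS. apply bdry_nbhd_some in HS. destruct HS as (d & Hd & HS).
  apply bdry_nbhd_none. exists (/ d ^ 2). intros p Hp H.
  destruct (inversion_coords p Hp) as (HN & E1 & E2).
  set (N := Cmod (zeta p) ^ 2 + height p ^ 2) in *. unfold H3 in Hp.
  assert (Hd2 : 0 < d ^ 2) by now apply pow_lt.
  assert (HNd : 1 < N * d ^ 2).
  { apply (Rmult_lt_compat_r _ _ _ Hd2) in H. rewrite Rinv_l in H by lra. easy. }
  assert (K : forall x, 0 <= x -> x ^ 2 <= N -> x / N < d).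
  { intros x Hx Hx2. apply Rmult_lt_reg_r with N; [easy|].
    replace (x / N * N) with x by (field; lra).
    apply Rsqr_incrst_0; [unfold Rsqr; nra|easy|nra]. }
  apply HS; [now apply HI| |].
  + rewrite E1. replace (zeta p / N - 0)%C with (zeta p / N)%C by ring.
    rewrite Cmod_div, Cmod_R, Rabs_pos_eq by (try apply RtoC_neq0; lra).
    apply K; [apply Cmod_ge_0|]. unfold N. assert (0 <= height p ^ 2) by apply pow2_ge_0. lra.
  + rewrite E2. apply K; [lra|]. unfold N. assert (0 <= Cmod (zeta p) ^ 2) by apply pow2_ge_0. lra.
- destruct HP as [_ Ha], HQ as [Hv _]. apply Hc0 in Hv. easy.
Qed.

(** In homogeneous coordinates infinity is no exception; the cases come from
    [mob_lower] and [mob_upper]. *)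
Lemma mob_bdry (L : mat2) (u v : C) (P Q : Cbar) : mat2_det L <> RtoC 0 ->
  is_Cbar_quot v u P -> is_Cbar_quot (mC L * u + mD L * v) (mA L * u + mB L * v) Q ->
  maps_bdry (mob L) P Q.
Proof.
destruct L as [a b c d]. cbn [mA mB mC mD]. intros HL HP HQ.
assert (Hc := Cconj_neq0).
assert (Hscale : forall (p q k : C) (R : Cbar), k <> RtoC 0 -> is_Cbar_quot p q R -> is_Cbar_quot (k * p) (k * q) R).
{ intros p q k [x|] Hk; simpl; intros [H1 H2].
  - split; [now apply Cmult_neq_0|]. rewrite H2. field. split; easy.
  - split; [rewrite H1; ring|now apply Cmult_neq_0]. }
assert (D : mat2_det (Mat2 a b c d) = (a * d - b * c)%C) by reflexivity. rewrite D in HL.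
destruct (Ceq_dec b 0) as [E|E].
- assert (Ha : a <> RtoC 0) by (intros Z; apply HL; rewrite Z, E; ring).
  assert (Hd : d <> RtoC 0) by (intros Z; apply HL; rewrite Z, E; ring).
  apply (maps_bdry_ext (aff (d / a) (c / a))).
  + intros p Hp. symmetry. now apply (mob_lower (Mat2 a b c d)).
  + apply (maps_bdry_aff _ _ u v).
    * intros Z. apply Hd. replace d with (d / a * a)%C by (field; easy). rewrite Z. ring.
    * easy.
    * apply (Hscale _ _ (/ a)%C) in HQ.
      -- replace (d / a * v + c / a * u)%C with (/ a * (c * u + d * v))%C by (field; easy).
         replace u with (/ a * (a * u + b * v))%C at 2 by (rewrite E; field; easy). exact HQ.
      -- intros Z. apply C1_nz. rewrite <- (Cinv_r a Ha), Z. ring.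
- apply (maps_bdry_ext (fun p => affc (- (a * d - b * c) / (b * b)) (d / b) (inversion (aff (RtoC 1) (a / b) p)))).
  { intros p Hp. symmetry. now apply (mob_upper (Mat2 a b c d)). }
  assert (Huv := is_Cbar_quot_nz _ _ _ HP).
  destruct (is_Cbar_quot_ex (1 * v + a / b * u)%C u) as [P1 HP1].
  { destruct (Ceq_dec u 0) as [Z|Z]; [|now left]. right. destruct Huv as [Hu|Hv]; [easy|].
    rewrite Z. replace (1 * v + a / b * 0)%C with v by ring. easy. }
  destruct (is_Cbar_quot_ex (Cconj u) (Cconj (1 * v + a / b * u))) as [P2 HP2].
  { destruct (is_Cbar_quot_nz _ _ _ HP1) as [Hu|Hv]; [right|left]; now apply Hc. }
  apply (maps_bdry_comp _ (fun p => inversion (aff (RtoC 1) (a / b) p)) P P2 Q).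
  + apply (maps_bdry_comp inversion (aff (RtoC 1) (a / b)) P P1 P2).
    * apply (maps_bdry_aff _ _ u v); [apply C1_nz|easy|easy].
    * now apply (maps_bdry_inversion u (1 * v + a / b * u)%C).
  + apply (maps_bdry_affc _ _ (Cconj (1 * v + a / b * u)) (Cconj u)).
    * intros Z. apply HL. replace (a * d - b * c)%C with (- (- (a * d - b * c) / (b * b)) * (b * b))%C by (field; easy).
      rewrite Z. ring.
    * easy.
    * rewrite !Cconj_conj. apply (Hscale _ _ (/ b)%C) in HQ.
      -- replace (1 * v + a / b * u)%C with (/ b * (a * u + b * v))%C by (field; easy).
         replace (- (a * d - b * c) / (b * b) * u + d / b * (/ b * (a * u + b * v)))%C
           with (/ b * (c * u + d * v))%C by (field; easy). exact HQ.
      -- intros Z. apply C1_nz. rewrite <- (Cinv_r b E), Z. ring.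
Qed.

(** * Isometries of hyperbolic space *)

Definition axis (b : R) : E3 := (RtoC 0, b).

(** This matrix is a multiple of a unitary one, so it acts as a rotation about
    [axis 1]. *)
Lemma mob_unitary_axis (be : C) (p : E3) : H3 p ->
  (zeta p - Cconj be * (1 - RtoC (Cmod (zeta p) ^ 2 + height p ^ 2)) - Cconj be * Cconj be * Cconj (zeta p))%C = RtoC 0 ->
  zeta (mob (Mat2 (RtoC 1) be (- Cconj be) (RtoC 1)) p) = RtoC 0.
Proof.
intros Hp H. unfold mob, pt, mat2_mul, frame, zeta at 1. cbn [mA mB mC mD fst].
match goal with |- (?n / ?d)%C = _ => replace n with (RtoC 0); [unfold Cdiv; ring|] end.
etransitivity; [symmetry; exact H|]. rewrite RtoC_plus, Cmod2_conj, RtoC_pow.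
rewrite !Cplus_conj, !Cmult_conj, !Cconj_RtoC. simpl. ring.
Qed.

Lemma det_unitary (be : C) : mat2_det (Mat2 (RtoC 1) be (- Cconj be) (RtoC 1)) = RtoC (1 + Cmod be ^ 2).
Proof. unfold mat2_det. cbn [mA mB mC mD]. rewrite RtoC_plus, Cmod2_conj. ring. Qed.

Lemma axis_H3 (b : R) : 0 < b -> H3 (axis b).
Proof. easy. Qed.

Lemma axis_eq (p : E3) : zeta p = RtoC 0 -> p = axis (height p).
Proof. destruct p as [z w]. unfold zeta, axis, height. simpl. now intros ->. Qed.

Lemma pair_on_axis (p q : E3) : H3 p -> H3 q -> exists (L : mat2) (b : R),
  mat2_det L <> RtoC 0 /\ 1 <= b /\ mob L p = axis 1 /\ mob L q = axis b.
Proof.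
intros Hp Hq.
assert (Hw : 0 < height p) by exact Hp.
assert (Hwc : RtoC (height p) <> RtoC 0) by (apply RtoC_neq0; lra).
set (L0 := Mat2 (RtoC 1) (RtoC 0) (- zeta p / RtoC (height p))%C (/ RtoC (height p))%C).
assert (D0 : mat2_det L0 <> RtoC 0).
{ unfold L0, mat2_det. cbn [mA mB mC mD]. intros E. apply C1_nz.
  transitivity ((1 * / height p - 0 * (- zeta p / height p)) * height p)%C; [field; easy|rewrite E; ring]. }
assert (E0 : mob L0 p = axis 1).
{ rewrite mob_lower by easy. unfold L0, aff, axis. cbn [mA mB mC mD]. f_equal.
  - field. easy.
  - replace (/ height p / 1)%C with (RtoC (/ height p)) by (rewrite RtoC_inv by lra; field; easy).
    rewrite Cmod_R, Rabs_pos_eq by (apply Rlt_le, Rinv_0_lt_compat; lra). field. lra. }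
set (q1 := mob L0 q). assert (H1 : H3 q1) by now apply mob_H3.
(* for [Cconj be = t * zeta q1] the condition of [mob_unitary_axis] is a real
   quadratic equation for [t] *)
assert (Hbe : exists be : C, (zeta q1 - Cconj be * (1 - RtoC (Cmod (zeta q1) ^ 2 + height q1 ^ 2)) - Cconj be * Cconj be * Cconj (zeta q1) = RtoC 0)%C).
{ set (z := zeta q1). set (n := Cmod z ^ 2). set (k := 1 - (n + height q1 ^ 2)).
  assert (Ht : exists t, n = 0 \/ 1 - t * k - t ^ 2 * n = 0).
  { destruct (Req_dec n 0) as [Hn|Hn]; [exists 0; now left|].
    assert (Hn' : 0 <= n) by apply pow2_ge_0.
    assert (HD : 0 <= k ^ 2 + 4 * n) by (assert (Hk := pow2_ge_0 k); lra).
    exists ((- k + sqrt (k ^ 2 + 4 * n)) / (2 * n)). right.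
    assert (S := sqrt_sqrt _ HD). set (s := sqrt (k ^ 2 + 4 * n)) in *.
    apply Rmult_eq_reg_r with (4 * n); [|lra].
    transitivity (4 * n - 2 * k * (- k + s) - (k * k - 2 * k * s + s * s)); [field; lra|]. rewrite S. ring. }
  destruct Ht as [t [Hn|Ht]].
  - exists (RtoC 0). assert (Z : z = RtoC 0).
    { apply Cmod_eq_0. apply Rsqr_0_uniq. unfold Rsqr. unfold n in Hn. simpl in Hn. lra. }
    rewrite Z, Cconj_RtoC. ring.
  - exists (RtoC t * Cconj z)%C. rewrite Cmult_conj, Cconj_conj, Cconj_RtoC.
    transitivity (z * (1 - t * (1 - RtoC (n + height q1 ^ 2)) - t * t * (z * Cconj z)))%C; [unfold n; ring|].
    rewrite <- Cmod2_conj. fold n.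
    replace (1 - t * (1 - RtoC (n + height q1 ^ 2)) - t * t * n)%C with (RtoC (1 - t * k - t ^ 2 * n)); [rewrite Ht; ring|].
    unfold k. rewrite !RtoC_minus, !RtoC_mult, RtoC_minus, RtoC_plus. replace (RtoC (t ^ 2)) with (t * t)%C by (rewrite <- RtoC_mult; f_equal; ring). ring. }
destruct Hbe as [be Hbe]. set (U := Mat2 (RtoC 1) be (- Cconj be) (RtoC 1)).
assert (Hbp : 0 < 1 + Cmod be ^ 2) by (assert (T := pow2_ge_0 (Cmod be)); lra).
assert (DU : mat2_det U <> RtoC 0).
{ unfold U. rewrite det_unitary. apply RtoC_neq0. lra. }
assert (EU : mob U (axis 1) = axis 1).
{ transitivity (axis (height (mob U (axis 1)))).
  - apply axis_eq, mob_unitary_axis; [apply axis_H3; lra|]. unfold axis, zeta, height. cbn [fst snd].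
    rewrite Cmod_0, Cconj_RtoC. replace (0 ^ 2 + 1 ^ 2) with 1 by ring. ring.
  - f_equal. unfold mob, pt, height at 1. cbn [snd]. rewrite det_mul. unfold U at 1. rewrite det_unitary.
    rewrite height_det by (apply axis_H3; lra). unfold U, frame, mat2_mul, axis, zeta, height. cbn [mA mB mC mD fst snd].
    replace (1 * 1 + be * 0)%C with (RtoC 1) by ring. replace (1 * 0 + be * 1)%C with be by ring.
    rewrite Cmult_1_r, Cmod_1, Cmod_R, Rabs_pos_eq by lra. field. lra. }
assert (E1 := axis_eq _ (mob_unitary_axis be q1 H1 Hbe)). fold U in E1.
assert (H2 : 0 < height (mob U q1)) by (apply mob_H3; easy).
set (b := height (mob U q1)) in *.
assert (DUL : mat2_det (mat2_mul U L0) <> RtoC 0) by (rewrite det_mul; now apply Cmult_neq_0).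
assert (F1 : mob (mat2_mul U L0) p = axis 1) by (rewrite <- mob_mul, E0 by easy; exact EU).
assert (F2 : mob (mat2_mul U L0) q = axis b) by (rewrite <- mob_mul by easy; exact E1).
destruct (Rle_or_lt 1 b) as [Hb|Hb]; [exists (mat2_mul U L0), b; exact (conj DUL (conj Hb (conj F1 F2)))|].
(* the half-turn that exchanges the ends of the axis *)
set (J := Mat2 (RtoC 0) (RtoC 1) (- RtoC 1)%C (RtoC 0)).
assert (DJ : mat2_det J = RtoC 1) by (unfold J, mat2_det; simpl; ring).
assert (DJ' : mat2_det J <> RtoC 0) by (rewrite DJ; apply C1_nz).
assert (EJ : forall c, 0 < c -> mob J (axis c) = axis (/ c)).
{ intros c Hc. unfold mob, pt. rewrite det_mul, DJ, height_det by now apply axis_H3.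
  unfold J, frame, mat2_mul, axis, zeta, height. cbn [mA mB mC mD fst snd].
  replace (0 * 1 + 1 * 0)%C with (RtoC 0) by ring. replace (0 * 0 + 1 * c)%C with (RtoC c) by ring.
  rewrite Cmult_1_l, Cmod_0, Cmod_R, Rabs_pos_eq by lra. f_equal.
  - unfold Cdiv. rewrite !Cconj_RtoC. ring.
  - field. lra. }
exists (mat2_mul J (mat2_mul U L0)), (/ b).
split; [rewrite det_mul; now apply Cmult_neq_0|].
split; [rewrite <- Rinv_1; apply Rinv_le_contravar; lra|].
split; rewrite <- mob_mul by easy.
- rewrite F1, EJ by lra. f_equal. field.
- rewrite F2. now apply EJ.
Qed.

(** The logarithm of the height grows at most at unit speed along a curve of
    unit hyperbolic speed. *)
Lemma preserves_metric_axis (Phi : E3 -> E3) (b b' : R) : preserves_metric Phi -> 1 <= b ->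
  Phi (axis 1) = axis 1 -> Phi (axis b) = axis b' -> b' <= b.
Proof.
intros HP Hb E1 E2.
assert (Hb' : 0 < b').
{ destruct (HP (axis b)) as [H _]; [apply axis_H3; lra|]. rewrite E2 in H. exact H. }
set (u := fun t => ln (height (Phi (axis t)))).
assert (Hu : forall t, 0 < t -> exists l, is_derive u t l /\ l <= / t).
{ intros t Ht. destruct (HP (axis t) (axis_H3 _ Ht)) as (HH & L & D & I).
  assert (Lax : @is_linear R_AbsRing R_NormedModule E3 axis).
  { apply (@is_linear_prod R_AbsRing R_NormedModule C_R_NormedModule R_NormedModule (fun _ : R => RtoC 0) (fun s : R => s)).
    - exact (@is_linear_zero R_AbsRing R_NormedModule C_R_NormedModule).
    - apply is_linear_id. }
  assert (D1 : @filterdiff R_AbsRing R_NormedModule E3 axis (locally t) axis) by (apply filterdiff_linear, Lax).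
  assert (D2 := filterdiff_comp' axis Phi t axis L D1 D).
  assert (Lh : @is_linear R_AbsRing E3 R_NormedModule height) by apply is_linear_snd.
  assert (D3 := filterdiff_comp' (fun s => Phi (axis s)) height t _ height D2 (filterdiff_linear height Lh)).
  set (k := height (L (axis 1))).
  assert (D4 : is_derive (fun s => height (Phi (axis s))) t k).
  { apply (@filterdiff_ext_lin R_AbsRing R_NormedModule R_NormedModule _ _ _ (fun s => height (L (axis s)))); [exact D3|].
    intros s. unfold k. transitivity (height (L (scal s (axis 1)))).
    - do 2 f_equal. apply injective_projections.
      + symmetry. exact (@scal_zero_r R_AbsRing C_R_NormedModule s).
      + symmetry. exact (Rmult_1_r s).
    - rewrite (linear_scal _ (proj1 D)). reflexivity. }
  unfold H3 in HH. set (w := height (Phi (axis t))) in *.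
  exists (k * / w). split.
  - apply (is_derive_comp ln (fun s => height (Phi (axis s))) t (/ w) k); [|exact D4]. now apply is_derive_ln.
  - assert (S := I (axis 1) (axis 1)). unfold hyp in S. fold w in S. change (height (axis t)) with t in S.
    replace (eucl (axis 1) (axis 1)) with 1 in S by (unfold eucl, axis, pos1, pos2, height; simpl; ring).
    assert (K2 : k * k <= eucl (L (axis 1)) (L (axis 1))).
    { unfold eucl, k. generalize (Rle_0_sqr (pos1 (L (axis 1)))) (Rle_0_sqr (pos2 (L (axis 1)))). unfold Rsqr. lra. }
    assert (Hw2 : 0 < w ^ 2) by now apply pow_lt. assert (Ht2 : 0 < t ^ 2) by now apply pow_lt.
    assert (K3 : (k / w) ^ 2 <= (/ t) ^ 2).
    { replace ((/ t) ^ 2) with (1 / t ^ 2) by (field; lra). rewrite <- S.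
      replace ((k / w) ^ 2) with (k * k / w ^ 2) by (field; lra). apply Rmult_le_compat_r; [|easy].
      now apply Rlt_le, Rinv_0_lt_compat. }
    assert (0 < / t) by now apply Rinv_0_lt_compat.
    change (k / w <= / t). destruct (Rle_or_lt (k / w) (/ t)); [easy|]. simpl in K3. nra. }
destruct (Rle_lt_or_eq_dec _ _ Hb) as [Hlt|Heq].
2: { subst b. rewrite E1 in E2. apply (f_equal height) in E2. unfold axis, height in E2. simpl in E2. lra. }
set (v := fun t => u t - ln t).
assert (Hv : forall t, 0 < t -> exists l, is_derive v t l /\ l <= 0).
{ intros t Ht. destruct (Hu t Ht) as (l & D & Hl). exists (l - / t). split; [|lra].
  apply (@is_derive_minus R_AbsRing R_NormedModule u ln); [easy|now apply is_derive_ln]. }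
assert (Dv : forall t, 0 < t -> is_derive v t (Derive v t) /\ Derive v t <= 0).
{ intros t Ht. destruct (Hv t Ht) as (l & D & Hl). rewrite (is_derive_unique _ _ _ D). easy. }
destruct (MVT_gen v 1 b (Derive v)) as (c & Hc & E).
- intros x Hx. rewrite Rmin_left, Rmax_right in Hx by lra. apply Dv. lra.
- intros x Hx. rewrite Rmin_left, Rmax_right in Hx by lra. apply continuity_pt_filterlim.
  apply (ex_derive_continuous v x). eexists. apply Dv. lra.
- rewrite Rmin_left, Rmax_right in Hc by lra. destruct (Dv c) as [_ Dc]; [lra|].
  change (ln (height (Phi (axis b))) - ln b - (ln (height (Phi (axis 1))) - ln 1) = Derive v c * (b - 1)) in E. rewrite E1, E2 in E. unfold axis, height in E. simpl in E. rewrite ln_1 in E.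
  assert (ln b' <= ln b) by nra. destruct (Rle_or_lt b' b); [easy|].
  assert (ln b < ln b') by (apply ln_increasing; lra). lra.
Qed.

Lemma delta_axis (b : R) : 0 < b -> delta (axis 1) (axis b) = (b - 1) ^ 2 / (2 * b).
Proof. intros Hb. unfold delta, axis, pos1, pos2, height. simpl. field. lra. Qed.

Lemma delta_axis_le (b b' : R) : 1 <= b' <= b -> delta (axis 1) (axis b') <= delta (axis 1) (axis b).
Proof.
intros H. rewrite !delta_axis by lra.
apply Rminus_le. replace ((b' - 1) ^ 2 / (2 * b') - (b - 1) ^ 2 / (2 * b)) with (- ((b - b') * (b * b' - 1) / (2 * b * b'))) by (field; lra).
assert (0 <= (b - b') * (b * b' - 1) / (2 * b * b')); [|lra].
apply Rmult_le_pos; [apply Rmult_le_pos; nra|apply Rlt_le, Rinv_0_lt_compat; nra].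
Qed.

Lemma mob_keeps_delta (L : mat2) (p q : E3) : mat2_det L <> RtoC 0 -> H3 p -> H3 q -> delta (mob L p) (mob L q) = delta p q.
Proof. intros HL. destruct (rigid_mob L HL) as (_ & H & _). apply H. Qed.

(** Two points can be moved to the axis, and there [delta] is an increasing
    function of the ratio of the heights. *)
Lemma preserves_metric_delta_le (Phi : E3 -> E3) (p q : E3) : preserves_metric Phi -> H3 p -> H3 q ->
  delta (Phi p) (Phi q) <= delta p q.
Proof.
intros HP Hp Hq. assert (Hp' : H3 (Phi p)) by now apply HP. assert (Hq' : H3 (Phi q)) by now apply HP.
destruct (pair_on_axis p q Hp Hq) as (L & b & DL & Hb & L1 & L2).
destruct (pair_on_axis (Phi p) (Phi q) Hp' Hq') as (L' & b' & DL' & Hb' & L1' & L2').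
assert (DLi := det_inv_neq0 L DL).
rewrite <- (mob_keeps_delta L' (Phi p)), <- (mob_keeps_delta L p), L1, L2, L1', L2' by easy.
apply delta_axis_le. split; [easy|].
apply (preserves_metric_axis (fun x => mob L' (Phi (mob (mat2_inv L) x)))).
- apply (preserves_metric_comp (mob L')); [now apply rigid_mob|].
  apply (preserves_metric_comp Phi); [easy|now apply rigid_mob].
- easy.
- now rewrite <- L1, mob_inv_l, L1'.
- now rewrite <- L2, mob_inv_l, L2'.
Qed.

Lemma isometry_keeps_delta (Phi : E3 -> E3) : isometry Phi -> keeps_delta Phi.
Proof.
intros (Psi & H1 & H2 & H12 & H21) p q Hp Hq. apply Rle_antisym; [now apply preserves_metric_delta_le|].
rewrite <- (H12 p), <- (H12 q) at 1 by easy. apply preserves_metric_delta_le; [easy|now apply H1|now apply H1].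
Qed.

(** The distances to the first three points determine a point up to the
    reflection in the plane through them. *)
Lemma delta_frame (p q : E3) : H3 p -> H3 q ->
  delta p (axis 1) = delta q (axis 1) -> delta p (axis 2) = delta q (axis 2) ->
  delta p ((RtoC 1, 1) : E3) = delta q ((RtoC 1, 1) : E3) ->
  height p = height q /\ pos1 p = pos1 q /\ pos2 p ^ 2 = pos2 q ^ 2.
Proof.
destruct p as [[x y] w], q as [[x' y'] w']. unfold H3, delta, axis, pos1, pos2, height. cbn [fst snd RtoC].
intros Hp Hq A1 A2 A3.
assert (K : forall a b, (x - a) ^ 2 + y ^ 2 + (w - b) ^ 2 = (x ^ 2 + y ^ 2 + w ^ 2) - 2 * a * x + a ^ 2 - 2 * w * b + b ^ 2) by (intros; ring).
set (S := x ^ 2 + y ^ 2 + w ^ 2). set (S' := x' ^ 2 + y' ^ 2 + w' ^ 2).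
assert (B1 : (S + 1) * w' = (S' + 1) * w).
{ apply Rmult_eq_reg_r with (/ (2 * w * w')); [|apply Rinv_neq_0_compat; nra].
  transitivity (((x - 0) ^ 2 + (y - 0) ^ 2 + (w - 1) ^ 2) / (2 * w * 1) + 1); [unfold S; field; lra|].
  rewrite A1. unfold S'; field; lra. }
assert (B2 : (S + 4) * w' = (S' + 4) * w).
{ apply Rmult_eq_reg_r with (/ (2 * w * w')); [|apply Rinv_neq_0_compat; nra].
  transitivity (2 * (((x - 0) ^ 2 + (y - 0) ^ 2 + (w - 2) ^ 2) / (2 * w * 2)) + 2); [unfold S; field; lra|].
  rewrite A2. unfold S'; field; lra. }
assert (B3 : (S - 2 * x + 2) * w' = (S' - 2 * x' + 2) * w).
{ apply Rmult_eq_reg_r with (/ (2 * w * w')); [|apply Rinv_neq_0_compat; nra].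
  transitivity (((x - 1) ^ 2 + (y - 0) ^ 2 + (w - 1) ^ 2) / (2 * w * 1) + 1); [unfold S; field; lra|].
  rewrite A3. unfold S'; field; lra. }
assert (Ew : w = w') by lra. subst w'. assert (ES : S = S') by nra. assert (Ex : x = x') by nra.
split; [easy|]. split; [easy|]. subst x'. unfold S, S' in ES. lra.
Qed.

Definition refl (p : E3) : E3 := (Cconj (zeta p), height p).

(** After composition with a suitable [mob M] the isometry fixes two points of
    the axis, hence all heights, and a third point, hence the first
    coordinate; the sign of the second coordinate is then decided by one more
    point. *)
Theorem isometry_classification (Phi : E3 -> E3) : isometry Phi -> exists L : mat2,
  mat2_det L <> RtoC 0 /\
  ((forall p, H3 p -> Phi p = mob L p) \/ (forall p, H3 p -> Phi p = mob L (refl p))).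
Proof.
intros HPhi. assert (HD := isometry_keeps_delta Phi HPhi). destruct HPhi as (_ & HP & _).
assert (HH : forall p, H3 p -> H3 (Phi p)) by (intros p Hp; now apply HP).
assert (A1 : H3 (axis 1)) by (apply axis_H3; lra). assert (A2 : H3 (axis 2)) by (apply axis_H3; lra).
set (p2 := ((RtoC 1, 1) : E3)). set (p3 := ((Ci, 1) : E3)).
assert (A3 : H3 p2) by (unfold H3, p2, height; simpl; lra). assert (A4 : H3 p3) by (unfold H3, p3, height; simpl; lra).
destruct (pair_on_axis (Phi (axis 1)) (Phi (axis 2))) as (L1 & b & DL1 & Hb & E1 & E2); [auto|auto|].
assert (Eb : b = 2).
{ assert (E := HD _ _ A1 A2). rewrite <- (mob_keeps_delta L1), E1, E2, !delta_axis in E by (auto; lra).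
  assert (E' : (b - 2) * (2 * b - 1) = 0).
  { transitivity (4 * b * ((b - 1) ^ 2 / (2 * b) - 1 / 4)); [field; lra|]. rewrite E. field. }
  apply Rmult_integral in E'. destruct E'; lra. }
subst b.
assert (HD1 : forall p q, H3 p -> H3 q -> delta (mob L1 (Phi p)) (mob L1 (Phi q)) = delta p q).
{ intros p q Hp Hq. rewrite mob_keeps_delta by auto. now apply HD. }
set (q2 := mob L1 (Phi p2)). assert (Hq2 : H3 q2) by (apply mob_H3; auto).
assert (Hq2v : height q2 = 1 /\ Cmod (zeta q2) = 1).
{ assert (F1 := HD1 _ _ A3 A1). assert (F2 := HD1 _ _ A3 A2). rewrite E1 in F1. rewrite E2 in F2. fold q2 in F1, F2.
  assert (Hm := Cmod2_alt (zeta q2)). assert (Hm0 := Cmod_ge_0 (zeta q2)).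
  destruct q2 as [[x y] w]. unfold H3, delta, axis, p2, pos1, pos2, height, zeta, Re, Im in *. cbn [fst snd RtoC] in *.
  assert (B1 : x ^ 2 + y ^ 2 + (w - 1) ^ 2 = w).
  { transitivity (2 * w * (((x - 0) ^ 2 + (y - 0) ^ 2 + (w - 1) ^ 2) / (2 * w * 1))); [field; lra|]. rewrite F1. field. }
  assert (B2 : x ^ 2 + y ^ 2 + (w - 2) ^ 2 = 2 * w).
  { transitivity (4 * w * (((x - 0) ^ 2 + (y - 0) ^ 2 + (w - 2) ^ 2) / (2 * w * 2))); [field; lra|]. rewrite F2. field. }
  assert (Ew : w = 1) by lra. split; [easy|]. subst w.
  assert (Cmod (x, y) ^ 2 = 1) by (rewrite Hm; lra). simpl in H. nra. }
destruct Hq2v as [Hw2 Hz2]. set (c := zeta q2) in *.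
assert (Hc : c <> RtoC 0) by (apply Cmod_gt_0; lra).
set (Ro := Mat2 c (RtoC 0) (RtoC 0) (RtoC 1)).
assert (DRo : mat2_det Ro <> RtoC 0) by (unfold Ro, mat2_det; cbn [mA mB mC mD]; replace (c * 1 - 0 * 0)%C with c by ring; easy).
assert (ERo : forall p, H3 p -> mob Ro p = (((/ c * zeta p)%C, height p) : E3)).
{ intros p Hp. rewrite mob_lower by easy. unfold Ro, aff. cbn [mA mB mC mD]. f_equal.
  - field. easy.
  - rewrite Cmod_div, Hz2, Cmod_1 by easy. field. }
set (M := mat2_mul Ro L1). assert (DM : mat2_det M <> RtoC 0) by (unfold M; rewrite det_mul; now apply Cmult_neq_0).
assert (M1 : mob M (Phi (axis 1)) = axis 1).
{ unfold M. rewrite <- mob_mul, E1, ERo by auto. unfold axis, zeta, height. cbn [fst snd]. f_equal. ring. }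
assert (M2 : mob M (Phi (axis 2)) = axis 2).
{ unfold M. rewrite <- mob_mul, E2, ERo by auto. unfold axis, zeta, height. cbn [fst snd]. f_equal. ring. }
assert (M3 : mob M (Phi p2) = p2).
{ unfold M. rewrite <- mob_mul by auto. fold q2. rewrite ERo by auto. unfold p2. f_equal; [|exact Hw2].
  fold c. field. easy. }
assert (HDM : forall p q, H3 p -> H3 q -> delta (mob M (Phi p)) (mob M (Phi q)) = delta p q).
{ intros p q Hp Hq. rewrite mob_keeps_delta by auto. now apply HD. }
assert (HM : forall p, H3 p -> H3 (mob M (Phi p))) by (intros p Hp; apply mob_H3; auto).
assert (K : forall p, H3 p -> height (mob M (Phi p)) = height p /\ pos1 (mob M (Phi p)) = pos1 p /\ pos2 (mob M (Phi p)) ^ 2 = pos2 p ^ 2).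
{ intros p Hp. apply delta_frame; auto.
  - rewrite <- M1 at 1. now apply HDM.
  - rewrite <- M2 at 1. now apply HDM.
  - fold p2. rewrite <- M3 at 1. now apply HDM. }
exists (mat2_inv M). split; [now apply det_inv_neq0|].
destruct (K p3 A4) as (K1 & K2 & K3).
assert (K3' : pos2 (mob M (Phi p3)) = 1 \/ pos2 (mob M (Phi p3)) = -1).
{ change (pos2 p3) with 1 in K3. assert (E : (pos2 (mob M (Phi p3)) - 1) * (pos2 (mob M (Phi p3)) + 1) = 0) by (simpl in K3; lra).
  apply Rmult_integral in E. destruct E; [left|right]; lra. }
(* the distance to the fourth point decides which of the two points it is *)
assert (K4 : forall p, H3 p -> pos2 (mob M (Phi p)) * pos2 (mob M (Phi p3)) = pos2 p).
{ intros p Hp. destruct (K p Hp) as (B1 & B2 & B3). assert (F := HDM p p3 Hp A4). unfold delta in F.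
  rewrite B1, B2, K1, K2 in F. change (pos1 p3) with 0 in F. change (pos2 p3) with 1 in F, K3. change (height p3) with 1 in F.
  unfold H3 in Hp. set (y' := pos2 (mob M (Phi p))) in *. set (s := pos2 (mob M (Phi p3))) in *.
  assert (G : (y' - s) ^ 2 = (pos2 p - 1) ^ 2).
  { set (k := (pos1 p - 0) ^ 2) in *. set (l := (height p - 1) ^ 2) in *.
    assert (k + (y' - s) ^ 2 + l = k + (pos2 p - 1) ^ 2 + l); [|lra].
    apply Rmult_eq_reg_r with (/ (2 * height p * 1)); [exact F|]. apply Rinv_neq_0_compat. lra. }
  simpl in G, B3, K3. lra. }
destruct K3' as [E|E]; [left|right]; intros p Hp; destruct (K p Hp) as (B1 & B2 & _); assert (B3 := K4 p Hp); rewrite E in B3.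
- rewrite <- (mob_inv_l M (Phi p)) by auto. f_equal. apply E3_ext; lra.
- rewrite <- (mob_inv_l M (Phi p)) by auto. f_equal. apply E3_ext; [exact B2| |exact B1].
  change (pos2 (mob M (Phi p)) = - pos2 p). lra.
Qed.

(** * Normalization of the end *)

Lemma C_derive_cder (f : C -> C) (z l : C) : cder f z l -> C_derive f z = l.
Proof.
intros H. apply (cder_unique f z); [|exact H]. apply cder_C_derive. now exists l.
Qed.

Lemma bryant_point (rho : R) (X : C -> E3) (F : C -> mat2) (s : C) :
  bryant_representation rho X F -> cover rho s -> X (Cexp s) = pt (F s).
Proof.
intros [_ H] Hs. destruct (H s Hs) as (D & _ & Z & W). unfold pt. rewrite D, Cmod_1.
rewrite <- Z. unfold Rdiv. rewrite Rmult_1_l, <- W. now destruct (X (Cexp s)).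
Qed.

Lemma moved_derive (rho : R) (F : C -> mat2) (L : mat2) : mat2_holomorphic (cover rho) F ->
  mat2_holomorphic (cover rho) (fun s => mat2_mul L (F s)) /\
  forall s, cover rho s -> mat2_derive (fun s => mat2_mul L (F s)) s = mat2_mul L (mat2_derive F s).
Proof.
intros (HA & HB & HC & HD).
assert (K : forall (c1 c2 : C) (f g : C -> C) s, holomorphic_on (cover rho) f -> holomorphic_on (cover rho) g -> cover rho s ->
  cder (fun s => c1 * f s + c2 * g s)%C s (c1 * C_derive f s + c2 * C_derive g s)%C).
{ intros c1 c2 f g s Hf Hg Hs. apply cder_plus; apply cder_scal; apply cder_C_derive; auto. }
assert (KA := fun s => K (mA L) (mB L) _ _ s HA HC). assert (KB := fun s => K (mA L) (mB L) _ _ s HB HD).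
assert (KC := fun s => K (mC L) (mD L) _ _ s HA HC). assert (KD := fun s => K (mC L) (mD L) _ _ s HB HD).
split.
- split; [|split; [|split]]; intros s Hs; eexists; [apply KA|apply KB|apply KC|apply KD]; exact Hs.
- intros s Hs. unfold mat2_derive, mat2_mul. cbn [mA mB mC mD].
  f_equal; apply C_derive_cder; [apply KA|apply KB|apply KC|apply KD]; exact Hs.
Qed.

Lemma moved_representation (rho : R) (X : C -> E3) (F : C -> mat2) (L : mat2) (g omega : C -> C) :
  mat2_det L = RtoC 1 -> bryant_representation rho X F -> weierstrass_data rho F g omega ->
  bryant_representation rho (fun z => mob L (X z)) (fun s => mat2_mul L (F s)) /\
  weierstrass_data rho (fun s => mat2_mul L (F s)) g omega.
Proof.
intros HL HF HW. assert (HL' : mat2_det L <> RtoC 0) by (rewrite HL; apply C1_nz).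
destruct (moved_derive rho F L (proj1 HF)) as [H1 H2]. split.
- split; [exact H1|]. intros s Hs. assert (HX := bryant_point rho X F s HF Hs).
  destruct HF as [_ HF]. destruct (HF s Hs) as (D1 & D2 & _ & _).
  split; [rewrite det_mul, HL, D1; ring|]. split; [rewrite H2, det_mul, D2 by easy; ring|].
  rewrite HX, <- pt_mul by (try rewrite D1; easy || apply C1_nz).
  unfold pt, zeta, height. cbn [fst snd]. split; [reflexivity|].
  rewrite det_mul, HL, D1, Cmult_1_l, Cmod_1. unfold Rdiv. ring.
- intros s Hs. rewrite H2 by easy. rewrite <- (HW s Hs). destruct HF as [_ HF]. destruct (HF s Hs) as (D1 & _).
  unfold mat2_inv. rewrite det_mul, HL, D1.
  destruct L as [a b c d]. destruct (F s) as [A B C0 D]. destruct (mat2_derive F s) as [A' B' C' D'].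
  unfold mat2_det in HL. cbn [mA mB mC mD] in HL.
  unfold mat2_mul, mat2_scale. cbn [mA mB mC mD].
  replace (/ (1 * 1))%C with (/ 1)%C by (f_equal; ring).
  assert (Hd : (/ 1 = a * d - b * c)%C) by (rewrite HL; field; apply C1_nz).
  assert (H11 : (/ 1 = 1)%C) by (field; apply C1_nz). rewrite H11.
  f_equal.
  + transitivity ((a * d - b * c) * (D * A' - B * C'))%C; [ring|rewrite HL; ring].
  + transitivity ((a * d - b * c) * (D * B' - B * D'))%C; [ring|rewrite HL; ring].
  + transitivity ((a * d - b * c) * (- C0 * A' + A * C'))%C; [ring|rewrite HL; ring].
  + transitivity ((a * d - b * c) * (- C0 * B' + A * D'))%C; [ring|rewrite HL; ring].
Qed.

Lemma pdisc_Cexp (rho : R) (s : C) : 0 < rho -> Re s < ln rho -> pdisc rho (Cexp s).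
Proof. intros Hr Hs. now apply cover_iff. Qed.

(** The horizontal coordinate winds [m] times around infinity; for [m >= 2] the
    pair of points from [common_value] contradicts injectivity. *)
Lemma winding_one (rho mu r : R) (m : nat) (X : C -> E3) (F : C -> mat2) (L : mat2)
  (f1 df1 f2 df2 g1 dg1 g2 dg2 : C -> C) :
  bryant_end rho X -> embedded rho X -> 0 < mu -> bryant_representation rho X F ->
  (1 <= m)%nat -> mat2_det L = RtoC 1 -> 0 < r <= rho ->
  hol1 r f1 df1 -> hol1 r f2 df2 -> hol1 r g1 dg1 -> hol1 r g2 dg2 ->
  f1 (RtoC 0) = RtoC 1 -> f2 (RtoC 0) = RtoC 1 ->
  (forall s, Re s < ln r ->
     mat2_mul L (F s) =
     Mat2 (zpow ((INR m - mu) / 2) s * f2 (Cexp s))%C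
       (RtoC ((mu - INR m) / (mu + INR m)) * zpow ((mu + INR m) / 2) s * g2 (Cexp s))%C
       (RtoC ((mu ^ 2 - INR m ^ 2) / (4 * INR m * mu)) * zpow ((- INR m - mu) / 2) s * f1 (Cexp s))%C
       (RtoC ((mu + INR m) ^ 2 / (4 * INR m * mu)) * zpow ((mu - INR m) / 2) s * g1 (Cexp s))%C) ->
  m = 1%nat.
Proof.
intros HX HE Hmu HF Hm1 HL Hr H1 H2 H3' H4 E1 E2 HG.
destruct (Nat.eq_dec m 1) as [|Hm]; [easy|]. exfalso.
assert (Hm2 : (2 <= m)%nat) by lia.
assert (HmR : 0 < INR m) by (apply lt_0_INR; lia).
assert (HL' : mat2_det L <> RtoC 0) by (rewrite HL; apply C1_nz).
assert (Hln : ln r <= ln rho) by (destruct (Rle_lt_or_eq_dec r rho) as [?| ->]; [lra|apply Rlt_le, ln_increasing; lra|lra]).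
assert (HXH : forall z, pdisc rho z -> H3 (X z)) by apply HX.
set (Y := fun z => mob L (X z)).
destruct (rigid_mob L HL') as (_ & _ & _ & HB). destruct (HB rho X HX) as [HY _].
set (k := (mu - INR m) / (mu + INR m)) in *.
set (E := fun s => (end_num mu f1 f2 g1 g2 s / RtoC (end_den mu k f2 g2 s) - 1)%C).
assert (HY1 : forall s, Re s < ln r ->
  zeta (Y (Cexp s)) = (RtoC ((mu ^ 2 - INR m ^ 2) / (4 * INR m * mu)) * (zpow (- INR m) s * (1 + E s)))%C).
{ intros s Hs. assert (Hc : cover rho s) by (apply cover_iff; lra).
  assert (D : mat2_det (F s) = RtoC 1) by now apply HF.
  assert (DLF : mat2_det (mat2_mul L (F s)) <> RtoC 0) by (rewrite det_mul, D, Cmult_1_r; easy).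
  unfold Y. rewrite (bryant_point rho X F s HF Hc), <- pt_mul by (try rewrite D; easy || apply C1_nz).
  assert (G := gram_pos _ DLF). rewrite HG in G by easy. cbn [mA mB] in G.
  assert (T := end_formula (INR m) mu f1 f2 g1 g2 s _ _ _ _ HmR Hmu eq_refl eq_refl eq_refl eq_refl (Rgt_not_eq _ _ G)).
  rewrite HG by easy. unfold pt, zeta. cbn [mA mB mC mD fst]. fold k in T.
  rewrite (proj1 (proj2 T)). unfold E. ring. }
assert (Htau : forall s, E (s + tau)%C = E s).
{ intros s. unfold E, end_num, end_den. rewrite Re_add_tau, Cexp_plus, Cexp_tau, Cmult_1_r. reflexivity. }
destruct (common_value m E (fun s => height (Y (Cexp s))) (ln r)) as (s1 & s2 & K1 & K2 & K3 & K4 & K5).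
- easy.
- apply (end_factor_smallLip r mu k f1 df1 f2 df2 g1 dg1 g2 dg2); try easy; apply Hr.
- intros s _. apply Htau.
- intros s _. now rewrite Cexp_plus, Cexp_tau, Cmult_1_r.
- intros s Hs. apply (continuous_comp Cexp (fun z => height (Y z))).
  + apply (cder_continuous _ _ _ (cder_Cexp s)).
  + destruct HY as (_ & _ & HS & _). destruct (HS 0%nat) as (_ & _ & HS0). apply HS0. apply pdisc_Cexp; lra.
- apply K3. assert (P1 : pdisc rho (Cexp s1)) by (apply pdisc_Cexp; lra).
  assert (P2 : pdisc rho (Cexp s2)) by (apply pdisc_Cexp; lra).
  apply HE; [easy|easy|].
  rewrite <- (mob_inv_l L (X (Cexp s1))), <- (mob_inv_l L (X (Cexp s2))) by auto. f_equal.
  change (Y (Cexp s1) = Y (Cexp s2)).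
  assert (EZ : zeta (Y (Cexp s1)) = zeta (Y (Cexp s2))) by (rewrite !HY1 by easy; now rewrite K5).
  cbv beta in K4. destruct (Y (Cexp s1)), (Y (Cexp s2)). unfold zeta, height in *. simpl in *. now subst.
Qed.

Lemma hol1_holomorphic (r : R) (f df : C -> C) : 0 < r -> hol1 r f df -> holomorphic_near_0 f.
Proof.
intros Hr H. apply locally_Cmod. exists r. split; [easy|]. intros z Hz.
exists (df z). apply H. now replace z with (z - 0)%C by ring.
Qed.

(** The leading coefficient of [zeta] at a canonical end. *)
Definition slope (mu : R) : R := (mu ^ 2 - 1) / (4 * mu).
(** The ratio of the leading coefficients in the first row of a canonical
    representation. *)
Definition skew (mu : R) : R := (mu - 1) / (mu + 1).

Lemma slope_neq0 (mu : R) : 0 < mu -> mu <> 1 -> slope mu <> 0.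
Proof.
intros H0 H1 Z. unfold slope in Z.
assert (Z' : (mu - 1) * (mu + 1) = 0).
{ transitivity ((mu ^ 2 - 1) / (4 * mu) * (4 * mu)); [field; lra|rewrite Z; ring]. }
apply Rmult_integral in Z'. destruct Z'; lra.
Qed.

Lemma canonical_form (rho mu : R) (X : C -> E3) (F : C -> mat2) (h : C -> C) :
  bryant_end rho X -> embedded rho X -> 0 < mu -> bryant_representation rho X F ->
  weierstrass_data rho F (zpow mu) (power_form (-1 - mu) h) ->
  holomorphic_near_0 h -> h (RtoC 0) <> RtoC 0 ->
  exists (L : mat2) (r : R) (f1 f2 g1 g2 : C -> C),
    mat2_det L = RtoC 1 /\ 0 < r <= rho /\ mu <> 1 /\
    holomorphic_near_0 f1 /\ f1 (RtoC 0) = RtoC 1 /\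
    holomorphic_near_0 f2 /\ f2 (RtoC 0) = RtoC 1 /\
    holomorphic_near_0 g1 /\ g1 (RtoC 0) = RtoC 1 /\
    holomorphic_near_0 g2 /\ g2 (RtoC 0) = RtoC 1 /\
    C_derive f1 (RtoC 0) = RtoC 0 /\
    forall s, Re s < ln r ->
      mat2_mul L (F s) =
      Mat2 (zpow ((1 - mu) / 2) s * f2 (Cexp s))%C
        (RtoC ((mu - 1) / (mu + 1)) * zpow ((1 + mu) / 2) s * g2 (Cexp s))%C
        (RtoC ((mu ^ 2 - 1) / (4 * mu)) * zpow ((-1 - mu) / 2) s * f1 (Cexp s))%C
        (RtoC ((1 + mu) ^ 2 / (4 * mu)) * zpow ((mu - 1) / 2) s * g1 (Cexp s))%C.
Proof.
intros HX HE Hmu HF HW Hh Hh0. assert (Hrho : 0 < rho) by apply HX.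
destruct (normal_form rho mu X F h Hrho Hmu HF HW Hh Hh0)
  as (m & l11 & l12 & l21 & l22 & r & f1 & df1 & f2 & df2 & g1 & dg1 & g2 & dg2 &
      Hm & Hmmu & HL & Hr & H1 & H2 & H3' & H4 & E1 & E2 & E3' & E4 & HG).
assert (Em : m = 1%nat).
{ apply (winding_one rho mu r m X F (Mat2 l11 l12 l21 l22) f1 df1 f2 df2 g1 dg1 g2 dg2); try easy.
  intros s Hs. destruct (HG s Hs) as (G1 & G2 & G3 & G4). unfold mat2_mul. cbn [mA mB mC mD].
  rewrite G1, G2, G3, G4. reflexivity. }
subst m. change (INR 1) with 1 in *.
set (k := (mu ^ 2 - 1) / (4 * mu)).
assert (Hk : RtoC k <> RtoC 0) by (apply RtoC_neq0, (slope_neq0 mu); lra).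
set (K := (1 + mu) ^ 2 / (4 * mu)).
assert (HK : RtoC K <> RtoC 0).
{ apply RtoC_neq0, Rgt_not_eq. unfold K. apply Rdiv_lt_0_compat; [apply pow_lt; lra|lra]. }
set (q := RtoC ((mu - 1) / (mu + 1))).
(* adding a multiple of the first row to the second one moves the first
   end point of the axis and is used to bring it to 0 *)
set (d1 := df1 (RtoC 0)). set (t := (- (k * d1))%C).
set (e1 := fun z : C => (f1 z - d1 * (z * f2 z))%C).
set (e2 := fun z : C => (g1 z + (t * q / K) * (z * g2 z))%C).
assert (De1 : forall z, Cmod z < r -> cder e1 z (df1 z - d1 * (1 * f2 z + z * df2 z))%C).
{ intros z Hz. apply cder_minus; [now apply H1|]. apply cder_scal. apply cder_mult; [apply cder_id|now apply H2]. }
assert (De2 : forall z, Cmod z < r -> cder e2 z (dg1 z + (t * q / K) * (1 * g2 z + z * dg2 z))%C).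
{ intros z Hz. apply cder_plus; [now apply H3'|]. apply cder_scal. apply cder_mult; [apply cder_id|now apply H4]. }
assert (near : forall f, (forall z, Cmod z < r -> exists l, cder f z l) -> holomorphic_near_0 f).
{ intros f Hf. apply locally_Cmod. exists r. split; [easy|]. intros z Hz. apply Hf. now replace z with (z - 0)%C by ring. }
exists (Mat2 l11 l12 (l21 + t * l11)%C (l22 + t * l12)%C), r, e1, f2, e2, g2.
split; [unfold mat2_det; cbn [mA mB mC mD]; rewrite <- HL; ring|].
split; [easy|]. split; [lra|].
split; [apply near; intros z Hz; eexists; now apply De1|].
split; [unfold e1; rewrite E1; ring|].
split; [now apply (hol1_holomorphic r f2 df2)|]. split; [easy|].
split; [apply near; intros z Hz; eexists; now apply De2|].
split; [unfold e2; rewrite E3'; ring|].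
split; [now apply (hol1_holomorphic r g2 dg2)|]. split; [easy|].
split.
- assert (H0 : Cmod (RtoC 0) < r) by (rewrite Cmod_0; lra).
  rewrite (C_derive_cder _ _ _ (De1 _ H0)), E2. fold d1. ring.
- intros s Hs. destruct (HG s Hs) as (G1 & G2 & G3 & G4).
  replace ((1 - mu) / 2) with ((-1 - mu) / 2 + 1) in * by field.
  replace ((mu + 1) / 2) with ((mu - 1) / 2 + 1) in * by field.
  replace ((1 + mu) / 2) with ((mu - 1) / 2 + 1) by field.
  replace ((- (1) - mu) / 2) with ((-1 - mu) / 2) in * by field.
  rewrite zpow_plus in G1, G2. rewrite !zpow_plus.
  replace (zpow 1 s) with (Cexp s) in * by (unfold zpow; f_equal; ring).
  replace ((mu ^ 2 - 1 ^ 2) / (4 * 1 * mu)) with k in * by (unfold k; field; lra).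
  replace ((mu + 1) ^ 2 / (4 * 1 * mu)) with K in * by (unfold K; field; lra).
  fold q in G2 |- *. fold k K.
  unfold mat2_mul. cbn [mA mB mC mD]. f_equal.
  + exact G1.
  + exact G2.
  + transitivity ((l21 * mA (F s) + l22 * mC (F s)) + t * (l11 * mA (F s) + l12 * mC (F s)))%C; [ring|].
    rewrite G1, G3. unfold e1, t. ring.
  + transitivity ((l21 * mB (F s) + l22 * mD (F s)) + t * (l11 * mB (F s) + l12 * mD (F s)))%C; [ring|].
    rewrite G2, G4. unfold e2. field. easy.
Qed.

(** * Existence of the axis *)

Lemma pdisc_le (r rho : R) (z : C) : r <= rho -> pdisc r z -> pdisc rho z.
Proof. unfold pdisc. lra. Qed.

Lemma Ck_subset (k : nat) (U V : C -> Prop) : (forall z, V z -> U z) -> forall f, Ck k U f -> Ck k V f.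
Proof.
intros H. induction k; simpl; intros f Hf.
- auto.
- destruct Hf as (H1 & H2 & H3). split; [auto|split; auto].
Qed.

Lemma bryant_end_restrict (r rho : R) (X : C -> E3) : 0 < r <= rho -> bryant_end rho X -> bryant_end r X.
Proof.
intros Hr (A1 & A2 & A3 & A4 & N & A5).
assert (K : forall z, pdisc r z -> pdisc rho z) by (intros z; apply pdisc_le, Hr).
split; [apply Hr|]. split; [auto|]. split; [|split].
- intros k. destruct (A3 k) as (B1 & B2 & B3). split; [|split]; now apply (Ck_subset k (pdisc rho)).
- intros z Hz. auto.
- exists N. auto.
Qed.

Lemma bryant_representation_restrict (r rho : R) (X : C -> E3) (F : C -> mat2) (g omega : C -> C) : r <= rho ->
  bryant_representation rho X F -> weierstrass_data rho F g omega ->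
  bryant_representation r X F /\ weierstrass_data r F g omega.
Proof.
intros Hr ((A1 & A2 & A3 & A4) & A5) HW.
assert (K : forall s, cover r s -> cover rho s) by (intros s; now apply pdisc_le).
split; [split|]; [|auto|intros s Hs; auto].
split; [|split; [|split]]; intros s Hs; auto.
Qed.

Lemma embedded_moved (rho : R) (X : C -> E3) (L : mat2) : mat2_det L <> RtoC 0 ->
  (forall z, pdisc rho z -> H3 (X z)) -> embedded rho X -> embedded rho (fun z => mob L (X z)).
Proof.
intros HL HH [H1 H2]. split.
- intros z z' Hz Hz' E. apply H1; [easy|easy|].
  rewrite <- (mob_inv_l L (X z)), E by auto. now apply mob_inv_l; auto.
- intros z Hz eps.
  assert (Hp : H3 (mob L (X z))) by (apply mob_H3; auto).
  destruct (rigid_mob (mat2_inv L) (det_inv_neq0 L HL)) as (HM & _).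
  destruct (HM _ Hp) as (_ & l & D & _).
  assert (Hc : continuous (mob (mat2_inv L)) (mob L (X z))) by (apply filterdiff_continuous; now exists l).
  assert (E : mob (mat2_inv L) (mob L (X z)) = X z) by (apply mob_inv_l; auto).
  specialize (H2 z Hz eps). rewrite <- E in H2. apply Hc in H2.
  unfold filtermap in H2. refine (filter_imp _ _ _ H2). intros p K z' Hz' Ep. apply K; [easy|].
  rewrite <- Ep. symmetry. apply mob_inv_l; auto.
Qed.

(** The Gauss curvature is computed from the first fundamental form, which
    isometries preserve. *)
Lemma gauss_curvature_ext (rho : R) (X Y : C -> E3) : (forall z, pdisc rho z -> ff_xx Y z = ff_xx X z) ->
  forall z, pdisc rho z -> gauss_curvature Y z = gauss_curvature X z.
Proof.
intros H z Hz. unfold gauss_curvature. rewrite H by easy.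
assert (U := pdisc_open rho).
assert (E : forall w, pdisc rho w -> ln (ff_xx Y w) / 2 = ln (ff_xx X w) / 2) by (intros w Hw; now rewrite H).
f_equal. f_equal. f_equal.
- apply (pdx_ext _ U); [|easy]. apply (pdx_ext _ U). exact E.
- apply (pdy_ext _ U); [|easy]. apply (pdy_ext _ U). exact E.
Qed.

Lemma ftc_ext (r rho : R) (X Y : C -> E3) : r <= rho -> (forall z, pdisc rho z -> ff_xx Y z = ff_xx X z) ->
  finite_total_curvature rho X -> finite_total_curvature r Y.
Proof.
intros Hr H [M HM]. exists M. intros eps r' H1 H2 H3. rewrite <- (HM eps r' H1 H2) by lra. right.
apply RInt_ext. intros t Ht. rewrite Rmin_left, Rmax_right in Ht by lra.
apply RInt_ext. intros th _. cbv zeta.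
assert (P : pdisc rho (t * cos th, t * sin th)).
{ unfold pdisc. change (t * cos th, t * sin th) with (t * cos th, t * sin th).
  assert (E : Cmod (t * cos th, t * sin th) = t).
  { replace ((t * cos th, t * sin th) : C) with (RtoC t * circ th)%C by (apply injective_projections; simpl; ring).
    rewrite Cmod_mult, Cmod_circ, Cmod_R, Rabs_pos_eq; lra. }
  rewrite E. lra. }
rewrite (gauss_curvature_ext rho X Y) by easy. now rewrite H.
Qed.

Lemma isometry_mob (L : mat2) : mat2_det L <> RtoC 0 -> isometry (mob L).
Proof.
intros HL. exists (mob (mat2_inv L)). split; [now apply rigid_mob|].
split; [apply rigid_mob; now apply det_inv_neq0|]. split; intros p Hp; [now apply mob_inv_l|now apply mob_inv_r].
Qed.

Lemma same_end_refl (X : C -> E3) : same_end X X.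
Proof.
exists (fun z => z), (fun z => z).
split; [apply filterlim_id|]. split; [apply filterlim_id|].
assert (FF : Filter (locally' (RtoC 0))) by apply locally'_filter.
split; [|split]; now apply filter_forall.
Qed.

(** The axis of an end is the image of [0] and infinity under the inverse of
    the transformation [L] that puts its representation in canonical form. *)
Definition axis_of (L : mat2) (A B : Cbar) : Prop :=
  is_Cbar_quot (- mC L) (mD L) A /\ is_Cbar_quot (- mA L) (mB L) B.

Lemma axis_of_ex (L : mat2) : mat2_det L = RtoC 1 -> exists A B, axis_of L A B.
Proof.
intros HL. assert (HL' : mat2_det L <> RtoC 0) by (rewrite HL; apply C1_nz).
assert (K : forall a b : C, a <> RtoC 0 \/ (- b)%C <> RtoC 0 \/ (a = RtoC 0 /\ b = RtoC 0)).
{ intros a b. destruct (Ceq_dec a 0); [|now left]. right. destruct (Ceq_dec b 0); [now right|left].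
  intros Z. apply n. replace b with (- - b)%C by ring. rewrite Z. ring. }
unfold axis_of. destruct L as [a b c d]. unfold mat2_det in HL'. cbn [mA mB mC mD] in *.
destruct (is_Cbar_quot_ex (- c) d) as [A HA].
{ destruct (K d c) as [|[|[-> ->]]]; [now left|now right|]. exfalso. apply HL'. ring. }
destruct (is_Cbar_quot_ex (- a) b) as [B HB].
{ destruct (K b a) as [|[|[-> ->]]]; [now left|now right|]. exfalso. apply HL'. ring. }
now exists A, B.
Qed.

Lemma axis_of_maps (L : mat2) (A B : Cbar) : mat2_det L = RtoC 1 -> axis_of L A B ->
  maps_bdry (mob L) A (Some (RtoC 0)) /\ maps_bdry (mob L) B None.
Proof.
intros HL [HA HB]. assert (HL' : mat2_det L <> RtoC 0) by (rewrite HL; apply C1_nz).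
destruct L as [a b c d]. cbn [mA mB mC mD] in *. split.
- apply (mob_bdry _ d (- c)%C); [easy|easy|]. cbn [mA mB mC mD].
  replace (a * d + b * - c)%C with (RtoC 1) by (rewrite <- HL; unfold mat2_det; simpl; ring).
  split; [apply C1_nz|]. unfold Cdiv. ring.
- apply (mob_bdry _ b (- a)%C); [easy|easy|]. cbn [mA mB mC mD]. split; [ring|].
  intros Z. apply C1_nz. rewrite <- HL. unfold mat2_det. cbn [mA mB mC mD].
  transitivity (- (c * b + d * - a))%C; [ring|rewrite Z; ring].
Qed.

Lemma maps_bdry_functional (Phi : E3 -> E3) (P Q R : Cbar) : (forall p, H3 p -> H3 (Phi p)) ->
  maps_bdry Phi P Q -> maps_bdry Phi P R -> Q = R.
Proof.
intros HH H1 H2. assert (FF := bdry_nbhd_filter P).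
apply (limit_bdry_unique (bdry_nbhd P) Phi); [|exact H1|exact H2].
generalize (bdry_nbhd_H3 P). apply filter_imp. exact HH.
Qed.

(** Besides the end itself the conclusion records the transformation [L] and
    the first column of the canonical representation, from which the axis is
    computed. *)
Lemma catenoidal_existence (rho mu : R) (X : C -> E3) (F : C -> mat2) (h : C -> C) :
  bryant_end rho X -> embedded rho X -> finite_total_curvature rho X -> ~ part_of_horosphere rho X ->
  0 < mu -> bryant_representation rho X F ->
  weierstrass_data rho F (zpow mu) (power_form (-1 - mu) h) ->
  holomorphic_near_0 h -> h (RtoC 0) <> RtoC 0 ->
  exists (L : mat2) (r : R) (f1 f2 : C -> C) (A B : Cbar),
    mat2_det L = RtoC 1 /\ axis_of L A B /\ mu <> 1 /\
    canonical_catenoidal_end r (fun z => mob L (X z)) mu (RtoC 0) /\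
    catenoidal_end rho X (1 - mu) A B /\ A <> B /\
    0 < r <= rho /\ holomorphic_near_0 f1 /\ f1 (RtoC 0) = RtoC 1 /\ C_derive f1 (RtoC 0) = RtoC 0 /\
    holomorphic_near_0 f2 /\ f2 (RtoC 0) = RtoC 1 /\
    forall s, Re s < ln r ->
      (mA L * mA (F s) + mB L * mC (F s) = zpow ((1 - mu) / 2) s * f2 (Cexp s))%C /\
      (mC L * mA (F s) + mD L * mC (F s) =
       RtoC ((mu ^ 2 - 1) / (4 * mu)) * zpow ((-1 - mu) / 2) s * f1 (Cexp s))%C.
Proof.
intros HX HE HT HN Hmu HF HW Hh Hh0.
destruct (canonical_form rho mu X F h HX HE Hmu HF HW Hh Hh0)
  as (L & r & f1 & f2 & g1 & g2 & HL & Hr & Hmu1 & A1 & A2 & A3 & A4 & A5 & A6 & A7 & A8 & D1 & HG).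
assert (HL' : mat2_det L <> RtoC 0) by (rewrite HL; apply C1_nz).
destruct (axis_of_ex L HL) as (A & B & HAB). destruct (axis_of_maps L A B HL HAB) as [MA MB].
destruct (rigid_mob L HL') as (R1 & _ & RH & RB).
assert (HneqAB : A <> B).
{ intros E. subst B. assert (Z := maps_bdry_functional (mob L) _ _ _ RH MA MB). easy. }
assert (HXr : bryant_end r X) by now apply (bryant_end_restrict r rho).
destruct (bryant_representation_restrict r rho X F _ _ (proj2 Hr) HF HW) as [HFr HWr].
destruct (moved_representation r X F L _ _ HL HFr HWr) as [HFm HWm].
assert (HHX : forall z, pdisc rho z -> H3 (X z)) by apply HX.
assert (HCan : canonical_catenoidal_end r (fun z => mob L (X z)) mu (RtoC 0)).
{ split; [easy|]. split; [easy|]. split; [now apply (RB r X)|].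
  split; [|split].
  - assert (T := embedded_moved rho X L HL' HHX HE). destruct T as [T1 T2]. split.
    + intros z z' Hz Hz'. apply T1; now apply (pdisc_le r).
    + intros z Hz eps. generalize (T2 z (pdisc_le r rho z (proj2 Hr) Hz) eps). apply filter_imp.
      intros p Hp z' Hz'. apply Hp. now apply (pdisc_le r).
  - apply (ftc_ext r rho X); [apply Hr| |easy]. now apply (RB rho X).
  - exists (fun s => mat2_mul L (F s)), h, f1, f2, g1, g2.
    split; [exact HFm|]. split; [exact Hh|]. split; [exact Hh0|]. split; [exact HWm|].
    repeat (split; [assumption|]). split.
    + intros s Hs. apply HG. now apply cover_iff in Hs.
    + rewrite D1. ring. }
exists L, r, f1, f2, A, B. split; [easy|]. split; [easy|]. split; [easy|]. split; [exact HCan|].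
split.
{ split; [easy|]. split; [easy|]. split; [easy|]. split; [easy|]. split; [easy|].
  exists mu. split; [reflexivity|]. exists (mob L). split; [now apply isometry_mob|].
  split; [easy|]. split; [easy|]. exists r, (fun z => mob L (X z)). split; [exact HCan|apply same_end_refl]. }
split; [easy|]. split; [easy|]. repeat (split; [assumption|]).
intros s Hs. specialize (HG s Hs). split.
- exact (f_equal mA HG).
- exact (f_equal mC HG).
Qed.

Lemma holomorphic_near_0_cder (f : C -> C) : holomorphic_near_0 f -> cder f (RtoC 0) (C_derive f (RtoC 0)).
Proof. intros H. apply cder_C_derive. exact (locally_singleton _ _ H). Qed.

(** The first two Taylor coefficients of both sides agree; [j] tells whether
    the factor on the right is [z] or [k]. *)
Lemma row_jet (la k r : R) (l1 l2 : C) (a c f : C -> C) (j : bool) : 0 < r ->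
  holomorphic_near_0 a -> holomorphic_near_0 c -> holomorphic_near_0 f ->
  (forall s, Re s < ln r -> (l1 * (zpow la s * a (Cexp s)) + l2 * (zpow la s * c (Cexp s)) =
     zpow la s * ((if j then Cexp s else RtoC k) * f (Cexp s)))%C) ->
  (l1 * a (RtoC 0) + l2 * c (RtoC 0) = (if j then RtoC 0 else RtoC k * f (RtoC 0)))%C /\
  (l1 * C_derive a (RtoC 0) + l2 * C_derive c (RtoC 0) =
    (if j then f (RtoC 0) else RtoC k * C_derive f (RtoC 0)))%C.
Proof.
intros Hr Ha Hc Hf H. apply holomorphic_near_0_cder in Ha, Hc, Hf.
set (u := fun z : C => (l1 * a z + l2 * c z)%C).
set (v := fun z : C => ((if j then z else RtoC k) * f z)%C).
assert (Du : cder u (RtoC 0) (l1 * C_derive a (RtoC 0) + l2 * C_derive c (RtoC 0))%C).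
{ apply cder_plus; now apply cder_scal. }
assert (Dv : cder v (RtoC 0) (if j then f (RtoC 0) else RtoC k * C_derive f (RtoC 0))%C).
{ unfold v. destruct j.
  - eapply cder_eq; [apply cder_mult; [apply cder_id|exact Hf]|]. cbv beta. ring.
  - now apply cder_scal. }
assert (E : forall z, z <> RtoC 0 -> Cmod z < r -> u z = v z).
{ intros z Hz Hz'. assert (Es : Re (clog z) < ln r).
  { simpl. apply ln_increasing; [now apply Cmod_gt_0|easy]. }
  specialize (H _ Es). rewrite (Cexp_clog z Hz) in H.
  assert (Hn := zpow_neq0 la (clog z)). unfold u, v.
  transitivity ((l1 * (zpow la (clog z) * a z) + l2 * (zpow la (clog z) * c z)) / zpow la (clog z))%C; [field; easy|].
  rewrite H. field. easy. }
assert (E0 : u (RtoC 0) = v (RtoC 0)).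
{ apply (eq_at_puncture u v r Hr); [apply (cder_continuous _ _ _ Du)|apply (cder_continuous _ _ _ Dv)|exact E]. }
split.
- unfold u in E0. rewrite E0. unfold v. destruct j; ring.
- apply (cder_unique v (RtoC 0)); [|exact Dv]. apply (cder_ext_loc u); [|exact Du].
  apply locally_Cmod. exists r. split; [easy|]. intros z Hz. replace (z - 0)%C with z in Hz by ring.
  destruct (Ceq_dec z 0) as [-> |Hz0]; [exact E0|now apply E].
Qed.

(** * Asymptotics of a canonical end *)

(** The mean value theorem on the segment from [w/2] to [w] avoids the point
    where the derivative is to be found. *)
Lemma derive_limit (f df : C -> C) (r : R) (l m : C) : 0 < r -> cder f (RtoC 0) l ->
  (forall z, 0 < Cmod z < r -> cder f z (df z)) ->
  (forall eps, 0 < eps -> exists d, 0 < d /\ forall z, 0 < Cmod z < d -> Cmod (df z - m) <= eps) ->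
  l = m.
Proof.
intros Hr Hl Hdf Hlim. apply Ceq_minus. apply Cmod_eq_0.
apply Rle_antisym; [|apply Cmod_ge_0]. apply le_epsilon. intros eps Heps. rewrite Rplus_0_l.
destruct (Hlim (eps / 4)) as (d1 & Hd1 & H1); [lra|].
destruct (proj1 (cder_eps _ _ _) Hl (eps / 4)) as (d2 & Hd2 & H2); [lra|].
set (x := Rmin r (Rmin d1 d2) / 2).
assert (Hx : 0 < x /\ x < r /\ x < d1 /\ x < d2).
{ assert (0 < Rmin r (Rmin d1 d2)) by (repeat apply Rmin_pos; easy).
  unfold x. revert H. unfold Rmin. repeat destruct Rle_dec; lra. }
destruct Hx as (Hx & Hxr & Hx1 & Hx2).
assert (Hseg : forall t, 0 <= t <= 1 -> exists y, x / 2 <= y <= x /\ (RtoC (x / 2) + RtoC t * (RtoC x - RtoC (x / 2)))%C = RtoC y).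
{ intros t Ht. exists (x / 2 + t * (x - x / 2)). split; [nra|]. now rewrite RtoC_plus, RtoC_mult, RtoC_minus. }
assert (Hmod : forall y, x / 2 <= y <= x -> Cmod (RtoC y) = y) by (intros y Hy; rewrite Cmod_R; apply Rabs_pos_eq; lra).
assert (M : Cmod ((f (RtoC x) - m * RtoC x) - (f (RtoC (x / 2)) - m * RtoC (x / 2)))%C <= eps / 4 * Cmod (RtoC x - RtoC (x / 2))%C).
{ apply (cder_mvt (fun z => f z - m * z)%C (fun z => df z - m)%C).
  - intros t Ht. destruct (Hseg t Ht) as (y & Hy & E). rewrite E.
    eapply cder_eq; [apply cder_minus; [apply Hdf; rewrite Hmod by easy; lra|apply cder_scal, cder_id]|]. ring.
  - intros t Ht. destruct (Hseg t Ht) as (y & Hy & E). rewrite E. apply H1. rewrite Hmod by easy. lra. }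
rewrite <- RtoC_minus, Cmod_R, Rabs_pos_eq in M by lra.
assert (A1 := H2 (RtoC x)). assert (A2 := H2 (RtoC (x / 2))).
replace (RtoC x - 0)%C with (RtoC x) in A1 by ring. replace (RtoC (x / 2) - 0)%C with (RtoC (x / 2)) in A2 by ring.
rewrite !Hmod in A1 by lra. rewrite !Hmod in A2 by lra. specialize (A1 Hx2). specialize (A2 ltac:(lra)).
assert (E : ((l - m) * RtoC (x / 2) = ((f x - m * x) - (f (x / 2)%R - m * (x / 2)%R)) + (- (f x - f 0 - l * x) + (f (x / 2)%R - f 0 - l * (x / 2)%R)))%C).
{ replace (RtoC x) with (RtoC (x / 2) + RtoC (x / 2))%C by (rewrite <- RtoC_plus; f_equal; field). ring. }
apply (f_equal Cmod) in E. rewrite Cmod_mult, Hmod in E by lra.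
assert (T1 := Cmod_triangle ((f x - m * x) - (f (x / 2)%R - m * (x / 2)%R)) (- (f x - f 0 - l * x) + (f (x / 2)%R - f 0 - l * (x / 2)%R))).
assert (T2 := Cmod_triangle (- (f x - f 0 - l * x)) (f (x / 2)%R - f 0 - l * (x / 2)%R)). rewrite Cmod_opp in T2.
assert (K : Cmod (l - m) * (x / 2) <= eps * (x / 2)) by lra.
apply Rmult_le_reg_r with (x / 2); lra.
Qed.

(** The Taylor coefficients of order 0 and 1 of both sides of [z v'(z) =
    U(z)]. That [U] vanishes at 0 follows from [derive_limit] for [z v(z)]. *)
Lemma jet_ode (v dv U : C -> C) (r : R) (l u : C) : 0 < r -> cder v (RtoC 0) l -> cder U (RtoC 0) u ->
  (forall z, 0 < Cmod z < r -> cder v z (dv z) /\ (z * dv z)%C = U z) ->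
  U (RtoC 0) = RtoC 0 /\ l = u.
Proof.
intros Hr Hv HU H.
assert (Cv := proj1 (continuous_C_eps _ _) (cder_continuous _ _ _ Hv)).
assert (CU := proj1 (continuous_C_eps _ _) (cder_continuous _ _ _ HU)).
assert (E0 : U (RtoC 0) = RtoC 0).
{ assert (E : (1 * v 0 + 0 * l = v 0 + U 0)%C).
  { apply (derive_limit (fun z => z * v z)%C (fun z => 1 * v z + z * dv z)%C r); [easy| | |].
    - apply cder_mult; [apply cder_id|easy].
    - intros z Hz. apply cder_mult; [apply cder_id|now apply H].
    - intros eps Heps. destruct (Cv (eps / 2)) as (d1 & Hd1 & K1); [lra|]. destruct (CU (eps / 2)) as (d2 & Hd2 & K2); [lra|].
      exists (Rmin r (Rmin d1 d2)). split; [repeat apply Rmin_pos; easy|]. intros z Hz.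
      assert (Hz' : 0 < Cmod z < r /\ Cmod z < d1 /\ Cmod z < d2) by (revert Hz; unfold Rmin; repeat destruct Rle_dec; lra).
      destruct Hz' as (Z1 & Z2 & Z3). rewrite (proj2 (H z Z1)).
      replace (1 * v z + U z - (v 0 + U 0))%C with ((v z - v 0) + (U z - U 0))%C by ring.
      replace z with (z - 0)%C in Z2, Z3 by ring. specialize (K1 z Z2). specialize (K2 z Z3).
      eapply Rle_trans; [apply Cmod_triangle|]. lra. }
  transitivity ((v 0 + U 0) - v 0)%C; [ring|]. rewrite <- E. ring. }
split; [easy|].
apply (derive_limit v dv r); [easy|easy|intros z Hz; now apply H|].
intros eps Heps. destruct (proj1 (cder_eps _ _ _) HU eps Heps) as (d & Hd & K).
exists (Rmin r d). split; [now apply Rmin_pos|]. intros z Hz.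
assert (Hz' : 0 < Cmod z < r /\ Cmod z < d) by (revert Hz; unfold Rmin; destruct Rle_dec; lra).
destruct Hz' as [Z1 Z2]. replace z with (z - 0)%C in Z2 by ring. specialize (K z Z2). rewrite E0, <- (proj2 (H z Z1)) in K.
replace (z * dv z - 0 - u * (z - 0))%C with ((dv z - u) * z)%C in K by ring. replace (z - 0)%C with z in K by ring.
rewrite Cmod_mult in K. apply Rmult_le_reg_r with (Cmod z); lra.
Qed.

Lemma row_jet_ode (mu rho d kap : R) (h P Q v1 v2 : C -> C) : 0 < d <= rho ->
  (forall s, Re s < ln rho -> row_ode mu h P Q s) ->
  (forall s, Re s < ln rho -> (zpow (mu / 2) s * P s)%C = (zpow kap s * v1 (Cexp s))%C /\
     (zpow (- (mu / 2)) s * Q s)%C = (zpow kap s * v2 (Cexp s))%C) ->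
  (forall z, Cmod z < d -> cder v1 z (C_derive v1 z) /\ cder v2 z (C_derive v2 z) /\ cder h z (C_derive h z)) ->
  let a := RtoC (mu / 2 - kap) in let b := RtoC (mu / 2 + kap) in
  let h0 := h (RtoC 0) in let h1 := C_derive h (RtoC 0) in
  let p := v1 (RtoC 0) in let q := v2 (RtoC 0) in
  let p1 := C_derive v1 (RtoC 0) in let q1 := C_derive v2 (RtoC 0) in
  ((a + h0) * p + h0 * q = 0)%C /\
  p1 = ((a + h0) * p1 + h1 * p + h0 * q1 + h1 * q)%C /\
  q1 = (- (h0 * p1) - h1 * p - (b + h0) * q1 - h1 * q)%C.
Proof.
intros Hd HO HF HD a b h0 h1 p q p1 q1.
assert (HS := solves_of_row_ode mu (ln rho) h P Q HO).
assert (H0 : Cmod (RtoC 0) < d) by (rewrite Cmod_0; lra).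
destruct (HD _ H0) as (D1 & D2 & D3).
assert (K : forall z, 0 < Cmod z < d ->
  (z * C_derive v1 z)%C = ((a + h z) * v1 z + h z * v2 z)%C /\
  (z * C_derive v2 z)%C = (- h z * v1 z - (b + h z) * v2 z)%C).
{ intros z Hz. destruct (HD z (proj2 Hz)) as (E1 & E2 & _).
  assert (Hz0 : z <> RtoC 0) by now apply Cmod_gt_0.
  assert (Hs : Re (clog z) < ln rho) by (simpl; apply ln_increasing; lra).
  assert (Hs' : exp (Re (clog z)) < d) by (simpl; rewrite exp_ln; lra).
  assert (T := factor_ode mu h (ln rho) kap d _ _ v1 v2 (C_derive v1 z) (C_derive v2 z) (clog z) HS (fun s Hs _ => HF s Hs) Hs Hs').
  rewrite Cexp_clog in T by easy. exact (T E1 E2). }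
destruct (jet_ode v1 (C_derive v1) (fun z => (a + h z) * v1 z + h z * v2 z)%C d p1
  ((RtoC 0 + h1) * p + (a + h0) * p1 + (h1 * q + h0 * q1))%C) as [J1 J2]; [lra|easy| | |].
{ apply (cder_plus (fun z => (a + h z) * v1 z)%C (fun z => h z * v2 z)%C).
  - apply (cder_mult (fun z => a + h z)%C v1); [|exact D1]. apply (cder_plus (fun _ => a) h); [apply cder_const|exact D3].
  - exact (cder_mult h v2 _ _ _ D3 D2). }
{ intros z Hz. exact (conj (proj1 (HD z (proj2 Hz))) (proj1 (K z Hz))). }
destruct (jet_ode v2 (C_derive v2) (fun z => - h z * v1 z - (b + h z) * v2 z)%C d q1
  ((- h1 * p + - h0 * p1) - ((RtoC 0 + h1) * q + (b + h0) * q1))%C) as [J3 J4]; [lra|easy| | |].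
{ apply (cder_minus (fun z => - h z * v1 z)%C (fun z => (b + h z) * v2 z)%C).
  - exact (cder_mult (fun z => - h z)%C v1 _ _ _ (cder_opp h _ _ D3) D1).
  - apply (cder_mult (fun z => b + h z)%C v2); [|exact D2]. apply (cder_plus (fun _ => b) h); [apply cder_const|exact D3]. }
{ intros z Hz. exact (conj (proj1 (proj2 (HD z (proj2 Hz)))) (proj2 (K z Hz))). }
split; [exact J1|]. split.
- rewrite J2 at 1. ring.
- rewrite J4 at 1. ring.
Qed.

Lemma C_derive_scal (c : C) (f : C -> C) (z : C) : @ex_derive C_AbsRing C_NormedModule f z ->
  cder (fun w => c * f w)%C z (C_derive (fun w => c * f w)%C z) /\ C_derive (fun w => c * f w)%C z = (c * C_derive f z)%C.
Proof.
intros H. apply cder_C_derive in H.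
assert (D := cder_scal c f z _ H). split; [apply cder_C_derive; eexists; exact D|now apply C_derive_cder].
Qed.

(** The vanishing of [f1'(0)] propagates through the differential equation: it
    forces [g1'(0)], then [h'(0)] and finally [f2'(0)] to vanish. *)
Lemma canonical_jet (rho mu : R) (Y : C -> E3) (F : C -> mat2) (h f1 f2 g1 g2 : C -> C) :
  0 < rho -> 0 < mu -> mu <> 1 -> bryant_representation rho Y F ->
  weierstrass_data rho F (zpow mu) (power_form (-1 - mu) h) ->
  holomorphic_near_0 h -> holomorphic_near_0 f1 -> holomorphic_near_0 f2 ->
  holomorphic_near_0 g1 -> holomorphic_near_0 g2 ->
  f1 (RtoC 0) = RtoC 1 -> f2 (RtoC 0) = RtoC 1 -> g1 (RtoC 0) = RtoC 1 -> g2 (RtoC 0) = RtoC 1 ->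
  (forall s, cover rho s ->
     F s =
     Mat2 (zpow ((1 - mu) / 2) s * f2 (Cexp s))%C
          (RtoC ((mu - 1) / (mu + 1)) * zpow ((1 + mu) / 2) s * g2 (Cexp s))%C
          (RtoC ((mu ^ 2 - 1) / (4 * mu)) * zpow ((-1 - mu) / 2) s * f1 (Cexp s))%C
          (RtoC ((1 + mu) ^ 2 / (4 * mu)) * zpow ((mu - 1) / 2) s * g1 (Cexp s))%C) ->
  C_derive f1 (RtoC 0) = RtoC 0 -> C_derive f2 (RtoC 0) = RtoC 0.
Proof.
intros Hrho Hmu Hmu1 HF HW Hh H1 H2 H3' H4 E1 E2 E3' E4 HG D1.
assert (ODE := bryant_ode rho mu Y F h Hrho HF HW).
assert (Hnear : locally (RtoC 0) (fun z : C => @ex_derive C_AbsRing C_NormedModule h z /\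
   (@ex_derive C_AbsRing C_NormedModule f1 z /\ @ex_derive C_AbsRing C_NormedModule f2 z) /\
   (@ex_derive C_AbsRing C_NormedModule g1 z /\ @ex_derive C_AbsRing C_NormedModule g2 z))).
{ apply filter_and; [exact Hh|]. apply filter_and; apply filter_and; assumption. }
apply locally_Cmod in Hnear. destruct Hnear as (d0 & Hd0 & Hnear).
set (d := Rmin d0 rho). assert (Hd : 0 < d <= rho) by (split; [now apply Rmin_pos|apply Rmin_r]).
assert (Hnear' : forall z, Cmod z < d -> @ex_derive C_AbsRing C_NormedModule h z /\
   (@ex_derive C_AbsRing C_NormedModule f1 z /\ @ex_derive C_AbsRing C_NormedModule f2 z) /\
   (@ex_derive C_AbsRing C_NormedModule g1 z /\ @ex_derive C_AbsRing C_NormedModule g2 z)).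
{ intros z Hz. apply Hnear. replace (z - 0)%C with z by ring. eapply Rlt_le_trans; [exact Hz|apply Rmin_l]. }
clear Hnear. assert (H0 : Cmod (RtoC 0) < d) by (rewrite Cmod_0; lra).
destruct (Hnear' _ H0) as (_ & (X1 & X2) & (X3 & X4)).
set (k := RtoC ((mu ^ 2 - 1) / (4 * mu))) in *. set (K := RtoC ((1 + mu) ^ 2 / (4 * mu))) in *.
set (qq := RtoC ((mu - 1) / (mu + 1))) in *.
assert (R2 := row_jet_ode mu rho d (- (1 / 2)) h (fun s => mC (F s)) (fun s => mD (F s)) (fun z => k * f1 z)%C (fun z => K * g1 z)%C Hd
  (fun s Hs => proj2 (proj2 (ODE s Hs)))).
assert (R1 := row_jet_ode mu rho d (1 / 2) h (fun s => mA (F s)) (fun s => mB (F s)) f2 (fun z => qq * g2 z)%C Hd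
  (fun s Hs => proj1 (proj2 (ODE s Hs)))).
destruct R2 as (A1 & A2 & A3).
{ intros s Hs. rewrite HG by now apply cover_iff. cbn [mC mD]. split.
  - replace (- (1 / 2)) with (mu / 2 + (-1 - mu) / 2) by field. rewrite zpow_plus. ring.
  - replace (- (1 / 2)) with (- (mu / 2) + (mu - 1) / 2) by field. rewrite zpow_plus. ring. }
{ intros z Hz. destruct (Hnear' z Hz) as (Y0 & (Y1 & Y2) & (Y3 & Y4)).
  split; [now apply C_derive_scal|]. split; [now apply C_derive_scal|now apply cder_C_derive]. }
destruct R1 as (_ & B2 & B3).
{ intros s Hs. rewrite HG by now apply cover_iff. cbn [mA mB]. split.
  - replace (1 / 2) with (mu / 2 + (1 - mu) / 2) by field. rewrite zpow_plus. ring.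
  - replace (1 / 2) with (- (mu / 2) + (1 + mu) / 2) by field. rewrite zpow_plus. ring. }
{ intros z Hz. destruct (Hnear' z Hz) as (Y0 & (Y1 & Y2) & (Y3 & Y4)).
  split; [now apply cder_C_derive|]. split; [now apply C_derive_scal|now apply cder_C_derive]. }
rewrite !(proj2 (C_derive_scal k f1 (RtoC 0) X1)), !(proj2 (C_derive_scal K g1 (RtoC 0) X3)) in A2, A3.
rewrite !(proj2 (C_derive_scal qq g2 (RtoC 0) X4)) in B2, B3.
rewrite E1, E3' in A1. rewrite D1, E1, E3' in A2, A3. rewrite E2, E4 in B2, B3.
set (h0 := h (RtoC 0)) in *. set (h1 := C_derive h (RtoC 0)) in *.
set (x := C_derive f2 (RtoC 0)) in *. set (y := C_derive g1 (RtoC 0)) in *. set (w := C_derive g2 (RtoC 0)) in *.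
set (M := RtoC mu) in *.
assert (HM : M <> RtoC 0) by (apply RtoC_neq0; lra).
assert (HM1 : (M + 1)%C <> RtoC 0) by (unfold M; rewrite <- RtoC_plus; apply RtoC_neq0; lra).
assert (H2n : RtoC 2 <> RtoC 0) by (apply RtoC_neq0; lra).
assert (H4n : RtoC 4 <> RtoC 0) by (apply RtoC_neq0; lra).
assert (Ek : k = ((M * M - 1) / (4 * M))%C).
{ unfold k, M. rewrite RtoC_div, RtoC_minus, RtoC_mult by lra. do 2 f_equal. rewrite <- RtoC_mult. f_equal. ring. }
assert (EK : K = ((M + 1) * (M + 1) / (4 * M))%C).
{ unfold K, M. transitivity (RtoC ((mu + 1) * (mu + 1) / (4 * mu))); [f_equal; field; lra|].
  rewrite RtoC_div, !RtoC_mult, !RtoC_plus by lra. reflexivity. }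
assert (Ea2 : RtoC (mu / 2 - - (1 / 2)) = ((M + 1) / 2)%C).
{ unfold M. rewrite <- RtoC_plus, <- RtoC_div by lra. f_equal. field. }
assert (Eb2 : RtoC (mu / 2 + - (1 / 2)) = ((M - 1) / 2)%C).
{ unfold M. rewrite <- RtoC_minus, <- RtoC_div by lra. f_equal. field. }
assert (Ea1 : RtoC (mu / 2 - 1 / 2) = ((M - 1) / 2)%C).
{ unfold M. rewrite <- RtoC_minus, <- RtoC_div by lra. f_equal. field. }
assert (Eb1 : RtoC (mu / 2 + 1 / 2) = ((M + 1) / 2)%C).
{ unfold M. rewrite <- RtoC_plus, <- RtoC_div by lra. f_equal. field. }
rewrite Ea2 in A1, A2. rewrite Eb2 in A3. rewrite Ea1 in B2. rewrite Eb1 in B3.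
assert (HkK : (k + K = (M + 1) / 2)%C) by (rewrite Ek, EK; field; auto).
assert (Hdiff : forall u v : C, u = v -> (u - v)%C = RtoC 0) by (intros u v ->; ring).
assert (Hh0 : h0 = (- k)%C).
{ assert (Z : ((M + 1) / 2 * (k + h0))%C = RtoC 0).
  { etransitivity; [|exact A1].
    transitivity ((M + 1) / 2 * k + h0 * (k + K))%C; [rewrite HkK; ring|]. ring. }
  apply Cmult_eq0 in Z. destruct Z as [Z|Z].
  - exfalso. apply HM1. transitivity ((M + 1) / 2 * 2)%C; [field; easy|rewrite Z; ring].
  - transitivity ((k + h0) - k)%C; [ring|rewrite Z; ring]. }
apply Hdiff in A2, A3, B2, B3.
assert (Hy : (K * y)%C = RtoC 0).
{ assert (Z : ((M + 1) / 2 * (K * y))%C = RtoC 0).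
  { match type of A2 with ?u = _ => match type of A3 with ?w = _ => transitivity (u + w)%C end end;
      [field; easy|rewrite A2, A3; ring]. }
  apply Cmult_eq0 in Z. destruct Z as [Z|Z]; [|easy].
  exfalso. apply HM1. transitivity ((M + 1) / 2 * 2)%C; [field; easy|rewrite Z; ring]. }
assert (Hh1 : h1 = RtoC 0).
{ assert (Z : (h1 * ((M + 1) / 2))%C = RtoC 0).
  { rewrite <- HkK. match type of A2 with ?u = _ => transitivity (- u - h0 * (K * y))%C end;
      [ring|rewrite A2, Hy; ring]. }
  apply Cmult_eq0 in Z. destruct Z as [Z|Z]; [easy|].
  exfalso. apply HM1. transitivity ((M + 1) / 2 * 2)%C; [field; easy|rewrite Z; ring]. }
rewrite Hh1, Hh0, Ek in B2, B3.
(* the system of the first row for the coefficients of f2 and g2 has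
   determinant 2 *)
assert (Z : (2 * x)%C = RtoC 0).
{ match type of B2 with ?u = _ => match type of B3 with ?w = _ =>
    transitivity (u * ((M + 3) / 2 - (M * M - 1) / (4 * M)) - w * ((M * M - 1) / (4 * M)))%C end end;
    [field; assumption|rewrite B2, B3; ring]. }
apply Cmult_eq0 in Z. destruct Z as [Z|Z]; [now apply H2n in Z|easy].
Qed.

(** The property holds near the puncture, in the coordinate [s]. *)
Definition deep (P : C -> Prop) : Prop := exists K, forall s, Re s < K -> P s.

Lemma deep_and (P Q : C -> Prop) : deep P -> deep Q -> deep (fun s => P s /\ Q s).
Proof.
intros [K1 H1] [K2 H2]. exists (Rmin K1 K2). intros s Hs.
assert (A1 := Rmin_l K1 K2). assert (A2 := Rmin_r K1 K2). split; [apply H1|apply H2]; lra.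
Qed.

Lemma deep_imp (P Q : C -> Prop) : (forall s, P s -> Q s) -> deep P -> deep Q.
Proof. intros H [K HK]. exists K. auto. Qed.

Lemma deep_lt (K : R) : deep (fun s => Re s < K).
Proof. now exists K. Qed.

Lemma deep_exp (a eps : R) : 0 < a -> 0 < eps -> deep (fun s => exp (a * Re s) <= eps).
Proof.
intros Ha He. destruct (exp_small a eps Ha He) as [K HK]. exists K. intros s Hs.
apply Rle_trans with (exp (a * K)); [|easy]. left. apply exp_increasing. nra.
Qed.

Lemma ln_le_sub1 (x : R) : 0 < x -> ln x <= x - 1.
Proof. intros Hx. assert (H := exp_ineq1_le (ln x)). rewrite exp_ln in H by easy. lra. Qed.

Lemma ln_near (a b : R) : 1 / 2 <= a -> 1 / 2 <= b -> Rabs (ln a - ln b) <= 2 * Rabs (a - b).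
Proof.
assert (K : forall a b, 1 / 2 <= a -> 1 / 2 <= b -> ln a - ln b <= 2 * Rabs (a - b)).
{ clear. intros a b Ha Hb. rewrite <- ln_div by lra.
  eapply Rle_trans; [apply ln_le_sub1; apply Rdiv_lt_0_compat; lra|].
  replace (a / b - 1) with ((a - b) / b) by (field; lra).
  apply Rle_trans with (Rabs (a - b) / b).
  - apply Rmult_le_compat_r; [apply Rlt_le, Rinv_0_lt_compat; lra|apply Rle_abs].
  - apply Rmult_le_reg_r with b; [lra|]. replace (Rabs (a - b) / b * b) with (Rabs (a - b)) by (field; lra).
    assert (P := Rabs_pos (a - b)). nra. }
intros Ha Hb. apply Rabs_le. assert (K1 := K a b Ha Hb). assert (K2 := K b a Hb Ha).
rewrite Rabs_minus_sym in K2. lra.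
Qed.

(** The logarithm of [1 + c |z|^(2 mu)] as a function of [u = ln |z|]. *)
Definition ell (c mu u : R) : R := ln (1 + c * exp (2 * mu * u)).

Lemma ell_small (c mu eps : R) : 0 <= c -> 0 < mu -> 0 < eps -> deep (fun s => Rabs (ell c mu (Re s)) <= eps).
Proof.
intros Hc Hmu He.
assert (H := deep_exp (2 * mu) (eps / (1 + c)) ltac:(lra) ltac:(apply Rdiv_lt_0_compat; lra)).
revert H. apply deep_imp. intros s Hs. unfold ell. set (E := exp (2 * mu * Re s)) in *.
assert (HE : 0 < E) by apply exp_pos.
assert (Hs' : (1 + c) * E <= eps).
{ apply (Rmult_le_compat_l (1 + c)) in Hs; [|lra]. replace ((1 + c) * (eps / (1 + c))) with eps in Hs by (field; lra). easy. }
assert (A := ln_le_sub1 (1 + c * E) ltac:(nra)). rewrite Rabs_pos_eq; [nra|].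
rewrite <- ln_1. apply Rcomplements.ln_le; nra.
Qed.

(** The corrections to the leading terms flatten out at the end. *)
Lemma ell_Lip (c mu eps : R) : 0 <= c -> 0 < mu -> 0 < eps -> exists K, forall u v, u < K -> v < K ->
  Rabs (ell c mu u - ell c mu v) <= eps * Rabs (u - v).
Proof.
intros Hc Hmu He.
destruct (exp_small (2 * mu) (eps / (1 + 2 * mu * c))) as [K HK]; [lra|apply Rdiv_lt_0_compat; nra|].
exists K. intros u v Hu Hv.
assert (D : forall t, is_derive (ell c mu) t (2 * mu * c * exp (2 * mu * t) / (1 + c * exp (2 * mu * t)))).
{ intros t. assert (Ht := exp_pos (2 * mu * t)). unfold ell. auto_derive; [nra|]. field. nra. }
destruct (MVT_gen (ell c mu) v u (fun t => 2 * mu * c * exp (2 * mu * t) / (1 + c * exp (2 * mu * t)))) as (t & Ht & E).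
- intros t _. apply D.
- intros t _. apply continuity_pt_filterlim. apply (ex_derive_continuous (ell c mu) t). eexists. apply D.
- rewrite E, Rabs_mult. apply Rmult_le_compat_r; [apply Rabs_pos|].
  assert (HtK : t < K) by (revert Ht; unfold Rmin, Rmax; repeat destruct Rle_dec; lra).
  assert (P := exp_pos (2 * mu * t)).
  assert (Q : exp (2 * mu * t) <= exp (2 * mu * K)) by (left; apply exp_increasing; nra).
  assert (Q' : (1 + 2 * mu * c) * exp (2 * mu * t) <= eps).
  { assert (T : exp (2 * mu * t) <= eps / (1 + 2 * mu * c)) by lra.
    assert (P0 : 0 < 1 + 2 * mu * c) by nra.
    apply (Rmult_le_compat_l (1 + 2 * mu * c)) in T; [|lra].
    replace ((1 + 2 * mu * c) * (eps / (1 + 2 * mu * c))) with eps in T by (field; lra). easy. }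
  assert (P1 : 0 < 1 + c * exp (2 * mu * t)) by nra.
  assert (P2 : 0 <= 2 * mu * c * exp (2 * mu * t)) by (assert (0 <= 2 * mu * c) by nra; nra).
  rewrite Rabs_pos_eq by (apply Rmult_le_pos; [easy|now apply Rlt_le, Rinv_0_lt_compat]).
  apply Rmult_le_reg_r with (1 + c * exp (2 * mu * t)); [easy|].
  replace (2 * mu * c * exp (2 * mu * t) / (1 + c * exp (2 * mu * t)) * (1 + c * exp (2 * mu * t)))
    with (2 * mu * c * exp (2 * mu * t)) by (field; lra).
  assert (0 <= eps * (c * exp (2 * mu * t))) by (apply Rmult_le_pos; nra). lra.
Qed.

Lemma jet_bound (f : C -> C) (l : C) (eps : R) : cder f (RtoC 0) l -> f (RtoC 0) = RtoC 1 -> 0 < eps ->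
  deep (fun s => Cmod (f (Cexp s) - 1)%C <= (Cmod l + eps) * exp (Re s)).
Proof.
intros H H0 He. destruct (proj1 (cder_eps _ _ _) H eps He) as (d & Hd & K).
exists (ln d). intros s Hs.
assert (Hz : Cmod (Cexp s) < d) by (rewrite Cmod_Cexp, <- (exp_ln d) by easy; now apply exp_increasing).
specialize (K (Cexp s)). replace (Cexp s - 0)%C with (Cexp s) in K by ring. specialize (K Hz).
rewrite H0, Cmod_Cexp in K.
replace (f (Cexp s) - 1)%C with ((f (Cexp s) - 1 - l * Cexp s) + l * Cexp s)%C by ring.
eapply Rle_trans; [apply Cmod_triangle|]. rewrite Cmod_mult, Cmod_Cexp. lra.
Qed.

Lemma prod_near (a b : C) (x : R) : Cmod (a - 1)%C <= x -> Cmod (b - 1)%C <= x -> x <= 1 ->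
  Cmod (Cconj a * b - 1)%C <= 3 * x.
Proof.
intros Ha Hb Hx.
replace (Cconj a * b - 1)%C with (Cconj (a - 1) * (b - 1) + (Cconj (a - 1) + (b - 1)))%C
  by (rewrite Cminus_conj, Cconj_RtoC; ring).
assert (P1 := Cmod_ge_0 (a - 1)). assert (P2 := Cmod_ge_0 (b - 1)).
eapply Rle_trans; [apply Cmod_triangle|]. rewrite Cmod_mult, Cmod_conj.
assert (T := Cmod_triangle (Cconj (a - 1)) (b - 1)). rewrite Cmod_conj in T. nra.
Qed.

Lemma skew_le1 (mu : R) : 0 < mu -> 0 <= skew mu ^ 2 <= 1.
Proof.
intros H. split; [apply pow2_ge_0|]. unfold skew. apply Rmult_le_reg_r with ((mu + 1) ^ 2); [apply pow_lt; lra|].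
replace (((mu - 1) / (mu + 1)) ^ 2 * (mu + 1) ^ 2) with ((mu - 1) ^ 2) by (field; lra). nra.
Qed.

(** In logarithmic polar coordinates the end agrees with a surface of
    revolution up to an error that is small compared with [|z|]. The position
    of the axis enters here: it makes the linear coefficients of [f1] and [f2]
    vanish. *)
Lemma canonical_asymptotics (rho mu : R) (Y : C -> E3) : canonical_catenoidal_end rho Y mu (RtoC 0) ->
  forall eps, 0 < eps -> deep (fun s =>
    let p := Y (Cexp s) in let u := Re s in
    H3 p /\ zeta p <> RtoC 0 /\
    Rabs (ln (height p) - ((mu - 1) * u - ell (skew mu ^ 2) mu u)) <= eps * exp u /\
    Rabs (ln (Cmod (zeta p)) - (ln (Rabs (slope mu)) - u + ell 1 mu u - ell (skew mu ^ 2) mu u)) <= eps * exp u /\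
    Cmod (zeta p * Cexp s - RtoC (slope mu))%C <= eps).
Proof.
intros (Hmu & Hmu1 & HB & _ & _ & F & h & f1 & f2 & g1 & g2 & HF & Hh & Hh0 & HW & H1 & E1 & H2 & E2 & H3' & E3' & H4 & E4 & HG & HZ).
assert (Hrho : 0 < rho) by apply HB.
assert (Hs0 := slope_neq0 mu Hmu Hmu1). assert (Hs0c := RtoC_neq0 _ Hs0).
assert (D1 : C_derive f1 (RtoC 0) = RtoC 0).
{ symmetry in HZ. apply Cmult_eq0 in HZ. destruct HZ as [HZ|HZ]; [|easy]. now apply Hs0c in HZ. }
assert (D2 := canonical_jet rho mu Y F h f1 f2 g1 g2 Hrho Hmu Hmu1 HF HW Hh H1 H2 H3' H4 E1 E2 E3' E4 HG D1).
apply holomorphic_near_0_cder in H1, H2, H3', H4. rewrite D1 in H1. rewrite D2 in H2.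
intros eps Heps. set (S := Rabs (slope mu)). assert (HS : 0 < S) by now apply Rabs_pos_lt.
set (e := Rmin (1 / 12) (eps / (26 * (S + 1)))).
assert (He : 0 < e) by (apply Rmin_pos; [lra|apply Rdiv_lt_0_compat; lra]).
assert (He1 : e <= 1 / 12) by apply Rmin_l.
assert (He2 : 26 * (S + 1) * e <= eps).
{ assert (T : e <= eps / (26 * (S + 1))) by apply Rmin_r. apply (Rmult_le_compat_l (26 * (S + 1))) in T; [|lra].
  replace (26 * (S + 1) * (eps / (26 * (S + 1)))) with eps in T by (field; lra). easy. }
set (M := Cmod (C_derive g1 (RtoC 0)) + Cmod (C_derive g2 (RtoC 0)) + 1).
assert (G1 := Cmod_ge_0 (C_derive g1 (RtoC 0))). assert (G2 := Cmod_ge_0 (C_derive g2 (RtoC 0))).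
assert (HM : 1 <= M) by (unfold M; lra).
assert (X1 := jet_bound f1 _ e H1 E1 He). assert (X2 := jet_bound f2 _ e H2 E2 He).
assert (X3 := jet_bound g1 _ 1 H3' E3' Rlt_0_1). assert (X4 := jet_bound g2 _ 1 H4 E4 Rlt_0_1).
assert (X5 := deep_exp (2 * mu) (e / M) ltac:(lra) ltac:(apply Rdiv_lt_0_compat; lra)).
assert (X6 := deep_exp 1 (/ M) ltac:(lra) ltac:(apply Rinv_0_lt_compat; lra)).
assert (X7 := deep_lt (ln rho)).
assert (X := deep_and _ _ (deep_and _ _ (deep_and _ _ X1 X2) (deep_and _ _ X3 X4)) (deep_and _ _ X5 (deep_and _ _ X6 X7))).
revert X. apply deep_imp. clear X1 X2 X3 X4 X5 X6 X7.
intros s [[[X1 X2] [X3 X4]] [X5 [X6 X7]]] p u.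
rewrite Cmod_0, Rplus_0_l in X1, X2. rewrite Rmult_1_l in X6. fold u in X1, X2, X3, X4, X5, X6, X7.
set (x := exp u) in *. assert (Hx : 0 < x) by apply exp_pos.
set (E := exp (2 * mu * u)) in *. assert (HE : 0 < E) by apply exp_pos.
assert (HMx : M * x <= 1).
{ apply (Rmult_le_compat_l M) in X6; [|lra]. rewrite Rinv_r in X6 by lra. easy. }
assert (HME : M * E <= e).
{ apply (Rmult_le_compat_l M) in X5; [|lra]. replace (M * (e / M)) with e in X5 by (field; lra). easy. }
assert (HEe : E <= e) by (assert (1 * E <= M * E) by (apply Rmult_le_compat_r; lra); lra).
assert (Hx1 : x <= 1) by (assert (1 * x <= M * x) by (apply Rmult_le_compat_r; lra); lra).
assert (Hexe : e * x <= e) by (assert (e * x <= e * 1) by (apply Rmult_le_compat_l; lra); lra).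
assert (Hex0 : 0 < e * x) by now apply Rmult_lt_0_compat.
assert (X3' : Cmod (g1 (Cexp s) - 1)%C <= M * x) by (eapply Rle_trans; [exact X3|]; apply Rmult_le_compat_r; unfold M; lra).
assert (X4' : Cmod (g2 (Cexp s) - 1)%C <= M * x) by (eapply Rle_trans; [exact X4|]; apply Rmult_le_compat_r; unfold M; lra).
assert (Hex : e * x <= 1) by lra.
assert (Q1 := prod_near _ _ _ X2 X1 Hex). assert (Q2 := prod_near _ _ _ X2 X2 Hex).
assert (Q3 := prod_near _ _ _ X4' X3' HMx). assert (Q4 := prod_near _ _ _ X4' X4' HMx).
assert (HMEx : E * (M * x) <= e * x) by (replace (E * (M * x)) with (M * E * x) by ring; apply Rmult_le_compat_r; lra).
destruct (skew_le1 mu Hmu) as [K0 K1]. set (kap := skew mu) in *.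
set (num := end_num mu f1 f2 g1 g2 s). set (den := end_den mu kap f2 g2 s).
assert (Nn : Cmod (num - RtoC (1 + E))%C <= 6 * (e * x)).
{ unfold num, end_num. fold u E.
  replace (Cconj (f2 (Cexp s)) * f1 (Cexp s) + E * (Cconj (g2 (Cexp s)) * g1 (Cexp s)) - RtoC (1 + E))%C
    with ((Cconj (f2 (Cexp s)) * f1 (Cexp s) - 1) + E * (Cconj (g2 (Cexp s)) * g1 (Cexp s) - 1))%C
    by (rewrite RtoC_plus; ring).
  eapply Rle_trans; [apply Cmod_triangle|]. rewrite Cmod_mult, Cmod_R, Rabs_pos_eq by lra.
  apply (Rmult_le_compat_l E) in Q3; [lra|lra]. }
assert (Nd : Rabs (den - (1 + kap ^ 2 * E)) <= 6 * (e * x)).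
{ unfold den, end_den. fold u E. rewrite <- (Cmod_R (_ - _)).
  replace (RtoC (Cmod (f2 (Cexp s)) ^ 2 + kap ^ 2 * E * Cmod (g2 (Cexp s)) ^ 2 - (1 + kap ^ 2 * E)))
    with ((Cconj (f2 (Cexp s)) * f2 (Cexp s) - 1) + RtoC (kap ^ 2 * E) * (Cconj (g2 (Cexp s)) * g2 (Cexp s) - 1))%C.
  2: { rewrite RtoC_minus, !RtoC_plus, (RtoC_mult (kap ^ 2 * E)), !Cmod2_conj. ring. }
  eapply Rle_trans; [apply Cmod_triangle|]. rewrite Cmod_mult, Cmod_R, Rabs_pos_eq by (apply Rmult_le_pos; lra).
  assert (kap ^ 2 * E <= 1 * E) by (apply Rmult_le_compat_r; lra). rewrite Rmult_1_l in H.
  assert (kap ^ 2 * E * Cmod (Cconj (g2 (Cexp s)) * g2 (Cexp s) - 1) <= E * (3 * (M * x))).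
  { apply Rmult_le_compat; [apply Rmult_le_pos; lra|apply Cmod_ge_0|easy|easy]. }
  lra. }
assert (Hex6 : 6 * (e * x) <= 1 / 2) by lra.
assert (Bn : Rabs (Cmod num - (1 + E)) <= 6 * (e * x)).
{ assert (T1 := Cmod_triangle (num - RtoC (1 + E)) (RtoC (1 + E))).
  assert (T2 := Cmod_triangle (num) (- (num - RtoC (1 + E)))). rewrite Cmod_opp in T2.
  replace (num - RtoC (1 + E) + RtoC (1 + E))%C with num in T1 by ring.
  replace (num + - (num - RtoC (1 + E)))%C with (RtoC (1 + E)) in T2 by ring.
  rewrite Cmod_R, Rabs_pos_eq in T1, T2 by lra. apply Rabs_le. lra. }
assert (Bn' : 1 / 2 <= Cmod num) by (apply Rabs_le_between in Bn; lra).
assert (HkE : 0 <= kap ^ 2 * E) by (apply Rmult_le_pos; lra).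
assert (Bd' : 1 / 2 <= den) by (apply Rabs_le_between in Nd; lra).
assert (Ln := ln_near _ _ Bn' (ltac:(lra) : 1 / 2 <= 1 + E)).
assert (Ld := ln_near _ _ Bd' (ltac:(lra) : 1 / 2 <= 1 + kap ^ 2 * E)).
assert (Hcov : cover rho s) by now apply cover_iff.
destruct (proj2 HF s Hcov) as (Dt & _ & Zt & Wt).
assert (HD : mat2_det (F s) <> RtoC 0) by (rewrite Dt; apply C1_nz).
assert (Gp := gram_pos _ HD).
assert (Form := end_formula 1 mu f1 f2 g1 g2 s (mA (F s)) (mB (F s)) (mC (F s)) (mD (F s)) Rlt_0_1 Hmu).
replace ((mu + 1) / 2) with ((1 + mu) / 2) in Form by field.
replace ((- (1) - mu) / 2) with ((-1 - mu) / 2) in Form by field.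
replace ((mu ^ 2 - 1 ^ 2) / (4 * 1 * mu)) with (slope mu) in Form by (unfold slope; field; lra).
replace ((mu + 1) ^ 2 / (4 * 1 * mu)) with ((1 + mu) ^ 2 / (4 * mu)) in Form by (field; lra).
assert (HGs := HG s Hcov).
destruct (Form (f_equal mA HGs) (f_equal mB HGs) (f_equal mC HGs) (f_equal mD HGs) (Rgt_not_eq _ _ Gp)) as (_ & FZ & FW).
rewrite <- Zt in FZ. rewrite <- Wt in FW. fold p in FZ, FW. change ((mu - 1) / (mu + 1)) with kap in FZ, FW. fold num den in FZ. fold u den in FW.
assert (Hden : 0 < den) by lra.
assert (Hnum0 : num <> RtoC 0) by (apply Cmod_gt_0; lra).
assert (Hden0 : RtoC den <> RtoC 0) by (apply RtoC_neq0; lra).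
assert (Hz0 : zeta p <> RtoC 0).
{ rewrite FZ. apply Cmult_neq_0; [apply Cmult_neq_0; [easy|apply zpow_neq0]|].
  intros Z. apply Hnum0. replace num with (num / den * den)%C by (field; easy). rewrite Z. ring. }
assert (HSe : 0 < S * e) by now apply Rmult_lt_0_compat.
assert (Hbig : 24 * e <= eps) by lra.
assert (Hbigx : 24 * (e * x) <= eps * x) by (rewrite <- Rmult_assoc; apply Rmult_le_compat_r; lra).
split; [unfold H3; rewrite FW; apply Rdiv_lt_0_compat; [apply exp_pos|lra]|].
split; [easy|]. split; [|split].
- rewrite FW, ln_div, ln_exp by (try apply exp_pos; lra). unfold ell. fold E.
  replace ((mu - 1) * u - ln den - ((mu - 1) * u - ln (1 + kap ^ 2 * E))) with (- (ln den - ln (1 + kap ^ 2 * E))) by ring.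
  rewrite Rabs_Ropp. lra.
- rewrite FZ, !Cmod_mult, Cmod_div, !Cmod_R, Cmod_zpow by easy. fold u S.
  rewrite (Rabs_pos_eq den) by lra.
  rewrite ln_mult, ln_mult, ln_exp, ln_div by (try apply exp_pos; try (apply Rmult_lt_0_compat; [|apply exp_pos]); try (apply Rdiv_lt_0_compat); lra).
  unfold ell. fold E. replace (1 * E) with E by ring.
  replace (ln S + - (1) * u + (ln (Cmod num) - ln den) - (ln S - u + ln (1 + E) - ln (1 + kap ^ 2 * E)))
    with ((ln (Cmod num) - ln (1 + E)) - (ln den - ln (1 + kap ^ 2 * E))) by ring.
  eapply Rle_trans; [apply Rabs_triang|]. rewrite Rabs_Ropp. lra.
- replace (zeta p * Cexp s - slope mu)%C with (RtoC (slope mu) * ((num - RtoC (1 + E)) - RtoC (den - (1 + kap ^ 2 * E)) + RtoC ((1 - kap ^ 2) * E)) / RtoC den)%C.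
  2: { rewrite FZ. assert (ZZ : (zpow (- (1)) s * Cexp s = 1)%C).
       { replace (Cexp s) with (zpow 1 s) by (unfold zpow; f_equal; ring). apply zpow_inv. }
       transitivity (RtoC (slope mu) * (zpow (- (1)) s * Cexp s) * (num / den) - RtoC (slope mu))%C; [|ring].
       rewrite ZZ. replace (num - RtoC (1 + E) - RtoC (den - (1 + kap ^ 2 * E)) + RtoC ((1 - kap ^ 2) * E))%C with (num - RtoC den)%C.
       - field. easy.
       - rewrite !RtoC_minus, !RtoC_mult, !RtoC_plus, RtoC_minus, RtoC_mult. ring. }
  rewrite Cmod_div, Cmod_mult, !Cmod_R by easy. fold S. rewrite (Rabs_pos_eq den) by lra.
  assert (T1 := Cmod_triangle (num - RtoC (1 + E) - RtoC (den - (1 + kap ^ 2 * E))) (RtoC ((1 - kap ^ 2) * E))).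
  assert (T2 := Cmod_triangle (num - RtoC (1 + E)) (- RtoC (den - (1 + kap ^ 2 * E)))).
  rewrite Cmod_opp, Cmod_R in T2. rewrite Cmod_R in T1.
  assert (T3 : Rabs ((1 - kap ^ 2) * E) <= e) by (rewrite Rabs_pos_eq by (apply Rmult_le_pos; lra);
    assert ((1 - kap ^ 2) * E <= 1 * E) by (apply Rmult_le_compat_r; lra); lra).
  set (W := Cmod (num - RtoC (1 + E) - RtoC (den - (1 + kap ^ 2 * E)) + RtoC ((1 - kap ^ 2) * E))%C) in *.
  assert (T4 : W <= 13 * e).
  { eapply Rle_trans; [exact T1|]. eapply Rle_trans; [apply Rplus_le_compat; [exact T2|exact T3]|]. lra. }
  apply Rmult_le_reg_r with den; [easy|]. replace (S * W / den * den) with (S * W) by (field; lra).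
  assert (S * W <= S * (13 * e)) by (apply Rmult_le_compat_l; lra).
  assert (eps * (1 / 2) <= eps * den) by (apply Rmult_le_compat_l; lra). lra.
Qed.

(** * Similarities between canonical ends *)

Lemma punctured_iff (Q : C -> Prop) : locally' (RtoC 0) Q <->
  exists d, 0 < d /\ forall z, 0 < Cmod z < d -> Q z.
Proof.
split.
- intros H. change (locally (RtoC 0) (fun z : C => z <> RtoC 0 -> Q z)) in H. apply locally_Cmod in H.
  destruct H as (d & Hd & H). exists d. split; [easy|]. intros z Hz. apply H.
  + now replace (z - 0)%C with z by ring.
  + now apply Cmod_gt_0.
- intros (d & Hd & H). change (locally (RtoC 0) (fun z : C => z <> RtoC 0 -> Q z)). apply locally_Cmod.
  exists d. split; [easy|]. intros z Hz Hz0. replace (z - 0)%C with z in Hz by ring. apply H. split; [now apply Cmod_gt_0|easy].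
Qed.

Lemma deep_punctured (Q : C -> Prop) : locally' (RtoC 0) Q -> deep (fun s => Q (Cexp s)).
Proof.
intros H. apply punctured_iff in H. destruct H as (d & Hd & H). exists (ln d). intros s Hs. apply H.
rewrite Cmod_Cexp. split; [apply exp_pos|]. rewrite <- (exp_ln d) by easy. now apply exp_increasing.
Qed.

Lemma deep_pull (phi : C -> C) (P : C -> Prop) : filterlim phi (locally' (RtoC 0)) (locally' (RtoC 0)) -> deep P ->
  deep (fun s => Cexp (clog (phi (Cexp s))) = phi (Cexp s) /\ P (clog (phi (Cexp s)))).
Proof.
intros Hphi [K HK].
apply (deep_punctured (fun z => Cexp (clog (phi z)) = phi z /\ P (clog (phi z)))).
apply (Hphi (fun w => Cexp (clog w) = w /\ P (clog w))). apply punctured_iff.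
exists (exp K). split; [apply exp_pos|]. intros z [Hz1 Hz2]. split; [apply Cexp_clog; now apply Cmod_gt_0|].
apply HK. simpl. rewrite <- (ln_exp K). now apply ln_increasing.
Qed.

Lemma affine_zero (p q : R) : (forall eps, 0 < eps -> deep (fun s => Rabs (p * Re s + q) <= eps)) -> p = 0 /\ q = 0.
Proof.
intros H.
assert (Hp : p = 0).
{ destruct (Req_dec p 0) as [|Hp]; [easy|]. exfalso. destruct (H 1 Rlt_0_1) as [K HK].
  assert (Ha : 0 < Rabs p) by now apply Rabs_pos_lt.
  assert (A1 := HK (RtoC (K - 1))). assert (A2 := HK (RtoC (K - 1 - 3 / Rabs p))). simpl in A1, A2.
  assert (P3 : 0 < 3 / Rabs p) by (apply Rdiv_lt_0_compat; lra).
  specialize (A1 ltac:(lra)). specialize (A2 ltac:(lra)).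
  assert (T := Rabs_triang (p * (K - 1) + q) (- (p * (K - 1 - 3 / Rabs p) + q))). rewrite Rabs_Ropp in T.
  replace (p * (K - 1) + q + - (p * (K - 1 - 3 / Rabs p) + q)) with (p * (3 / Rabs p)) in T by ring.
  rewrite Rabs_mult, (Rabs_pos_eq (3 / Rabs p)) in T by lra.
  replace (Rabs p * (3 / Rabs p)) with 3 in T by (field; lra). lra. }
split; [easy|]. destruct (Req_dec q 0) as [|Hq]; [easy|]. exfalso.
assert (Ha : 0 < Rabs q) by now apply Rabs_pos_lt.
destruct (H (Rabs q / 2)) as [K HK]; [lra|]. specialize (HK (RtoC (K - 1))). simpl in HK. specialize (HK ltac:(lra)).
rewrite Hp in HK. replace (0 * (K - 1) + q) with q in HK by ring. lra.
Qed.

Lemma exp_near (x : R) : Rabs x <= 1 / 2 -> Rabs (exp x - 1) <= 2 * Rabs x.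
Proof.
intros Hx. apply Rabs_le_between in Hx. assert (H1 := exp_ineq1_le x). assert (H2 := exp_ineq1_le (- x)).
rewrite exp_Ropp in H2. assert (Hp := exp_pos x).
assert (H3 : (1 - x) * exp x <= 1).
{ apply (Rmult_le_compat_r (exp x)) in H2; [|lra]. rewrite Rinv_l in H2 by lra. lra. }
assert (A1 := Rle_abs x). assert (A2 := Rle_abs (- x)). rewrite Rabs_Ropp in A2.
apply Rabs_le. split; [lra|]. destruct (Rle_or_lt 0 x) as [P|P].
- rewrite Rabs_pos_eq by easy. assert (exp x <= 2) by nra. nra.
- assert (exp x < exp 0) by now apply exp_increasing. rewrite exp_0 in H. assert (0 <= Rabs x) by apply Rabs_pos. lra.
Qed.

Section Comparison.

Variables (rho rho' mu mu' : R) (Y Y' : C -> E3) (phi : C -> C) (al be : C) (cj : C -> C).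
Hypothesis HY : canonical_catenoidal_end rho Y mu (RtoC 0).
Hypothesis HY' : canonical_catenoidal_end rho' Y' mu' (RtoC 0).
Hypothesis Hphi : filterlim phi (locally' (RtoC 0)) (locally' (RtoC 0)).
Hypothesis Hal : al <> RtoC 0.
Hypothesis cj_mod : forall z, Cmod (cj z) = Cmod z.
Hypothesis cj_mult : forall z w, cj (z * w)%C = (cj z * cj w)%C.
Hypothesis cj_plus : forall z w, cj (z + w)%C = (cj z + cj w)%C.
Hypothesis cj_cj : forall z, cj (cj z) = z.
Hypothesis cj_real : forall x, cj (RtoC x) = RtoC x.
Hypothesis HYY' : locally' (RtoC 0) (fun z => Y' (phi z) =
  (((al * cj (zeta (Y z)) + be)%C, Cmod al * height (Y z)) : E3)).

(* the parameter of the second end that corresponds to [s] *)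
Let sp (s : C) : C := clog (phi (Cexp s)).
Let a : R := ln (Cmod al).
Let S : R := Rabs (slope mu).
Let S' : R := Rabs (slope mu').

Lemma comparison_pos : 0 < mu /\ 0 < mu' /\ mu <> 1 /\ mu' <> 1 /\ 0 < S /\ 0 < S' /\ 0 < Cmod al.
Proof.
destruct HY as (H1 & H2 & _). destruct HY' as (H1' & H2' & _). repeat (split; [assumption|]).
split; [now apply Rabs_pos_lt, slope_neq0|]. split; [now apply Rabs_pos_lt, slope_neq0|now apply Cmod_gt_0].
Qed.

Lemma comparison_facts (eps : R) : 0 < eps -> deep (fun s =>
  let u := Re s in let u' := Re (sp s) in
  let z := zeta (Y (Cexp s)) in let z' := zeta (Y' (phi (Cexp s))) in
  let w := height (Y (Cexp s)) in
  0 < w /\ z <> RtoC 0 /\ z' <> RtoC 0 /\ z' = (al * cj z + be)%C /\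
  Rabs (ln w - ((mu - 1) * u - ell (skew mu ^ 2) mu u)) <= eps * exp u /\
  Rabs (a + ln w - ((mu' - 1) * u' - ell (skew mu' ^ 2) mu' u')) <= eps * exp u' /\
  Rabs (ln (Cmod z) - (ln S - u + ell 1 mu u - ell (skew mu ^ 2) mu u)) <= eps * exp u /\
  Rabs (ln (Cmod z') - (ln S' - u' + ell 1 mu' u' - ell (skew mu' ^ 2) mu' u')) <= eps * exp u' /\
  Cmod (z * Cexp s - RtoC (slope mu))%C <= eps).
Proof.
intros He. destruct comparison_pos as (_ & _ & _ & _ & _ & _ & Hap).
assert (F1 := canonical_asymptotics rho mu Y HY eps He).
assert (F2 := deep_pull phi _ Hphi (canonical_asymptotics rho' mu' Y' HY' eps He)).
assert (F3 := deep_punctured _ HYY').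
generalize (deep_and _ _ F1 (deep_and _ _ F2 F3)). apply deep_imp. cbv zeta.
intros s [(A1 & A2 & A3 & A4 & A5) [[B0 (B1 & B2 & B3 & B4 & _)] D]].
rewrite B0 in B1, B2, B3, B4. fold (sp s) in B3, B4.
assert (Hw : height (Y' (phi (Cexp s))) = Cmod al * height (Y (Cexp s))) by (rewrite D; reflexivity).
rewrite Hw, ln_mult in B3 by (try exact A1; easy). fold a in B3.
repeat (split; [first [assumption|rewrite D; reflexivity]|]). exact A5.
Qed.

(** To leading order [ln |zeta|] is [- u] and the logarithm of the height is
    [(mu - 1) u], up to constants. Eliminating the parameter of the second end
    leaves an affine function of [u] that tends to 0. *)
Lemma comparison_coarse : mu' = mu /\ a = 0 /\ deep (fun s => Rabs (Re (sp s) - Re s) <= 1).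
Proof.
destruct comparison_pos as (M1 & M2 & M3 & M4 & M5 & M6 & M7).
set (c := ln S' - ln S - a).
assert (K : forall eps, 0 < eps -> deep (fun s => Rabs (Re (sp s) - Re s - c) <= 8 * eps /\
   Rabs ((mu' - mu) * Re s + ((mu' - 1) * c - a)) <= (4 + 8 * Rabs (mu' - 1)) * eps)).
{ intros eps He.
  assert (F1 := comparison_facts eps He).
  assert (F2 := comparison_facts (S / 2) ltac:(lra)).
  destruct (skew_le1 mu M1) as [W1 _]. destruct (skew_le1 mu' M2) as [W2 _].
  assert (F3 := deep_and _ _ (ell_small 1 mu eps ltac:(lra) M1 He) (ell_small (skew mu ^ 2) mu eps W1 M1 He)).
  assert (F4 := deep_pull phi _ Hphi (deep_and _ _ (ell_small 1 mu' eps ltac:(lra) M2 He) (deep_and _ _ (ell_small (skew mu' ^ 2) mu' eps W2 M2 He) (deep_lt 0)))).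
  set (b := Cmod be). assert (Hb : 0 <= b) by apply Cmod_ge_0.
  assert (F5 := deep_exp 1 (Rmin eps (1 / 2) * (Cmod al * S) / (2 * (b + 1))) Rlt_0_1
    ltac:(apply Rdiv_lt_0_compat; [apply Rmult_lt_0_compat; [apply Rmin_pos; lra|nra]|lra])).
  generalize (deep_and _ _ (deep_and _ _ F1 F2) (deep_and _ _ (deep_and _ _ F3 F4) (deep_and _ _ F5 (deep_lt 0)))).
  apply deep_imp. cbv zeta. clear F1 F2 F3 F4 F5.
  intros s [[(P1 & P2 & P3 & P4 & P5 & P6 & P7 & P8 & _) F2] [[[E1 E2] [_ [E3 [E4 U']]]] [F5 U]]].
  assert (P9 := proj2 (proj2 (proj2 (proj2 (proj2 (proj2 (proj2 (proj2 F2)))))))). clear F2.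
  fold (sp s) in E3, E4, U'. rewrite Rmult_1_l in F5.
  set (u := Re s) in *. set (u' := Re (sp s)) in *.
  set (z := zeta (Y (Cexp s))) in *. set (z' := zeta (Y' (phi (Cexp s)))) in *. set (w := height (Y (Cexp s))) in *.
  assert (X : exp u <= 1) by (rewrite <- exp_0; left; now apply exp_increasing).
  assert (X' : exp u' <= 1) by (rewrite <- exp_0; left; now apply exp_increasing).
  assert (Xp := exp_pos u).
  assert (Y1 : eps * exp u <= eps) by (assert (eps * exp u <= eps * 1) by (apply Rmult_le_compat_l; lra); lra).
  assert (Y2 : eps * exp u' <= eps) by (assert (eps * exp u' <= eps * 1) by (apply Rmult_le_compat_l; lra); lra).
  assert (Zp : 0 < Cmod z) by now apply Cmod_gt_0. assert (Zp' : 0 < Cmod z') by now apply Cmod_gt_0.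
  (* the translation is negligible far away *)
  assert (Hz : S / 2 <= Cmod z * exp u).
  { assert (T := Cmod_triangle (z * Cexp s) (- (z * Cexp s - slope mu))). rewrite Cmod_opp, Cmod_mult, Cmod_Cexp in T.
    replace (z * Cexp s + - (z * Cexp s - slope mu))%C with (RtoC (slope mu)) in T by ring.
    rewrite Cmod_R in T. fold S u in T. lra. }
  set (q := Cmod z' / (Cmod al * Cmod z)).
  assert (Haz : 0 < Cmod al * Cmod z) by now apply Rmult_lt_0_compat.
  assert (Hq : Rabs (q - 1) <= Rmin eps (1 / 2)).
  { assert (T : Rabs (Cmod z' - Cmod al * Cmod z) <= b).
    { rewrite <- (cj_mod z), <- Cmod_mult, P4.
      assert (T1 := Cmod_triangle (al * cj z) be). assert (T2 := Cmod_triangle (al * cj z + be) (- be)).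
      rewrite Cmod_opp in T2. replace (al * cj z + be + - be)%C with (al * cj z)%C in T2 by ring. fold b in T1, T2.
      apply Rabs_le. lra. }
    replace (q - 1) with ((Cmod z' - Cmod al * Cmod z) / (Cmod al * Cmod z)) by (unfold q; field; lra).
    rewrite Rabs_div, (Rabs_pos_eq (_ * _)) by lra.
    set (e := Rmin eps (1 / 2)) in *. assert (He' : 0 < e) by (apply Rmin_pos; lra).
    apply Rmult_le_reg_r with (Cmod al * Cmod z); [easy|].
    replace (Rabs (Cmod z' - Cmod al * Cmod z) / (Cmod al * Cmod z) * (Cmod al * Cmod z)) with (Rabs (Cmod z' - Cmod al * Cmod z)) by (field; lra).
    eapply Rle_trans; [exact T|].
    apply Rmult_le_reg_r with (exp u); [easy|].
    apply (Rmult_le_compat_l b) in F5; [|easy].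
    apply (Rmult_le_compat_l (e * Cmod al)) in Hz; [|apply Rmult_le_pos; lra].
    apply Rle_trans with (e * Cmod al * (S / 2)); [|eapply Rle_trans; [exact Hz|right; ring]].
    eapply Rle_trans; [exact F5|].
    replace (b * (e * (Cmod al * S) / (2 * (b + 1)))) with ((e * Cmod al * (S / 2)) * (b / (b + 1))) by (field; lra).
    rewrite <- (Rmult_1_r (e * Cmod al * (S / 2))) at 2. apply Rmult_le_compat_l.
    - repeat (apply Rmult_le_pos; try lra).
    - apply Rmult_le_reg_r with (b + 1); [lra|]. replace (b / (b + 1) * (b + 1)) with b by (field; lra). lra. }
  assert (Lq : Rabs (ln (Cmod z') - a - ln (Cmod z)) <= 2 * eps).
  { replace (ln (Cmod z') - a - ln (Cmod z)) with (ln q - ln 1).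
    - assert (Hq1 := Rmin_l eps (1 / 2)). assert (Hq2 := Rmin_r eps (1 / 2)).
      assert (Hq3 : 1 / 2 <= q) by (apply Rabs_le_between in Hq; lra).
      eapply Rle_trans; [apply ln_near; lra|]. lra.
    - unfold q. rewrite ln_1, ln_div, ln_mult by easy. unfold a. ring. }
  apply Rabs_le_between in P5, P6, P7, P8, E1, E2, E3, E4, Lq.
  assert (D1 : Rabs (u' - u - c) <= 8 * eps) by (apply Rabs_le; unfold c; lra).
  split; [exact D1|].
  replace ((mu' - mu) * u + ((mu' - 1) * c - a)) with (((mu' - 1) * u' - a - (mu - 1) * u) + - ((mu' - 1) * (u' - u - c))) by ring.
  eapply Rle_trans; [apply Rabs_triang|]. rewrite Rabs_Ropp, Rabs_mult, Rmult_plus_distr_r. apply Rplus_le_compat.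
  - apply Rabs_le. lra.
  - replace (8 * Rabs (mu' - 1) * eps) with (Rabs (mu' - 1) * (8 * eps)) by ring. apply Rmult_le_compat_l; [apply Rabs_pos|easy]. }
assert (HC : 0 < 4 + 8 * Rabs (mu' - 1)) by (assert (T := Rabs_pos (mu' - 1)); lra).
destruct (affine_zero (mu' - mu) ((mu' - 1) * c - a)) as [Q1 Q2].
{ intros eps He. generalize (K (eps / (4 + 8 * Rabs (mu' - 1))) ltac:(now apply Rdiv_lt_0_compat)). apply deep_imp.
  intros s [_ H]. replace ((4 + 8 * Rabs (mu' - 1)) * (eps / (4 + 8 * Rabs (mu' - 1)))) with eps in H by (field; lra). exact H. }
assert (Em : mu' = mu) by lra.
assert (ES : S' = S) by (unfold S, S'; now rewrite Em).
assert (Ec : c = - a) by (unfold c; rewrite ES; ring).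
assert (Ea : a = 0).
{ rewrite Ec, Em in Q2. assert (Z : mu * a = 0) by lra. apply Rmult_integral in Z. destruct Z; lra. }
split; [easy|]. split; [easy|].
generalize (K (1 / 8) ltac:(lra)). apply deep_imp. intros s [H _]. rewrite Ec, Ea in H.
replace (Re (sp s) - Re s - - 0) with (Re (sp s) - Re s) in H by ring. lra.
Qed.

Lemma comparison_al : Cmod al = 1.
Proof.
destruct comparison_pos as (_ & _ & _ & _ & _ & _ & M). destruct comparison_coarse as (_ & H & _).
apply ln_inv; [easy|lra|]. now rewrite ln_1.
Qed.

(** Next order: the heights force the parameters to agree up to a factor
    [1 + o(|z|)], so the distances to the axis agree up to [o(1)]. *)
Lemma comparison_fine (eps : R) : 0 < eps -> deep (fun s =>
  Rabs (Cmod (zeta (Y' (phi (Cexp s)))) - Cmod (zeta (Y (Cexp s)))) <= eps).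
Proof.
intros He.
destruct comparison_pos as (M1 & _ & M3 & _ & M5 & _ & _). destruct comparison_coarse as (Em & Ea & Hd).
set (m := Rabs (mu - 1)). assert (Hm : 0 < m) by (apply Rabs_pos_lt; lra).
set (lam := Rmin (m / 2) (1 / 2)). assert (Hlam : 0 < lam) by (apply Rmin_pos; lra).
assert (Hlam1 : lam <= m / 2) by apply Rmin_l. assert (Hlam2 : lam <= 1 / 2) by apply Rmin_r.
set (Ct := 16 / m + 4). assert (HCt : 4 <= Ct) by (assert (0 < 16 / m) by (apply Rdiv_lt_0_compat; lra); unfold Ct; lra).
set (e := Rmin (1 / (2 * Ct)) (eps / (2 * Ct * (S + 1)))).
assert (Hc2 : 0 < 2 * Ct * (S + 1)) by (apply Rmult_lt_0_compat; lra).
assert (He' : 0 < e) by (apply Rmin_pos; apply Rdiv_lt_0_compat; lra).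
assert (He1 : Ct * e <= 1 / 2).
{ assert (T : e <= 1 / (2 * Ct)) by apply Rmin_l. apply (Rmult_le_compat_l Ct) in T; [|lra].
  replace (Ct * (1 / (2 * Ct))) with (1 / 2) in T by (field; lra). easy. }
assert (He2 : 2 * Ct * (S + 1) * e <= eps).
{ assert (T : e <= eps / (2 * Ct * (S + 1))) by apply Rmin_r. apply (Rmult_le_compat_l (2 * Ct * (S + 1))) in T; [|lra].
  replace (2 * Ct * (S + 1) * (eps / (2 * Ct * (S + 1)))) with eps in T by (field; lra). easy. }
destruct (skew_le1 mu M1) as [W1 _].
destruct (ell_Lip 1 mu lam ltac:(lra) M1 Hlam) as [K1 L1].
destruct (ell_Lip (skew mu ^ 2) mu lam W1 M1 Hlam) as [K2 L2].
assert (F1 := comparison_facts e He'). assert (F2 := comparison_facts 1 Rlt_0_1).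
assert (F3 := deep_and _ _ (deep_lt K1) (deep_and _ _ (deep_lt K2) (deep_lt 0))).
assert (F4 := deep_pull phi _ Hphi F3).
generalize (deep_and _ _ (deep_and _ _ F1 F2) (deep_and _ _ (deep_and _ _ F3 F4) Hd)).
apply deep_imp. cbv zeta. clear F1 F2 F3 F4.
intros s [[(P1 & P2 & P3 & _ & P5 & P6 & P7 & P8 & _) F2] [[[V1 [V2 V3]] [_ [V4 [V5 _]]]] Hd']].
assert (P9 := proj2 (proj2 (proj2 (proj2 (proj2 (proj2 (proj2 (proj2 F2)))))))). clear F2.
fold (sp s) in V4, V5. rewrite Em, Ea, ?Rplus_0_l in P6. rewrite Em in P8.
assert (ES : S' = S) by (unfold S, S'; now rewrite Em). rewrite ES in P8.
specialize (L1 _ _ V4 V1). specialize (L2 _ _ V5 V2).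
set (u := Re s) in *. set (u' := Re (sp s)) in *.
set (z := zeta (Y (Cexp s))) in *. set (z' := zeta (Y' (phi (Cexp s)))) in *. set (w := height (Y (Cexp s))) in *.
set (x := exp u) in *. assert (Hx : 0 < x) by apply exp_pos.
set (d := u' - u) in *.
assert (Hx1 : x <= 1) by (unfold x; rewrite <- exp_0; left; now apply exp_increasing).
assert (Hx' : exp u' <= 3 * x).
{ replace u' with (d + u) by (unfold d; ring). rewrite exp_plus. apply Rmult_le_compat_r; [fold x; lra|].
  apply Rle_trans with (exp 1); [|apply exp_le_3]. apply Rabs_le_between in Hd'.
  destruct (Rle_lt_or_eq_dec d 1) as [Hlt| ->]; [lra|left; now apply exp_increasing|lra]. }
assert (Hex' : e * exp u' <= 3 * (e * x)) by (apply (Rmult_le_compat_l e) in Hx'; lra).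
assert (Hex : 0 < e * x) by now apply Rmult_lt_0_compat.
set (A := ell (skew mu ^ 2) mu u' - ell (skew mu ^ 2) mu u) in *.
set (B := ell 1 mu u' - ell 1 mu u) in *.
assert (Pd := Rabs_pos d).
assert (Hlam1d : lam * Rabs d <= m / 2 * Rabs d) by now apply Rmult_le_compat_r.
assert (Hlam2d : lam * Rabs d <= 1 / 2 * Rabs d) by now apply Rmult_le_compat_r.
assert (Q1 : m * Rabs d <= 8 * (e * x)).
{ assert (T : Rabs ((mu - 1) * d) <= Rabs A + 4 * (e * x)).
  { apply Rabs_le_between in P5, P6. assert (TA := Rle_abs A). assert (TA' := Rle_abs (- A)). rewrite Rabs_Ropp in TA'.
    apply Rabs_le. unfold A, d in *. lra. }
  rewrite Rabs_mult in T. fold m in T. lra. }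
assert (Q2 : Rabs d <= 8 / m * (e * x)).
{ apply Rmult_le_reg_l with m; [easy|]. replace (m * (8 / m * (e * x))) with (8 * (e * x)) by (field; lra). easy. }
set (eta := ln (Cmod z') - ln (Cmod z)).
assert (Q3 : Rabs eta <= Ct * (e * x)).
{ assert (T : Rabs eta <= Rabs d + Rabs A + Rabs B + 4 * (e * x)).
  { apply Rabs_le_between in P7, P8.
    assert (TA := Rle_abs A). assert (TA' := Rle_abs (- A)). rewrite Rabs_Ropp in TA'.
    assert (TB := Rle_abs B). assert (TB' := Rle_abs (- B)). rewrite Rabs_Ropp in TB'.
    assert (TD := Rle_abs d). assert (TD' := Rle_abs (- d)). rewrite Rabs_Ropp in TD'.
    apply Rabs_le. unfold A, B, d, eta in *. lra. }
  unfold Ct. replace ((16 / m + 4) * (e * x)) with (2 * (8 / m * (e * x)) + 4 * (e * x)) by (field; lra). lra. }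
assert (Zp : 0 < Cmod z) by now apply Cmod_gt_0. assert (Zp' : 0 < Cmod z') by now apply Cmod_gt_0.
assert (HCex : Ct * (e * x) <= 1 / 2).
{ rewrite <- Rmult_assoc. assert (Ct * e * x <= Ct * e * 1) by (apply Rmult_le_compat_l; [apply Rmult_le_pos; lra|easy]). lra. }
assert (N := exp_near eta ltac:(lra)).
assert (Ez : Cmod z' - Cmod z = Cmod z * (exp eta - 1)).
{ unfold eta, Rminus at 3. rewrite exp_plus, exp_Ropp, !exp_ln by easy. field. lra. }
rewrite Ez, Rabs_mult, (Rabs_pos_eq (Cmod z)) by lra.
assert (Hzx : Cmod z * x <= S + 1).
{ assert (T := Cmod_triangle (z * Cexp s - slope mu) (slope mu)).
  replace (z * Cexp s - slope mu + slope mu)%C with (z * Cexp s)%C in T by ring.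
  rewrite Cmod_mult, Cmod_Cexp, Cmod_R in T. fold u x S in T. lra. }
apply Rle_trans with (Cmod z * (2 * (Ct * (e * x)))); [apply Rmult_le_compat_l; lra|].
replace (Cmod z * (2 * (Ct * (e * x)))) with (2 * Ct * e * (Cmod z * x)) by ring.
apply Rle_trans with (2 * Ct * e * (S + 1)); [|lra].
apply Rmult_le_compat_l; [|easy]. assert (0 < Ct * e) by (apply Rmult_lt_0_compat; lra). lra.
Qed.

(** A translation would show up as a constant defect on the ray along which
    it points away from the axis. *)
Lemma comparison_axis : be = RtoC 0.
Proof.
destruct (Ceq_dec be 0) as [|Hbe]; [easy|]. exfalso.
destruct comparison_pos as (M1 & _ & M3 & _ & M5 & _ & _). assert (Ha := comparison_al).
set (b := Cmod be). assert (Hb : 0 < b) by now apply Cmod_gt_0.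
set (e := Rmin 1 (Rmin (S / 2) (b * S / (4 * (S + 2))))).
assert (Hbs : 0 < b * S) by now apply Rmult_lt_0_compat.
assert (He : 0 < e) by (repeat apply Rmin_pos; try lra; apply Rdiv_lt_0_compat; lra).
assert (He1 : e <= 1) by apply Rmin_l.
assert (He2 : e <= S / 2) by (eapply Rle_trans; [apply Rmin_r|apply Rmin_l]).
assert (He3 : e * (4 * (S + 2)) <= b * S).
{ assert (T : e <= b * S / (4 * (S + 2))) by (eapply Rle_trans; [apply Rmin_r|apply Rmin_r]).
  apply (Rmult_le_compat_r (4 * (S + 2))) in T; [|lra].
  replace (b * S / (4 * (S + 2)) * (4 * (S + 2))) with (b * S) in T by (field; lra). easy. }
destruct (deep_and _ _ (comparison_facts e He) (deep_and _ _ (comparison_fine e He) (deep_lt 0))) as [K HK].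
(* the direction in which [al * cj (zeta)] is parallel to [be] *)
set (e0 := (Cconj be * al * RtoC (slope mu) / RtoC (b * S))%C).
assert (Hbsc : RtoC (b * S) <> RtoC 0) by (apply RtoC_neq0; lra).
assert (He0 : Cmod e0 = 1).
{ unfold e0. rewrite Cmod_div, !Cmod_mult, Cmod_conj, Ha, !Cmod_R, (Rabs_pos_eq (b * S)) by (easy || lra).
  fold b S. field. lra. }
assert (He0n : cj e0 <> RtoC 0) by (apply Cmod_gt_0; rewrite cj_mod, He0; lra).
set (s := (RtoC (Rmin (K - 1) (-1)) + clog (cj e0))%C).
assert (Hs : Re s = Rmin (K - 1) (-1)).
{ unfold s. rewrite Re_plus. simpl. rewrite cj_mod, He0, ln_1. ring. }
assert (HsK : Re s < K) by (rewrite Hs; assert (T := Rmin_l (K - 1) (-1)); lra).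
assert (Es : Cexp s = (RtoC (exp (Re s)) * cj e0)%C).
{ rewrite Hs. unfold s. rewrite Cexp_plus, Cexp_clog by easy. f_equal.
  unfold Cexp, RtoC; simpl. rewrite cos_0, sin_0. f_equal; ring. }
destruct (HK s HsK) as [(P1 & P2 & P3 & P4 & _ & _ & _ & _ & P9) [Q Hneg]]. cbv zeta in *.
set (z := zeta (Y (Cexp s))) in *. set (z' := zeta (Y' (phi (Cexp s)))) in *.
set (x := exp (Re s)) in *. assert (Hx : 0 < x) by apply exp_pos.
assert (Hx1 : x <= 1) by (unfold x; rewrite <- exp_0; left; now apply exp_increasing).
assert (Hxc : RtoC x <> RtoC 0) by (apply RtoC_neq0; lra).
set (dl := (z * Cexp s - slope mu)%C) in *.
assert (Ez : (RtoC x * (cj z * e0))%C = (RtoC (slope mu) + cj dl)%C).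
{ rewrite <- (cj_real (slope mu)), <- cj_plus.
  transitivity (cj (z * Cexp s)%C); [rewrite Es, !cj_mult, cj_cj, cj_real; ring|f_equal; unfold dl; ring]. }
assert (Hsl : RtoC (slope mu) <> RtoC 0) by now apply RtoC_neq0, slope_neq0.
set (W := (al * cj z)%C).
assert (EW : (Cconj be * W * RtoC x)%C = (RtoC (b * S) + RtoC (b * S) / RtoC (slope mu) * cj dl)%C).
{ transitivity (RtoC (b * S) / RtoC (slope mu) * (RtoC x * (cj z * e0)))%C.
  - unfold W, e0. field. split; assumption.
  - rewrite Ez. field. easy. }
assert (HW : b * S / 2 <= Re (Cconj be * W)%C * x).
{ replace (Re (Cconj be * W)%C * x) with (Re (Cconj be * W * RtoC x)%C) by (unfold Re; simpl; ring).
  rewrite EW, Re_plus. set (er := (RtoC (b * S) / RtoC (slope mu) * cj dl)%C).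
  assert (Her : Cmod er <= b * e).
  { unfold er. rewrite Cmod_mult, Cmod_div, !Cmod_R, cj_mod, (Rabs_pos_eq (b * S)) by (easy || lra). fold S.
    replace (b * S / S * Cmod dl) with (b * Cmod dl) by (field; lra). apply Rmult_le_compat_l; lra. }
  assert (T := re_le_Cmod er). apply Rabs_le_between in T.
  assert (b * e <= b * (S / 2)) by (apply Rmult_le_compat_l; lra). simpl (Re (RtoC (b * S))). lra. }
assert (Ez2 : Cmod z' ^ 2 = Cmod z ^ 2 + 2 * Re (Cconj be * W)%C + b ^ 2).
{ assert (EWz : Cmod W = Cmod z) by (unfold W; rewrite Cmod_mult, cj_mod, Ha; ring).
  rewrite <- EWz, P4. fold W. unfold b. rewrite !Cmod2_alt. destruct W, be. unfold Re, Im; simpl. ring. }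
assert (Hzx : Cmod z * x <= S + 1).
{ assert (T := Cmod_triangle dl (slope mu)).
  replace (dl + slope mu)%C with (z * Cexp s)%C in T by (unfold dl; ring).
  rewrite Cmod_mult, Cmod_Cexp, Cmod_R in T. fold x S in T. lra. }
assert (Zp := Cmod_ge_0 z). assert (Zp' := Cmod_ge_0 z').
apply Rabs_le_between in Q.
assert (U1 : Cmod z' ^ 2 - Cmod z ^ 2 <= e * (2 * Cmod z + e)).
{ assert (Cmod z' ^ 2 <= (Cmod z + e) ^ 2) by (apply pow_incr; lra). simpl in *. lra. }
assert (U2 : (Cmod z' ^ 2 - Cmod z ^ 2) * x <= e * (2 * (Cmod z * x) + e * x)).
{ replace (e * (2 * (Cmod z * x) + e * x)) with (e * (2 * Cmod z + e) * x) by ring. apply Rmult_le_compat_r; lra. }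
assert (U3 : b * S <= (Cmod z' ^ 2 - Cmod z ^ 2) * x).
{ rewrite Ez2. assert (0 <= b ^ 2 * x) by (apply Rmult_le_pos; [apply pow2_ge_0|lra]). lra. }
assert (U4 : e * x <= 1) by (assert (e * x <= 1 * x) by (apply Rmult_le_compat_r; lra); lra).
assert (U5 : e * (2 * (Cmod z * x) + e * x) <= e * (2 * S + 3)) by (apply Rmult_le_compat_l; lra).
assert (0 < e * (2 * S + 5)) by (apply Rmult_lt_0_compat; lra). lra.
Qed.

End Comparison.

(** * Uniqueness of the axis *)

Lemma punctured_deep (Q : C -> Prop) : deep (fun s => Q (Cexp s)) -> locally' (RtoC 0) Q.
Proof.
intros [K HK]. apply punctured_iff. exists (exp K). split; [apply exp_pos|]. intros z [Hz1 Hz2].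
rewrite <- (Cexp_clog z) by now apply Cmod_gt_0. apply HK. simpl. rewrite <- (ln_exp K). now apply ln_increasing.
Qed.

Lemma punctured_proper : ProperFilter (locally' (RtoC 0)).
Proof.
constructor; [|apply locally'_filter].
intros P HP. apply punctured_iff in HP. destruct HP as (d & Hd & HP). exists (RtoC (d / 2)). apply HP.
rewrite Cmod_R, Rabs_pos_eq; lra.
Qed.

Lemma canonical_to_infinity (rho mu : R) (Y : C -> E3) : canonical_catenoidal_end rho Y mu (RtoC 0) ->
  filterlim Y (locally' (RtoC 0)) (bdry_nbhd None).
Proof.
intros HY Q HQ. apply bdry_nbhd_none in HQ. destruct HQ as [M HM].
assert (HS : 0 < Rabs (slope mu)).
{ destruct HY as (H1 & H2 & _). now apply Rabs_pos_lt, slope_neq0. }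
set (S := Rabs (slope mu)) in *.
assert (F1 := canonical_asymptotics rho mu Y HY (S / 2) ltac:(lra)).
set (M' := Rabs M + 1). assert (HM' : 1 <= M' /\ M < M' * M').
{ assert (T1 := Rabs_pos M). assert (T2 := Rle_abs M). unfold M'. split; [lra|nra]. }
assert (F2 := deep_exp 1 (S / (2 * M')) Rlt_0_1 ltac:(apply Rdiv_lt_0_compat; lra)).
apply punctured_deep. generalize (deep_and _ _ F1 F2). apply deep_imp. cbv zeta.
intros s [(A1 & _ & _ & _ & A5) B]. apply HM; [easy|]. rewrite Rmult_1_l in B.
assert (T := Cmod_triangle (zeta (Y (Cexp s)) * Cexp s) (- (zeta (Y (Cexp s)) * Cexp s - slope mu))).
rewrite Cmod_opp in T. replace (zeta (Y (Cexp s)) * Cexp s + - (zeta (Y (Cexp s)) * Cexp s - slope mu))%C with (RtoC (slope mu)) in T by ring.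
rewrite Cmod_R, Cmod_mult, Cmod_Cexp in T. fold S in T.
set (c := Cmod (zeta (Y (Cexp s)))) in *. set (x := exp (Re s)) in *. assert (Hx : 0 < x) by apply exp_pos.
assert (Hc0 : 0 <= c) by apply Cmod_ge_0.
assert (Hc : M' <= c).
{ apply (Rmult_le_compat_l c) in B; [|easy]. apply Rmult_le_reg_r with (S / (2 * M')); [apply Rdiv_lt_0_compat; lra|].
  replace (M' * (S / (2 * M'))) with (S / 2) by (field; lra). lra. }
assert (M' * M' <= c * c) by (apply Rmult_le_compat; lra).
assert (T2 := pow2_ge_0 (height (Y (Cexp s)))). lra.
Qed.

Lemma maps_bdry_id (P : Cbar) : maps_bdry (fun p => p) P P.
Proof. intros S HS. exact HS. Qed.

Lemma mob_bdry_ex (L : mat2) (P : Cbar) : mat2_det L <> RtoC 0 -> exists Q, maps_bdry (mob L) P Q.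
Proof.
intros HL.
assert (Huv : exists u v, is_Cbar_quot v u P).
{ destruct P as [x|].
  - exists (RtoC 1), x. split; [apply C1_nz|field; apply C1_nz].
  - exists (RtoC 0), (RtoC 1). split; [easy|apply C1_nz]. }
destruct Huv as (u & v & HP).
destruct (is_Cbar_quot_ex (mC L * u + mD L * v)%C (mA L * u + mB L * v)%C) as [Q HQ].
{ destruct (Ceq_dec (mA L * u + mB L * v)%C 0) as [E1|]; [|now left].
  destruct (Ceq_dec (mC L * u + mD L * v)%C 0) as [E2|]; [|now right].
  exfalso.
  assert (Zu : (mat2_det L * u)%C = RtoC 0).
  { unfold mat2_det. transitivity (mD L * (mA L * u + mB L * v) - mB L * (mC L * u + mD L * v))%C; [ring|rewrite E1, E2; ring]. }
  assert (Zv : (mat2_det L * v)%C = RtoC 0).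
  { unfold mat2_det. transitivity (mA L * (mC L * u + mD L * v) - mC L * (mA L * u + mB L * v))%C; [ring|rewrite E1, E2; ring]. }
  apply Cmult_eq0 in Zu, Zv. destruct Zu as [Z|Zu]; [easy|]. destruct Zv as [Z|Zv]; [easy|].
  destruct (is_Cbar_quot_nz _ _ _ HP); easy. }
exists Q. now apply (mob_bdry L u v).
Qed.

(** The inverse matrix acts on the boundary as well, and limits are unique. *)
Lemma mob_bdry_inj (L : mat2) (P Q R : Cbar) : mat2_det L <> RtoC 0 ->
  maps_bdry (mob L) P R -> maps_bdry (mob L) Q R -> P = Q.
Proof.
intros HL H1 H2. destruct (mob_bdry_ex (mat2_inv L) R (det_inv_neq0 L HL)) as [T HT].
assert (K : forall P, maps_bdry (mob L) P R -> P = T).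
{ intros P' HP'. apply (maps_bdry_functional (fun p => p) P'); [easy|apply maps_bdry_id|].
  apply (maps_bdry_ext (fun p => mob (mat2_inv L) (mob L p))); [intros p Hp; now apply mob_inv_l|].
  now apply (maps_bdry_comp _ _ P' R T). }
rewrite (K P), (K Q); easy.
Qed.

Lemma isometry_comp (Phi Psi : E3 -> E3) : isometry Phi -> isometry Psi -> isometry (fun p => Phi (Psi p)).
Proof.
intros (Phi' & A1 & A2 & A3 & A4) (Psi' & B1 & B2 & B3 & B4). exists (fun p => Psi' (Phi' p)).
split; [now apply preserves_metric_comp|]. split; [now apply preserves_metric_comp|]. split; intros p Hp.
- rewrite A3; [now apply B3|]. now apply B1.
- rewrite B4; [now apply A4|]. now apply A2.
Qed.

Lemma isometry_H3 (Phi : E3 -> E3) (p : E3) : isometry Phi -> H3 p -> H3 (Phi p).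
Proof. intros (Psi & A1 & _) Hp. now apply A1. Qed.

(** The filter [F] stands for an end of a surface. A matrix whose upper right
    entry is nonzero sends infinity to a finite point of the boundary, so that
    of [Th] vanishes. *)
Lemma isometry_fixing_infinity (Th : E3 -> E3) (F : (E3 -> Prop) -> Prop) (FF : ProperFilter F) :
  isometry Th -> F H3 -> filterlim (fun p => p) F (bdry_nbhd None) -> filterlim Th F (bdry_nbhd None) ->
  exists (al be : C) (cj : C -> C), al <> RtoC 0 /\
    (cj = (fun z => z) \/ cj = Cconj) /\
    forall p, H3 p -> Th p = (((al * cj (zeta p) + be)%C, Cmod al * height p) : E3).
Proof.
intros HTh HF H1 H2. destruct (isometry_classification Th HTh) as (M & HM & HMc).
set (sg := fun cj : C -> C => fun p : E3 => ((cj (zeta p), height p) : E3)).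
assert (Hcj : exists cj : C -> C, (cj = (fun z => z) \/ cj = Cconj) /\ forall p, H3 p -> Th p = mob M (sg cj p)).
{ destruct HMc as [H|H].
  - exists (fun z => z). split; [now left|]. intros p Hp. rewrite H by easy. unfold sg. now destruct p.
  - exists Cconj. split; [now right|]. exact H. }
destruct Hcj as (cj & Hcj & HT).
assert (Hsg3 : forall p, H3 p -> H3 (sg cj p)) by (intros p Hp; exact Hp).
assert (Hsg : maps_bdry (sg cj) None None).
{ assert (Hm : forall z, Cmod (cj z) = Cmod z) by (destruct Hcj as [-> | ->]; [easy|apply Cmod_conj]).
  intros S HS. apply bdry_nbhd_none in HS. destruct HS as [K HS]. apply bdry_nbhd_none. exists K.
  intros p Hp H. apply HS; [exact Hp|]. change (K < Cmod (cj (zeta p)) ^ 2 + height p ^ 2). now rewrite Hm. }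
destruct (Ceq_dec (mB M) 0) as [HB|HB].
- assert (HA : mA M <> RtoC 0) by (intros Z; apply HM; unfold mat2_det; rewrite HB, Z; ring).
  assert (HD : mD M <> RtoC 0) by (intros Z; apply HM; unfold mat2_det; rewrite HB, Z; ring).
  exists (mD M / mA M)%C, (mC M / mA M)%C, cj. split; [|split; [exact Hcj|]].
  + intros Z. apply HD. replace (mD M) with (mD M / mA M * mA M)%C by (field; easy). rewrite Z. ring.
  + intros p Hp. rewrite HT, mob_lower by auto. reflexivity.
- exfalso.
  assert (Hfin : maps_bdry (mob M) None (Some (mD M / mB M)%C)).
  { apply (mob_bdry M (RtoC 0) (RtoC 1)); [easy|split; [easy|apply C1_nz]|]. split.
    - replace (mA M * 0 + mB M * 1)%C with (mB M) by ring. easy.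
    - f_equal; ring. }
  assert (E : None = Some (mD M / mB M)%C).
  { apply (limit_bdry_unique F Th); [|exact H2|].
    - revert HF. apply filter_imp. intros p Hp. now apply isometry_H3.
    - apply (filterlim_ext_loc (fun p => mob M (sg cj p))).
      + revert HF. apply filter_imp. intros p Hp. symmetry. now apply HT.
      + apply (filterlim_comp _ _ _ (fun p => p) (fun p => mob M (sg cj p)) _ _ _ H1).
        exact (maps_bdry_comp _ _ _ _ _ Hsg Hfin). }
  easy.
Qed.

(** Both canonical ends go to infinity, so the isometry that relates them is a
    similarity; the comparison of the two ends shows that it also fixes 0.
    Hence both isometries pull 0 and infinity back to the same boundary
    points. *)
Lemma catenoidal_uniqueness (rho r mu : R) (X : C -> E3) (L : mat2) (A B : Cbar) :
  bryant_end rho X -> mat2_det L <> RtoC 0 ->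
  canonical_catenoidal_end r (fun z => mob L (X z)) mu (RtoC 0) ->
  maps_bdry (mob L) A (Some (RtoC 0)) -> maps_bdry (mob L) B None ->
  forall (chi' : R) (A' B' : Cbar), catenoidal_end rho X chi' A' B' ->
    chi' = 1 - mu /\ A' = A /\ B' = B.
Proof.
intros HX HL HY HA HB chi' A' B' (_ & _ & _ & _ & _ & mu' & Hchi & Phi & HPhi & HA' & HB' & rho' & Y' & HY' & Hsame).
destruct Hsame as (phi & psi & Hphi & _ & _ & _ & HXY).
assert (HXH : forall z, pdisc rho z -> H3 (X z)) by apply HX.
assert (Hrho : 0 < rho) by apply HX.
set (Y := fun z => mob L (X z)) in *.
set (Th := fun p => Phi (mob (mat2_inv L) p)).
assert (HTh : isometry Th) by (apply (isometry_comp Phi); [easy|now apply isometry_mob, det_inv_neq0]).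
assert (FF := punctured_proper).
assert (HYH : locally' (RtoC 0) (fun z => H3 (X z) /\ H3 (Y z))).
{ apply punctured_iff. exists rho. split; [easy|]. intros z Hz. split; [now apply HXH|apply mob_H3; auto]. }
assert (HThY : locally' (RtoC 0) (fun z => Th (Y z) = Y' (phi z))).
{ generalize (filter_and _ _ HYH HXY). apply filter_imp. intros z [[H1 _] H2].
  unfold Th, Y. now rewrite mob_inv_l. }
assert (LY := canonical_to_infinity r mu Y HY).
assert (LY' := filterlim_comp _ _ _ phi Y' _ _ _ Hphi (canonical_to_infinity rho' mu' Y' HY')).
assert (PF : ProperFilter (filtermap Y (locally' (RtoC 0)))) by apply filtermap_proper_filter, FF.
destruct (isometry_fixing_infinity Th (filtermap Y (locally' (RtoC 0))) PF HTh) as (al & be & cj & Hal & Hcj & HThf).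
{ unfold filtermap. generalize HYH. apply filter_imp. now intros z [_ H]. }
{ exact LY. }
{ change (filterlim (fun z => Th (Y z)) (locally' (RtoC 0)) (bdry_nbhd None)).
  apply (filterlim_ext_loc (fun z => Y' (phi z))); [|exact LY'].
  generalize HThY. apply filter_imp. intros z H. now symmetry. }
assert (cj_mod : forall z, Cmod (cj z) = Cmod z) by (destruct Hcj as [-> | ->]; [easy|apply Cmod_conj]).
assert (cj_mult : forall z w, cj (z * w)%C = (cj z * cj w)%C) by (destruct Hcj as [-> | ->]; [easy|apply Cmult_conj]).
assert (cj_plus : forall z w, cj (z + w)%C = (cj z + cj w)%C) by (destruct Hcj as [-> | ->]; [easy|apply Cplus_conj]).
assert (cj_minus : forall z w, cj (z - w)%C = (cj z - cj w)%C) by (destruct Hcj as [-> | ->]; [easy|apply Cminus_conj]).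
assert (cj_cj : forall z, cj (cj z) = z) by (destruct Hcj as [-> | ->]; [easy|apply Cconj_conj]).
assert (cj_real : forall x, cj (RtoC x) = RtoC x) by (destruct Hcj as [-> | ->]; [easy|apply Cconj_RtoC]).
assert (HYY' : locally' (RtoC 0) (fun z => Y' (phi z) = (((al * cj (zeta (Y z)) + be)%C, Cmod al * height (Y z)) : E3))).
{ generalize (filter_and _ _ HYH HThY). apply filter_imp. intros z [[_ H1] H2]. rewrite <- H2. now apply HThf. }
destruct (comparison_coarse r rho' mu mu' Y Y' phi al be cj HY HY' Hphi Hal cj_mod HYY') as (Emu & _ & _).
assert (Eal := comparison_al r rho' mu mu' Y Y' phi al be cj HY HY' Hphi Hal cj_mod HYY').
assert (Ebe := comparison_axis r rho' mu mu' Y Y' phi al be cj HY HY' Hphi Hal cj_mod cj_mult cj_plus cj_cj cj_real HYY').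
split; [lra|].
(* [Phi] and [mob L] differ by a similarity that fixes 0 and infinity *)
set (al' := cj (/ al)%C).
assert (Hal' : al' <> RtoC 0).
{ apply Cmod_gt_0. unfold al'. rewrite cj_mod. apply Cmod_gt_0. intros Z. apply C1_nz. rewrite <- (Cinv_r al Hal), Z. ring. }
assert (Eal' : Cmod al' = 1) by (unfold al'; rewrite cj_mod, Cmod_inv, Eal by easy; field).
destruct (maps_bdry_simil_like al' (RtoC 0) cj Hal' cj_minus cj_mod) as [S1 S2].
set (Sim := fun p : E3 => (((al' * cj (zeta p) + 0)%C, Cmod al' * height p) : E3)) in *.
assert (ESim : forall p, H3 p -> Sim (Phi p) = mob L p).
{ intros p Hp. assert (Hq : H3 (mob L p)) by now apply mob_H3.
  replace (Phi p) with (Th (mob L p)) by (unfold Th; now rewrite mob_inv_l).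
  rewrite HThf, Ebe, Eal by easy. unfold Sim. rewrite Eal'. destruct (mob L p) as [z w]. unfold zeta, height. cbn [fst snd].
  apply injective_projections; cbn [fst snd]; [|change (@eq R (1 * (1 * w)) w); ring].
  match goal with |- ?l = ?r => change (@eq C l r) end. rewrite !cj_plus, cj_mult, cj_cj, cj_real. unfold al'.
  transitivity (cj (/ al * al)%C * z)%C; [rewrite cj_mult; ring|].
  replace (/ al * al)%C with (RtoC 1) by (field; easy). rewrite cj_real. ring. }
specialize (S1 (RtoC 0)). rewrite cj_real in S1. replace (al' * 0 + 0)%C with (RtoC 0) in S1 by ring.
assert (K : forall P Q R, maps_bdry Phi P Q -> maps_bdry Sim Q R -> maps_bdry (mob L) P R).
{ intros P Q R HP HQ. apply (maps_bdry_ext (fun p => Sim (Phi p))); [exact ESim|]. now apply (maps_bdry_comp _ _ P Q R). }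
split.
- apply (mob_bdry_inj L _ _ (Some (RtoC 0))); [easy|now apply (K _ (Some (RtoC 0)))|easy].
- apply (mob_bdry_inj L _ _ None); [easy|now apply (K _ None)|easy].
Qed.

Theorem theorem4
  (rho : R) (X : C -> E3) (mu nu : R) (h : C -> C)
  (end_X : bryant_end rho X)
  (emb_X : embedded rho X)
  (ftc_X : finite_total_curvature rho X)
  (not_horo : ~ part_of_horosphere rho X)
  (mu_gt0 : 0 < mu) (nu_le : nu <= -1) (mu_nu : mu + nu = -1)
  (hol_h : holomorphic_near_0 h) (h0 : h (RtoC 0) <> RtoC 0)
  (data_X : exists F : C -> mat2,
     bryant_representation rho X F /\
     weierstrass_data rho F (zpow mu) (power_form nu h)) :
  exists (chi : R) (A B : Cbar),
    (A <> B /\ catenoidal_end rho X chi A B) /\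
    (forall (chi' : R) (A' B' : Cbar),
       A' <> B' -> catenoidal_end rho X chi' A' B' ->
       chi' = chi /\ A' = A /\ B' = B) /\
    chi = 1 - mu /\
    (forall (F : C -> mat2) (a b c d : C -> C),
       bryant_representation rho X F ->
       weierstrass_data rho F (zpow mu) (power_form nu h) ->
       holomorphic_near_0 a -> holomorphic_near_0 b ->
       holomorphic_near_0 c -> holomorphic_near_0 d ->
       (forall s, cover rho s ->
          F s = Mat2 (zpow ((-1 - mu) / 2) s * a (Cexp s))%C
                     (zpow ((mu - 1) / 2) s * b (Cexp s))%C
                     (zpow ((-1 - mu) / 2) s * c (Cexp s))%C
                     (zpow ((mu - 1) / 2) s * d (Cexp s))%C) ->
       is_Cbar_quot (C_derive c (RtoC 0)) (C_derive a (RtoC 0)) A /\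
       is_Cbar_quot (c (RtoC 0)) (a (RtoC 0)) B).
Proof.
assert (Enu : nu = -1 - mu) by lra. subst nu. clear nu_le mu_nu.
destruct data_X as (F & HF & HW).
destruct (catenoidal_existence rho mu X F h end_X emb_X ftc_X not_horo mu_gt0 HF HW hol_h h0)
  as (L & r & _ & _ & A & B & HL & HAB & _ & HY & HC & Hne & _).
assert (HL' : mat2_det L <> RtoC 0) by (rewrite HL; apply C1_nz).
destruct (axis_of_maps L A B HL HAB) as [MA MB].
assert (U := catenoidal_uniqueness rho r mu X L A B end_X HL' HY MA MB).
exists (1 - mu), A, B. split; [easy|]. split; [intros chi' A' B' _; apply U|]. split; [reflexivity|].
clear F HF HW. intros F a b c d HF HW Ha _ Hc _ HFf.
destruct (catenoidal_existence rho mu X F h end_X emb_X ftc_X not_horo mu_gt0 HF HW hol_h h0)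
  as (M & r' & f1 & f2 & A1 & B1 & HM & [HA1 HB1] & Hmu1 & _ & HC1 & _ & Hr' & Hf1 & E1 & D1 & Hf2 & E2 & HG).
destruct (U _ _ _ HC1) as (_ & -> & ->).
assert (Hln : ln r' <= ln rho) by (apply Rcomplements.ln_le; lra).
assert (Hslope := RtoC_neq0 _ (slope_neq0 mu mu_gt0 Hmu1)). fold (slope mu) in HG.
destruct (row_jet ((-1 - mu) / 2) 0 r' (mA M) (mB M) a c f2 true (proj1 Hr') Ha Hc Hf2) as [J1 J2].
{ intros s Hs. destruct (HG s Hs) as [G _]. rewrite HFf in G by (apply cover_iff; [apply end_X|lra]). cbn [mA mC] in G.
  rewrite G. replace ((1 - mu) / 2) with ((-1 - mu) / 2 + 1) by field. rewrite zpow_plus.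
  replace (zpow 1 s) with (Cexp s) by (unfold zpow; f_equal; ring). ring. }
destruct (row_jet ((-1 - mu) / 2) (slope mu) r' (mC M) (mD M) a c f1 false (proj1 Hr') Ha Hc Hf1) as [J3 J4].
{ intros s Hs. destruct (HG s Hs) as [_ G]. rewrite HFf in G by (apply cover_iff; [apply end_X|lra]). cbn [mA mC] in G.
  rewrite G. ring. }
rewrite E1 in J3. rewrite D1 in J4. rewrite E2 in J2.
destruct M as [m11 m12 m21 m22]. unfold mat2_det in HM. cbn [mA mB mC mD] in *.
set (k := RtoC (slope mu)) in *.
set (a0 := a (RtoC 0)) in *. set (c0 := c (RtoC 0)) in *.
set (a1 := C_derive a (RtoC 0)) in *. set (c1 := C_derive c (RtoC 0)) in *.
(* Cramer's rule *)
assert (Ea1 : a1 = m22).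
{ transitivity (m22 * (m11 * a1 + m12 * c1) - m12 * (m21 * a1 + m22 * c1) + (1 - (m11 * m22 - m12 * m21)) * a1)%C; [ring|].
  rewrite J2, J4, HM. ring. }
assert (Ec1 : c1 = (- m21)%C).
{ transitivity (m11 * (m21 * a1 + m22 * c1) - m21 * (m11 * a1 + m12 * c1) + (1 - (m11 * m22 - m12 * m21)) * c1)%C; [ring|].
  rewrite J2, J4, HM. ring. }
assert (Ea0 : a0 = (- k * m12)%C).
{ transitivity (m22 * (m11 * a0 + m12 * c0) - m12 * (m21 * a0 + m22 * c0) + (1 - (m11 * m22 - m12 * m21)) * a0)%C; [ring|].
  rewrite J1, J3, HM. ring. }
assert (Ec0 : c0 = (- k * - m11)%C).
{ transitivity (m11 * (m21 * a0 + m22 * c0) - m21 * (m11 * a0 + m12 * c0) + (1 - (m11 * m22 - m12 * m21)) * c0)%C; [ring|].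
  rewrite J1, J3, HM. ring. }
(* these vectors define the axis of [M], up to the factor [- k] *)
rewrite Ea1, Ec1, Ea0, Ec0. split; [exact HA1|].
assert (Hk : (- k)%C <> RtoC 0) by (intros Z; apply Hslope; replace k with (- - k)%C by ring; rewrite Z; ring).
destruct B as [x|]; destruct HB1 as [Q1 Q2]; split.
- now apply Cmult_neq_0.
- rewrite Q2. field. split; assumption.
- rewrite Q1. ring.
- now apply Cmult_neq_0.
Qed.
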